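(* Let $k\ge1$ be an integer. For any real sequence $(c_p)_{p\ge 2}$ with $\sum_{p\ge2}2^pc_p^2<\infty$, with $\xi(s)=\sum_{p\ge 2}c_p^2s^p$, and any $h\in\mathbb R$, there exists $\beta_k$ such that for all $\beta>\beta_k$ the mixed $p$-spin model with mixture $\xi$ and external field $h$ at inverse temperature $\beta$ is at least $k$-RSB, i.e. the support of the Parisi measure $\alpha_{P,\beta}(dt)$ contains at least $k+1$ distinct points.
   Context: $\mathcal M$ is the set of cumulative distribution functions $\alpha$ of probability measures $\alpha(ds)$ on $[0,1]$. For $\beta>0$ and $\alpha\in\mathcal M$, let $\Psi_{\alpha,\beta}$ be the weak solution on $[0,1]\times\mathbb R$ of $$\partial_t\Psi_{\alpha,\beta}(t,x)=-\frac{\xi''(t)}2\bigl(\partial_{xx}\Psi_{\alpha,\beta}(t,x)+\beta\alpha(t)(\partial_x\Psi_{\alpha,\beta}(t,x))^2\bigr),\quad (t,x)\in[0,1)\times\mathbb R,\qquad \Psi_{\alpha,\beta}(1,x)=\frac{\log\cosh\beta x}{\beta}.$$ Weak solution means: $\Psi_{\alpha,\beta}$ is continuous with essentially bounded weak derivative $\partial_x\Psi_{\alpha,\beta}$ and satisfies the equation, with its terminal condition, after integration against smooth compactly supported test functions on $(0,1]\times\mathbb R$. The Parisi functional is $$\mathcal P_\beta(\alpha)=\frac{\log2}\beta+\Psi_{\alpha,\beta}(0,h)-\frac12\int_0^1\beta\alpha(s)s\,\xi''(s)\,ds .$$ Its minimizer over $\mathcal M$, whose uniqueness is taken from the earlier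 literature, is denoted $\alpha_{P,\beta}$, and the probability measure $\alpha_{P,\beta}(dt)$ on $[0,1]$ is called the Parisi measure. (By the Parisi formula, $\inf_{\alpha\in\mathcal M}\mathcal P_\beta(\alpha)$ is the almost sure limiting free energy $\lim_{N\to\infty}\frac1{\beta N}\log\sum_{\sigma\in\{-1,1\}^N}e^{\beta H_N(\sigma)}$ of the mixed $p$-spin Hamiltonian $H_N(\sigma)=\sum_{p\ge2}c_pN^{-(p-1)/2}\sum_{1\le i_1,\dots,i_p\le N}g_{i_1,\dots,i_p}\sigma_{i_1}\cdots\sigma_{i_p}+h\sum_{i=1}^N\sigma_i$, with i.i.d. standard normal $g_{i_1,\dots,i_p}$.) *)

(* Defs.v *)
From HB Require Import structures.
From mathcomp Require Import all_boot all_order all_algebra.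
From mathcomp Require Import all_classical all_reals all_analysis.

Set Implicit Arguments.
Unset Strict Implicit.
Unset Printing Implicit Defensive.

Import Order.TTheory GRing.Theory Num.Theory.
Import numFieldNormedType.Exports.

Local Open Scope classical_set_scope.
Local Open Scope ring_scope.

(* Only the entries [c p] with [p >= 2] matter. *)
Definition xi (R : realType) (c : nat -> R) (s : R) : R :=
  limn (fun n : nat => \sum_(2 <= p < n) (c p ^+ 2 * s ^+ p)).

Definition xi'' (R : realType) (c : nat -> R) : R -> R := derive1n 2 (xi c).

Definition cosh (R : realType) (x : R) : R := (expR x + expR (- x)) / 2.

(* Functions of (t, x) are curried, time first. *)
Definition partial_t (R : realType) (u : R -> R -> R) : R -> R -> R :=
  fun t x => derive1 (u ^~ x) t.

Definition partial_x (R : realType) (u : R -> R -> R) : R -> R -> R :=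
  fun t x => derive1 (u t) x.

(* The iterated partial derivative of [u] along a word in {t, x}, where [true]
   stands for a derivative in t. *)
Definition iter_partial (R : realType) (w : seq bool) (u : R -> R -> R) :
    R -> R -> R :=
  foldr (fun b v => if b then partial_t v else partial_x v) u w.

Definition smooth2 (R : realType) (u : R -> R -> R) : Prop :=
  forall w : seq bool,
    [/\ continuous (fun z : R * R => iter_partial w u z.1 z.2),
        forall t x : R, derivable (iter_partial w u ^~ x) t 1 &
        forall t x : R, derivable (iter_partial w u t) x 1].

(* Smooth functions on the plane with compact support contained in [A].
   For [A] = {0 < t}, the restrictions to {t <= 1} are exactly the smooth
   functions with compact support in (0,1] x R, which need not vanish at
   t = 1. *)
Definition test_function (R : realType) (A : set (R * R))
    (phi : R -> R -> R) : Prop :=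
  smooth2 phi /\
  exists K : set (R * R),
    [/\ compact K, K `<=` A & forall t x : R, ~ K (t, x) -> phi t x = 0].

Definition strip (R : realType) : set (R * R) :=
  [set z : R * R | 0 <= z.1 <= 1].
Arguments strip : clear implicits.

Notation lebesgue2 R :=
  (@lebesgue_measure R \x @lebesgue_measure R)%E (only parsing).

(* [v] represents the weak derivative of [u] in x on (0,1) x R, and is
   essentially bounded. *)
Definition bounded_weak_partial_x (R : realType) (u v : R -> R -> R) : Prop :=
  [/\ measurable_fun (strip R) (fun z : R * R => v z.1 z.2),
      exists M : R,
        {ae lebesgue2 R, forall z : R * R, strip R z -> `|v z.1 z.2| <= M} &
      forall phi : R -> R -> R,
        test_function [set z : R * R | 0 < z.1 < 1] phi ->
        \int[lebesgue2 R]_(z in strip R) (u z.1 z.2 * partial_x phi z.1 z.2) =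
        - \int[lebesgue2 R]_(z in strip R) (v z.1 z.2 * phi z.1 z.2)].

(* The integral identity is the equation
     d_t Psi = - xi''/2 (d_xx Psi + beta alpha (d_x Psi)^2)
   multiplied by [phi] and integrated by parts over [0,1] x R, once in t and
   twice in x; the boundary term at t = 1 carries the terminal condition
   Psi(1,x) = log (cosh (beta x)) / beta, and there is none at t = 0 since
   [phi] vanishes there. *)
Definition weak_solution (R : realType) (c : nat -> R) (beta : R)
    (alpha : R -> R) (Psi : R -> R -> R) : Prop :=
  {within strip R, continuous (fun z : R * R => Psi z.1 z.2)} /\
  exists v : R -> R -> R,
    bounded_weak_partial_x Psi v /\
    forall phi : R -> R -> R,
      test_function [set z : R * R | 0 < z.1] phi ->
      \int[lebesgue2 R]_(z in strip R)
        (- (Psi z.1 z.2 * partial_t phi z.1 z.2)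
         + xi'' c z.1 / 2
           * (Psi z.1 z.2 * partial_x (partial_x phi) z.1 z.2
              + beta * alpha z.1 * v z.1 z.2 ^+ 2 * phi z.1 z.2))
      + \int[@lebesgue_measure R]_(x in setT)
          (phi 1 x * (ln (cosh (beta * x)) / beta)) = 0.

(* The weak solution, determined on [0,1] x R and unspecified elsewhere. *)
Definition parisi_pde (R : realType) (c : nat -> R) (beta : R)
    (alpha : R -> R) : R -> R -> R :=
  xget (fun _ _ : R => 0) [set Psi | weak_solution c beta alpha Psi].

Definition parisi_functional (R : realType) (c : nat -> R) (h beta : R)
    (alpha : R -> R) : R :=
  ln 2 / beta + parisi_pde c beta alpha 0 h
  - 2^-1 * \int[@lebesgue_measure R]_(s in `[0, 1])
             (beta * alpha s * s * xi'' c s).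

(* Probability measures on [0,1] are represented as probability measures on
   the real line giving mass 1 to [0,1]. *)
Definition unit_supported (R : realType) (mu : probability R R) : Prop :=
  mu `[0, 1]%classic = 1%E.

Definition distribution_function (R : realType) (mu : probability R R)
    (s : R) : R := fine (mu `]-oo, s]%classic).

Definition cdf01 (R : realType) : set (R -> R) :=
  [set alpha | exists2 mu : probability R R,
     unit_supported mu & alpha = distribution_function mu].
Arguments cdf01 : clear implicits.

Definition is_minimizer (R : realType) (c : nat -> R) (h beta : R)
    (alpha : R -> R) : Prop :=
  cdf01 R alpha /\
  forall alpha' : R -> R, cdf01 R alpha' ->
    parisi_functional c h beta alpha <= parisi_functional c h beta alpha'.

(* [mu] is the Parisi measure: its distribution function is the minimizer, i.e.
   the one and only one, of the Parisi functional.  If [c p = 0] for all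
   [p >= 2] the functional is constant and there is no Parisi measure. *)
Definition is_parisi_measure (R : realType) (c : nat -> R) (h beta : R)
    (mu : probability R R) : Prop :=
  [/\ unit_supported mu,
      is_minimizer c h beta (distribution_function mu) &
      forall alpha : R -> R,
        is_minimizer c h beta alpha -> alpha = distribution_function mu].

Definition measure_support (R : realType) (mu : probability R R) : set R :=
  [set x | forall U : set R, open U -> U x -> (0 < mu U)%E].

(* Main.v *)
(* If the support of the Parisi measure has at most k points, the minimizer
   alpha is a step function and gamma = beta alpha takes at most k positive
   values.  For such alpha the Cole-Hopf transformation solves the equation level
   by level; that every weak solution agrees with this one follows from a
   contraction argument on the difference of two solutions, through the Duhamel
   formula and the gradient bound |grad heat_a f| <= C |f| / sqrt a.

   The largest value of gamma is beta, and it is bounded independently of beta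
   as follows.  Comparing with the Dirac mass at 1 bounds
   gamma(q) (w3(1) - w3(q)) at every atom q, where w3' = (1 - s) xi''(s).
   Conversely, if gamma <= A before the atom q, then q cannot be close to 1:
   among k + 1 consecutive intervals of length proportional to L before q, one
   contains no support point; moving a little mass from q to its left end s
   costs at most of order (w3(q) - w3(s)) = O(L^2), while the strict convexity
   gap of the Cole-Hopf operator on that interval gains at least of order
   L^(3/2).  Hence q <= 1 - L with L depending on A only, so gamma(q) is bounded
   in terms of A, and an induction over the at most k atoms bounds beta. *)

From HB Require Import structures.
Require Import Defs.
From mathcomp Require Import all_boot all_order all_algebra.
From mathcomp Require Import all_classical all_reals all_analysis.
From mathcomp Require Import measurable_realfun.
From mathcomp Require Import ring lra.

Set Implicit Arguments.
Unset Strict Implicit.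
Unset Printing Implicit Defensive.

Import Order.TTheory GRing.Theory Num.Theory.
Import numFieldNormedType.Exports.

Local Open Scope classical_set_scope.
Local Open Scope ring_scope.

(** * Gaussian averages *)

Section Int.
Context {R : realType}.
Notation mu := (@lebesgue_measure R).
Implicit Types f g : R -> R.

(** The estimates must survive beta tending to infinity, where the levels at and after an atom [q]
    may be arbitrarily large. All that lies beyond [q] enters a comparison as one common terminal
    function. The Cole-Hopf operator preserves a class of functions (even, convex, nonnegative, C^1,
    slope at most 1) that contains log cosh(beta x) / beta for every beta, and the constants use
    only this class and a bound A for the levels before [q]. The power 3/2 has two sources. Raising
    the level by e over an increment a of the clock w = xi' adds at most e a / 2, minus a multiple
    of e a times a Gaussian of variance of order a: strict convexity acts where the slope stays away
    from 1 and -1, which is guaranteed within a distance sqrt a of the origin. Carried back to time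
    0, this Gaussian spreads to a variance of order 1 and loses a factor of order sqrt a in height,
    while h stays fixed. The cost is quadratic because w3' vanishes at 1. The equation is solved by
    choice among weak solutions, hence the need for uniqueness in the whole class. *)

Definition Int f : R := \int[mu]_y f y.
Definition intg f : Prop := mu.-integrable setT (EFin \o f).

Lemma intg_measurable f : intg f -> measurable_fun setT f.
Proof. by move/measurable_int/measurable_EFinP. Qed.

Lemma eq_Int f g : f =1 g -> Int f = Int g.
Proof. by move=> /funext ->. Qed.

Lemma intgD f g : intg f -> intg g -> intg (fun y => f y + g y).
Proof. by move=> hf hg; have := integrableD measurableT hf hg; apply: eq_integrable. Qed.

Lemma intgZl k f : intg f -> intg (fun y => k * f y).
Proof. by move=> hf; have := integrableZl measurableT k hf; apply: eq_integrable. Qed.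

Lemma intgZr k f : intg f -> intg (fun y => f y * k).
Proof. by move=> /(intgZl k); apply: eq_integrable => // y _ /=; rewrite mulrC. Qed.

Lemma intgN f : intg f -> intg (fun y => - f y).
Proof. by move/(intgZl (-1)); apply: eq_integrable => // y _ /=; rewrite mulN1r. Qed.

Lemma intgB f g : intg f -> intg g -> intg (fun y => f y - g y).
Proof. by move=> hf /intgN; exact: intgD. Qed.

Lemma intg_norm f : intg f -> intg (fun y => `|f y|).
Proof. by move/integrable_norm. Qed.

Lemma intg_le f g : measurable_fun setT f -> (forall y, `|f y| <= g y) ->
  intg g -> intg f.
Proof.
move=> mf fg; apply: le_integrable => //; first exact/measurable_EFinP.
by move=> y _ /=; rewrite lee_fin (le_trans (fg y))// ler_norm.
Qed.

Lemma IntD f g : intg f -> intg g -> Int (fun y => f y + g y) = Int f + Int g.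
Proof. by move=> hf hg; apply: RintegralD. Qed.

Lemma IntB f g : intg f -> intg g -> Int (fun y => f y - g y) = Int f - Int g.
Proof. by move=> hf hg; apply: RintegralB. Qed.

Lemma IntZl k f : intg f -> Int (fun y => k * f y) = k * Int f.
Proof. by move=> hf; apply: RintegralZl. Qed.

Lemma IntZr k f : intg f -> Int (fun y => f y * k) = Int f * k.
Proof. by move=> hf; apply: RintegralZr. Qed.

Lemma IntN f : intg f -> Int (fun y => - f y) = - Int f.
Proof.
by move=> /(IntZl (-1)); rewrite mulN1r => <-; apply: eq_Int => y; rewrite mulN1r.
Qed.

Lemma Int_ge0 f : (forall y, 0 <= f y) -> 0 <= Int f.
Proof. by move=> f0; apply: Rintegral_ge0. Qed.

Lemma le_Int f g : intg f -> intg g -> (forall y, f y <= g y) -> Int f <= Int g.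
Proof. by move=> hf hg fg; apply: le_Rintegral. Qed.

Lemma le_norm_Int f : intg f -> `|Int f| <= Int (fun y => `|f y|).
Proof. by move=> hf; apply: le_normr_Rintegral. Qed.

Lemma IntE f : intg f -> (\int[mu]_y (f y)%:E)%E = (Int f)%:E.
Proof. by move=> hf; rewrite /Int /Rintegral fineK// integrable_fin_num. Qed.

(** The image of Lebesgue measure under the affine map, scaled by [s], has the right value on
    half-open intervals, and a measure with these values is unique. *)
Lemma lebesgue_affine (s x : R) (A : set R) : 0 < s -> measurable A ->
  (s%:E * mu ((fun z : R => (x + s * z)%R) @^-1` A) = mu A)%E.
Proof.
move=> s0 mA.
have maff : measurable_fun setT (fun z : R => x + s * z : measurableTypeR R).
  by apply: measurable_funD => //; exact: measurable_funM.
pose m0 : {measure set (measurableTypeR R) -> \bar R} :=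
  pushforward mu (fun z : R => x + s * z : measurableTypeR R).
pose m := mscale (NngNum (ltW s0)) (m0 maff).
have := @lebesgue_measure_unique R m.
move=> /(_ _ A mA) -> // X [[a b] _ <-].
rewrite /m/= /mscale/= /pushforward/=.
have -> : (fun z : R => x + s * z) @^-1` `]a, b] = `](a - x) / s, (b - x) / s]%classic.
  apply/seteqP; split => z /=; rewrite !in_itv/= ltr_pdivrMr// ler_pdivlMr// ltrBlDr lerBrDr;
  by rewrite (mulrC z) (addrC x).
rewrite !lebesgue_measure_itv/= !lte_fin ltr_pM2r ?invr_gt0// ltrD2r.
case: ifPn => // _; last by rewrite mule0.
by rewrite -!EFinD -EFinM; congr EFin; field; rewrite gt_eqF.
Qed.

Lemma ge0_integral_affine (s x : R) (f : measurableTypeR R -> \bar R) : 0 < s ->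
  measurable_fun setT f -> (forall y, 0 <= f y)%E ->
  (\int[mu]_y f y = s%:E * \int[mu]_z f (x + s * z)%R)%E.
Proof.
move=> s0 mf f0.
have maff : measurable_fun setT (fun z : R => x + s * z : measurableTypeR R).
  by apply: measurable_funD => //; exact: measurable_funM.
pose m0 : {measure set (measurableTypeR R) -> \bar R} :=
  pushforward mu (fun z : R => x + s * z : measurableTypeR R).
transitivity (\int[mscale (NngNum (ltW s0)) (m0 maff)]_y f y)%E.
  apply: eq_measure_integral => A mA _ /=.
  by rewrite /mscale/= /pushforward/= lebesgue_affine.
rewrite ge0_integral_mscale//=; congr (_ * _)%E.
by rewrite ge0_integral_pushforward// preimage_setT.
Qed.

Lemma intg_affine (s x : R) f : 0 < s -> intg f -> intg (fun z => f (x + s * z)).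
Proof.
move=> s0 hf; have mf := intg_measurable hf.
apply/integrableP; split.
  apply/measurable_EFinP; apply: (measurableT_comp mf).
  by apply: measurable_funD => //; exact: measurable_funM.
have /integrableP[_] := hf.
rewrite (@ge0_integral_affine s x)//=.
  case: (integral _ _ _) (integral_ge0 mu (D := setT) (f := fun z : R => `|(f (x + s * z)%R)%:E|%E)) => //=.
    by move=> r _ _; rewrite ltry.
  by rewrite gt0_muley.
by apply/measurable_EFinP; apply: measurableT_comp.
Qed.

Lemma Int_affine (s x : R) f : 0 < s -> intg f ->
  Int f = s * Int (fun z => f (x + s * z)).
Proof.
move=> s0 hf; have hf' := intg_affine x s0 hf; have mf := intg_measurable hf.
apply: EFin_inj; rewrite EFinM -!IntE//.
rewrite integralE [in RHS]integralE.
have mfE : measurable_fun setT (fun y : measurableTypeR R => (f y)%:E) by exact/measurable_EFinP.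
rewrite (@ge0_integral_affine s x (fun y => ((fun y => (f y)%:E)^\+ y)%E))//; last exact: measurable_funepos.
rewrite (@ge0_integral_affine s x (fun y => ((fun y => (f y)%:E)^\- y)%E))//; last exact: measurable_funeneg.
have ep : (\int[mu]_z (fun y => (f y)%:E)^\+ (x + s * z)%R = \int[mu]_z (fun z => (f (x + s * z)%R)%:E)^\+ z)%E.
  by apply: eq_integral => z _; rewrite !funeposE.
have en : (\int[mu]_z (fun y => (f y)%:E)^\- (x + s * z)%R = \int[mu]_z (fun z => (f (x + s * z)%R)%:E)^\- z)%E.
  by apply: eq_integral => z _; rewrite !funenegE.
rewrite ep en -muleBr//.
exact: (integrable_add_def measurableT hf').
Qed.

Lemma intg_opp f : intg f -> intg (fun z => f (- z)).
Proof.
move=> hf; have mf := intg_measurable hf.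
have mo : measurable_fun setT (fun z : R => - z : measurableTypeR R) by exact: measurable_funN.
have pE : (\int[mu]_z `|(f (- z))%:E| = \int[mu]_z `|(f z)%:E|)%E.
  transitivity (\int[pushforward mu (-%R : R -> measurableTypeR R)]_y `|(f y)%:E|)%E.
    rewrite ge0_integral_pushforward//.
    by apply/measurable_EFinP; apply: measurableT_comp.
  by apply: eq_measure_integral => A mA _; exact: lebesgue_measureN.
apply/integrableP; split.
  by apply/measurable_EFinP; exact: measurableT_comp mf mo.
by rewrite /= pE; have /integrableP[_] := hf.
Qed.

Lemma Int_opp f : intg f -> Int (fun z => f (- z)) = Int f.
Proof.
move=> hf; have mf := intg_measurable hf.
have mo : measurable_fun setT (fun z : R => - z : measurableTypeR R) by exact: measurable_funN.
rewrite /Int /Rintegral; congr fine.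
transitivity (\int[pushforward mu (-%R : R -> measurableTypeR R)]_y (f y)%:E)%E.
  rewrite integral_pushforward//=; first exact/measurable_EFinP.
  exact: intg_opp hf.
by apply: eq_measure_integral => A mA _; exact: lebesgue_measureN.
Qed.

End Int.

Section Gauss.
Context {R : realType}.
Implicit Types (f g : R -> R) (k d c x : R).

Lemma intg_gauss k d : 0 < k -> intg (fun z => expR (- (k * (z + d) ^+ 2))).
Proof.
move=> k0; have s0 : 0 < Num.sqrt k by rewrite sqrtr_gt0.
have /(intg_affine (Num.sqrt k * d) s0) : intg (fun z : R => expR (- z ^+ 2)).
  exact: integrableT_gauss.
apply: eq_integrable => // z _ /=; congr (expR (- _))%:E.
by rewrite -mulrDr exprMn sqr_sqrtr ?ltW// addrC.
Qed.

Lemma Int_gauss k d : 0 < k ->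
  Int (fun z => expR (- (k * (z + d) ^+ 2))) = Num.sqrt pi / Num.sqrt k.
Proof.
move=> k0; have s0 : 0 < Num.sqrt k by rewrite sqrtr_gt0.
have ig : intg (fun z : R => expR (- z ^+ 2)) by exact: integrableT_gauss.
have IG : Int (fun z : R => expR (- z ^+ 2)) = Num.sqrt pi.
  by apply: EFin_inj; rewrite -IntE// integralT_gauss.
apply: (mulfI (lt0r_neq0 s0)); rewrite mulrCA divff ?mulr1 ?gt_eqF//.
rewrite -IG (Int_affine (Num.sqrt k * d) s0 ig); congr (_ * _).
apply: eq_Int => z; congr (expR (- _)).
by rewrite -mulrDr exprMn sqr_sqrtr ?ltW// addrC.
Qed.

(** At most exponential growth: wide enough for [exp (c * f)] with [f] Lipschitz, stable under sums,
    products and affine substitution, and integrable against every Gaussian. *)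
Definition egrow f := measurable_fun setT f /\
  exists C c : R, [/\ 0 <= C, 0 <= c & forall y, `|f y| <= C * expR (c * `|y|)].

Lemma intg_egrow f k : egrow f -> 0 < k -> intg (fun z => f z * expR (- (k * z ^+ 2))).
Proof.
move=> [mf [C [c [C0 c0 fC]]]] k0.
have k20 : 0 < k / 2 by rewrite divr_gt0.
have /(intgZl (C * expR (c ^+ 2 / (2 * k)))) := intg_gauss 0 k20.
apply: intg_le.
  apply: measurable_funM => //; apply: measurableT_comp => //; apply: measurableT_comp => //.
  exact: measurable_funM.
move=> z; rewrite normrM (ger0_norm (expR_ge0 _)) addr0.
apply: (le_trans (ler_wpM2r (expR_ge0 _) (fC z))).
rewrite -!mulrA ler_wpM2l// -!expRD ler_expR.
(* Half of the Gaussian exponent absorbs the linear growth: the difference is a perfect square. *)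
have h : c * `|z| <= c ^+ 2 / (2 * k) + k / 2 * z ^+ 2.
  rewrite -[z ^+ 2]real_normK ?num_real// -subr_ge0.
  have -> : c ^+ 2 / (2 * k) + k / 2 * `|z| ^+ 2 - c * `|z| = (c - k * `|z|) ^+ 2 / (2 * k).
    by field; rewrite gt_eqF.
  by rewrite divr_ge0 ?sqr_ge0// mulr_ge0// ltW.
lra.
Qed.

Lemma egrow_cst k : egrow (fun=> k).
Proof.
split; first exact: measurable_cst.
exists `|k|, 0; split => // y; by rewrite mul0r expR0 mulr1.
Qed.

Lemma egrowD f g : egrow f -> egrow g -> egrow (fun y => f y + g y).
Proof.
move=> [mf [C [c [C0 c0 fC]]]] [mg [D [d [D0 d0 gD]]]].
split; first exact: measurable_funD.
exists (C + D), (c + d); split; rewrite ?addr_ge0// => y.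
apply: (le_trans (ler_normD _ _)); rewrite mulrDl lerD//.
  apply: (le_trans (fC y)); rewrite ler_wpM2l// ler_expR ler_wpM2r// lerDl//.
apply: (le_trans (gD y)); rewrite ler_wpM2l// ler_expR ler_wpM2r// lerDr//.
Qed.

Lemma egrowM f g : egrow f -> egrow g -> egrow (fun y => f y * g y).
Proof.
move=> [mf [C [c [C0 c0 fC]]]] [mg [D [d [D0 d0 gD]]]].
split; first exact: measurable_funM.
exists (C * D), (c + d); split; rewrite ?addr_ge0 ?mulr_ge0// => y.
by rewrite normrM mulrDl expRD mulrACA ler_pM.
Qed.

Lemma egrowN f : egrow f -> egrow (fun y => - f y).
Proof.
move=> [mf [C [c [C0 c0 fC]]]]; split; first exact: measurableT_comp.
by exists C, c; split => // y; rewrite normrN.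
Qed.

Lemma egrowB f g : egrow f -> egrow g -> egrow (fun y => f y - g y).
Proof. by move=> hf /egrowN; exact: egrowD. Qed.

Lemma egrow_norm f : egrow f -> egrow (fun y => `|f y|).
Proof.
move=> [mf [C [c [C0 c0 fC]]]]; split; first exact: measurableT_comp.
by exists C, c; split => // y; rewrite normr_id.
Qed.

Lemma egrow_id : egrow (fun y => y).
Proof.
split; first exact: measurable_id.
exists 1, 1; split => // y; rewrite !mul1r.
by apply: le_trans (expR_ge1Dx _); rewrite lerDr.
Qed.

Lemma egrowX f n : egrow f -> egrow (fun y => f y ^+ n).
Proof.
move=> hf; elim: n => [|n IH].
  by rewrite (_ : (fun _ => _) = (fun=> 1)); [exact: egrow_cst|apply/funext => y; rewrite expr0].
rewrite (_ : (fun _ => _) = (fun y => f y * f y ^+ n)); first exact: egrowM.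
by apply/funext => y; rewrite exprS.
Qed.

Lemma egrow_affine f x k : egrow f -> egrow (fun z => f (x + k * z)).
Proof.
move=> [mf [C [c [C0 c0 fC]]]]; split.
  by apply: (measurableT_comp mf); apply: measurable_funD => //; exact: measurable_funM.
exists (C * expR (c * `|x|)), (c * `|k|); split; rewrite ?mulr_ge0 ?expR_ge0// => y.
apply: (le_trans (fC _)); rewrite -mulrA ler_wpM2l// -expRD ler_expR -mulrA -mulrDr ler_wpM2l//.
by rewrite -normrM ler_normD.
Qed.

Lemma egrow_le f g : measurable_fun setT f -> (forall y, `|f y| <= g y) -> egrow g -> egrow f.
Proof.
move=> mf fg [mg [D [d [D0 d0 gD]]]]; split => //; exists D, d; split => // y.
by apply: (le_trans (fg y)); apply: le_trans (gD y); exact: ler_norm.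
Qed.

Lemma egrow_expR k : egrow (fun y => expR (k * `|y|)).
Proof.
split; first by apply: measurableT_comp => //; apply: measurable_funM => //; exact: measurableT_comp.
exists 1, `|k|; split => // y; rewrite mul1r (ger0_norm (expR_ge0 _)) ler_expR.
by rewrite ler_wpM2r// ler_norm.
Qed.

Definition Gd (z : R) := (Num.sqrt (pi *+ 2))^-1 * expR (- (2^-1 * z ^+ 2)).

Lemma sqrt2pi_gt0 : 0 < Num.sqrt (pi *+ 2 : R).
Proof. by rewrite sqrtr_gt0 mulrn_wgt0// pi_gt0. Qed.

Lemma Gd_ge0 z : 0 <= Gd z.
Proof. by rewrite mulr_ge0 ?expR_ge0// invr_ge0 ltW// sqrt2pi_gt0. Qed.

Lemma GdN z : Gd (- z) = Gd z.
Proof. by rewrite /Gd sqrrN. Qed.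

Lemma intg_Gd f : egrow f -> intg (fun z => f z * Gd z).
Proof.
move=> hf; have h2 : (0 : R) < 2^-1 by rewrite invr_gt0.
have /(intgZl (Num.sqrt (pi *+ 2))^-1) := intg_egrow hf h2.
by apply: eq_integrable => // z _ /=; rewrite mulrCA.
Qed.

Lemma Int_Gd : Int Gd = 1.
Proof.
have h2 : (0 : R) < 2^-1 by rewrite invr_gt0.
rewrite /Gd IntZl; last first.
  by have := intg_gauss 0 h2; apply: eq_integrable => // z _ /=; rewrite addr0.
have -> : Int (fun y : R => expR (- (2^-1 * y ^+ 2))) = Num.sqrt pi / Num.sqrt 2^-1.
  by rewrite -(Int_gauss 0 h2); apply: eq_Int => z; rewrite addr0.
rewrite -[pi *+ 2]mulr_natr (sqrtrM _ (pi_ge0 R)) sqrtrV// invrK mulVf//.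
by rewrite gt_eqF// mulr_gt0// sqrtr_gt0 ?pi_gt0.
Qed.

Definition Eg f := Int (fun z => f z * Gd z).
(** Average of [f] at [x] plus a centred Gaussian of variance [a]. The square root being 0 on
    negative numbers, this is the identity for [a <= 0]; continuity in [a] thus holds on the whole
    line. *)
Definition heat (a : R) f x := Eg (fun z => f (x + Num.sqrt a * z)).

Lemma Eg_cst k : Eg (fun=> k) = k.
Proof.
rewrite /Eg IntZl ?Int_Gd ?mulr1//.
by have := intg_Gd (egrow_cst 1); apply: eq_integrable => // z _ /=; rewrite mul1r.
Qed.

Lemma EgD f g : egrow f -> egrow g -> Eg (fun y => f y + g y) = Eg f + Eg g.
Proof.
by move=> hf hg; rewrite /Eg -IntD; [apply: eq_Int => z; rewrite mulrDl|exact: intg_Gd|exact: intg_Gd].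
Qed.

Lemma EgB f g : egrow f -> egrow g -> Eg (fun y => f y - g y) = Eg f - Eg g.
Proof.
by move=> hf hg; rewrite /Eg -IntB; [apply: eq_Int => z; rewrite mulrBl|exact: intg_Gd|exact: intg_Gd].
Qed.

Lemma EgZl k f : egrow f -> Eg (fun y => k * f y) = k * Eg f.
Proof.
by move=> hf; rewrite /Eg -IntZl; [apply: eq_Int => z; rewrite mulrA|exact: intg_Gd].
Qed.

Lemma le_Eg f g : egrow f -> egrow g -> (forall y, f y <= g y) -> Eg f <= Eg g.
Proof.
move=> hf hg fg; apply: le_Int; [exact: intg_Gd|exact: intg_Gd|].
by move=> y; rewrite ler_wpM2r// Gd_ge0.
Qed.

Lemma Eg_ge0 f : (forall y, 0 <= f y) -> 0 <= Eg f.
Proof. by move=> f0; apply: Int_ge0 => y; rewrite mulr_ge0// Gd_ge0. Qed.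

Lemma le_norm_Eg f : egrow f -> `|Eg f| <= Eg (fun y => `|f y|).
Proof.
move=> hf; apply: (le_trans (le_norm_Int (intg_Gd hf))).
by under eq_Int do rewrite normrM (ger0_norm (Gd_ge0 _)).
Qed.

Lemma Eg_opp f : egrow f -> Eg (fun z => f (- z)) = Eg f.
Proof.
move=> hf; rewrite /Eg -[RHS]Int_opp; last exact: intg_Gd.
by apply: eq_Int => z; rewrite GdN.
Qed.

End Gauss.

(** * The heat semigroup *)

Section Under.
Context {R : realType}.
Implicit Types (f g G : R -> R) (F dF : R -> R -> R).

Lemma ballP (a r x : R) : `](a - r), (a + r)[%classic x <-> `|x - a| < r.
Proof. by rewrite /= in_itv/= ltr_norml; split => /andP[h1 h2]; apply/andP; split; lra. Qed.

Lemma derive_Int F dF G (a r : R) : 0 < r ->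
  (forall x, `|x - a| < r -> intg (F x)) ->
  (forall x y, `|x - a| < r -> is_derive x 1 (F^~ y) (dF x y)) ->
  intg G -> (forall x y, `|x - a| < r -> `|dF x y| <= G y) ->
  is_derive a 1 (fun x => Int (F x)) (Int (dF a)).
Proof.
move=> r0 iF dFd iG FG.
have aa : `|a - a| < r by rewrite subrr normr0.
have pE x y : `|x - a| < r -> partial1of2 F x y = dF x y.
  by move=> xr; rewrite /partial1of2 derive1E; apply: derive_val; exact: dFd.
have Ia : `](a - r), (a + r)[%classic a by apply/ballP.
have h1 x : `](a - r), (a + r)[%classic x -> (@lebesgue_measure R).-integrable setT (EFin \o F x).
  by move=> /ballP; exact: iF.
have h2 x y : `](a - r), (a + r)[%classic x -> [set: R] y -> derivable (F^~ y) x 1.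
  by move=> /ballP xr _; have [] := dFd x y xr.
have G0 y : 0 <= G y by apply: le_trans (FG a y aa); exact: normr_ge0.
have h3 x y : `](a - r), (a + r)[%classic x -> [set: R] y -> `|partial1of2 F x y| <= G y.
  by move=> /ballP xr _; rewrite pE//; exact: FG.
split; first exact: (derivable_under_integral measurableT Ia h1 h2 G0 iG h3).
rewrite -derive1E.
have := differentiation_under_integral measurableT Ia h1 h2 G0 iG h3.
rewrite /Int => ->.
by apply: eq_Int => y; rewrite pE.
Qed.

Lemma cont_Int F G (a r : R) : 0 < r ->
  (forall x, `|x - a| < r -> intg (F x)) ->
  (forall x y, `|x - a| < r -> {for x, continuous (F^~ y)}) ->
  intg G -> (forall x y, `|x - a| < r -> `|F x y| <= G y) ->
  {for a, continuous (fun x => Int (F x))}.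
Proof.
move=> r0 iF cF iG FG.
have aa : `|a - a| < r by rewrite subrr normr0.
have h1 x : `](a - r), (a + r)[%classic x -> (@lebesgue_measure R).-integrable setT (EFin \o F x).
  by move=> /ballP; exact: iF.
have h2 : {ae (@lebesgue_measure R), forall y, [set: R] y -> {in `](a - r), (a + r)[%classic, continuous (F^~ y)}}.
  by apply: aeW => y _ x; rewrite inE => /ballP; exact: cF.
have h3 x : `](a - r), (a + r)[%classic x -> {ae (@lebesgue_measure R), forall y, [set: R] y -> `|F x y| <= G y}.
  by move=> /ballP xr; apply: aeW => y _; exact: FG.
apply: (continuity_under_integral measurableT h1 h2 iG h3).
by rewrite inE; apply/ballP.
Qed.

End Under.

Section Kernel.
Context {R : realType}.
Implicit Types (f g : R -> R) (a x u y : R).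

(** Gaussian density of variance [a]. Its factor [a ^ (-1/2)] is written [exp (- ln a / 2)], so that
    both partial derivatives are [K] times a rational function. *)
Definition K a u : R := (Num.sqrt (pi *+ 2))^-1 * expR (- (2^-1 * ln a + u ^+ 2 / (2 * a))).

Lemma K_ge0 a u : 0 <= K a u.
Proof. by rewrite mulr_ge0 ?expR_ge0// invr_ge0 ltW// sqrt2pi_gt0. Qed.

Lemma dK_u a u : a != 0 -> is_derive u 1 (K a) (- (u / a) * K a u).
Proof.
move=> a0; rewrite /K; move: (Num.sqrt _)^-1 => c.
apply: is_derive_eq.
rewrite /GRing.scale/=.
by field.
Qed.

Lemma dK_a a u : 0 < a -> is_derive a 1 (K^~ u) ((u ^+ 2 / a ^+ 2 - a^-1) / 2 * K a u).
Proof.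
move=> a0.
have a0' : a != 0 by rewrite gt_eqF.
rewrite /K; move: (Num.sqrt _)^-1 => c.
have hl := is_derive1_ln a0.
have hi : is_derive a 1 (fun b => u ^+ 2 / (2 * b)) (- (u ^+ 2 / (2 * a ^+ 2))).
  have h2 : (2 * a) != 0 by rewrite mulf_neq0.
  apply: is_derive_eq.
  by rewrite /GRing.scale/=; field.
apply: is_derive_eq.
rewrite /GRing.scale/=.
by field.
Qed.

Lemma sqrK a z : 0 < a -> Num.sqrt a * K a (Num.sqrt a * z) = Gd z.
Proof.
move=> a0; have s0 : 0 < Num.sqrt a by rewrite sqrtr_gt0.
rewrite /K /Gd mulrCA; congr (_ * _).
rewrite opprD expRD mulrA.
have -> : expR (- (2^-1 * ln a)) = (Num.sqrt a)^-1.
  rewrite expRN; congr (_^-1).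
  by rewrite mulrC expRM lnK ?posrE// powR12_sqrt ?ltW.
rewrite divff ?gt_eqF// mul1r; congr (expR (- _)).
rewrite exprMn sqr_sqrtr ?ltW//; field; by rewrite gt_eqF.
Qed.

(** Since [(x - y)^2 >= y^2 / 2 - x^2], a single Gaussian in [y] dominates the kernel for bounded
    [x] and for [a] between two positive bounds, as differentiation under the integral requires. *)
Lemma K_bound (a0 a1 X : R) : 0 < a0 -> a0 <= a1 -> 0 <= X -> exists D k : R, [/\ 0 <= D, 0 < k &
  forall a x y, a0 <= a -> a <= a1 -> `|x| <= X -> K a (x - y) <= D * expR (- (k * y ^+ 2))].
Proof.
move=> a00 a01 X0.
have a10 : 0 < a1 by apply: lt_le_trans a01.
exists ((Num.sqrt (pi *+ 2))^-1 * expR (- (2^-1 * ln a0) + X ^+ 2 / (2 * a1))), (4 * a1)^-1; split.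
- by rewrite mulr_ge0 ?expR_ge0// invr_ge0 ltW// sqrt2pi_gt0.
- by rewrite invr_gt0 mulr_gt0.
move=> a x y h0 h1 xX; rewrite /K -[leRHS]mulrA ler_wpM2l ?invr_ge0 ?(ltW sqrt2pi_gt0)//.
rewrite -expRD ler_expR.
have ap : 0 < a by apply: lt_le_trans h0.
have hl : ln a0 <= ln a by rewrite ler_ln ?posrE.
have hx : x ^+ 2 <= X ^+ 2 by rewrite -[x ^+ 2]real_normK ?num_real// lerXn2r ?nnegrE.
have h2 : (x - y) ^+ 2 / (2 * a1) <= (x - y) ^+ 2 / (2 * a).
  by rewrite ler_wpM2l ?sqr_ge0// lef_pV2 ?posrE ?mulr_gt0// ler_wpM2l.
have h3 : (y ^+ 2 / 2 - X ^+ 2) / (2 * a1) <= (x - y) ^+ 2 / (2 * a1).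
  rewrite ler_wpM2r ?invr_ge0 ?mulr_ge0 ?(ltW a10)//.
  have : 0 <= (y - 2 * x) ^+ 2 by rewrite sqr_ge0.
  nra.
have h4 : (y ^+ 2 / 2 - X ^+ 2) / (2 * a1) = (4 * a1)^-1 * y ^+ 2 - X ^+ 2 / (2 * a1).
  by field; rewrite gt_eqF.
lra.
Qed.

(** Moments of the kernel. They are stable under differentiation in [x] and in [a], so every
    derivative of the heat flow of a merely measurable [f] can be read off from them. *)
Definition J f (n : nat) a x : R := Int (fun y => f y * (x - y) ^+ n * K a (x - y)).

Lemma J_dom f n (a0 a1 X : R) : egrow f -> 0 < a0 -> a0 <= a1 -> 0 <= X ->
  exists2 G : R -> R, intg G &
  forall a x y, a0 <= a -> a <= a1 -> `|x| <= X -> `|f y * (x - y) ^+ n * K a (x - y)| <= G y.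
Proof.
move=> hf a00 a01 X0; have [D [k [D0 k0 h]]] := K_bound a00 a01 X0.
exists (fun y => (`|f y| * (X + `|y|) ^+ n * D) * expR (- (k * y ^+ 2))).
  apply: intg_egrow => //; apply: egrowM; last exact: egrow_cst.
  apply: egrowM; first exact: egrow_norm.
  by apply: egrowX; apply: egrowD; [exact: egrow_cst|exact/egrow_norm/egrow_id].
move=> a x y h0 h1 xX; rewrite normrM (ger0_norm (K_ge0 _ _)) normrM normrX -!mulrA.
rewrite ler_wpM2l// ler_pM ?exprn_ge0 ?K_ge0//; last exact: h.
rewrite lerXn2r ?nnegrE ?addr_ge0//.
by apply: (le_trans (ler_normB _ _)); rewrite lerD2r.
Qed.

Lemma measurable_K a x : measurable_fun setT (fun y : R => K a (x - y)).
Proof.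
rewrite /K; apply: measurable_funM => //; apply: measurableT_comp => //.
apply: measurable_funN; apply: measurable_funD => //; apply: measurable_funM => //.
by apply: measurable_funX; apply: measurable_funB.
Qed.

Lemma measurable_Jf f n a x : egrow f -> measurable_fun setT (fun y : R => f y * (x - y) ^+ n * K a (x - y)).
Proof.
move=> [mf _]; apply: measurable_funM; last exact: measurable_K.
by apply: measurable_funM => //; apply: measurable_funX; apply: measurable_funB.
Qed.

Lemma intg_J f n a x : egrow f -> 0 < a -> intg (fun y => f y * (x - y) ^+ n * K a (x - y)).
Proof.
move=> hf a0; have [G iG h] := J_dom n hf a0 (lexx a) (normr_ge0 x).
by apply: (intg_le _ _ iG); [exact: measurable_Jf|move=> y; apply: h].
Qed.

Lemma JE f n a x : egrow f -> 0 < a ->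
  J f n a x = Eg (fun z => f (x + Num.sqrt a * z) * (- (Num.sqrt a * z)) ^+ n).
Proof.
move=> hf a0; have s0 : 0 < Num.sqrt a by rewrite sqrtr_gt0.
rewrite /J (Int_affine x s0 (intg_J n x hf a0)) -IntZl; last exact: (intg_affine x s0 (intg_J n x hf a0)).
apply: eq_Int => z.
have -> : x - (x + Num.sqrt a * z) = - (Num.sqrt a * z) by ring.
rewrite -(sqrK z a0) mulrCA; congr (_ * (_ * _)).
by rewrite /K sqrrN.
Qed.

Lemma heatJ f a x : egrow f -> 0 < a -> heat a f x = J f 0 a x.
Proof. by move=> hf a0; rewrite JE// /heat; apply: eq_Int => z; rewrite expr0 mulr1. Qed.

Lemma d_subX n (v y : R) : is_derive v 1 (fun v => (v - y) ^+ n) (n%:R * (v - y) ^+ n.-1).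
Proof.
have hs : is_derive v 1 (fun v : R => v - y) 1 by apply: is_derive_eq; rewrite oppr0 addr0.
have h := is_deriveX n hs.
rewrite exprfctE in h; apply: (is_derive_eq h).
by rewrite /GRing.scale/= mulr1.
Qed.

(** The index [n.-1] is harmless at [n = 0], where its coefficient is zero. *)
Lemma dJ_x f n a x : egrow f -> 0 < a ->
  is_derive x 1 (J f n a) (n%:R * J f n.-1 a x - J f n.+1 a x / a).
Proof.
move=> hf a0; have a0' : a != 0 by rewrite gt_eqF.
have X0 : 0 <= `|x| + 1 by rewrite addr_ge0.
have [G1 iG1 h1] := J_dom n.-1 hf a0 (lexx a) X0.
have [G2 iG2 h2] := J_dom n.+1 hf a0 (lexx a) X0.
have -> : n%:R * J f n.-1 a x - J f n.+1 a x / a =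
    Int (fun y => n%:R * (f y * (x - y) ^+ n.-1 * K a (x - y)) - (f y * (x - y) ^+ n.+1 * K a (x - y)) / a).
  rewrite IntB ?IntZl ?IntZr//; [exact: intg_J|exact: intg_J|apply/intgZl|apply/intgZr]; exact: intg_J.
have xX v : `|v - x| < 1 -> `|v| <= `|x| + 1.
  move=> vx; rewrite -[v](subrK x) addrC; apply: (le_trans (ler_normD _ _)); rewrite lerD2l; exact: ltW.
apply: (@derive_Int _ (fun v y => f y * (v - y) ^+ n * K a (v - y))
  (fun v y => n%:R * (f y * (v - y) ^+ n.-1 * K a (v - y)) - (f y * (v - y) ^+ n.+1 * K a (v - y)) / a)
  (fun y => n%:R * G1 y + G2 y / a) x 1) => //.
- by move=> v _; exact: intg_J.
- move=> v y _.
  have hK : is_derive v 1 (fun v => K a (v - y)) (- ((v - y) / a) * K a (v - y)).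
    have h := dK_u (v - y) a0'.
    have hs : is_derive v 1 (fun v : R => v - y) 1 by apply: is_derive_eq; rewrite oppr0 addr0.
    by have := @is_derive1_comp _ (K a) (fun v => v - y) v _ _ h hs; rewrite mulr1.
  have hX := d_subX n v y.
  have hXK := is_deriveM hX hK.
  have := is_deriveZ (f y) hXK.
  rewrite (_ : f y \*: _ = (fun v => f y * (v - y) ^+ n * K a (v - y))); last first.
    by apply/funext => w; rewrite /= /GRing.scale/= mulrA.
  move=> h; apply: (is_derive_eq h); rewrite /GRing.scale/= exprS.
  by move: (K a (v - y)) ((v - y) ^+ n.-1) ((v - y) ^+ n) => k1 k2 k3; field.
- by apply: intgD; [exact: intgZl|exact: intgZr].
- move=> v y /xX vX; apply: (le_trans (ler_normB _ _)); rewrite lerD//.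
    by rewrite normrM normr_nat ler_wpM2l// h1.
  by rewrite normrM normfV (gtr0_norm a0) ler_wpM2r ?invr_ge0 ?(ltW a0)// h2.
Qed.

Lemma dJ_a f n a x : egrow f -> 0 < a ->
  is_derive a 1 (J f n ^~ x) ((J f n.+2 a x / a ^+ 2 - J f n a x / a) / 2).
Proof.
move=> hf a0; have a0' : a != 0 by rewrite gt_eqF.
have a20 : 0 < a / 2 by rewrite divr_gt0.
have a2a : a / 2 <= 2 * a by lra.
have [G1 iG1 h1] := J_dom n hf a20 a2a (normr_ge0 x).
have [G2 iG2 h2] := J_dom n.+2 hf a20 a2a (normr_ge0 x).
have -> : (J f n.+2 a x / a ^+ 2 - J f n a x / a) / 2 =
    Int (fun y => ((f y * (x - y) ^+ n.+2 * K a (x - y)) / a ^+ 2 - (f y * (x - y) ^+ n * K a (x - y)) / a) / 2).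
  rewrite IntZr ?IntB ?IntZr//; try exact: intg_J; try (apply: intgZr; exact: intg_J).
  by apply: intgB; apply: intgZr; exact: intg_J.
have xX v : `|v - a| < a / 2 -> a / 2 < v /\ v < 2 * a.
  by rewrite ltr_norml => /andP[]; split; lra.
apply: (@derive_Int _ (fun v y => f y * (x - y) ^+ n * K v (x - y))
  (fun v y => ((f y * (x - y) ^+ n.+2 * K v (x - y)) / v ^+ 2 - (f y * (x - y) ^+ n * K v (x - y)) / v) / 2)
  (fun y => (G2 y / (a / 2) ^+ 2 + G1 y / (a / 2)) / 2) a (a / 2)).
- exact: a20.
- by move=> v /xX[v0 _]; apply: intg_J => //; lra.
- move=> v y /xX[v0 _].
  have v00 : 0 < v by lra.
  have hK := dK_a (x - y) v00.
  have := is_deriveZ (f y * (x - y) ^+ n) hK.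
  move=> h; apply: (is_derive_eq h); rewrite /GRing.scale/= !exprS expr0.
  move: (K v (x - y)) ((x - y) ^+ n) => k1 k2; field; by rewrite gt_eqF.
- by apply: intgZr; apply: intgD; exact: intgZr.
- move=> v y /xX[v0 v1].
  have v00 : 0 < v by lra.
  rewrite normrM (ger0_norm (_ : 0 <= 2^-1)) ?invr_ge0// ler_wpM2r ?invr_ge0//.
  apply: (le_trans (ler_normB _ _)); rewrite lerD//.
    rewrite normrM ler_pM//; first by apply: h2 => //; lra.
    rewrite ger0_norm ?invr_ge0 ?exprn_ge0 ?(ltW v00)//.
    by rewrite lef_pV2 ?posrE ?exprn_gt0// lerXn2r ?nnegrE; lra.
  rewrite normrM ler_pM//; first by apply: h1 => //; lra.
  rewrite ger0_norm ?invr_ge0 ?(ltW v00)//.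
  by rewrite lef_pV2 ?posrE//; lra.
Qed.

End Kernel.

Section Heat.
Context {R : realType}.
Implicit Types (f g : R -> R) (a x u y : R).

Lemma egrow_heat f a x : egrow f -> egrow (fun z => f (x + Num.sqrt a * z)).
Proof. exact: egrow_affine. Qed.

Lemma heatD f g a x : egrow f -> egrow g -> heat a (fun y => f y + g y) x = heat a f x + heat a g x.
Proof. by move=> hf hg; rewrite /heat EgD//; exact: egrow_heat. Qed.

Lemma heatB f g a x : egrow f -> egrow g -> heat a (fun y => f y - g y) x = heat a f x - heat a g x.
Proof. by move=> hf hg; rewrite /heat EgB//; exact: egrow_heat. Qed.

Lemma heatZ f k a x : egrow f -> heat a (fun y => k * f y) x = k * heat a f x.
Proof. by move=> hf; rewrite /heat EgZl//; exact: egrow_heat. Qed.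

Lemma heat_cst k a x : heat a (fun=> k) x = k.
Proof. by rewrite /heat Eg_cst. Qed.

Lemma le_heat f g a x : egrow f -> egrow g -> (forall y, f y <= g y) -> heat a f x <= heat a g x.
Proof. by move=> hf hg fg; rewrite /heat le_Eg//; exact: egrow_heat. Qed.

Lemma heat_ge0 f a x : (forall y, 0 <= f y) -> 0 <= heat a f x.
Proof. by move=> f0; apply: Eg_ge0. Qed.

Lemma heat_norm f a x : egrow f -> `|heat a f x| <= heat a (fun y => `|f y|) x.
Proof. by move=> hf; apply: le_norm_Eg; exact: egrow_heat. Qed.

Lemma heat0 f x : heat 0 f x = f x.
Proof.
rewrite /heat (_ : (fun z => f _) = (fun=> f x)) ?Eg_cst//.
by apply/funext => z; rewrite sqrtr0 mul0r addr0.
Qed.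

Lemma heat_opp f a x : egrow f -> heat a f (- x) = heat a (fun y => f (- y)) x.
Proof.
move=> hf; rewrite /heat -Eg_opp; last exact: egrow_affine.
by apply: eq_Int => z; rewrite mulrN -opprD.
Qed.

Lemma dheat_x f a x : egrow f -> 0 < a -> is_derive x 1 (heat a f) (- (J f 1 a x / a)).
Proof.
move=> hf a0; rewrite (_ : heat a f = J f 0 a); last by apply/funext => y; rewrite heatJ.
by apply: is_derive_eq; [exact: dJ_x|rewrite mul0r sub0r].
Qed.

Lemma dheat_xx f a x : egrow f -> 0 < a ->
  is_derive x 1 (fun x => - (J f 1 a x / a)) ((J f 2 a x / a - J f 0 a x) / a).
Proof.
move=> hf a0; have h := dJ_x 1 x hf a0.
by apply: is_derive_eq; rewrite /GRing.scale/= mulr0 add0r mul1r; field; rewrite gt_eqF.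
Qed.

(** Half of the value in [dheat_xx]: the heat equation, with all derivatives on the kernel. *)
Lemma dheat_a f a x : egrow f -> 0 < a ->
  is_derive a 1 (fun a => heat a f x) (((J f 2 a x / a - J f 0 a x) / a) / 2).
Proof.
move=> hf a0; have := dJ_a 0 x hf a0.
have -> : (J f 2 a x / a ^+ 2 - J f 0 a x / a) / 2 = ((J f 2 a x / a - J f 0 a x) / a) / 2.
  by field; rewrite gt_eqF.
apply: near_eq_is_derive => //.
near=> b; rewrite heatJ//; near: b; exact: lt_nbhsr.
Unshelve. all: by end_near. Qed.

(** The derivative falls on [f] and not on the kernel, which makes the formula valid down to
    [a = 0]. *)
Lemma dheat_f f (f' : R -> R) a x : egrow f -> egrow f' -> (forall y, is_derive y 1 f (f' y)) ->
  is_derive x 1 (heat a f) (heat a f' x).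
Proof.
move=> hf hf' df; have [_ [C [c [C0 c0 fC]]]] := hf'.
apply: (@derive_Int _ (fun v z => f (v + Num.sqrt a * z) * Gd z) (fun v z => f' (v + Num.sqrt a * z) * Gd z)
  (fun z => (C * expR (c * (`|x| + 1)) * expR ((c * Num.sqrt a) * `|z|)) * Gd z) x 1) => //.
- by move=> v _; apply: intg_Gd; exact: egrow_affine.
- move=> v z _; have h := df (v + Num.sqrt a * z).
  have hs : is_derive v 1 (fun v : R => v + Num.sqrt a * z) 1 by apply: is_derive_eq; rewrite addr0.
  have := @is_derive1_comp _ f (fun v => v + Num.sqrt a * z) v _ _ h hs; rewrite mulr1 => hc.
  by apply: is_derive_eq; rewrite /GRing.scale/= mulr0 add0r mulrC.
- by apply: intg_Gd; apply: egrowM; [exact: egrow_cst|exact: egrow_expR].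
- move=> v z vx; rewrite normrM (ger0_norm (Gd_ge0 _)) ler_wpM2r ?Gd_ge0//.
  apply: (le_trans (fC _)); rewrite -mulrA ler_wpM2l// -expRD ler_expR -mulrA -mulrDr ler_wpM2l//.
  apply: (le_trans (ler_normD _ _)); rewrite normrM (ger0_norm (sqrtr_ge0 _)) lerD2r.
  rewrite -[v](subrK x) addrC; apply: (le_trans (ler_normD _ _)); rewrite lerD2l; exact: ltW.
Qed.

Lemma heat_cont f a x : egrow f -> continuous f -> {for a, continuous (fun a => heat a f x)}.
Proof.
move=> hf cf; have [mf [C [c [C0 c0 fC]]]] := hf.
apply: (@cont_Int _ (fun b z => f (x + Num.sqrt b * z) * Gd z)
  (fun z => (C * expR (c * `|x|) * expR ((c * Num.sqrt (`|a| + 1)) * `|z|)) * Gd z) a 1) => //.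
- by move=> v _; apply: intg_Gd; exact: egrow_affine.
- move=> v z _; apply: cvgM; last exact: cvg_cst.
  apply: continuous_comp; last exact: cf.
  by apply: cvgD; [exact: cvg_cst|apply: cvgM; [exact: sqrt_continuous|exact: cvg_cst]].
- by apply: intg_Gd; apply: egrowM; [exact: egrow_cst|exact: egrow_expR].
- move=> v z vx; rewrite normrM (ger0_norm (Gd_ge0 _)) ler_wpM2r ?Gd_ge0//.
  apply: (le_trans (fC _)); rewrite -mulrA ler_wpM2l// -expRD ler_expR -mulrA -mulrDr ler_wpM2l//.
  apply: (le_trans (ler_normD _ _)); rewrite normrM (ger0_norm (sqrtr_ge0 _)) lerD2l ler_wpM2r//.
  rewrite ler_wsqrtr//; apply: (le_trans (ler_norm _)).
  rewrite -[v](subrK a) addrC; apply: (le_trans (ler_normD _ _)); rewrite lerD2l; exact: ltW.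
Qed.

(* Both sides are the second derivative of [heat a f]: the kernel or the function can be differentiated. *)
Lemma heat_ibp f (f' f'' : R -> R) a x : egrow f -> egrow f' -> egrow f'' ->
  (forall y, is_derive y 1 f (f' y)) -> (forall y, is_derive y 1 f' (f'' y)) -> 0 < a ->
  (J f 2 a x / a - J f 0 a x) / a = heat a f'' x.
Proof.
move=> hf hf' hf'' df df' a0.
have e : heat a f' = (fun x => - (J f 1 a x / a)).
  apply/funext => y.
  by rewrite -(derive_val (is_derive := dheat_f a y hf hf' df)) -(derive_val (is_derive := dheat_x y hf a0)).
have := dheat_f a x hf' hf'' df'; rewrite e => h.
by rewrite -(derive_val (is_derive := h)) -(derive_val (is_derive := dheat_xx x hf a0)).
Qed.

End Heat.

(** * The Cole-Hopf operator on convex profiles *)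

Section ExLg.
Context {R : realType}.
Implicit Types (g x y : R).

(** The exponential and the logarithm of the Cole-Hopf transformation, normalised to have value 0
    and slope 1 at the origin. With this normalisation the level [g = 0] is the limit of the
    positive ones, and there the operator becomes the linear heat flow. *)
Definition ex g x : R := if g == 0 then x else (expR (g * x) - 1) / g.
Definition lg g y : R := if g == 0 then y else ln (1 + g * y) / g.

Lemma ex_om g x : 1 + g * ex g x = expR (g * x).
Proof.
rewrite /ex; case: eqVneq => [->|g0]; first by rewrite !mul0r expR0 addr0.
by rewrite mulrCA divff// mulr1 addrC subrK.
Qed.

Lemma exK g x : lg g (ex g x) = x.
Proof.
rewrite /lg ex_om /ex; case: eqVneq => // g0.
by rewrite expRK mulrAC divff// mul1r.
Qed.

Lemma lgK g y : 0 < 1 + g * y -> ex g (lg g y) = y.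
Proof.
rewrite /ex /lg; case: eqVneq => // g0 h.
by rewrite mulrCA divff// mulr1 lnK ?posrE// addrAC subrr add0r mulrAC divff// mul1r.
Qed.

Lemma dex g x : is_derive x 1 (ex g) (expR (g * x)).
Proof.
rewrite /ex; case: eqVneq => [->|g0]; first by rewrite mul0r expR0; exact: is_derive_id.
apply: is_derive_eq; rewrite /GRing.scale/=.
by move: (expR _) => e; field.
Qed.

Lemma dlg g y : 0 < 1 + g * y -> is_derive y 1 (lg g) (1 + g * y)^-1.
Proof.
rewrite /lg; case: eqVneq => [->|g0] h; first by rewrite mul0r addr0 invr1; exact: is_derive_id.
have hl := is_derive1_ln h.
have hs : is_derive y 1 (fun y => 1 + g * y) g by apply: is_derive_eq; rewrite /GRing.scale/=; ring.
have hc := @is_derive1_comp _ (@ln R) (fun y => 1 + g * y) y _ _ hl hs.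
have := is_deriveZ g^-1 hc.
rewrite (_ : g^-1 \*: _ = (fun y => ln (1 + g * y) / g)); last first.
  by apply/funext => w; rewrite /= /GRing.scale/= mulrC.
move=> hd; apply: (is_derive_eq hd); rewrite /GRing.scale/=.
by rewrite mulrC -mulrA divff// mulr1.
Qed.

Lemma le_ex g x y : 0 <= g -> x <= y -> ex g x <= ex g y.
Proof.
rewrite le_eqVlt eq_sym => /predU1P[->|g0] xy; first by rewrite /ex eqxx.
by rewrite /ex gt_eqF// ler_pM2r ?invr_gt0// lerD2r ler_expR ler_pM2l.
Qed.

Lemma le_lg g x y : 0 <= g -> 0 < 1 + g * x -> x <= y -> lg g x <= lg g y.
Proof.
rewrite le_eqVlt eq_sym => /predU1P[->|g0] h xy; first by rewrite /lg eqxx.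
have h' : 1 + g * x <= 1 + g * y by rewrite lerD2l ler_pM2l.
by rewrite /lg gt_eqF// ler_pM2r ?invr_gt0// ler_ln ?posrE//; apply: lt_le_trans h'.
Qed.

Lemma ex0 g : ex g 0 = 0.
Proof. by rewrite /ex mulr0 expR0 subrr mul0r; case: ifP. Qed.

Lemma ex_ge0 g x : 0 <= g -> 0 <= x -> 0 <= ex g x.
Proof. by move=> g0 /(le_ex g0); rewrite ex0. Qed.

Lemma ex_le g x : 0 <= g -> 0 <= x -> ex g x <= x * expR (g * x).
Proof.
rewrite le_eqVlt eq_sym => /predU1P[->|g0] x0; first by rewrite /ex eqxx mul0r expR0 mulr1.
rewrite /ex gt_eqF// ler_pdivrMr// lerBlDl.
have h := expR_ge1Dx (- (g * x)).
have : expR (g * x) * (1 - g * x) <= 1.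
  apply: (le_trans (ler_wpM2l (expR_ge0 _) h)); rewrite -expRD subrr expR0//.
by move: (expR _) => e; lra.
Qed.

(** The tangent to the exponential at the mean [M] lies below it, and averaging its values at [A]
    and [B] gives back [exp M]. *)
Lemma convex_exp (t A B : R) : 0 <= t <= 1 ->
  expR (t * A + (1 - t) * B) <= t * expR A + (1 - t) * expR B.
Proof.
move=> /andP[t0 t1]; set M := t * A + (1 - t) * B.
have h C : expR M * (1 + (C - M)) <= expR C.
  rewrite -[X in _ <= expR X](_ : M + (C - M) = C); last by ring.
  by rewrite [leRHS]expRD; apply: ler_wpM2l; [exact: expR_ge0|exact: expR_ge1Dx].
have t1' : 0 <= 1 - t by rewrite subr_ge0.
apply: (le_trans _ (lerD (ler_wpM2l t0 (h A)) (ler_wpM2l t1' (h B)))).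
rewrite le_eqVlt; apply/orP; left; apply/eqP.
by rewrite /M; move: (expR _) => e; ring.
Qed.

(** The form of convexity behind Hölder's inequality. The heights [u] and [w] are free (later,
    values of the Cole-Hopf operator at two points) and [M] is [c] times their mean; with these
    weights [exp_shift_sum] recombines the right-hand side into [exp M]. *)
Lemma convex_exp_shift (c t M u w f1 f2 f3 : R) : 0 <= c -> 0 <= t <= 1 ->
  M = c * (t * u + (1 - t) * w) -> f3 <= t * f1 + (1 - t) * f2 ->
  expR (c * f3) <= t * expR (M - c * u) * expR (c * f1) + (1 - t) * expR (M - c * w) * expR (c * f2).
Proof.
move=> c0 t01 ME h.
have e1 : t * expR (M - c * u) * expR (c * f1) = t * expR (M - c * u + c * f1) by rewrite -mulrA -expRD.
have e2 : (1 - t) * expR (M - c * w) * expR (c * f2) = (1 - t) * expR (M - c * w + c * f2) by rewrite -mulrA -expRD.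
rewrite e1 e2; apply: le_trans (convex_exp _ _ t01); rewrite ler_expR.
apply: (le_trans (ler_wpM2l c0 h)).
by rewrite le_eqVlt; apply/orP; left; apply/eqP; rewrite ME; ring.
Qed.

Lemma exp_shift_sum (t M u w : R) :
  t * expR (M - u) * expR u + (1 - t) * expR (M - w) * expR w = expR M.
Proof.
have e1 : t * expR (M - u) * expR u = t * expR M by rewrite -mulrA -expRD subrK.
have e2 : (1 - t) * expR (M - w) * expR w = (1 - t) * expR M by rewrite -mulrA -expRD subrK.
by rewrite e1 e2 -mulrDl addrC subrK mul1r.
Qed.

End ExLg.

Section Profiles.
Context {R : realType}.
Implicit Types (f g : R -> R) (c a x y : R).

(** The properties of log cosh that the Cole-Hopf operator preserves. The constants of the gap
    estimates depend on a function through these alone, hence neither on beta nor on the number of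
    levels already applied. *)
Record profile (f : R -> R) : Prop := Profile {
  pr_der : forall y, derivable f y 1;
  pr_cont : continuous (derive1 f);
  pr_le1 : forall y, `|derive1 f y| <= 1;
  pr_ge0 : forall y, 0 <= f y;
  pr_even : forall y, f (- y) = f y;
  pr_convex : forall t x y, 0 <= t <= 1 -> f (t * x + (1 - t) * y) <= t * f x + (1 - t) * f y
}.

Lemma pr_is_derive f y : profile f -> is_derive y 1 f (derive1 f y).
Proof. by move=> hf; rewrite derive1E; apply: derivableP; exact: pr_der. Qed.

Lemma pr_continuous f : profile f -> continuous f.
Proof. by move=> hf x; apply: differentiable_continuous; apply/derivable1_diffP; exact: pr_der. Qed.

Lemma lip_derive f : (forall y, derivable f y 1) -> (forall y, `|derive1 f y| <= 1) ->
  forall x y, `|f x - f y| <= `|x - y|.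
Proof.
move=> df d1.
have cf : continuous f by move=> z; apply: differentiable_continuous; apply/derivable1_diffP.
suff main x y : x < y -> `|f y - f x| <= `|y - x|.
  move=> x y; case: (ltgtP x y) => [xy|xy|->]; last by rewrite !subrr.
    by rewrite distrC [leRHS]distrC; exact: main.
  exact: main.
move=> xy.
have [||z _ ->] := @MVT R f (derive1 f) x y xy.
- by move=> z _; rewrite derive1E; apply: derivableP.
- exact: continuous_subspaceT.
by rewrite normrM ler_piMl.
Qed.

Lemma pr_lip f x y : profile f -> `|f x - f y| <= `|x - y|.
Proof. by move=> hf; apply: lip_derive; [exact: pr_der|exact: pr_le1]. Qed.

Lemma pr_le f y : profile f -> f y <= f 0 + `|y|.
Proof.
by move=> hf; rewrite -lerBlDl; apply: (le_trans (ler_norm _)); apply: (le_trans (pr_lip _ _ hf)); rewrite subr0.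
Qed.

Lemma egrow_pr f : profile f -> egrow f.
Proof.
move=> hf; apply: (@egrow_le _ f (fun y => f 0 + `|y|)).
- exact: continuous_measurable_fun (pr_continuous hf).
- by move=> y; rewrite ger0_norm ?pr_ge0// pr_le.
- by apply: egrowD; [exact: egrow_cst|exact/egrow_norm/egrow_id].
Qed.

Definition om c f y : R := expR (c * f y).

Lemma om_ge1 c f y : profile f -> 0 <= c -> 1 <= om c f y.
Proof. by move=> hf c0; rewrite -[1]expR0 ler_expR mulr_ge0// pr_ge0. Qed.

Lemma om_continuous c f : profile f -> continuous (om c f).
Proof.
move=> hf y; apply: (@continuous_comp _ _ _ (fun y => c * f y) expR); last exact: continuous_expR.
by apply: cvgM; [exact: cvg_cst|exact: pr_continuous].
Qed.

Lemma egrow_om c f : profile f -> 0 <= c -> egrow (om c f).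
Proof.
move=> hf c0; apply: (@egrow_le _ _ (fun y => expR (c * f 0) * expR (c * `|y|))).
- by apply: continuous_measurable_fun; exact: om_continuous.
- move=> y; rewrite ger0_norm ?expR_ge0// -expRD ler_expR -mulrDr ler_wpM2l//.
  exact: pr_le.
- by apply: egrowM; [exact: egrow_cst|exact: egrow_expR].
Qed.

Lemma exf_continuous c f : profile f -> continuous (fun y => ex c (f y)).
Proof.
move=> hf y; apply: (@continuous_comp _ _ _ f (ex c)); first exact: pr_continuous.
by apply: differentiable_continuous; apply/derivable1_diffP; have [] := dex c (f y).
Qed.

Lemma egrow_ex c f : profile f -> 0 <= c -> egrow (fun y => ex c (f y)).
Proof.
move=> hf c0; apply: (@egrow_le _ _ (fun y => f y * om c f y)).
- by apply: continuous_measurable_fun; exact: exf_continuous.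
- move=> y; rewrite ger0_norm; first by apply: ex_le => //; exact: pr_ge0.
  by apply: ex_ge0 => //; exact: pr_ge0.
- by apply: egrowM; [exact: egrow_pr|exact: egrow_om].
Qed.

Lemma egrow_dpr f : profile f -> egrow (derive1 f).
Proof.
move=> hf; apply: (@egrow_le _ _ (fun=> 1)); last exact: egrow_cst.
  exact: continuous_measurable_fun (pr_cont hf).
exact: pr_le1.
Qed.

Lemma dexf c f y : profile f -> is_derive y 1 (fun y => ex c (f y)) (om c f y * derive1 f y).
Proof. by move=> hf; apply: is_derive1_comp; [exact: dex|exact: pr_is_derive]. Qed.

(* Locked: failing conversions would otherwise unfold it down to the integral. *)
Fact Phi_key : unit. Proof. exact: tt. Qed.
Definition Phi : R -> R -> (R -> R) -> R -> R :=
  locked_with Phi_key (fun c a f x => lg c (heat a (fun y => ex c (f y)) x)).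

Lemma PhiE c a f : Phi c a f = fun x => lg c (heat a (fun y => ex c (f y)) x).
Proof. by rewrite /Phi unlock. Qed.

Section PhiBasic.
Variables (c a : R) (f : R -> R).
Hypotheses (hf : profile f) (c0 : 0 <= c).

Lemma heat_om x : 1 + c * heat a (fun y => ex c (f y)) x = heat a (om c f) x.
Proof.
rewrite -heatZ; last exact: egrow_ex.
rewrite -{1}(heat_cst 1 a x) -heatD; [|exact: egrow_cst|]; last first.
  by apply: egrowM; [exact: egrow_cst|exact: egrow_ex].
by congr (heat a _ x); apply/funext => y; rewrite ex_om.
Qed.

Lemma heat_om_ge1 x : 1 <= heat a (om c f) x.
Proof.
rewrite -[leLHS](heat_cst 1 a x); apply: le_heat; [exact: egrow_cst|exact: egrow_om|].
by move=> y; exact: om_ge1.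
Qed.

Lemma heat_om_gt0 x : 0 < heat a (om c f) x.
Proof. exact: lt_le_trans ltr01 (heat_om_ge1 x). Qed.

Lemma ex_Phi x : ex c (Phi c a f x) = heat a (fun y => ex c (f y)) x.
Proof. by rewrite PhiE lgK// heat_om heat_om_gt0. Qed.

Lemma om_Phi x : om c (Phi c a f) x = heat a (om c f) x.
Proof. by rewrite /om -ex_om ex_Phi heat_om. Qed.

Lemma egrow_omd : egrow (fun y => om c f y * derive1 f y).
Proof. by apply: egrowM; [exact: egrow_om|exact: egrow_dpr]. Qed.

Lemma dPhi x : is_derive x 1 (Phi c a f)
  (heat a (fun y => om c f y * derive1 f y) x / heat a (om c f) x).
Proof.
have h1 := dheat_f a x (egrow_ex hf c0) egrow_omd (fun y => dexf c y hf).
have h2 : is_derive (heat a (fun y => ex c (f y)) x) 1 (lg c) (1 + c * heat a (fun y => ex c (f y)) x)^-1.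
  by apply: dlg; rewrite heat_om heat_om_gt0.
by rewrite PhiE; have := is_derive1_comp h2 h1; rewrite heat_om mulrC.
Qed.

Lemma dPhiE x : derive1 (Phi c a f) x =
  heat a (fun y => om c f y * derive1 f y) x / heat a (om c f) x.
Proof. by rewrite derive1E; apply: derive_val; exact: dPhi. Qed.

Lemma Phi_ge0 x : 0 <= Phi c a f x.
Proof.
rewrite PhiE -[X in X <= _](exK c) ex0; apply: le_lg => //; first by rewrite mulr0 addr0.
by apply: heat_ge0 => y; rewrite ex_ge0// pr_ge0.
Qed.

Lemma Phi_even x : Phi c a f (- x) = Phi c a f x.
Proof.
rewrite PhiE heat_opp; last exact: egrow_ex.
by congr (lg c (heat a _ x)); apply/funext => y; rewrite pr_even.
Qed.

(** For [c > 0] this is Hölder's inequality for exponential Gaussian means; for [c = 0] the operator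
    is a plain average. *)
Lemma Phi_convex (t x y : R) : 0 <= t <= 1 ->
  Phi c a f (t * x + (1 - t) * y) <= t * Phi c a f x + (1 - t) * Phi c a f y.
Proof.
move=> t01; have /andP[t0 t1] := t01; have t1' : 0 <= 1 - t by rewrite subr_ge0.
have xyz z : t * x + (1 - t) * y + Num.sqrt a * z =
    t * (x + Num.sqrt a * z) + (1 - t) * (y + Num.sqrt a * z) by ring.
have [cE|cn0] := eqVneq c 0.
  rewrite PhiE /lg cE eqxx /heat.
  have e w : egrow (fun z => ex 0 (f (w + Num.sqrt a * z))).
    by rewrite -cE; exact: (egrow_affine _ _ (egrow_ex hf c0)).
  rewrite -!EgZl// -EgD; [|by apply: egrowM => //; exact: egrow_cst..].
  apply: le_Eg => //; first by apply: egrowD; apply: egrowM => //; exact: egrow_cst.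
  by move=> z; rewrite /ex eqxx xyz; exact: pr_convex.
have cp : 0 < c by rewrite lt_neqAle eq_sym cn0.
set u := Phi c a f x; set w := Phi c a f y.
rewrite -(ler_pM2l cp) -ler_expR -/(om c (Phi c a f) _) om_Phi.
have hu : heat a (om c f) x = expR (c * u) := esym (om_Phi x).
have hw : heat a (om c f) y = expR (c * w) := esym (om_Phi y).
(* Normalising factors: once the means at [x] and [y] are written as [exp (c * u)] and
   [exp (c * w)], the weighted sum is exactly the exponential of the claimed bound. *)
pose k1 := expR (c * (t * u + (1 - t) * w) - c * u).
pose k2 := expR (c * (t * u + (1 - t) * w) - c * w).
have e v : egrow (fun z => om c f (v + Num.sqrt a * z)).
  by apply: egrow_affine; exact: egrow_om.
apply: (@le_trans _ _ (t * k1 * heat a (om c f) x + (1 - t) * k2 * heat a (om c f) y)).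
  have e1 := egrowM (egrow_cst (t * k1)) (e x).
  have e2 := egrowM (egrow_cst ((1 - t) * k2)) (e y).
  have E3 := EgD e1 e2.
  rewrite (EgZl _ (e x)) (EgZl _ (e y)) in E3.
  rewrite -[leRHS]E3; apply: le_Eg; [exact: e|exact: egrowD e1 e2|].
  move=> z; rewrite xyz; apply: convex_exp_shift => //; exact: pr_convex.
by rewrite hu hw le_eqVlt; apply/orP; left; apply/eqP; exact: exp_shift_sum.
Qed.

Lemma heat_continuous h : 0 <= a -> egrow h -> continuous h -> continuous (heat a h).
Proof.
rewrite le_eqVlt => /predU1P[<-|a0] hh ch.
  by rewrite (_ : heat 0 h = h)//; apply/funext => x; exact: heat0.
move=> x; apply: differentiable_continuous; apply/derivable1_diffP.
by have [] := dheat_x x hh a0.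
Qed.

Lemma omd_continuous : continuous (fun y => om c f y * derive1 f y).
Proof. by move=> y; apply: cvgM; [exact: om_continuous|exact: pr_cont]. Qed.

Lemma Phi_le1 x : `|derive1 (Phi c a f) x| <= 1.
Proof.
rewrite dPhiE normrM normfV (gtr0_norm (heat_om_gt0 x)) ler_pdivrMr ?heat_om_gt0// mul1r.
apply: (le_trans (heat_norm _ _ egrow_omd)); apply: le_heat; [exact/egrow_norm/egrow_omd|exact: egrow_om|].
by move=> y; rewrite normrM (ger0_norm (expR_ge0 _)) ler_piMr ?expR_ge0// pr_le1.
Qed.

Lemma profile_Phi : 0 <= a -> profile (Phi c a f).
Proof.
move=> a0; split.
- by move=> y; have [] := dPhi y.
- rewrite (_ : derive1 _ = (fun x => heat a (fun y => om c f y * derive1 f y) x / heat a (om c f) x)); last first.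
    by apply/funext => x; exact: dPhiE.
  move=> x; apply: cvgM; first by apply: heat_continuous; [|exact: egrow_omd|exact: omd_continuous].
  apply: cvgV; first by rewrite gt_eqF// heat_om_gt0.
  by apply: heat_continuous; [|exact: egrow_om|exact: om_continuous].
- exact: Phi_le1.
- exact: Phi_ge0.
- exact: Phi_even.
- exact: Phi_convex.
Qed.

End PhiBasic.

Lemma Phi0 c f : Phi c 0 f = f.
Proof. by apply/funext => x; rewrite PhiE heat0 exK. Qed.

Lemma Phi_a_cont c f a x : profile f -> 0 <= c -> {for a, continuous (fun a => Phi c a f x)}.
Proof.
move=> hf c0.
rewrite (_ : (fun a => Phi c a f x) = (fun a => lg c (heat a (fun y => ex c (f y)) x))); last by apply/funext => b; rewrite PhiE.
apply: (@continuous_comp _ _ _ (fun a => heat a (fun y => ex c (f y)) x) (lg c)).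
  by apply: heat_cont; [exact: egrow_ex|exact: exf_continuous].
apply: differentiable_continuous; apply/derivable1_diffP.
by have [] := dlg (y := heat a (fun y => ex c (f y)) x) (_ : 0 < 1 + c * _); rewrite ?heat_om// heat_om_gt0.
Qed.

Lemma dPhi_a_cont c f a x : profile f -> 0 <= c -> {for a, continuous (fun a => derive1 (Phi c a f) x)}.
Proof.
move=> hf c0.
rewrite (_ : (fun a => derive1 (Phi c a f) x) = (fun a => heat a (fun y => om c f y * derive1 f y) x / heat a (om c f) x)); last first.
  by apply/funext => b; exact: dPhiE.
apply: cvgM; first by apply: heat_cont; [exact: egrow_omd|exact: omd_continuous].
apply: cvgV; first by rewrite gt_eqF// heat_om_gt0.
by apply: heat_cont; [exact: egrow_om|exact: om_continuous].
Qed.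

(** Second space derivative of the heat flow of [ex c o f], taken on the kernel because a profile is
    only C^1. *)
Definition Uxx c a f x : R :=
  (J (fun y => ex c (f y)) 2 a x / a - J (fun y => ex c (f y)) 0 a x) / a.

Definition Phixx c a f x : R :=
  Uxx c a f x / heat a (om c f) x - c * derive1 (Phi c a f) x ^+ 2.

Lemma dPhi_xx c a f x : profile f -> 0 <= c -> 0 < a ->
  is_derive x 1 (derive1 (Phi c a f)) (Phixx c a f x).
Proof.
move=> hf c0 a0.
have hU : is_derive x 1 (heat a (fun y => om c f y * derive1 f y)) (Uxx c a f x).
  have -> : heat a (fun y => om c f y * derive1 f y) = (fun x => - (J (fun y => ex c (f y)) 1 a x / a)).
    apply/funext => y.
    rewrite -(derive_val (is_derive := dheat_f a y (egrow_ex hf c0) (egrow_omd hf c0) (fun y => dexf c y hf))).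
    by rewrite -(derive_val (is_derive := dheat_x y (egrow_ex hf c0) a0)).
  exact: dheat_xx (egrow_ex hf c0) a0.
have hN : is_derive x 1 (heat a (om c f)) (c * heat a (fun y => om c f y * derive1 f y) x).
  have -> : heat a (om c f) = (fun x => 1 + c * heat a (fun y => ex c (f y)) x).
    by apply/funext => y; rewrite heat_om.
  have h1 := dheat_f a x (egrow_ex hf c0) (egrow_omd hf c0) (fun y => dexf c y hf).
  have h2 := is_deriveZ c h1.
  have := is_deriveD (is_derive_cst (1 : R) x 1) h2.
  by rewrite add0r.
have n0 : heat a (om c f) x != 0 by rewrite gt_eqF// heat_om_gt0.
rewrite (_ : derive1 _ = (fun x => heat a (fun y => om c f y * derive1 f y) x / heat a (om c f) x)); last first.
  by apply/funext => b; exact: dPhiE.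
have hV := is_deriveV n0 hN.
have := is_deriveM hU hV.
move=> h; apply: (is_derive_eq h); rewrite /Phixx dPhiE// /GRing.scale/=.
move: n0; move: (heat a (om c f) x) (heat a _ x) (Uxx _ _ _ _) => N D U n0.
by field.
Qed.

(** The Parisi equation on one level, with the variance as backward time. The quadratic term added
    here cancels the one inside [Phixx], and what remains is the heat equation for
    [ex c (Phi c a f)] divided by its weight. *)
Lemma dPhi_a c a f x : profile f -> 0 <= c -> 0 < a ->
  is_derive a 1 (fun a => Phi c a f x) ((Phixx c a f x + c * derive1 (Phi c a f) x ^+ 2) / 2).
Proof.
move=> hf c0 a0.
have h1 := dheat_a x (egrow_ex hf c0) a0.
have h2 : is_derive (heat a (fun y => ex c (f y)) x) 1 (lg c) (1 + c * heat a (fun y => ex c (f y)) x)^-1.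
  by apply: dlg; rewrite heat_om// heat_om_gt0.
have := @is_derive1_comp _ (lg c) (fun a => heat a (fun y => ex c (f y)) x) a _ _ h2 h1.
move=> h; under eq_fun do rewrite PhiE.
apply: (is_derive_eq h).
by rewrite heat_om// /Phixx subrK -/(Uxx c a f x) mulrA [_^-1 * _]mulrC.
Qed.

Lemma J_egrow h n A : egrow h -> 0 <= A -> exists C k : R, [/\ 0 <= C, 0 <= k &
  forall a x, 0 < a -> a <= A -> `|J h n a x| <= C * expR (k * `|x|)].
Proof.
move=> hh A0; have [mh [C [k [C0 k0 hC]]]] := hh.
pose E := Eg (fun z : R => C * expR (k * Num.sqrt A * `|z|) * (Num.sqrt A * `|z|) ^+ n).
have eE : egrow (fun z : R => C * expR (k * Num.sqrt A * `|z|) * (Num.sqrt A * `|z|) ^+ n).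
  apply: egrowM; first by apply: egrowM; [exact: egrow_cst|exact: egrow_expR].
  by apply: egrowX; apply: egrowM; [exact: egrow_cst|exact/egrow_norm/egrow_id].
exists E, k; split => //.
  by apply: Eg_ge0 => z; rewrite !mulr_ge0 ?expR_ge0 ?exprn_ge0 ?mulr_ge0.
move=> a x a0 aA; rewrite JE// /E mulrC -EgZl//.
have e1 : egrow (fun z => h (x + Num.sqrt a * z) * (- (Num.sqrt a * z)) ^+ n).
  apply: egrowM; first exact: egrow_affine.
  by apply: egrowX; apply: egrowN; apply: egrowM; [exact: egrow_cst|exact: egrow_id].
apply: (le_trans (le_norm_Eg e1)); apply: le_Eg; [exact: egrow_norm|by apply: egrowM => //; exact: egrow_cst|].
have sA : Num.sqrt a <= Num.sqrt A by rewrite ler_wsqrtr.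
move=> z; rewrite normrM normrX normrN normrM (ger0_norm (sqrtr_ge0 _)) mulrA.
rewrite ler_pM ?exprn_ge0 ?mulr_ge0//; last by rewrite lerXn2r ?nnegrE ?mulr_ge0// ler_wpM2r.
apply: (le_trans (hC _)); rewrite mulrCA ler_wpM2l// -expRD ler_expR -mulrA -mulrDr ler_wpM2l//.
apply: (le_trans (ler_normD _ _)); rewrite lerD2l normrM (ger0_norm (sqrtr_ge0 _)) ler_wpM2r//.
Qed.

(** The bound degenerates as [a] tends to 0, since a profile need not have a second derivative; it
    provides dominating functions where the variance stays away from 0. *)
Lemma Phi_bounds c f A : profile f -> 0 <= c -> 0 < A -> exists C k : R, [/\ 0 <= C, 0 <= k &
  forall a x, 0 < a -> a <= A -> `|Phixx c a f x| <= C * expR (k * `|x|) / a ^+ 2].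
Proof.
move=> hf c0 A0.
have [C2 [k2 [C20 k20 h2]]] := J_egrow 2 (egrow_ex hf c0) (ltW A0).
have [C1 [k1 [C10 k10 h1]]] := J_egrow 0 (egrow_ex hf c0) (ltW A0).
exists (C2 + A * C1 + c * A ^+ 2), (k1 + k2); split; rewrite ?addr_ge0 ?mulr_ge0 ?(ltW A0) ?exprn_ge0//.
move=> a x a0 aA.
rewrite ler_pdivlMr ?exprn_gt0// -[X in _ * X](ger0_norm (exprn_ge0 2 (ltW a0))) -normrM.
rewrite /Phixx mulrBl; apply: (le_trans (ler_normB _ _)); rewrite [leRHS]mulrDl lerD//.
  rewrite mulrAC normrM normfV (gtr0_norm (heat_om_gt0 _ hf c0 _)).
  apply: (@le_trans _ _ `|Uxx c a f x * a ^+ 2|).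
    by rewrite ler_pdivrMr ?heat_om_gt0// ler_peMr// heat_om_ge1.
  rewrite /Uxx (_ : _ * _ = J (fun y => ex c (f y)) 2 a x - a * J (fun y => ex c (f y)) 0 a x); last first.
    by field; rewrite gt_eqF.
  apply: (le_trans (ler_normB _ _)); rewrite mulrDl lerD//.
    apply: (le_trans (h2 _ _ a0 aA)); rewrite ler_wpM2l// ler_expR ler_wpM2r// lerDr//.
  rewrite normrM (gtr0_norm a0) -mulrA ler_pM ?(ltW a0)//.
  apply: (le_trans (h1 _ _ a0 aA)); rewrite ler_wpM2l// ler_expR ler_wpM2r// lerDl//.
have hd : derive1 (Phi c a f) x ^+ 2 <= 1.
  by rewrite -[_ ^+ 2]real_normK ?num_real// exprn_ile1// Phi_le1.
rewrite ger0_norm; last by apply: mulr_ge0; [apply: mulr_ge0 => //; exact: sqr_ge0|exact: sqr_ge0].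
rewrite -[leLHS]mulrA -[leRHS]mulrA; apply: ler_wpM2l => //.
apply: (@le_trans _ _ (1 * A ^+ 2)).
  apply: ler_pM; rewrite ?sqr_ge0//.
  by rewrite lerXn2r ?nnegrE ?(ltW a0) ?(ltW A0).
rewrite mul1r ler_peMr ?exprn_ge0 ?(ltW A0)//.
by rewrite -[1]expR0 ler_expR mulr_ge0// addr_ge0.
Qed.

(** [x] is a convex combination of [y] and [- y], where an even function takes the same value. *)
Lemma pr_monotone f x y : profile f -> `|x| <= `|y| -> f x <= f y.
Proof.
move=> hf xy; have [y0|y0] := eqVneq y 0.
  by move: xy; rewrite y0 normr0 normr_le0 => /eqP ->.
pose t := (x / y + 1) / 2.
have xy1 : `|x / y| <= 1 by rewrite normrM normfV ler_pdivrMr ?normr_gt0// mul1r.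
have t01 : 0 <= t <= 1 by move: xy1; rewrite ler_norml /t => /andP[h1 h2]; apply/andP; split; lra.
have -> : x = t * y + (1 - t) * (- y) by rewrite /t; field.
apply: (le_trans (pr_convex hf _ _ t01)); rewrite (pr_even hf).
by rewrite -mulrDl addrC subrK mul1r.
Qed.

Lemma dpr_odd f y : profile f -> derive1 f (- y) = - derive1 f y.
Proof.
move=> hf.
have hs : is_derive y 1 (fun y : R => - y) (-1) by exact: is_deriveNid.
have := @is_derive1_comp _ f (fun y => - y) y _ _ (pr_is_derive (- y) hf) hs.
rewrite (_ : _ \o _ = f); last by apply/funext => z /=; exact: pr_even.
by move=> h; rewrite [X in _ = - X]derive1E (derive_val (is_derive := h)) mulrN1 opprK.
Qed.

Lemma dpr_le0 f y : profile f -> y <= 0 -> derive1 f y <= 0.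
Proof.
move=> hf; rewrite le_eqVlt => /predU1P[->|y0].
  by have := dpr_odd 0 hf; rewrite oppr0 => h; lra.
rewrite -[leRHS]addr0 -lerBlDl; apply/ler_addgt0Pr => k k0; rewrite add0r.
(* Subtracting [k * z] turns the monotonicity on the negative half-line into a strict one; the slope
   is then at most [k], for every [k > 0]. *)
have hk (z : R) : is_derive z 1 (fun z => f z - k * z) (derive1 f z - k).
  have h1 := pr_is_derive z hf.
  by apply: is_derive_eq; rewrite /GRing.scale/=; ring.
suff : derive1 (fun z => f z - k * z) y <= 0.
  by rewrite derive1E (derive_val (is_derive := hk y)); lra.
apply: (@decr_derive1_le0_itvNy _ _ true 0).
- by move=> z _; have [] := hk z.
- move=> u v; rewrite !in_itv/= => u0 v0 uv.
  have : f u <= f v by apply: pr_monotone => //; rewrite !ltr0_norm//; lra.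
  have : k * v < k * u by rewrite ltr_pM2l.
  by lra.
- by rewrite in_itv/=.
Qed.

Definition lcosh (b x : R) : R := ln (cosh (b * x)) / b.

Lemma cosh_gt0 (x : R) : 0 < cosh x.
Proof. by rewrite divr_gt0// addr_gt0 ?expR_gt0. Qed.

Lemma dlcosh b x : 0 < b -> is_derive x 1 (lcosh b)
  ((expR (b * x) - expR (- (b * x))) / (expR (b * x) + expR (- (b * x)))).
Proof.
move=> b0; have hl := is_derive1_ln (cosh_gt0 (b * x)).
have hs : is_derive x 1 (fun x => cosh (b * x)) (b * (expR (b * x) - expR (- (b * x))) / 2).
  rewrite /cosh; apply: is_derive_eq; rewrite /GRing.scale/=.
  move: (expR _) (expR _) => e1 e2; by field.
have hc := @is_derive1_comp _ (@ln R) (fun x => cosh (b * x)) x _ _ hl hs.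
have := is_deriveZ b^-1 hc.
rewrite (_ : b^-1 \*: _ = lcosh b); last first.
  by apply/funext => w; rewrite /= /GRing.scale/= mulrC.
move=> h; apply: (is_derive_eq h); rewrite /GRing.scale/= /cosh.
have := expR_gt0 (b * x); have := expR_gt0 (- (b * x)).
move: (expR _) (expR _) => e1 e2 h1 h2; field.
by rewrite !gt_eqF// addr_gt0.
Qed.

Lemma lcoshE b x : 0 < b -> expR (b * lcosh b x) = cosh (b * x).
Proof. by move=> b0; rewrite /lcosh mulrCA divff ?gt_eqF// mulr1 lnK// posrE cosh_gt0. Qed.

Lemma profile_lcosh b : 0 < b -> profile (lcosh b).
Proof.
move=> b0.
have dE : derive1 (lcosh b) = (fun x => (expR (b * x) - expR (- (b * x))) / (expR (b * x) + expR (- (b * x)))).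
  by apply/funext => x; rewrite derive1E; apply: derive_val; exact: dlcosh.
have dn0 x : expR (b * x) + expR (- (b * x)) != 0 by rewrite gt_eqF// addr_gt0 ?expR_gt0.
split.
- by move=> y; have [] := dlcosh y b0.
- rewrite dE => x; apply: differentiable_continuous; apply/derivable1_diffP.
  by apply: derivableM; last apply: derivableV => //; exact: ex_derive.
- move=> y; rewrite dE ler_norml -[- 1]mulN1r ler_pdivlMr ?ler_pdivrMr ?addr_gt0 ?expR_gt0//.
  have := expR_gt0 (b * y); have := expR_gt0 (- (b * y)).
  by move: (expR _) (expR _) => e1 e2 h1 h2; apply/andP; split; lra.
- move=> y; rewrite /lcosh divr_ge0 ?(ltW b0)// ln_ge0// /cosh ler_pdivlMr// mul1r.
  by have := expR_ge1Dx (b * y); have := expR_ge1Dx (- (b * y)); lra.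
- by move=> y; rewrite /lcosh /cosh mulrN opprK addrC.
- move=> t x y t01; set u := lcosh b x; set w := lcosh b y.
  rewrite -(ler_pM2l b0) -ler_expR lcoshE//.
  (* Dividing by the values at the endpoints reduces the claim to the convexity of exp along the two
     normalised exponents, as in [Phi_convex]. *)
  have eu : cosh (b * x) * expR (- (b * u)) = 1 by rewrite -(lcoshE x b0) -expRD subrr expR0.
  have ew : cosh (b * y) * expR (- (b * w)) = 1 by rewrite -(lcoshE y b0) -expRD subrr expR0.
  rewrite -[leRHS]mul1r -ler_pdivrMr ?expR_gt0// -expRN /cosh.
  have h1 := convex_exp (b * x - b * u) (b * y - b * w) t01.
  have h2 := convex_exp (- (b * x) - b * u) (- (b * y) - b * w) t01.
  rewrite !(expRD _ (- (b * u))) !(expRD _ (- (b * w))) in h1 h2.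
  move: eu ew; rewrite /cosh => eu ew.
  rewrite mulrAC mulrDl -!expRD.
  have -> : b * (t * x + (1 - t) * y) - b * (t * u + (1 - t) * w) = t * (b * x - b * u) + (1 - t) * (b * y - b * w) by ring.
  have -> : - (b * (t * x + (1 - t) * y)) - b * (t * u + (1 - t) * w) = t * (- (b * x) - b * u) + (1 - t) * (- (b * y) - b * w) by ring.
  rewrite ler_pdivrMr// mul1r.
  apply: (le_trans (lerD h1 h2)); rewrite le_eqVlt; apply/orP; left; apply/eqP.
  transitivity (2 * (t * ((expR (b * x) + expR (- (b * x))) / 2 * expR (- (b * u))) +
     (1 - t) * ((expR (b * y) + expR (- (b * y))) / 2 * expR (- (b * w))))).
    by move: (expR (b * x)) (expR (- (b * x))) (expR (b * y)) (expR (- (b * y))) (expR (- (b * u))) (expR (- (b * w))) => ? ? ? ? ? ?; field.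
  by rewrite eu ew; ring.
Qed.

End Profiles.

(** * Tilted averages and strict gains *)

Section Tilt.
Context {R : realType}.
Implicit Types (f g h F : R -> R) (a b c x y v B E k : R).

(** Mean of [h] under the Gaussian at [x] reweighted by [exp (c * f)] and normalised. By
    [dPhi_tilt], the slope of [Phi c a f] is the tilted mean of the slope of [f]. *)
Definition tilt c a f h x : R := heat a (fun y => om c f y * h y) x / heat a (om c f) x.

Lemma dPhi_tilt c a f x : profile f -> 0 <= c -> derive1 (Phi c a f) x = tilt c a f (derive1 f) x.
Proof. by move=> hf c0; rewrite dPhiE. Qed.

Lemma egrow_omM c f h : profile f -> 0 <= c -> egrow h -> egrow (fun y => om c f y * h y).
Proof. by move=> hf c0; apply: egrowM; exact: egrow_om. Qed.

Lemma le_tilt c a f h g x : profile f -> 0 <= c -> egrow h -> egrow g -> (forall y, h y <= g y) ->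
  tilt c a f h x <= tilt c a f g x.
Proof.
move=> hf c0 eh eg hg; rewrite /tilt ler_wpM2r ?invr_ge0 ?(ltW (heat_om_gt0 _ hf c0 _))//.
apply: le_heat; [exact: egrow_omM|exact: egrow_omM|] => y.
by rewrite ler_wpM2l// expR_ge0.
Qed.

Lemma tilt_1B c a f h x : profile f -> 0 <= c -> egrow h ->
  tilt c a f (fun y => 1 - h y) x = 1 - tilt c a f h x.
Proof.
move=> hf c0 eh; rewrite /tilt.
rewrite (_ : (fun y => om c f y * (1 - h y)) = (fun y => om c f y - om c f y * h y)); last first.
  by apply/funext => y; rewrite mulrBr mulr1.
rewrite heatB; [|exact: egrow_om|exact: egrow_omM].
by rewrite mulrBl divff// gt_eqF// heat_om_gt0.
Qed.

(** [B] bounds [c * sqrt a], the Lipschitz constant of the tilting exponent in the Gaussian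
    variable. The numerator comes from [- B * |z| - z^2 / 2 >= - B^2 / 2 - z^2], the denominator
    bounds the normalisation. *)
Definition cT B : R := (Num.sqrt (pi *+ 2))^-1 * expR (- (B ^+ 2 / 2)) / Eg (fun z => expR (B * `|z|)).

Lemma Eg_expabs_ge1 B : 0 <= B -> 1 <= Eg (fun z => expR (B * `|z|)).
Proof.
move=> B0; rewrite -[leLHS](Eg_cst 1); apply: le_Eg; [exact: egrow_cst|exact: egrow_expR|].
by move=> z; rewrite -[1]expR0 ler_expR mulr_ge0.
Qed.

Lemma cT_gt0 B : 0 <= B -> 0 < cT B.
Proof.
move=> B0; rewrite /cT divr_gt0//; last by apply: lt_le_trans ltr01 _; exact: Eg_expabs_ge1.
by rewrite mulr_gt0 ?expR_gt0// invr_gt0 sqrt2pi_gt0.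
Qed.

Lemma intg_expsq h : egrow h -> intg (fun z => h z * expR (- z ^+ 2)).
Proof.
move=> eh; have := intg_egrow eh ltr01.
by apply: eq_integrable => // z _ /=; rewrite mul1r.
Qed.

(** As [f] is 1-Lipschitz, tilting changes the Gaussian weight by at most [exp (B * |z|)] either
    way. Giving up half of the Gaussian exponent pays for this and leaves the weight [exp (- z^2)],
    with a constant depending on [B] alone. *)
Lemma tilt_lower c a f h x B : profile f -> 0 <= c -> 0 <= a -> c * Num.sqrt a <= B ->
  egrow h -> (forall y, 0 <= h y) ->
  cT B * Int (fun z => h (x + Num.sqrt a * z) * expR (- z ^+ 2)) <= tilt c a f h x.
Proof.
move=> hf c0 a0 cB eh h0.
have B0 : 0 <= B by apply: le_trans cB; rewrite mulr_ge0.
have lip z : `|c * f (x + Num.sqrt a * z) - c * f x| <= B * `|z|.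
  rewrite -mulrBr normrM (ger0_norm c0).
  apply: (le_trans (ler_wpM2l c0 (pr_lip _ _ hf))).
  by rewrite addrAC subrr add0r normrM (ger0_norm (sqrtr_ge0 _)) mulrA ler_wpM2r.
have up : heat a (om c f) x <= om c f x * Eg (fun z => expR (B * `|z|)).
  rewrite -EgZl; last exact: egrow_expR.
  apply: le_Eg; [exact/egrow_affine/egrow_om|apply: egrowM; [exact: egrow_cst|exact: egrow_expR]|].
  move=> z; rewrite /om -expRD ler_expR.
  by have := lip z; rewrite ler_norml => /andP[_]; lra.
set I := Int _.
have I0 : 0 <= I by apply: Int_ge0 => z; rewrite mulr_ge0 ?expR_ge0.
have ei : egrow (fun z => h (x + Num.sqrt a * z)) by exact: egrow_affine.
have lo : om c f x * ((Num.sqrt (pi *+ 2))^-1 * expR (- (B ^+ 2 / 2))) * I <= heat a (fun y => om c f y * h y) x.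
  rewrite -IntZl; last exact: intg_expsq.
  apply: le_Int; first exact/intgZl/intg_expsq.
    apply: intg_Gd; exact: (egrow_affine _ _ (egrow_omM hf c0 eh)).
  move=> z; set hz := h _; have hz0 : 0 <= hz by exact: h0.
  have e : expR (- (B ^+ 2 / 2)) * expR (- z ^+ 2) <= expR (- (B * `|z|)) * expR (- (2^-1 * z ^+ 2)).
    rewrite -!expRD ler_expR.
    have : 0 <= (B - `|z|) ^+ 2 by exact: sqr_ge0.
    rewrite sqrrB [`|z| ^+ 2]real_normK ?num_real//; lra.
  have e2 : om c f x * expR (- (B * `|z|)) <= om c f (x + Num.sqrt a * z).
    rewrite /om -expRD ler_expR.
    by have := lip z; rewrite ler_norml => /andP[]; lra.
  rewrite /Gd.
  have s0 : 0 <= (Num.sqrt (pi *+ 2))^-1 :> R by rewrite invr_ge0 ltW// sqrt2pi_gt0.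
  apply: (@le_trans _ _ (om c f x * (Num.sqrt (pi *+ 2))^-1 * hz * (expR (- (B * `|z|)) * expR (- (2^-1 * z ^+ 2))))).
    have := ler_wpM2l (mulr_ge0 (mulr_ge0 (expR_ge0 (c * f x)) s0) hz0) e.
    rewrite -/(om c f x); move: (om c f x) (Num.sqrt _)^-1 (expR _) (expR _) (expR _) (expR _) => ? ? ? ? ? ?; lra.
  have := ler_wpM2r (mulr_ge0 (mulr_ge0 s0 hz0) (expR_ge0 (- (2^-1 * z ^+ 2)))) e2.
  move: (om c f x) (om c f _) (Num.sqrt _)^-1 (expR _) (expR _) => ? ? ? ? ?; lra.
rewrite /tilt ler_pdivlMr ?heat_om_gt0//.
have EB := lt_le_trans ltr01 (Eg_expabs_ge1 B0).
apply: le_trans lo; rewrite /cT.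
have cTI : 0 <= (Num.sqrt (pi *+ 2))^-1 * expR (- (B ^+ 2 / 2)) / Eg (fun z => expR (B * `|z|)) * I.
  by rewrite !mulr_ge0 ?invr_ge0 ?expR_ge0 ?(ltW EB) ?(ltW sqrt2pi_gt0).
apply: (le_trans (ler_wpM2l cTI up)).
rewrite le_eqVlt; apply/orP; left; apply/eqP.
move: EB; move: (om c f x) (Num.sqrt _)^-1 (expR _) (Eg _) => ? ? ? E ?.
by field; rewrite gt_eqF.
Qed.

(** Gaussian of variance [v] normalised to 1 at the origin. Lower bounds of this shape are
    reproduced by tilted means, with a larger variance and a smaller height. *)
Definition bump v x : R := expR (- (x ^+ 2 / (2 * v))).

Lemma bump_ge0 v x : 0 <= bump v x. Proof. exact: expR_ge0. Qed.

Lemma bump_le1 v x : 0 <= v -> bump v x <= 1.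
Proof.
by move=> v0; rewrite -[1]expR0 ler_expR oppr_le0 divr_ge0 ?sqr_ge0// mulr_ge0.
Qed.

Lemma le_bump u v x : 0 < u -> u <= v -> bump u x <= bump v x.
Proof.
move=> u0 uv; rewrite ler_expR lerN2 ler_wpM2l ?sqr_ge0// lef_pV2 ?posrE ?mulr_gt0//.
  by rewrite ler_wpM2l.
exact: lt_le_trans uv.
Qed.

Lemma egrow_bump v : 0 <= v -> egrow (bump v).
Proof.
move=> v0; apply: (@egrow_le _ _ (fun=> 1)); last exact: egrow_cst.
  apply: measurableT_comp => //; apply: measurable_funN.
  by apply: measurable_funM => //; exact: measurable_funX.
by move=> y; rewrite ger0_norm ?bump_ge0// bump_le1.
Qed.

(** The weight [exp (- z^2)] is a Gaussian of variance 1/2, so the variance grows by [a / 2] and the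
    height falls by the ratio of the standard deviations. *)
Lemma Int_bump v a x : 0 < v -> 0 <= a ->
  Int (fun z => bump v (x + Num.sqrt a * z) * expR (- z ^+ 2)) =
  Num.sqrt pi * (Num.sqrt v / Num.sqrt (v + a / 2)) * bump (v + a / 2) x.
Proof.
move=> v0 a0; set k := 1 + a / (2 * v).
have k0 : 0 < k by rewrite ltr_pwDl// divr_ge0// mulr_ge0// ltW.
have va : v + a / 2 = v * k by rewrite /k; field; rewrite gt_eqF.
set d := x * Num.sqrt a / (2 * v * k).
have e z : bump v (x + Num.sqrt a * z) * expR (- z ^+ 2) = bump (v * k) x * expR (- (k * (z + d) ^+ 2)).
  rewrite /bump -!expRD; congr expR.
  have sa : Num.sqrt a ^+ 2 = a by rewrite sqr_sqrtr.
  rewrite /d; move: sa; move: (Num.sqrt a) => s sa.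
  have kE : a = 2 * v * (k - 1) by rewrite /k; field; rewrite gt_eqF.
  rewrite -sa in kE.
  have kn0 : k != 0 by rewrite gt_eqF.
  have vn0 : v != 0 by rewrite gt_eqF.
  apply/eqP; rewrite -subr_eq0; apply/eqP.
  (* [d] is the shift that completes the square. The two exponents then differ by a multiple of
     [s ^+ 2 - 2 * v * (k - 1)], which vanishes by the choice of [k]. *)
  rewrite [LHS](_ : _ = (s ^+ 2 - 2 * v * (k - 1)) * (x ^+ 2 / (4 * v ^+ 2 * k) - z ^+ 2 / (2 * v))).
    by rewrite kE subrr mul0r.
  by field; rewrite kn0 vn0.
rewrite (eq_Int e) IntZl; last exact: intg_gauss.
rewrite Int_gauss// va sqrtrM ?(ltW v0)// mulrC; congr (_ * _).
congr (_ * _).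
by rewrite invfM mulrA divff ?mul1r// gt_eqF// sqrtr_gt0.
Qed.

Definition cB B : R := cT B * Num.sqrt pi.

Lemma cB_gt0 B : 0 <= B -> 0 < cB B.
Proof. by move=> B0; rewrite mulr_gt0 ?cT_gt0// sqrtr_gt0 pi_gt0. Qed.

Lemma cB_le1 B : 0 <= B -> cB B <= 1.
Proof.
move=> B0; rewrite /cB /cT mulrAC ler_pdivrMr; last exact: lt_le_trans ltr01 (Eg_expabs_ge1 B0).
rewrite mul1r; apply: le_trans (Eg_expabs_ge1 B0).
rewrite mulrAC -[leRHS]mulr1; apply: ler_pM; [by apply: mulr_ge0; rewrite ?invr_ge0|exact: expR_ge0| |].
- rewrite mulrC ler_pdivrMr ?sqrt2pi_gt0// mul1r; apply: ler_wsqrtr.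
  by rewrite mulr2n lerDl; exact: pi_ge0.
- by rewrite -[leRHS]expR0 ler_expR oppr_le0 divr_ge0 ?sqr_ge0.
Qed.

Lemma tilt_bump c a f v x B : profile f -> 0 <= c -> 0 <= a -> c * Num.sqrt a <= B -> 0 < v ->
  cB B * (Num.sqrt v / Num.sqrt (v + a / 2)) * bump (v + a / 2) x <= tilt c a f (bump v) x.
Proof.
move=> hf c0 a0 caB v0.
have := tilt_lower x hf c0 a0 caB (egrow_bump (ltW v0)) (bump_ge0 v).
by rewrite Int_bump// !mulrA.
Qed.

Lemma expRN_le k : 0 <= k <= 1 -> expR (- k) <= 1 - k / 2.
Proof.
move=> /andP[k0 k1]; rewrite expRN invf_ple ?posrE ?expR_gt0//; last by lra.
apply: le_trans (expR_ge1Dx k); rewrite -div1r ler_pdivrMr; last by lra.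
nra.
Qed.

(** From [exp (- u) <= 1 - u / 2] on [[0, 1]]; this is the origin of the condition [c * k <= 1] and
    of the factor 1/2 in front of the tilted mean. *)
Lemma Phi_gain c a F f h E k x : profile F -> profile f -> 0 <= c -> 0 <= k -> c * k <= 1 ->
  egrow h -> (forall y, 0 <= h y <= 1) -> (forall y, F y <= f y + E - k * h y) ->
  Phi c a F x <= Phi c a f x + E - k / 2 * tilt c a f h x.
Proof.
move=> hF hf c0 k0 ck eh h01 Ff.
have [cE|cn0] := eqVneq c 0.
  have e0 g : (fun y => ex 0 (g y)) = g by apply/funext => y; rewrite /ex eqxx.
  have o1 g : om 0 g = fun=> 1 by apply/funext => y; rewrite /om mul0r expR0.
  rewrite cE !PhiE /tilt /lg eqxx !e0 o1 heat_cst divr1.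
  rewrite (_ : (fun y => 1 * h y) = h); last by apply/funext => y; rewrite mul1r.
  have th : 0 <= heat a h x by apply: heat_ge0 => y; have /andP[] := h01 y.
  have /(le_trans _) : heat a (fun y => (f y + E) - k * h y) x <= heat a f x + E - k / 2 * heat a h x.
    rewrite heatB ?heatD ?heat_cst ?heatZ//; try exact: egrow_cst; try exact: egrow_pr.
    - by have := mulr_ge0 k0 th; lra.
    - by apply: egrowD; [exact: egrow_pr|exact: egrow_cst].
    - by apply: egrowM => //; exact: egrow_cst.
  apply; apply: le_heat => //; first exact: egrow_pr.
  apply: egrowB; first by apply: egrowD; [exact: egrow_pr|exact: egrow_cst].
  by apply: egrowM => //; exact: egrow_cst.
have cp : 0 < c by rewrite lt_neqAle eq_sym cn0.
have T0 : 0 <= tilt c a f h x.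
  rewrite divr_ge0 ?(ltW (heat_om_gt0 _ hf c0 _))//.
  by apply: heat_ge0 => y; rewrite mulr_ge0 ?expR_ge0//; have /andP[] := h01 y.
rewrite -(ler_pM2l cp) -ler_expR -/(om c (Phi c a F) x) om_Phi//.
apply: (@le_trans _ _ (expR (c * E) * (heat a (om c f) x - c * k / 2 * heat a (fun y => om c f y * h y) x))).
  have e1 := egrow_om hf c0; have e2 := egrow_omM hf c0 eh.
  rewrite -heatZ// -heatB//; last by apply: egrowM => //; exact: egrow_cst.
  have e3 : egrow (fun y => om c f y - c * k / 2 * (om c f y * h y)).
    by apply: egrowB => //; apply: egrowM => //; exact: egrow_cst.
  rewrite -heatZ//; apply: le_heat; [exact: egrow_om|by apply: egrowM => //; exact: egrow_cst|].
  move=> y; have /andP[h0 h1] := h01 y.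
  have ckh : 0 <= c * k * h y <= 1.
    by rewrite !mulr_ge0//= mulr_ile1 ?mulr_ge0.
  apply: (@le_trans _ _ (expR (c * E) * om c f y * expR (- (c * k * h y)))).
    rewrite /om -!expRD ler_expR.
    by have := ler_wpM2l c0 (Ff y); lra.
  have := ler_wpM2l (mulr_ge0 (expR_ge0 (c * E)) (expR_ge0 (c * f y))) (expRN_le ckh).
  rewrite -/(om c f y); move: (om c f y) (expR _) (expR _) => ? ? ?; lra.
have n0 := heat_om_gt0 a hf c0 x.
have -> : heat a (fun y => om c f y * h y) x = heat a (om c f) x * tilt c a f h x.
  by rewrite /tilt mulrCA divff ?mulr1// gt_eqF.
have -> : heat a (om c f) x - c * k / 2 * (heat a (om c f) x * tilt c a f h x) =
    heat a (om c f) x * (1 - c * k / 2 * tilt c a f h x) by ring.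
have e : 1 - c * k / 2 * tilt c a f h x <= expR (- (c * k / 2 * tilt c a f h x)).
  exact: expR_ge1Dx.
have := ler_wpM2l (mulr_ge0 (expR_ge0 (c * E)) (ltW n0)) e.
rewrite mulrA => h2; apply: (le_trans h2).
rewrite -om_Phi// /om -!expRD ler_expR; lra.
Qed.

Lemma Phi_shift c a F f E x : profile F -> profile f -> 0 <= c ->
  (forall y, F y <= f y + E) -> Phi c a F x <= Phi c a f x + E.
Proof.
move=> hF hf c0 Ff.
have := @Phi_gain c a F f (fun=> 0) E 0 x hF hf c0 (lexx 0).
rewrite mulr0 !mul0r subr0; apply => //; first exact: egrow_cst.
- by move=> y; rewrite lexx ler01.
- by move=> y; rewrite subr0.
Qed.

(** A level transmits a Gaussian gain as a Gaussian gain. Its height is multiplied by [cB B / 2] and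
    by a ratio of standard deviations, and the ratios of successive levels telescope. *)
Lemma Phi_propagate c a F f E k v x B : profile F -> profile f -> 0 <= c -> 0 <= a -> 0 <= k ->
  c * k <= 1 -> c * Num.sqrt a <= B -> 0 < v ->
  (forall y, F y <= f y + E - k * bump v y) ->
  Phi c a F x <= Phi c a f x + E - (k * (cB B / 2) * (Num.sqrt v / Num.sqrt (v + a / 2))) * bump (v + a / 2) x.
Proof.
move=> hF hf c0 a0 k0 ck caB v0 Ff.
have h01 y : 0 <= bump v y <= 1 by rewrite bump_ge0 bump_le1// ltW.
apply: (le_trans (Phi_gain a x hF hf c0 k0 ck (egrow_bump (ltW v0)) h01 Ff)).
rewrite lerD2l lerN2.
have := ler_wpM2l k0 (tilt_bump x hf c0 a0 caB v0).
move: (tilt _ _ _ _ _) (cB B) (bump _ _) (Num.sqrt v / _) => ? ? ? ?; lra.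
Qed.

Lemma Int_indic_itv u : Int (fun z => \1_(`[u - 1, u]%classic : set R) z) = 1.
Proof.
rewrite /Int /Rintegral integral_indic//= setIT lebesgue_measure_itv/= lte_fin.
by rewrite ifT//=; lra.
Qed.

(** By evenness let [x >= 0]. An even convex function has slope at most 0 on the negative half-line,
    so [1 - f'] is at least 1 there, and its tilted mean is bounded below by the mass that the
    Gaussian sends across the origin. *)
Lemma slope_bound c a f x B : profile f -> 0 <= c -> 0 < a -> c * Num.sqrt a <= B ->
  cT B * expR (- 2) * bump (a / 4) x <= 1 - `|derive1 (Phi c a f) x|.
Proof.
move=> hf c0 a0 caB.
have hP := profile_Phi hf c0 (ltW a0).
have B0 : 0 <= B by apply: le_trans caB; rewrite mulr_ge0.
wlog x0 : x / 0 <= x.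
  move=> H; have [|x0] := leP 0 x; first exact: H.
  have -> : `|derive1 (Phi c a f) x| = `|derive1 (Phi c a f) (- x)|.
    by rewrite dpr_odd// normrN.
  have -> : bump (a / 4) x = bump (a / 4) (- x) by rewrite /bump sqrrN.
  by apply: H; lra.
have d0 : 0 <= derive1 (Phi c a f) x.
  have := @dpr_le0 _ (Phi c a f) (- x) hP; rewrite dpr_odd// => /(_ _); rewrite oppr_le0 => /(_ x0).
  by rewrite oppr_le0.
rewrite (ger0_norm d0) dPhi_tilt// -tilt_1B//; last exact: egrow_dpr.
have e1 : egrow (fun y => 1 - derive1 f y) by apply: egrowB; [exact: egrow_cst|exact: egrow_dpr].
have p0 y : 0 <= 1 - derive1 f y.
  by have := pr_le1 hf y; rewrite ler_norml => /andP[]; lra.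
apply: le_trans (tilt_lower x hf c0 (ltW a0) caB e1 p0).
rewrite -mulrA ler_wpM2l ?(ltW (cT_gt0 B0))//.
have s0 : 0 < Num.sqrt a by rewrite sqrtr_gt0.
(* For [z] in [[- s - 1, - s]] the point [x + sqrt a * z] is at most 0, and
   [z^2 <= (s + 1)^2 <= 2 + 2 * s^2]; the term [2 * s^2] is the exponent of [bump (a / 4) x]. *)
set s := x / Num.sqrt a.
have s0' : 0 <= s by rewrite divr_ge0// ltW.
have sE : s ^+ 2 = x ^+ 2 / a by rewrite /s expr_div_n sqr_sqrtr// ltW.
have -> : expR (- 2) * bump (a / 4) x = expR (- 2 - 2 * s ^+ 2).
  rewrite expRD; congr (_ * expR _).
  by rewrite sE; field; rewrite gt_eqF.
have iI : intg (fun z => \1_(`[- s - 1, - s]%classic : set R) z).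
  exact: integrable_indic_itv.
apply: (@le_trans _ _ (expR (- 2 - 2 * s ^+ 2) * Int (fun z => \1_(`[- s - 1, - s]%classic : set R) z))).
  by rewrite Int_indic_itv mulr1.
rewrite -IntZl//.
apply: le_Int; [exact: intgZl|apply: intg_expsq; exact: (egrow_affine x (Num.sqrt a) e1)|].
move=> z; rewrite indicE; case: (boolP (z \in _)) => [|_]; last first.
  by rewrite mulr0 mulr_ge0 ?expR_ge0.
rewrite inE/= in_itv/= => /andP[z1 z2]; rewrite mulr1.
have y0 : x + Num.sqrt a * z <= 0.
  have : Num.sqrt a * z <= Num.sqrt a * (- s) by rewrite ler_wpM2l// ltW.
  by rewrite /s mulrN mulrCA divff ?mulr1 ?gt_eqF//; lra.
have h1 : 1 <= 1 - derive1 f (x + Num.sqrt a * z) by have := dpr_le0 hf y0; lra.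
apply: (@le_trans _ _ (1 * expR (- z ^+ 2))); last by rewrite ler_wpM2r ?expR_ge0.
rewrite mul1r ler_expR.
have := mulr_ge0 (_ : 0 <= s + 1 + z) (_ : 0 <= s + 1 - z).
move=> /(_ ltac:(lra) ltac:(lra)) h2.
have := sqr_ge0 (s - 1) => h3.
lra.
Qed.

Lemma Eg_id : Eg (fun z : R => z) = 0.
Proof.
have := Eg_opp (@egrow_id R).
have -> : Eg (fun z : R => - z) = - Eg (fun z : R => z).
  rewrite -[RHS]mulN1r -EgZl; last exact: egrow_id.
  by apply: eq_Int => z; rewrite mulN1r.
by lra.
Qed.

Lemma Eg_exp k : Eg (fun z : R => expR (k * z)) = expR (k ^+ 2 / 2).
Proof.
have h2 : (0 : R) < 2^-1 by rewrite invr_gt0.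
rewrite /Eg.
rewrite (_ : (fun z => _) = (fun z => expR (k ^+ 2 / 2) * ((Num.sqrt (pi *+ 2))^-1 * expR (- (2^-1 * (z + - k) ^+ 2))))); last first.
  apply/funext => z; rewrite /Gd mulrCA [RHS]mulrCA; congr (_ * _).
  by rewrite -!expRD; congr expR; field.
rewrite IntZl; last exact/intgZl/intg_gauss.
have := Int_Gd (R := R); rewrite /Gd IntZl; last first.
  by have := intg_gauss 0 h2; apply: eq_integrable => // z _ /=; rewrite addr0.
rewrite (_ : Int (fun y : R => expR (- (2^-1 * y ^+ 2))) = Num.sqrt pi / Num.sqrt 2^-1); last first.
  by rewrite -(Int_gauss 0 h2); apply: eq_Int => z; rewrite addr0.
by rewrite IntZl ?Int_gauss//; [move=> ->; rewrite mulr1|exact: intg_gauss].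
Qed.

(** On an affine function of slope 1 the operator is explicit and adds [c * a / 2]; monotonicity
    does the rest. Summed over the levels, this term yields the growth in beta that the a priori
    bound exploits. *)
Lemma Phi_linear_lower c a F C x : profile F -> 0 <= c -> 0 <= a -> (forall y, y - C <= F y) ->
  x - C + c * a / 2 <= Phi c a F x.
Proof.
move=> hF c0 a0 FC.
have [cE|cn0] := eqVneq c 0.
  rewrite cE !PhiE /lg eqxx mul0r mul0r addr0.
  have -> : x - C = Eg (fun z => (x - C) + Num.sqrt a * z).
    rewrite EgD ?EgZl ?Eg_cst ?Eg_id ?mulr0 ?addr0//; [exact: egrow_id|exact: egrow_cst|].
    by apply: egrowM; [exact: egrow_cst|exact: egrow_id].
  apply: le_Eg.
  - by apply: egrowD; [exact: egrow_cst|apply: egrowM; [exact: egrow_cst|exact: egrow_id]].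
  - exact: (egrow_affine _ _ (egrow_ex hF (lexx 0))).
  by move=> z; rewrite /ex eqxx; apply: le_trans (FC _); lra.
have cp : 0 < c by rewrite lt_neqAle eq_sym cn0.
rewrite -(ler_pM2l cp) -ler_expR -/(om c (Phi c a F) x) om_Phi//.
have -> : expR (c * (x - C + c * a / 2)) = Eg (fun z => expR (c * (x - C)) * expR (c * Num.sqrt a * z)).
  have eE : egrow (fun z => expR (c * Num.sqrt a * z)).
    apply: (@egrow_le _ _ (fun z => expR (c * Num.sqrt a * `|z|))).
    - by apply: measurableT_comp => //; exact: measurable_funM.
    - move=> z; rewrite ger0_norm ?expR_ge0// ler_expR ler_wpM2l ?mulr_ge0//; exact: ler_norm.
    - exact: egrow_expR.
  rewrite EgZl// Eg_exp -expRD; congr expR.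
  by rewrite exprMn sqr_sqrtr//; field.
apply: le_Eg.
- apply: egrowM; first exact: egrow_cst.
  apply: (@egrow_le _ _ (fun z => expR (c * Num.sqrt a * `|z|))).
  + by apply: measurableT_comp => //; exact: measurable_funM.
  + move=> z; rewrite ger0_norm ?expR_ge0// ler_expR ler_wpM2l ?mulr_ge0//; exact: ler_norm.
  + exact: egrow_expR.
- by apply: egrow_affine; exact: egrow_om.
move=> z; rewrite /om -expRD ler_expR.
have := ler_wpM2l c0 (FC (x + Num.sqrt a * z)); lra.
Qed.

Lemma lcosh_le b x : 0 < b -> lcosh b x <= `|x|.
Proof.
move=> b0; rewrite -(ler_pM2l b0) -ler_expR lcoshE// /cosh ler_pdivrMr//.
have h1 : expR (b * x) <= expR (b * `|x|) by rewrite ler_expR ler_pM2l// ler_norm.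
have h2 : expR (- (b * x)) <= expR (b * `|x|) by rewrite ler_expR -mulrN ler_pM2l// -normrN ler_norm.
by move: h1 h2; move: (expR _) (expR _) (expR _) => ? ? ?; lra.
Qed.

Lemma lcosh_ge b x : 0 < b -> x - ln 2 / b <= lcosh b x.
Proof.
move=> b0; rewrite -(ler_pM2l b0) -ler_expR lcoshE//.
rewrite mulrBr mulrCA divff ?gt_eqF// mulr1 expRB lnK ?posrE// /cosh ler_wpM2r ?invr_ge0//.
by rewrite lerDl expR_ge0.
Qed.

Lemma Phi0_le a F x : profile F -> (forall y, F y <= `|y|) ->
  Phi 0 a F x <= `|x| + Num.sqrt a * Eg (fun z : R => `|z|).
Proof.
move=> hF Fle; rewrite !PhiE /lg eqxx.
rewrite -[X in X + _](Eg_cst `|x|) -EgZl; last exact/egrow_norm/egrow_id.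
have e2 : egrow (fun z : R => Num.sqrt a * `|z|).
  by apply: egrowM; [exact: egrow_cst|exact/egrow_norm/egrow_id].
rewrite -EgD//; last exact: egrow_cst.
apply: le_Eg.
- exact: (egrow_affine _ _ (egrow_ex hF (lexx 0))).
- by apply: egrowD => //; exact: egrow_cst.
move=> z; rewrite /ex eqxx; apply: (le_trans (Fle _)).
by apply: (le_trans (ler_normD _ _)); rewrite normrM (ger0_norm (sqrtr_ge0 _)).
Qed.

End Tilt.

(** * The strict gap of the Cole-Hopf operator when its level is raised *)

Section Gap.
Context {R : realType}.
Implicit Types (f g h F : R -> R) (a b c e x y v B k r : R).

Lemma heat_nonpos a f x : a <= 0 -> heat a f x = f x.
Proof.
move=> a0; rewrite /heat (_ : (fun z => f _) = (fun=> f x)) ?Eg_cst//.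
by apply/funext => z; rewrite ler0_sqrtr// mul0r addr0.
Qed.

Lemma profile_Phi_all c a f : profile f -> 0 <= c -> profile (Phi c a f).
Proof.
move=> hf c0; have [a0|a0] := leP 0 a; first exact: profile_Phi.
rewrite (_ : Phi c a f = f)//; apply/funext => x.
by rewrite PhiE heat_nonpos ?exK// ltW.
Qed.

Lemma egrow_ex_le c k b : 0 <= c -> 0 <= k -> 0 <= b -> egrow (fun z : R => ex c (k + b * `|z|)).
Proof.
move=> c0 k0 b0; apply: (@egrow_le _ _ (fun z => (k + b * `|z|) * (expR (c * k) * expR (c * b * `|z|)))).
- apply: (@measurableT_comp _ _ _ _ _ _ (ex c)).
    apply: continuous_measurable_fun => z; apply: differentiable_continuous; apply/derivable1_diffP.
    by have [] := dex c z.
  by apply: measurable_funD => //; apply: measurable_funM => //; exact: normr_measurable.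
- move=> z; have kb : 0 <= k + b * `|z| by rewrite addr_ge0// mulr_ge0.
  rewrite ger0_norm; last exact: ex_ge0.
  by rewrite -expRD -mulrA -mulrDr; exact: ex_le.
- apply: egrowM; first by apply: egrowD; [exact: egrow_cst|apply: egrowM; [exact: egrow_cst|exact/egrow_norm/egrow_id]].
  by apply: egrowM; [exact: egrow_cst|exact: egrow_expR].
Qed.

Lemma Phi_ub c f b1 : profile f -> 0 <= c -> exists2 V1 : R, 0 <= V1 &
  forall b, b <= b1 -> Phi c b f 0 <= V1.
Proof.
move=> hf c0; set V1 := lg c (Eg (fun z => ex c (f 0 + Num.sqrt b1 * `|z|))).
have H b : b <= b1 -> Phi c b f 0 <= V1.
  move=> bb; rewrite PhiE; apply: le_lg; [exact: c0|by rewrite heat_om// heat_om_gt0|].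
  apply: le_Eg.
  - exact: (egrow_affine _ _ (egrow_ex hf c0)).
  - by apply: egrow_ex_le => //; exact: pr_ge0.
  move=> z; apply: le_ex => //; apply: (le_trans (pr_le _ hf)).
  rewrite add0r normrM (ger0_norm (sqrtr_ge0 _)) lerD2l ler_wpM2r//.
  by rewrite ler_wsqrtr.
exists V1 => //; apply: le_trans (H b1 (lexx _)).
exact: Phi_ge0.
Qed.

Lemma lip_cont (W : R -> R -> R) (u : R -> R) r :
  (forall s x y, `|W s x - W s y| <= `|x - y|) ->
  {for r, continuous (W^~ (u r))} -> {for r, continuous u} ->
  {for r, continuous (fun s => W s (u s))}.
Proof.
move=> lW cW cu; apply/cvgrPdist_lt => e e0.
have e2 : 0 < e / 2 by rewrite divr_gt0.
near=> s.
rewrite (_ : W r (u r) - W s (u s) = (W r (u r) - W s (u r)) + (W s (u r) - W s (u s))); last by ring.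
apply: (le_lt_trans (ler_normD _ _)); rewrite [ltRHS](splitr e) ltrD//.
  by near: s; move/cvgrPdist_lt : cW; apply.
apply: (le_lt_trans (lW _ _ _)).
by near: s; move/cvgrPdist_lt : cu; apply.
Unshelve. all: by end_near. Qed.

Lemma le_1Bsqr (u : R) : 0 <= u -> u <= 1 -> 1 - u <= 1 - u ^+ 2.
Proof. by move=> u0 u1; nra. Qed.

Lemma gap_arith (e a I0 I1 I2 T1 T2 t b : R) :
  I1 - I0 = - (e / 2) * (1 - T1) * (a / 2 - 0) -> I2 - I1 = - (e / 2) * (1 - T2) * (a - a / 2) ->
  0 <= e * a * T2 -> e * a * (t * b) <= e * a * T1 ->
  I0 <= I2 + e / 2 * a - e * a / 4 * t * b.
Proof. by move=> E1 E2 h1 h2; lra. Qed.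

Lemma le_eighth a r : r < a / 2 -> a / 8 <= (a - r) / 4.
Proof. by move=> h; lra. Qed.

Lemma le_half a r : 0 < a -> r < a / 2 -> a / 8 + r / 2 <= 2 * 2 * (a / 8).
Proof. by move=> h h'; lra. Qed.

Section Interp.
Variables (c e a : R) (f : R -> R) (x : R).
Hypotheses (hf : profile f) (c0 : 0 <= c) (e0 : 0 <= e) (a0 : 0 < a).

Let c' := c + e.
Let c'0 : 0 <= c'. Proof. by rewrite addr_ge0. Qed.
Let V r := Phi c' (a - r) f.
Let hV r : profile (V r). Proof. exact: profile_Phi_all. Qed.

(* Flow for a time a - r at level c', then for a time r at level c: this joins
   the two sides of [Phi_gap], and the gap is the integral of its derivative. *)
Definition interp r : R := Phi c r (V r) x.

(** Holds at every real [r], in particular at the endpoints 0 and [a], where [dinterp] says nothing;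
    the mean value theorem needs exactly this. *)
Lemma interp_cont r : {for r, continuous interp}.
Proof.
have [V1 V10 hV1] := Phi_ub (a + `|r| + 1) hf c'0.
have Vle s y : `|s - r| < 1 -> V s y <= V1 + `|y|.
  move=> sr; apply: (le_trans (pr_le _ (hV s))); rewrite lerD2r; apply: hV1.
  by move: sr; have := ler_norm (- r); rewrite normrN ltr_norml => ? /andP[]; lra.
rewrite (_ : interp = (fun r => lg c (heat r (fun y => ex c (V r y)) x))); last by apply/funext => b; rewrite /interp PhiE.
apply: (@continuous_comp _ _ _ (fun r => heat r (fun y => ex c (V r y)) x) (lg c)); last first.
  apply: differentiable_continuous; apply/derivable1_diffP.
  by have [] := dlg (y := heat r (fun y => ex c (V r y)) x) (_ : 0 < 1 + c * _); rewrite ?heat_om// heat_om_gt0.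
apply: (@cont_Int _ (fun s z => ex c (V s (x + Num.sqrt s * z)) * Gd z)
  (fun z => ex c ((V1 + `|x|) + Num.sqrt (`|r| + 1) * `|z|) * Gd z) r 1) => //.
- by move=> s _; apply: intg_Gd; exact: (egrow_affine _ _ (egrow_ex (hV s) c0)).
- move=> s z sr; apply: cvgM; last exact: cvg_cst.
  apply: (@continuous_comp _ _ _ (fun s => V s (x + Num.sqrt s * z)) (ex c)); last first.
    by apply: differentiable_continuous; apply/derivable1_diffP; have [] := dex c (V s (x + Num.sqrt s * z)).
  apply: (@lip_cont V (fun s => x + Num.sqrt s * z)).
  + by move=> *; exact: pr_lip.
  + apply: (@continuous_comp _ _ _ (fun s => a - s) (fun b => Phi c' b f (x + Num.sqrt s * z))).
      by apply: cvgB; [exact: cvg_cst|exact: cvg_id].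
    exact: Phi_a_cont.
  + by apply: cvgD; [exact: cvg_cst|apply: cvgM; [exact: sqrt_continuous|exact: cvg_cst]].
- by apply: intg_Gd; apply: egrow_ex_le => //; rewrite addr_ge0.
- move=> s z sr; rewrite normrM (ger0_norm (Gd_ge0 _)) ler_wpM2r ?Gd_ge0//.
  rewrite ger0_norm; last by apply: ex_ge0 => //; exact: pr_ge0.
  apply: le_ex => //; apply: (le_trans (Vle _ _ sr)); rewrite -addrA lerD2l.
  apply: (le_trans (ler_normD _ _)); rewrite lerD2l normrM (ger0_norm (sqrtr_ge0 _)) ler_wpM2r//.
  rewrite ler_wsqrtr//; apply: (le_trans (ler_norm _)).
  rewrite -[s](subrK r) addrC; apply: (le_trans (ler_normD _ _)); rewrite lerD2l; exact: ltW.
Qed.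

Lemma egrow_J h n b : egrow h -> 0 < b -> egrow (J h n b).
Proof.
move=> eh b0; split.
  apply: continuous_measurable_fun => z; apply: differentiable_continuous; apply/derivable1_diffP.
  by have [] := dJ_x n z eh b0.
have [C [k [C0 k0 h1]]] := J_egrow n eh (ltW b0).
by exists C, k; split => // y; apply: h1.
Qed.

Lemma egrow_Phixx k b : 0 <= k -> 0 < b -> egrow (Phixx k b f).
Proof.
move=> k0 b0.
have [C [l [C0 l0 h1]]] := Phi_bounds hf k0 b0.
apply: (@egrow_le _ _ (fun y => C * expR (l * `|y|) * (b ^+ 2)^-1)).
- apply: measurable_funB.
    apply: measurable_funM.
      have [m1 _] := egrow_J 2 (egrow_ex hf k0) b0.
      have [m2 _] := egrow_J 0 (egrow_ex hf k0) b0.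
      by apply: measurable_funM => //; apply: measurable_funB => //; exact: measurable_funM.
    apply: continuous_measurable_fun => z; apply: cvgV; first by rewrite gt_eqF// heat_om_gt0.
    by apply: heat_continuous; [exact: ltW|exact: egrow_om|exact: om_continuous].
  apply: measurable_funM => //; apply: measurable_funX.
  apply: continuous_measurable_fun; apply: pr_cont; exact: profile_Phi_all.
- by move=> y; exact: h1.
- apply: egrowM; last exact: egrow_cst.
  by apply: egrowM; [exact: egrow_cst|exact: egrow_expR].
Qed.

Let Va r y := (Phixx c' (a - r) f y + c' * derive1 (V r) y ^+ 2) / 2.
Let hr r y := om c (V r) y * - Va r y.

Let dV r y : r < a -> is_derive r 1 (V^~ y) (- Va r y).
Proof.
move=> ra; have ar : 0 < a - r by rewrite subr_gt0.
have h1 := dPhi_a y hf c'0 ar.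
have hs : is_derive r 1 (fun r : R => a - r) (-1).
  have h := is_deriveB (is_derive_cst a r 1) (is_derive_id r 1).
  by apply: (is_derive_eq h); rewrite sub0r.
have h := @is_derive1_comp _ (fun b => Phi c' b f y) (fun r => a - r) r _ _ h1 hs.
by apply: (is_derive_eq h); rewrite mulrN1.
Qed.

(** The second derivatives cancel: the inner flow runs backward at level [c'], the outer one forward
    at level [c]. What is left is the difference of the quadratic terms, [- e / 2] times the squared
    slope, averaged by the outer tilt. *)
Lemma dinterp r : 0 < r -> r < a ->
  is_derive r 1 interp (- (e / 2) * tilt c r (V r) (fun y => derive1 (V r) y ^+ 2) x).
Proof.
move=> r0 ra; have b0 : 0 < a - r by rewrite subr_gt0.
(* Half the distance to the ends, so that near [r] both the outer variance [s] and the inner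
   variance [a - s] stay away from 0. *)
set rho := Num.min r (a - r) / 2.
have rho0 : 0 < rho by rewrite divr_gt0// lt_min r0.
have rhor : rho <= r / 2 by rewrite ler_pM2r ?invr_gt0// ge_min lexx.
have rhoa : rho <= (a - r) / 2 by rewrite ler_pM2r ?invr_gt0// ge_min lexx orbT.
have rng s : `|s - r| < rho -> [/\ r / 2 < s, s < 2 * r, (a - r) / 2 < a - s & a - s < a].
  by rewrite ltr_norml => /andP[h1 h2]; split; lra.
have [V1 V10 hV1] := Phi_ub a hf c'0.
have Vle s y : `|s - r| < rho -> V s y <= V1 + `|y|.
  move=> /rng[s1 s2 s3 s4]; apply: (le_trans (pr_le _ (hV s))); rewrite lerD2r; apply: hV1; exact: ltW.
have [C [k [C0 k0 hC]]] := Phi_bounds hf c'0 a0.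
have r20 : 0 < r / 2 by rewrite divr_gt0.
have r2r : r / 2 <= 2 * r by lra.
have [D [kk [D0 kk0 hK]]] := K_bound r20 r2r (normr_ge0 x).
(* For [s] within [rho] of [r], [H0] dominates [ex c (V s y)], [H1] its derivative in [s], and [P]
   the logarithmic derivative of the kernel in [s]. *)
pose H0 := fun y : R => (V1 + `|y|) * (expR (c * V1) * expR (c * `|y|)).
pose H1 := fun y : R => expR (c * V1) * expR (c * `|y|) * ((C * expR (k * `|y|) / ((a - r) / 2) ^+ 2 + c') / 2).
pose P := fun y : R => ((`|x| + `|y|) ^+ 2 / (r / 2) ^+ 2 + (r / 2)^-1) / 2.
have eabs : egrow (fun y : R => `|y|) by exact/egrow_norm/egrow_id.
have eH0 : egrow H0.
  apply: egrowM; first by apply: egrowD => //; exact: egrow_cst.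
  by apply: egrowM; [exact: egrow_cst|exact: egrow_expR].
have eH1 : egrow H1.
  apply: egrowM; first by apply: egrowM; [exact: egrow_cst|exact: egrow_expR].
  apply: egrowM; last exact: egrow_cst.
  apply: egrowD; last exact: egrow_cst.
  apply: egrowM; last exact: egrow_cst.
  by apply: egrowM; [exact: egrow_cst|exact: egrow_expR].
have eP : egrow P.
  apply: egrowM; last exact: egrow_cst.
  apply: egrowD; last exact: egrow_cst.
  apply: egrowM; last exact: egrow_cst.
  by apply: egrowX; apply: egrowD => //; exact: egrow_cst.
have omle s y : `|s - r| < rho -> om c (V s) y <= expR (c * V1) * expR (c * `|y|).
  by move=> sr; rewrite /om -expRD ler_expR -mulrDr ler_wpM2l// Vle.
have d2 s y : derive1 (V s) y ^+ 2 <= 1.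
  by rewrite -[_ ^+ 2]real_normK ?num_real// exprn_ile1// pr_le1.
have hH0 s y : `|s - r| < rho -> `|ex c (V s y)| <= H0 y.
  move=> sr; rewrite ger0_norm; last by apply: ex_ge0 => //; exact: pr_ge0.
  apply: (le_trans (ex_le c0 (pr_ge0 (hV s) y))); rewrite ler_pM ?expR_ge0 ?pr_ge0 ?Vle//.
  exact: omle.
have hH1 s y : `|s - r| < rho -> `|hr s y| <= H1 y.
  move=> sr; have [s1 s2 s3 s4] := rng _ sr.
  have b20 : 0 < (a - r) / 2 by rewrite divr_gt0.
  have bs0 : 0 < a - s by apply: lt_trans s3.
  rewrite normrM (ger0_norm (expR_ge0 _)) normrN; apply: ler_pM; rewrite ?expR_ge0//; first exact: omle.
  rewrite /Va normrM (ger0_norm (_ : 0 <= 2^-1)) ?invr_ge0// ler_wpM2r ?invr_ge0//.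
  apply: (le_trans (ler_normD _ _)); apply: lerD.
    apply: (le_trans (hC _ y bs0 (ltW s4))); rewrite ler_wpM2l ?mulr_ge0 ?expR_ge0//.
    rewrite lef_pV2 ?posrE ?exprn_gt0// lerXn2r ?nnegrE ?(ltW b20) ?(ltW bs0)//; exact: ltW.
  rewrite ger0_norm; last by apply: mulr_ge0 => //; exact: sqr_ge0.
  exact: ler_piMr.
have hP s y : `|s - r| < rho -> `|((x - y) ^+ 2 / s ^+ 2 - s^-1) / 2| <= P y.
  move=> sr; have [s1 s2 s3 s4] := rng _ sr.
  have s0 : 0 < s by apply: lt_trans s1.
  rewrite normrM (ger0_norm (_ : 0 <= 2^-1)) ?invr_ge0// ler_wpM2r ?invr_ge0//.
  apply: (le_trans (ler_normB _ _)); apply: lerD.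
    rewrite ger0_norm ?divr_ge0 ?sqr_ge0//; apply: ler_pM; rewrite ?sqr_ge0 ?invr_ge0 ?sqr_ge0//.
      rewrite -[(x - y) ^+ 2]real_normK ?num_real// lerXn2r ?nnegrE ?addr_ge0//; exact: ler_normB.
    rewrite lef_pV2 ?posrE ?exprn_gt0// lerXn2r ?nnegrE ?(ltW r20) ?(ltW s0)//; exact: ltW.
  by rewrite ger0_norm ?invr_ge0 ?(ltW s0)// lef_pV2 ?posrE// ltW.
have hKr s y : `|s - r| < rho -> K s (x - y) <= D * expR (- (kk * y ^+ 2)).
  by move=> /rng[s1 s2 _ _]; apply: hK; [exact: ltW|exact: ltW|].
pose dF s y := hr s y * K s (x - y) + ex c (V s y) * (((x - y) ^+ 2 / s ^+ 2 - s^-1) / 2 * K s (x - y)).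
have hder : is_derive r 1 (fun s => Int (fun y => ex c (V s y) * K s (x - y))) (Int (dF r)).
  apply: (@derive_Int _ (fun s y => ex c (V s y) * K s (x - y)) dF
    (fun y => ((H1 y + H0 y * P y) * D) * expR (- (kk * y ^+ 2))) r rho).
  - exact: rho0.
  - move=> s /rng[s1 s2 s3 s4].
    have s0 : 0 < s by apply: lt_trans s1.
    have := intg_J 0 x (egrow_ex (hV s) c0) s0.
    by apply: eq_integrable => // y _ /=; rewrite expr0 mulr1.
  - move=> s y /rng[s1 s2 s3 s4].
    have s0 : 0 < s by apply: lt_trans s1.
    have sa : s < a by lra.
    have h1 := @is_derive1_comp _ (ex c) (V^~ y) s _ _ (dex c (V s y)) (dV y sa).
    have h2 := is_deriveM h1 (dK_a (x - y) s0).
    apply: (is_derive_eq h2); rewrite /dF /hr /om /GRing.scale/= addrC; congr (_ + _).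
    by rewrite mulrC.
  - apply: intg_egrow => //; apply: egrowM; last exact: egrow_cst.
    by apply: egrowD => //; exact: egrowM.
  - move=> s y sr; rewrite /dF mulrA -mulrDl normrM (ger0_norm (K_ge0 _ _)) -[leRHS]mulrA.
    apply: ler_pM; rewrite ?K_ge0//; last exact: hKr.
    apply: (le_trans (ler_normD _ _)); apply: lerD; first exact: hH1.
    by rewrite normrM; apply: ler_pM => //; [exact: hH0|exact: hP].
have hx1 y : is_derive y 1 (fun y => ex c (V r y)) (om c (V r) y * derive1 (V r) y) by exact: dexf.
have hx2 y : is_derive y 1 (fun y => om c (V r) y * derive1 (V r) y)
    (om c (V r) y * (Phixx c' (a - r) f y + c * derive1 (V r) y ^+ 2)).
  have hom : is_derive y 1 (om c (V r)) (c * derive1 (V r) y * om c (V r) y).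
    have hl := is_deriveZ c (pr_is_derive y (hV r)).
    have := @is_derive1_comp _ expR (fun y => c * V r y) y _ _ (is_derive_expR _) hl.
    by move=> h; apply: (is_derive_eq h); rewrite mulrC.
  have h := is_deriveM hom (dPhi_xx y hf c'0 b0).
  apply: (is_derive_eq h); rewrite /GRing.scale/= -/(V r).
  move: (om _ _ _) (Phixx _ _ _ _) (derive1 _ _) => ? ? ?; ring.
have ed2 : egrow (fun y => derive1 (V r) y ^+ 2) by apply: egrowX; exact: egrow_dpr.
have exx : egrow (Phixx c' (a - r) f) by exact: egrow_Phixx.
have e2 : egrow (fun y => om c (V r) y * (Phixx c' (a - r) f y + c * derive1 (V r) y ^+ 2)).
  apply: egrowM; first exact: egrow_om.
  by apply: egrowD => //; apply: egrowM => //; exact: egrow_cst.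
have ehr : egrow (hr r).
  apply: egrowM; first exact: egrow_om.
  apply: egrowN; apply: egrowM; last exact: egrow_cst.
  by apply: egrowD => //; apply: egrowM => //; exact: egrow_cst.
(* Integration by parts turns the derivative of the kernel in time into the second space derivative
   of [ex c (V r)], which meets the time derivative of [V] under the same weight. *)
have E : Int (dF r) = - (e / 2) * heat r (fun y => om c (V r) y * derive1 (V r) y ^+ 2) x.
  have ibp := heat_ibp x (egrow_ex (hV r) c0) (egrow_omd (hV r) c0) e2 hx1 hx2 r0.
  have i0 := intg_J 0 x (egrow_ex (hV r) c0) r0.
  have i2 := intg_J 2 x (egrow_ex (hV r) c0) r0.
  have ih := intg_J 0 x ehr r0.
  transitivity (J (hr r) 0 r x + (J (fun y => ex c (V r y)) 2 r x / r - J (fun y => ex c (V r y)) 0 r x) / r / 2).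
    rewrite /J -IntZr// -IntB//; last exact: intgZr.
    have i3 := intgB (intgZr r^-1 i2) i0.
    rewrite -IntZr// -IntZr; last exact: intgZr.
    rewrite -IntD//; last by do 2 apply: intgZr.
    apply: eq_Int => y; rewrite /dF !expr0 !mulr1; congr (_ + _).
    by move: (ex _ _) (K _ _) => ? ?; field; rewrite gt_eqF.
  rewrite ibp -heatJ// -heatZ; last by apply: egrowM => //; exact: egrow_om.
  rewrite -[X in _ + X](_ : heat r (fun y => 2^-1 * (om c (V r) y * (Phixx c' (a - r) f y + c * derive1 (V r) y ^+ 2))) x = _).
    rewrite -heatD//; last by apply: egrowM => //; exact: egrow_cst.
    congr (heat r _ x); apply/funext => y; rewrite /hr /Va /c'.
    by move: (om _ _ _) (Phixx _ _ _ _) (derive1 _ _) => ? ? ?; field.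
  by rewrite heatZ// mulrC.
have hN : is_derive r 1 (fun s => heat s (fun y => ex c (V s y)) x) (Int (dF r)).
  move: hder; apply: near_eq_is_derive.
  near=> s.
  have s0 : 0 < s by near: s; exact: lt_nbhsr.
  rewrite heatJ//; last exact: egrow_ex.
  by apply: eq_Int => y; rewrite expr0 mulr1.
have hlg : is_derive (heat r (fun y => ex c (V r y)) x) 1 (lg c) (1 + c * heat r (fun y => ex c (V r y)) x)^-1.
  by apply: dlg; rewrite heat_om// heat_om_gt0.
have := @is_derive1_comp _ (lg c) (fun s => heat s (fun y => ex c (V s y)) x) r _ _ hlg hN.
move=> h; rewrite (_ : interp = (fun r => lg c (heat r (fun y => ex c (V r y)) x))); last by apply/funext => b; rewrite /interp PhiE.
apply: (is_derive_eq h).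
by rewrite heat_om// E /tilt mulrC -mulrA.
Unshelve. all: by end_near. Qed.

(** The constant of [slope_bound] times that of [tilt_bump]; the last factor 1/2 is a lower bound
    for the ratio of standard deviations while the outer time is below [a / 2]. *)
Definition th0 B : R := cT B * expR (- 2) * (cB B / 2).

Lemma th0_gt0 B : 0 <= B -> 0 < th0 B.
Proof.
move=> B0; rewrite /th0; apply: mulr_gt0; last by rewrite divr_gt0// cB_gt0.
by apply: mulr_gt0; [exact: cT_gt0|exact: expR_gt0].
Qed.

Lemma tiltZ k b g h y : profile g -> egrow h -> tilt c b g (fun y => k * h y) y = k * tilt c b g h y.
Proof.
move=> hg eh; rewrite /tilt mulrA -heatZ; last exact: egrow_omM.
by congr (heat b _ y / _); apply/funext => z; rewrite mulrCA.
Qed.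

Lemma tilt_ge0 b g h y : profile g -> (forall y, 0 <= h y) -> 0 <= tilt c b g h y.
Proof.
move=> hg h0; rewrite divr_ge0 ?(ltW (heat_om_gt0 _ hg c0 _))//.
by apply: heat_ge0 => z; rewrite mulr_ge0 ?expR_ge0.
Qed.

Local Opaque cT cB.

(** While [r1 < a / 2], the inner flow has lasted longer than [a / 2], so [slope_bound] keeps its
    slope away from 1 and -1 near the origin; the outer tilt then spreads this deficit. *)
Lemma gap_tilt B r1 : 0 < r1 -> r1 < a / 2 -> c' * Num.sqrt a <= B ->
  th0 B * bump (a / 8) x <= tilt c r1 (V r1) (fun y => 1 - derive1 (V r1) y ^+ 2) x.
Proof.
move=> r10 r11 caB.
have a2a : a / 2 < a by rewrite ltr_pdivrMr// ltr_pMr// ltr1n.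
have B0 : 0 <= B by apply: le_trans caB; apply: mulr_ge0; [exact: c'0|exact: sqrtr_ge0].
have v0 : 0 < a / 8 by rewrite divr_gt0.
have eb := egrow_bump (ltW v0).
have ed : egrow (fun y => 1 - derive1 (V r1) y ^+ 2).
  by apply: egrowB; [exact: egrow_cst|apply: egrowX; exact: egrow_dpr].
have kk0 : 0 <= cT B * expR (- 2).
  by apply: mulr_ge0; [exact: ltW (cT_gt0 B0)|exact: expR_ge0].
apply: (@le_trans _ _ (tilt c r1 (V r1) (fun y => cT B * expR (- 2) * bump (a / 8) y) x)); last first.
  apply: (le_tilt _ _ (hV r1) c0 _ ed); first by apply: egrowM; [exact: egrow_cst|exact: eb].
  move=> y.
  have ar : 0 < a - r1 by rewrite subr_gt0; exact: lt_trans r11 a2a.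
  have hB : c' * Num.sqrt (a - r1) <= B.
    by apply: le_trans caB; apply: (ler_wpM2l c'0); apply: ler_wsqrtr; rewrite gerBl; exact: ltW.
  apply: (@le_trans _ _ (1 - `|derive1 (V r1) y|)).
    apply: le_trans (slope_bound y hf c'0 ar hB); apply: (ler_wpM2l kk0).
    apply: le_bump; first by rewrite divr_gt0.
    exact: le_eighth.
  have := pr_le1 (hV r1) y; have := normr_ge0 (derive1 (V r1) y).
  rewrite -[derive1 (V r1) y ^+ 2]real_normK ?num_real//.
  exact: le_1Bsqr.
rewrite (tiltZ _ _ _ (hV r1) eb) /th0 -[leLHS]mulrA; apply: (ler_wpM2l kk0).
have hB : c * Num.sqrt r1 <= B.
  apply: le_trans caB; apply: ler_pM => //; first by rewrite lerDl.
  by apply: ler_wsqrtr; exact: ltW (lt_trans r11 a2a).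
apply: le_trans (tilt_bump x (hV r1) c0 (ltW r10) hB v0).
rewrite -[leRHS]mulrA -[leLHS]mulrA; apply: ler_wpM2l; first exact: ltW (cB_gt0 B0).
have r1a : a / 8 <= a / 8 + r1 / 2 by rewrite lerDl divr_ge0// ltW.
apply: ler_pM; [by []|exact: bump_ge0| |exact: le_bump].
rewrite ler_pdivlMr; last by rewrite sqrtr_gt0; exact: lt_le_trans r1a.
have e2 : 2 * Num.sqrt (a / 8) = Num.sqrt (2 * 2 * (a / 8)) by rewrite [in RHS]sqrtrM// -[2 * 2]expr2 sqrtr_sqr ger0_norm.
rewrite ler_pdivrMl// e2; apply: ler_wsqrtr; exact: le_half.
Qed.

(** Mean value theorem for [interp] on each half of [[0, a]]. A squared slope equal to 1 would give
    the term [e / 2 * a]; the deficit is bounded below on the first half and merely nonnegative on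
    the second. *)
Lemma Phi_gap B : c' * Num.sqrt a <= B ->
  Phi c' a f x <= Phi c a f x + e / 2 * a - e * a / 4 * th0 B * bump (a / 8) x.
Proof.
move=> caB.
have B0 : 0 <= B by apply: le_trans caB; rewrite mulr_ge0.
have dd r : 0 < r -> r < a -> is_derive r 1 interp (- (e / 2) * (1 - tilt c r (V r) (fun y => 1 - derive1 (V r) y ^+ 2) x)).
  move=> r0 ra; apply: (is_derive_eq (dinterp r0 ra)); congr (_ * _).
  rewrite tilt_1B//; first by rewrite opprB addrC subrK.
  by apply: egrowX; exact: egrow_dpr.
have d2 r y : 0 <= 1 - derive1 (V r) y ^+ 2.
  by rewrite subr_ge0 -[_ ^+ 2]real_normK ?num_real// exprn_ile1// pr_le1.
have a20 : 0 < a / 2 by rewrite divr_gt0.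
have a2a : a / 2 < a by lra.
have ic : continuous interp by move=> r; exact: interp_cont.
pose dI r := - (e / 2) * (1 - tilt c r (V r) (fun y => 1 - derive1 (V r) y ^+ 2) x).
have [|r1 /[!in_itv]/= /andP[r10 r11] E1] := @MVT R interp dI 0 (a / 2) a20 _ (continuous_subspaceT ic).
  by move=> r /[!in_itv]/= /andP[r0 r1]; apply: dd => //; exact: lt_trans r1 a2a.
have [|r2 /[!in_itv]/= /andP[r20 r21] E2] := @MVT R interp dI (a / 2) a a2a _ (continuous_subspaceT ic).
  by move=> r /[!in_itv]/= /andP[h1 h2]; apply: dd => //; exact: lt_trans a20 h1.
have I0 : interp 0 = Phi c' a f x by rewrite /interp Phi0 /V subr0.
have Ia : interp a = Phi c a f x by rewrite /interp /V subrr Phi0.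
have t2 : 0 <= tilt c r2 (V r2) (fun y => 1 - derive1 (V r2) y ^+ 2) x by apply: tilt_ge0.
have t1 := gap_tilt r10 r11 caB.
move: E1 E2; rewrite /dI I0 Ia.
set T1 := tilt _ _ _ _ _ in t1 *; set T2 := tilt _ _ _ _ _ in t2 *.
move=> E1 E2.
have h1 := mulr_ge0 (mulr_ge0 e0 (ltW a0)) t2.
have h2 := ler_wpM2l (mulr_ge0 e0 (ltW a0)) t1.
exact: gap_arith E1 E2 h1 h2.
Qed.

End Interp.

Lemma Phi_crude c e a f x : profile f -> 0 <= c -> 0 <= e -> 0 <= a ->
  Phi (c + e) a f x <= Phi c a f x + e / 2 * a.
Proof.
move=> hf c0 e0; rewrite le_eqVlt => /predU1P[<-|a0]; first by rewrite !Phi0 mulr0 addr0.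
apply: (le_trans (Phi_gap x hf c0 e0 a0 (lexx _))).
rewrite lerBlDr lerDl; apply: mulr_ge0; last exact: bump_ge0.
apply: mulr_ge0; first by apply: divr_ge0 => //; apply: mulr_ge0 => //; exact: ltW.
by apply/ltW/th0_gt0; apply: mulr_ge0 => //; exact: addr_ge0.
Qed.

End Gap.

(** * Values along finitely many levels *)

Section Values.
Context {R : realType}.
Implicit Types (gam w f F g : R -> R) (s e x a E k v B : R) (es : seq R).

(** [es] lists the breakpoints after [s]; between two of them the level is the value of [gam] at the
    left one and the variance is the increment of [w]. A repeated breakpoint has variance 0 and
    changes nothing, so lists need not be strictly increasing. *)
Fixpoint pval gam w g s es : R -> R :=
  if es is e :: es' then Phi (gam s) (w e - w s) (pval gam w g e es') else g.

(** The Stieltjes integral of the step function [gam] against [w]. *)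
Fixpoint levsum gam w s es : R :=
  if es is e :: es' then gam s * (w e - w s) + levsum gam w e es' else 0.

Lemma pval_cat gam w g s es1 es2 :
  pval gam w g s (es1 ++ es2) = pval gam w (pval gam w g (last s es1) es2) s es1.
Proof. by elim: es1 s => //= e es IH s; rewrite IH. Qed.

Lemma profile_pval gam w g s es : (forall t : R, 0 <= gam t) -> profile g ->
  profile (pval gam w g s es).
Proof. by move=> g0 hg; elim: es s => //= e es IH s; exact: profile_Phi_all. Qed.

Lemma path_le_last (s : R) es : path <=%R s es -> s <= last s es.
Proof.
elim: es s => //= e es IH s /andP[se pe]; exact: le_trans (IH _ pe).
Qed.

Lemma eq_pval gam gam' w g s es : path <=%R s es ->
  (forall t, s <= t -> t < last s es -> gam' t = gam t) -> pval gam' w g s es = pval gam w g s es.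
Proof.
elim: es s => //= e es IH s /andP[se pe] gg.
rewrite IH//; last by move=> t et; apply: gg; exact: le_trans et.
(* A level of length zero may sit at the very end of the range, where the two functions can differ;
   its variance is 0. *)
have [->|tu'] := eqVneq s e; first by rewrite subrr !Phi0.
by rewrite gg//; apply: lt_le_trans (path_le_last pe); rewrite lt_neqAle tu'.
Qed.

Section Monotone.
Variables (gam w : R -> R).
Hypothesis gam0 : forall t : R, 0 <= gam t.
Hypothesis wmono : forall s t : R, 0 <= s -> s <= t -> t <= 1 -> w s <= w t.

Lemma pval_lower g s es C x : profile g -> 0 <= s -> path <=%R s es -> last s es <= 1 ->
  (forall y, y - C <= g y) -> x - C + levsum gam w s es / 2 <= pval gam w g s es x.
Proof.
move=> hg + + + gC; elim: es s x => [|e es IH] s x /= s0.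
  by move=> _ _; rewrite mul0r addr0.
move=> /andP[se pe] l1; have e0 : 0 <= e by exact: le_trans se.
have we : 0 <= w e - w s by rewrite subr_ge0 wmono//; exact: le_trans (path_le_last pe) l1.
have hv := profile_pval w e es gam0 hg.
have := @Phi_linear_lower _ (gam s) (w e - w s) _ (C - levsum gam w e es / 2) x hv (gam0 s) we.
move=> /(_ _) h; apply: le_trans (h _); first by rewrite le_eqVlt; apply/orP; left; apply/eqP; field.
by move=> y; apply: le_trans (IH _ _ e0 pe l1); rewrite opprB addrA -addrA [_ - C]addrC addrA.
Qed.

Lemma pval_crude gam' F f s es E x (e : R) : profile F -> profile f -> 0 <= e -> 0 <= s ->
  path <=%R s es -> last s es <= 1 ->
  (forall t, s <= t -> t < last s es -> gam' t = gam t + e) ->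
  (forall y, F y <= f y + E) ->
  pval gam' w F s es x <= pval gam w f s es x + E + e / 2 * (w (last s es) - w s).
Proof.
move=> hF hf e0 + + + + FE; elim: es s x => [|u es IH] s x /= s0.
  by move=> _ _ _; rewrite subrr mulr0 addr0.
move=> /andP[su pu] l1 gg; have u0 : 0 <= u by exact: le_trans su.
have ul := path_le_last pu.
have we : 0 <= w u - w s by rewrite subr_ge0 wmono//; exact: le_trans ul l1.
have IH' y := IH u y u0 pu l1 (fun t ut => gg t (le_trans su ut)).
(* The sign of [gam'] is known only on the range where it equals [gam + e], so this is proved along
   the list and not by [profile_pval]. *)
have hv' : profile (pval gam' w F u es).
  have : forall t, u <= t -> t < last u es -> 0 <= gam' t.
    by move=> t ut tl; rewrite gg ?addr_ge0//; exact: le_trans ut.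
  elim: es u pu {IH IH' l1 gg su u0 ul we} => //= v es IH u /andP[uv pv] g0.
  have hv : profile (pval gam' w F v es) by apply: IH => // t vt; apply: g0; exact: le_trans vt.
  have [->|uv'] := eqVneq u v; first by rewrite subrr Phi0.
  apply: profile_Phi_all => //; apply: g0 => //.
  by apply: lt_le_trans (path_le_last pv); rewrite lt_neqAle uv'.
have hv := profile_pval w u es gam0 hf.
have [sE|su'] := eqVneq s u.
  by rewrite sE subrr !Phi0; exact: IH'.
have sl : s < last u es by apply: lt_le_trans ul; rewrite lt_neqAle su'.
rewrite gg//.
set E' := E + e / 2 * (w (last u es) - w u).
have h1 : Phi (gam s + e) (w u - w s) (pval gam' w F u es) x <=
    Phi (gam s + e) (w u - w s) (pval gam w f u es) x + E'.
  by apply: Phi_shift => //; [exact: addr_ge0|move=> y; rewrite /E' addrA; exact: IH'].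
apply: (le_trans h1).
have h2 := Phi_crude x hv (gam0 s) e0 we.
apply: (le_trans (lerD h2 (lexx E'))).
rewrite /E' le_eqVlt; apply/orP; left; apply/eqP; move: (Phi _ _ _ _) => ?; ring.
Qed.

(** Iterates [Phi_propagate]. The ratios of standard deviations telescope, so the number of levels
    enters only through the power of [cB B / 2]; [A] bounds the levels crossed, [V] every increment
    of [w], and [B] the product [A * sqrt V]. *)
Lemma pval_propagate F f s es E k v x A V B : profile F -> profile f -> 0 <= s ->
  path <=%R s es -> last s es <= 1 -> 0 <= A -> 0 <= k -> A * k <= 1 -> 0 < v -> 0 <= V ->
  A * Num.sqrt V <= B -> (forall t u, 0 <= t -> t <= u -> u <= 1 -> w u - w t <= V) ->
  (forall t, s <= t -> t < last s es -> gam t <= A) ->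
  (forall y, F y <= f y + E - k * bump v y) ->
  pval gam w F s es x <= pval gam w f s es x + E -
    k * (cB B / 2) ^+ size es * (Num.sqrt v / Num.sqrt (v + (w (last s es) - w s) / 2))
      * bump (v + (w (last s es) - w s) / 2) x.
Proof.
move=> hF hf + + + A0 k0 Ak v0 V0 AB wV + FE.
have B0 : 0 <= B by apply: le_trans AB; apply: mulr_ge0 => //; exact: sqrtr_ge0.
have c0 := cB_gt0 B0; have c1 := cB_le1 B0.
elim: es s x => [|u es IH] s x /= s0.
  move=> _ _ _; rewrite subrr mul0r addr0 expr0 mulr1 divff ?mulr1//.
  by rewrite gt_eqF// sqrtr_gt0.
move=> /andP[su pu] l1 gg; have u0 : 0 <= u by exact: le_trans su.
have ul := path_le_last pu.
have u1 : u <= 1 by exact: le_trans ul l1.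
have we : 0 <= w u - w s by rewrite subr_ge0 wmono.
have wl : 0 <= w (last u es) - w u by rewrite subr_ge0 wmono.
have IH' y := IH u y u0 pu l1 (fun t ut => gg t (le_trans su ut)).
have hvF := profile_pval w u es gam0 hF.
have hvf := profile_pval w u es gam0 hf.
set v1 := v + (w (last u es) - w u) / 2 in IH'.
have v10 : 0 < v1 by rewrite /v1 ltr_pwDl// divr_ge0.
set k1 := k * (cB B / 2) ^+ size es * (Num.sqrt v / Num.sqrt v1) in IH'.
have r1 : Num.sqrt v / Num.sqrt v1 <= 1.
  by rewrite ler_pdivrMr ?sqrtr_gt0// mul1r ler_wsqrtr// /v1 lerDl divr_ge0.
have r0 : 0 <= Num.sqrt v / Num.sqrt v1 by rewrite divr_ge0.
have cn : (cB B / 2) ^+ size es <= 1.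
  rewrite exprn_ile1//; first by rewrite divr_ge0// ltW.
  by rewrite ler_pdivrMr// mul1r (le_trans c1)//; exact: ler1n.
have cn0 : 0 <= (cB B / 2) ^+ size es by rewrite exprn_ge0// divr_ge0// ltW.
have k10 : 0 <= k1 by rewrite /k1; apply: mulr_ge0 => //; exact: mulr_ge0.
have k1k : k1 <= k.
  rewrite /k1 -mulrA ler_piMr//; exact: mulr_ile1.
have ve : v1 + (w u - w s) / 2 = v + (w (last u es) - w s) / 2.
  by rewrite /v1; field.
(* A level of length zero loses nothing; the extra factor [cB B / 2], at most 1, is paid
   nevertheless to keep the count by the size of the list. *)
have [sE|su'] := eqVneq s u.
  rewrite -ve sE subrr !Phi0 mul0r addr0; apply: (le_trans (IH' x)); rewrite lerD2l lerN2.
  rewrite -/v1; apply: ler_wpM2r; first exact: bump_ge0.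
  rewrite /k1; apply: ler_wpM2r => //; apply: ler_wpM2l => //.
  rewrite exprS ler_piMl// ler_pdivrMr// mul1r (le_trans c1)//; exact: ler1n.
have sl : s < last u es by apply: lt_le_trans ul; rewrite lt_neqAle su'.
have gA : gam s <= A by apply: gg.
have ck : gam s * k1 <= 1 by apply: le_trans Ak; apply: ler_pM.
have caB : gam s * Num.sqrt (w u - w s) <= B.
  apply: le_trans AB; apply: ler_pM => //; apply: ler_wsqrtr; exact: wV.
apply: (le_trans (Phi_propagate x hvF hvf (gam0 s) we k10 ck caB v10 IH')).
rewrite ve lerD2l lerN2 le_eqVlt; apply/orP; left; apply/eqP; congr (_ * _).
rewrite /k1 exprS; move: r0 r1 => _ _.
have s0' : Num.sqrt v1 != 0 by rewrite gt_eqF// sqrtr_gt0.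
move: s0'; move: (Num.sqrt v1) (Num.sqrt _)^-1 (Num.sqrt v) (cB B) (_ ^+ _) => p q r t z pn0.
by field.
Qed.

End Monotone.

(** The values from [q] on coincide. Raising the levels on [[g1, q)] costs the crude amount, on
    [[s, g1)] the gap is gained, and this gain is transported to time 0 by [pval_propagate]. The
    power is one more than the size of [l1] because [s] itself ends a level. *)
Lemma pval_compare gam gam' w g (e s g1 q x A V B : R) l1 l2 l3 :
  (forall t : R, 0 <= gam t) -> (forall t, 0 <= gam' t) ->
  (forall s t : R, 0 <= s -> s <= t -> t <= 1 -> w s <= w t) ->
  (forall t u, 0 <= t -> t <= u -> u <= 1 -> w u - w t <= V) ->
  profile g -> 0 < e -> path <=%R 0 (l1 ++ s :: g1 :: l2 ++ q :: l3) ->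
  last q l3 <= 1 -> s < g1 -> w s < w g1 ->
  (forall t, 0 <= t -> t < s -> gam' t = gam t) ->
  (forall t, s <= t -> t < q -> gam' t = gam t + e) ->
  (forall t, q <= t -> gam' t = gam t) ->
  0 <= A -> (forall t, 0 <= t -> t <= s -> gam t <= A) -> 0 <= V -> (A + e) * Num.sqrt V <= B ->
  A * (e * (w g1 - w s) / 4 * th0 B) <= 1 ->
  pval gam' w g 0 (l1 ++ s :: g1 :: l2 ++ q :: l3) x <=
  pval gam w g 0 (l1 ++ s :: g1 :: l2 ++ q :: l3) x + e / 2 * (w q - w s) -
    e * (w g1 - w s) / 4 * th0 B * (cB B / 2) ^+ (size l1).+1 *
    (Num.sqrt ((w g1 - w s) / 8) / Num.sqrt ((w g1 - w s) / 8 + (w s - w 0) / 2)) *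
    bump ((w g1 - w s) / 8 + (w s - w 0) / 2) x.
Proof.
move=> gam0 gam0' wm wV hg e0 pth lq sg wsg h1 h2 h3 A0 gA V0 AB Ak.
have -> : l1 ++ s :: g1 :: l2 ++ q :: l3 = rcons l1 s ++ g1 :: (rcons l2 q ++ l3).
  by rewrite !cat_rcons.
have {}pth : path <=%R 0 (rcons l1 s ++ g1 :: (rcons l2 q ++ l3)) by rewrite !cat_rcons.
have cut gm : pval gm w g 0 (rcons l1 s ++ g1 :: (rcons l2 q ++ l3)) =
    pval gm w (Phi (gm s) (w g1 - w s) (pval gm w (pval gm w g q l3) g1 (rcons l2 q))) 0 (rcons l1 s).
  by rewrite pval_cat last_rcons /= pval_cat last_rcons.
rewrite !cut.
move: pth; rewrite cat_path /= cat_path !last_rcons => /and4P[p1 _ p2 p3].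
have sl : 0 <= s by have := path_le_last p1; rewrite last_rcons.
have g1q : g1 <= q by have := path_le_last p2; rewrite last_rcons.
have q1 : q <= 1 by apply: le_trans lq; exact: path_le_last.
have s1 : s <= 1 by apply: le_trans q1; apply: le_trans g1q; exact: ltW.
have g10 : 0 <= g1 by apply: le_trans sl _; exact: ltW.
have TE : pval gam' w g q l3 = pval gam w g q l3 by apply: eq_pval => // t qt _; exact: h3.
have hT := profile_pval w q l3 gam0 hg.
rewrite TE; set T := pval gam w g q l3 in hT *.
set M := pval gam w T g1 (rcons l2 q); set M' := pval gam' w T g1 (rcons l2 q).
have hM : profile M by exact: profile_pval.
have hM' : profile M' by exact: profile_pval.
have MM y : M' y <= M y + e / 2 * (w q - w g1).
  have := @pval_crude gam w gam0 wm gam' T T g1 (rcons l2 q) 0 y e hT hT (ltW e0) g10 p2.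
  rewrite !last_rcons addr0; apply=> //.
    by move=> t t1 t2; apply: h2 => //; apply: le_trans t1; exact: ltW.
  by move=> z; rewrite addr0.
have a0 : 0 < w g1 - w s by rewrite subr_gt0.
set a := w g1 - w s in a0 Ak *.
have B0 : 0 <= B by apply: le_trans AB; apply: mulr_ge0; [rewrite addr_ge0// ltW|exact: sqrtr_ge0].
have aV : a <= V by apply: wV => //; [exact: ltW|exact: le_trans q1].
have gsA : gam s <= A by apply: gA.
have hB : (gam s + e) * Num.sqrt a <= B.
  apply: le_trans AB; apply: ler_pM => //; first by rewrite addr_ge0// ltW.
    by rewrite lerD2r.
  by rewrite ler_wsqrtr.
set k := e * a / 4 * th0 B in Ak *.
have gap y : Phi (gam' s) a M' y <= Phi (gam s) a M y + e / 2 * (w q - w s) - k * bump (a / 8) y.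
  rewrite h2//; last exact: lt_le_trans sg g1q.
  have q1' := Phi_shift a y hM' hM (addr_ge0 (gam0 s) (ltW e0)) MM.
  have q2 := Phi_gap y hM (gam0 s) (ltW e0) a0 hB.
  apply: (le_trans q1'); move: q2; rewrite -/k /a; move: (Phi _ _ _ _) (Phi _ _ _ _) (k * _) => ? ? ?; lra.
have k0 : 0 <= k.
  apply: mulr_ge0; last exact/ltW/th0_gt0.
  by apply: divr_ge0 => //; apply: mulr_ge0; exact: ltW.
have hG : profile (Phi (gam s) a M) by exact: profile_Phi_all.
have hG' : profile (Phi (gam' s) a M') by exact: profile_Phi_all.
have v0 : 0 < a / 8 by rewrite divr_gt0.
have AB' : A * Num.sqrt V <= B.
  by apply: le_trans AB; apply: ler_wpM2r => //; rewrite lerDl ltW.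
have lr : last 0 (rcons l1 s) <= 1 by rewrite last_rcons.
have fin := @pval_propagate gam w gam0 wm (Phi (gam' s) a M') (Phi (gam s) a M) 0 (rcons l1 s)
  (e / 2 * (w q - w s)) k (a / 8) x A V B hG' hG (lexx 0) p1 lr A0 k0 Ak v0 V0 AB' wV.
rewrite !last_rcons size_rcons in fin.
have E : pval gam' w (Phi (gam' s) a M') 0 (rcons l1 s) = pval gam w (Phi (gam' s) a M') 0 (rcons l1 s).
  by apply: eq_pval => //; rewrite last_rcons.
rewrite E; apply: fin => // t t0 ts.
by apply: gA => //; exact: ltW.
Qed.

End Values.

(** * The mixture *)

Section PowerSeries.
Context {R : realType}.
Implicit Types (a c : nat -> R) (s t x y K : R).

Definition ps a s : R := limn (pseries a s).

Lemma natrX_le n x y : 0 <= y -> y <= x -> n.+1%:R * ((x - y) * y ^+ n) <= x ^+ n.+1 - y ^+ n.+1.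
Proof.
move=> y0 yx; elim: n => [|n IH]; first by rewrite expr0 !expr1 !mulr1 mul1r.
have x0 : 0 <= x by exact: le_trans yx.
have -> : x ^+ n.+2 - y ^+ n.+2 = x * (x ^+ n.+1 - y ^+ n.+1) + (x - y) * y ^+ n.+1.
  by rewrite ![_ ^+ n.+2]exprS; ring.
rewrite -natr1 mulrDl mul1r lerD2r.
apply: le_trans (ler_wpM2l x0 IH); rewrite [leRHS]mulrCA; apply: ler_wpM2l; first exact: ler0n.
rewrite [leRHS]mulrCA; apply: ler_wpM2l; first by rewrite subr_ge0.
by rewrite exprS; apply: ler_wpM2r => //; exact: exprn_ge0.
Qed.

(** By [natrX_le], [(n + 1) * (x - y) * y^n <= x^(n+1)]: for nonnegative coefficients a
    differentiation costs only an arbitrarily small part of the interval of convergence. *)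
Lemma is_cvg_ps_diffs a x y : (forall i, 0 <= a i) -> cvgn (pseries a x) -> 0 <= y -> y < x ->
  cvgn (pseries (pseries_diffs a) y).
Proof.
move=> a0 ca y0 yx.
have x0 : 0 <= x by exact: le_trans (ltW yx).
have xy : 0 < x - y by rewrite subr_gt0.
apply: (@series_le_cvg _ _ (fun n => (x - y)^-1 * (a n.+1 * x ^+ n.+1))) => [n|n|n|].
- by apply: mulr_ge0; [apply: mulr_ge0 => //; exact: ler0n|exact: exprn_ge0].
- by apply: mulr_ge0; [rewrite invr_ge0 ltW|apply: mulr_ge0 => //; exact: exprn_ge0].
- rewrite /pseries_diffs mulrC ler_pdivlMr// mulrC !mulrA -mulrA mulrC.
  rewrite -mulrA; apply: ler_wpM2l => //.
  apply: le_trans (_ : x ^+ n.+1 - y ^+ n.+1 <= _); last by rewrite gerBl exprn_ge0.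
  by apply: le_trans (natrX_le n y0 (ltW yx)); rewrite le_eqVlt; apply/orP; left; apply/eqP; ring.
- have -> : (fun n => (x - y)^-1 * (a n.+1 * x ^+ n.+1)) =
     (x - y)^-1 *: (fun n => a n.+1 * x ^+ n.+1) by apply/funext.
  apply: is_cvg_seriesZ.
  have -> : series (fun n => a n.+1 * x ^+ n.+1) = (fun n => pseries a x (n + 1)%N - a 0).
    apply/funext => n; rewrite /series /pseries /series/= addn1 big_nat_recl// expr0 mulr1.
    by rewrite addrAC subrr add0r.
  apply: is_cvgB; last exact: is_cvg_cst.
  by apply/cvg_ex; exists (limn (pseries a x)); rewrite (cvg_shiftn 1 (pseries a x)).
Qed.

Lemma dps a x K : (forall i, 0 <= a i) -> cvgn (pseries a K) -> `|x| < K ->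
  is_derive x 1 (ps a) (ps (pseries_diffs a) x).
Proof.
move=> a0 ca xK.
have K0 : 0 < K by exact: le_lt_trans xK.
(* Two intermediate radii, because term by term differentiation asks for convergence of the series
   and of its first two derived series at a common point beyond [x]. *)
pose K1 := (`|x| + K) / 2; pose K2 := (`|x| + K1) / 2.
have x0 : 0 <= `|x| by [].
have K1K : K1 < K by rewrite /K1; lra.
have xK1 : `|x| < K1 by rewrite /K1; lra.
have K2K1 : K2 < K1 by rewrite /K2; lra.
have xK2 : `|x| < K2 by rewrite /K2; lra.
have K10 : 0 <= K1 by lra.
have K20 : 0 <= K2 by lra.
have d0 i : 0 <= pseries_diffs a i by apply: mulr_ge0.
have c1 : cvgn (pseries a K2) by apply: is_cvg_pseries_inside ca _; rewrite !ger0_norm ?ltW//; lra.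
have c2 : cvgn (pseries (pseries_diffs a) K1) by exact: is_cvg_ps_diffs ca _ _.
have c3 : cvgn (pseries (pseries_diffs a) K2) by apply: is_cvg_pseries_inside c2 _; rewrite !ger0_norm.
have c4 := is_cvg_ps_diffs d0 c2 K20 K2K1.
by apply: (pseries_snd_diffs c1 c3 c4); rewrite [ltRHS]ger0_norm.
Qed.

Lemma le_ps a x y : (forall i, 0 <= a i) -> cvgn (pseries a y) -> 0 <= x -> x <= y -> ps a x <= ps a y.
Proof.
move=> a0 cy x0 xy; have y0 := le_trans x0 xy.
move: xy; rewrite le_eqVlt => /predU1P[->//|xy].
have cx : cvgn (pseries a x) by apply: is_cvg_pseries_inside cy _; rewrite !ger0_norm.
apply: lim_series_le => // n; apply: ler_wpM2l => //.
by rewrite lerXn2r ?nnegrE// ltW.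
Qed.

Lemma ps_ge_term a x n : (forall i, 0 <= a i) -> cvgn (pseries a x) -> 0 <= x -> a n * x ^+ n <= ps a x.
Proof.
move=> a0 cx x0; have t0 i : 0 <= a i * x ^+ i by apply: mulr_ge0 => //; exact: exprn_ge0.
have nd : nondecreasing_seq (pseries a x) by apply: nondecreasing_series => i _ _; exact: t0.
apply: le_trans (nondecreasing_cvgn_le nd cx n.+1).
by rewrite /pseries /series/= big_nat_recr//= lerDr sumr_ge0.
Qed.

Lemma ps_ge0 a x : (forall i, 0 <= a i) -> cvgn (pseries a x) -> 0 <= x -> 0 <= ps a x.
Proof.
move=> a0 cx x0; apply: le_trans (ps_ge_term 0 a0 cx x0); rewrite expr0 mulr1; exact: a0.
Qed.

Lemma ps_cst0 a x : (forall i, a i = 0) -> ps a x = 0.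
Proof.
move=> a0; rewrite /ps (_ : pseries a x = fun=> 0) ?lim_cst//.
by apply/funext => n; rewrite /pseries /series/= big1// => i _; rewrite a0 mul0r.
Qed.

End PowerSeries.

Section Mixture.
Context {R : realType} (c : nat -> R).
Hypothesis hc : (\sum_(2 <= p <oo) (2 ^+ p * c p ^+ 2)%:E < +oo)%E.

Definition mixcoef (p : nat) : R := if (2 <= p)%N then c p ^+ 2 else 0.

Lemma mixcoef_ge0 p : 0 <= mixcoef p.
Proof. by rewrite /mixcoef; case: ifP => // _; exact: sqr_ge0. Qed.

Lemma xi_ps : xi c = ps mixcoef.
Proof.
apply/funext => s; rewrite /xi /ps; congr (limn _); apply/funext => n.
rewrite /pseries /series/=.
have [n2|n2] := leqP 2 n; last first.
  rewrite big_geq; last exact: ltnW.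
  rewrite big_nat_cond big1// => i; rewrite /= andbT => ilt.
  by rewrite /mixcoef leqNgt (leq_trans ilt (ltnW n2)) mul0r.
rewrite [RHS](@big_cat_nat _ _ _ 2 0 n)//= [X in _ = X + _]big1_seq ?add0r; last first.
  by move=> i; rewrite mem_index_iota => /andP[_ /andP[_ i2]]; rewrite /mixcoef leqNgt i2 mul0r.
by apply: eq_big_nat => i /andP[i2 _]; rewrite /mixcoef i2.
Qed.

(** The summability assumption is convergence at 2, so the mixture is smooth on a neighbourhood of
    [[0, 1]] and the two-sided derivatives in [xi''] are meaningful at 0 and at 1. *)
Lemma cvg_mix2 : cvgn (pseries mixcoef 2).
Proof.
apply: nnseries_is_cvg => [n|].
  by apply: mulr_ge0; [exact: mixcoef_ge0|exact: exprn_ge0].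
move: hc; rewrite eseries_cond eseries_mkcond; apply: le_lt_trans.
rewrite le_eqVlt; apply/orP; left; apply/eqP; apply: eq_eseriesr => i _ /=.
by rewrite /mixcoef; case: ifP => _; [rewrite mulrC|rewrite mul0r].
Qed.

Definition xi1 : R -> R := ps (pseries_diffs mixcoef).
Definition xi2 : R -> R := ps (pseries_diffs (pseries_diffs mixcoef)).

Lemma diffs_ge0 (a : nat -> R) i : (forall i, 0 <= a i) -> 0 <= pseries_diffs a i.
Proof. by move=> a0; apply: mulr_ge0. Qed.

Let d1 i : 0 <= pseries_diffs mixcoef i. Proof. exact/diffs_ge0/mixcoef_ge0. Qed.
Let d2 i : 0 <= pseries_diffs (pseries_diffs mixcoef) i. Proof. exact/diffs_ge0/d1. Qed.

Let cvg1 (K : R) : 0 <= K -> K < 2 -> cvgn (pseries (pseries_diffs mixcoef) K).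
Proof. by move=> K0 K2; exact: is_cvg_ps_diffs mixcoef_ge0 cvg_mix2 K0 K2. Qed.

Let cvg2 (K : R) : 0 <= K -> K < 2 -> cvgn (pseries (pseries_diffs (pseries_diffs mixcoef)) K).
Proof.
move=> K0 K2; apply: (is_cvg_ps_diffs d1 (@cvg1 ((K + 2) / 2) _ _)) => //; lra.
Qed.

Lemma dxi (s : R) : `|s| < 2 -> is_derive s 1 (xi c) (xi1 s).
Proof. by move=> s2; rewrite xi_ps; exact: dps mixcoef_ge0 cvg_mix2 s2. Qed.

Lemma dxi1 (s : R) : `|s| < 2 -> is_derive s 1 xi1 (xi2 s).
Proof.
move=> s2; have s0 : 0 <= `|s| by [].
by apply: (dps d1 (@cvg1 ((`|s| + 2) / 2) _ _)); lra.
Qed.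

Lemma xi2_cont s : `|s| < 2 -> {for s, continuous xi2}.
Proof.
move=> s2; have s0 : 0 <= `|s| by [].
apply: differentiable_continuous; apply/derivable1_diffP.
have h : is_derive s 1 xi2 (ps (pseries_diffs (pseries_diffs (pseries_diffs mixcoef))) s).
  by apply: (dps d2 (@cvg2 ((`|s| + 2) / 2) _ _)); lra.
by [].
Qed.

Lemma xi''E s : `|s| < 2 -> xi'' c s = xi2 s.
Proof.
move=> s2; rewrite /xi'' /=.
have h : is_derive s 1 (derive1 (xi c)) (xi2 s).
  move: (dxi1 s2); apply: near_eq_is_derive => //.
  have /(_ (nbhs_filter _)) := @cvgr_lt _ _ _ _ _ _ (@norm_continuous _ _ s) 2 s2.
  by apply: filterS => t t2; rewrite derive1E; have := dxi t2; move=> ?; rewrite derive_val.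
by rewrite derive1E; apply: derive_val.
Qed.

Lemma xi2_ge0 s : 0 <= s -> s < 2 -> 0 <= xi2 s.
Proof. by move=> s0 s2; apply: ps_ge0 => //; exact: cvg2. Qed.

Lemma le_xi2 s t : 0 <= s -> s <= t -> t < 2 -> xi2 s <= xi2 t.
Proof. by move=> s0 st t2; apply: le_ps => //; apply: cvg2 => //; exact: le_trans st. Qed.

Lemma xi2_gt0 p s : (2 <= p)%N -> c p != 0 -> 0 < s -> s < 2 -> 0 < xi2 s.
Proof.
move=> p2 cp s0 s2.
apply: lt_le_trans (ps_ge_term (p - 2)%N d2 (cvg2 (ltW s0) s2) (ltW s0)).
apply: mulr_gt0; last exact: exprn_gt0.
rewrite /pseries_diffs; case: p p2 cp => [|[|p]]// _ cp; rewrite subn2/=.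
apply: mulr_gt0; first by rewrite ltr0n.
apply: mulr_gt0; first by rewrite ltr0n.
by rewrite /mixcoef/= exprn_even_gt0.
Qed.

Lemma xi2_eq0 s : (forall p, (2 <= p)%N -> c p = 0) -> xi2 s = 0.
Proof.
move=> c0; apply: ps_cst0 => i; rewrite /pseries_diffs /mixcoef/=.
by rewrite c0// expr0n/= !mulr0.
Qed.

End Mixture.

(** * Integration on the strip *)

Section PlaneTools.
Context {R : realType}.
Notation mu := (@lebesgue_measure R).
Implicit Types (F G : R -> R -> R) (f g q : R -> R) (a b s t x y r M : R).

(** Integrals over segments are written as integrals over the line with this factor, so that a
    single integral calculus serves throughout. *)
Definition ind a b t : R := \1_(`[a, b]%classic : set R) t.

Lemma ind1 a b t : a <= t -> t <= b -> ind a b t = 1.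
Proof. by move=> at' tb; rewrite /ind indicE mem_set//= in_itv/= at' tb. Qed.

Lemma ind0 a b t : (t < a) || (b < t) -> ind a b t = 0.
Proof.
move=> h; rewrite /ind indicE memNset//= in_itv/= => /andP[h1 h2].
by move: h; rewrite !ltNge h1 h2.
Qed.

Lemma ind_ge0 a b t : 0 <= ind a b t.
Proof. by rewrite /ind indicE. Qed.

Lemma ind_le1 a b t : ind a b t <= 1.
Proof. by rewrite /ind indicE lern1 leq_b1. Qed.

Lemma measurable_ind a b : measurable_fun setT (ind a b).
Proof. exact: measurable_indic. Qed.

Lemma intg_ind a b : intg (ind a b).
Proof.
by have := @integrable_indic_itv R a b true false; apply: eq_integrable.
Qed.

Lemma Int_ind a b : a <= b -> Int (ind a b) = b - a.
Proof.
move=> ab; apply: EFin_inj; rewrite -IntE; last exact: intg_ind.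
rewrite (@integral_indic _ _ _ mu _ measurableT `[a, b]%classic (measurable_itv _)).
rewrite setIT [LHS](lebesgue_measure_itv `[a, b])/= lte_fin.
move: ab; rewrite le_eqVlt => /predU1P[->|ab]; first by rewrite ltxx subrr.
by rewrite ab -EFinB.
Qed.

Lemma floor_approx_cvg x : ((Num.floor (n.+1%:R * x))%:~R / n.+1%:R) @[n --> \oo] --> x.
Proof.
apply: (@squeeze_cvgr _ _ _ _ (fun n => x - n.+1%:R^-1) (fun=> x)); last exact: cvg_cst.
  near=> n; have n0 : (0 : R) < n.+1%:R by rewrite ltr0n.
  rewrite ler_pdivlMr// ler_pdivrMr// mulrBl mulVf ?gt_eqF//.
  have := floor_le_tmp (n.+1%:R * x); have := floorD1_gt (n.+1%:R * x).
  rewrite intrD1 mulrC; lra.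
rewrite -[X in _ --> X]subr0; apply: cvgB; first exact: cvg_cst.
exact: cvg_harmonic.
Unshelve. all: by end_near.
Qed.

Lemma measurable_floor n (k : int) : measurable [set x : R | Num.floor (n.+1%:R * x) = k].
Proof.
rewrite (_ : [set _ | _] = (fun x : R => n.+1%:R * x) @^-1` `[k%:~R, (k + 1)%:~R[%classic).
  rewrite -[X in measurable X]setTI.
  have m : measurable_fun setT (fun x : R => n.+1%:R * x : measurableTypeR R) by exact: measurable_funM.
  by apply: m.
apply/seteqP; split => x /=; rewrite in_itv/=.
  by move=> <-; rewrite floor_le_tmp floorD1_gt.
by move=> h; apply/floor_def.
Qed.

(** Rounding [x] down to a multiple of [1 / (n + 1)] gives a function that is measurable on each of
    countably many strips, and continuity in [x] recovers [F] in the limit. *)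
Lemma measurable_caratheodory F : (forall t, continuous (F t)) ->
  (forall x, measurable_fun setT (F^~ x)) ->
  measurable_fun [set: measurableTypeR R * measurableTypeR R] (fun z => F z.1 z.2).
Proof.
move=> cF mF.
apply: (@measurable_fun_cvg _ _ _ _ (fun n (z : measurableTypeR R * measurableTypeR R) =>
    F z.1 ((Num.floor (n.+1%:R * z.2))%:~R / n.+1%:R))); last first.
  move=> [t x] _ /=; apply: continuous_cvg; [exact: cF|exact: floor_approx_cvg].
move=> n _ Y mY; rewrite setTI.
rewrite (_ : _ @^-1` _ = \bigcup_(k in [set: int])
   ((F^~ (k%:~R / n.+1%:R) @^-1` Y) `*` [set x | Num.floor (n.+1%:R * x) = k])).
  apply: countable_bigcupT_measurable => [|k]; first exact: countableP.
  apply: measurableX; last exact: measurable_floor.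
  by rewrite -[X in measurable X]setTI; exact: mF.
apply/seteqP; split => [[t x]/= h|[t x]/= [k _ [/= h e]]]; last by rewrite e.
by exists (Num.floor (n.+1%:R * x)).
Qed.

Definition meas2 F : Prop :=
  measurable_fun [set: measurableTypeR R * measurableTypeR R] (fun z => F z.1 z.2).

Section Fubini.
Variables (F : R -> R -> R) (g1 g2 : R -> R).
Hypotheses (mF : meas2 F) (i1 : intg g1) (i2 : intg g2).
Hypothesis Fg : forall t x, `|F t x| <= g1 t * g2 x.

Lemma meas2_l t : measurable_fun setT (F t).
Proof. exact: (measurableT_comp mF (pair1_measurable t)). Qed.

Lemma meas2_r x : measurable_fun setT (F^~ x).
Proof. exact: (measurableT_comp mF (pair2_measurable x)). Qed.

Lemma intg_l t : intg (F t).
Proof.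
apply: (@intg_le _ _ (fun x => g1 t * g2 x)); [exact: meas2_l| |exact: intgZl].
by move=> x; exact: Fg.
Qed.

Lemma intg_r x : intg (F^~ x).
Proof.
apply: (@intg_le _ _ (fun t => g1 t * g2 x)); [exact: meas2_r| |exact: intgZr].
by move=> t; exact: Fg.
Qed.

Lemma integrable_prod : (mu \x mu)%E.-integrable setT (fun z => (F z.1 z.2)%:E).
Proof.
apply/integrable12ltyP; first exact/measurable_EFinP.
apply: (@le_lt_trans _ _ (\int[mu]_t (`|g1 t| * Int (fun x => `|g2 x|))%:E)%E).
  apply: ge0_le_integral => //=.
  - by move=> t _; exact: integral_ge0.
  - have mF' : measurable_fun setT (fun z : measurableTypeR R * measurableTypeR R => `|(F z.1 z.2)%:E|%E).
      by apply: measurableT_comp => //; exact/measurable_EFinP.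
    exact: (@measurable_fun_fubini_tonelli_F _ _ _ _ _ mu _ mF' (fun z => abse_ge0 _)).
  - apply/measurable_EFinP; apply: measurable_funM => //.
    by apply: measurableT_comp => //; exact: intg_measurable.
  - move=> t _; rewrite (@IntE _ (fun x => `|F t x|)); last exact/intg_norm/intg_l.
    rewrite lee_fin -IntZl; last exact: intg_norm.
    apply: le_Int; [exact/intg_norm/intg_l|exact/intgZl/intg_norm|].
    by move=> x; apply: (le_trans (Fg t x)); rewrite -normrM; exact: ler_norm.
rewrite (@IntE _ (fun t => `|g1 t| * Int (fun x => `|g2 x|))) ?ltry//.
exact/intgZr/intg_norm.
Qed.

Lemma intg_IntF : intg (fun t => Int (F t)).
Proof.
have := integrable_fubini_F integrable_prod; apply: eq_integrable => // t _ /=.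
by rewrite /fubini_F/= (@IntE _ (F t))//; exact: intg_l.
Qed.

Lemma Rintegral_prod : \int[(mu \x mu)%E]_z (F z.1 z.2) = Int (fun t => Int (F t)).
Proof.
rewrite /Rintegral -(integral12_prod_meas1 integrable_prod) /fubini_F/=.
rewrite [in RHS]/Int /Rintegral; congr fine; apply: eq_integral => t _.
by rewrite (@IntE _ (F t))//; exact: intg_l.
Qed.

Lemma Int_swap : Int (fun t => Int (F t)) = Int (fun x => Int (F^~ x)).
Proof.
rewrite -Rintegral_prod /Rintegral -(integral21_prod_meas1 integrable_prod) /fubini_G/=.
rewrite [in RHS]/Int /Rintegral; congr fine; apply: eq_integral => t _.
by rewrite (@IntE _ (F^~ t))//; exact: intg_r.
Qed.

End Fubini.

Lemma measurable_strip : measurable (strip R : set (measurableTypeR R * measurableTypeR R)).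
Proof.
rewrite (_ : strip R = `[0, 1]%classic `*` setT); first exact: measurableX.
by apply/seteqP; split => z /=; rewrite in_itv/= => // -[].
Qed.

Lemma meas2_strip (G : R * R -> R) : measurable_fun (strip R : set (measurableTypeR R * measurableTypeR R)) G ->
  meas2 (fun t x => ind 0 1 t * G (t, x)).
Proof.
move=> mG; have := (measurable_restrictT G measurable_strip).1 mG.
apply: eq_measurable_fun => -[t x] _; rewrite patchE /ind indicE /=.
have -> : ((t, x) \in strip R) = (t \in `[0, 1]%classic).
  by apply/idP/idP => /set_mem h; apply/mem_set; move: h; rewrite /= in_itv.
by case: (t \in _); rewrite ?mul1r ?mul0r.
Qed.

Section Strip.
Variables (G : R * R -> R) (g1 g2 : R -> R).
Hypothesis mG : measurable_fun (strip R : set (measurableTypeR R * measurableTypeR R)) G.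
Hypotheses (i1 : intg g1) (i2 : intg g2).
Hypothesis Gg : forall t x, 0 <= t -> t <= 1 -> `|G (t, x)| <= g1 t * g2 x.
Hypotheses (g10 : forall t, 0 <= g1 t) (g20 : forall x, 0 <= g2 x).

Let hF t x : `|ind 0 1 t * G (t, x)| <= g1 t * g2 x.
Proof.
rewrite normrM ger0_norm ?ind_ge0//.
have [/andP[t0 t1]|] := boolP (0 <= t <= 1).
  by rewrite ind1// mul1r; exact: Gg.
by rewrite negb_and -!ltNge => h; rewrite ind0// mul0r mulr_ge0.
Qed.

Let IntE t : Int (fun x => ind 0 1 t * G (t, x)) = ind 0 1 t * Int (fun x => G (t, x)).
Proof.
have [/andP[t0 t1]|] := boolP (0 <= t <= 1).
  by rewrite ind1// mul1r; apply: eq_Int => x; rewrite mul1r.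
rewrite negb_and -!ltNge => h; rewrite ind0// mul0r.
under eq_Int do rewrite mul0r.
by rewrite /Int Rintegral_cst// mul0r.
Qed.

Lemma intg_strip : intg (fun t => ind 0 1 t * Int (fun x => G (t, x))).
Proof. by under eq_fun do rewrite -IntE; exact: intg_IntF (meas2_strip mG) i1 i2 hF. Qed.

Lemma Rintegral_strip :
  \int[(mu \x mu)%E]_(z in strip R) G z = Int (fun t => ind 0 1 t * Int (fun x => G (t, x))).
Proof.
transitivity (\int[(mu \x mu)%E]_z (ind 0 1 z.1 * G (z.1, z.2))).
  rewrite Rintegral_mkcond; congr Rintegral; apply/funext => -[t x] /=.
  rewrite patchE /ind indicE.
  have -> : ((t, x) \in strip R) = (t \in `[0, 1]%classic).
    by apply/idP/idP => /set_mem h; apply/mem_set; move: h; rewrite /= in_itv.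
  by case: (t \in _); rewrite ?mul1r ?mul0r.
by rewrite (Rintegral_prod (meas2_strip mG) i1 i2 hF); apply: eq_Int => t; exact: IntE.
Qed.

End Strip.

Lemma ae_eq_Rintegral (d : measure_display) (T : measurableType d) (m : {measure set T -> \bar R})
    (D : set T) (f g : T -> R) : measurable D -> measurable_fun D f -> measurable_fun D g ->
  {ae m, forall z, D z -> f z = g z} -> \int[m]_(z in D) f z = \int[m]_(z in D) g z.
Proof.
move=> mD mf mg fg; rewrite /Rintegral; congr fine; apply: ae_eq_integral => //.
- exact/measurable_EFinP.
- exact/measurable_EFinP.
- by apply: filterS fg => z h Dz; rewrite h.
Qed.

End PlaneTools.

(** * Primitives, indicators and compact supports on the line *)

Section Calculus.
Context {R : realType}.
Notation mu := (@lebesgue_measure R).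
Implicit Types (F G : R -> R -> R) (f g q Q : R -> R) (a b s t x y r M : R).

Lemma derive1_near0 f x : (\forall y \near x, f y = 0) -> derive1 f x = 0.
Proof.
move=> h; have d0 : is_derive x 1 (fun=> 0 : R) 0 by exact: is_derive_cst.
have d1 : is_derive x 1 f 0 by move: d0; apply: near_eq_is_derive; apply: filterS h => y ->.
by rewrite derive1E derive_val.
Qed.

Lemma near_norm_gt r x : r < `|x| -> \forall y \near x, r < `|y|.
Proof. exact: (@cvgr_gt _ _ _ (nbhs_filter x) Num.norm `|x| (@norm_continuous _ _ x)). Qed.

Lemma segment_bound q a b : continuous q ->
  exists2 M, 0 <= M & forall t, a <= t -> t <= b -> `|q t| <= M.
Proof.
move=> cq.
have : compact (q @` `[a, b]%classic).
  by apply: continuous_compact; [exact: continuous_subspaceT|exact: segment_compact].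
move=> /compact_bounded [N [Nr hN]].
exists (`|N| + 1); first by rewrite addr_ge0.
move=> t at' tb; apply: (hN (`|N| + 1)).
  by apply: (le_lt_trans (real_ler_norm Nr)); rewrite ltrDl.
by exists t => //=; rewrite in_itv/= at' tb.
Qed.

Lemma intg_indc q a b : continuous q -> intg (fun t => ind a b t * q t).
Proof.
move=> cq; have [M M0 hM] := segment_bound a b cq.
apply: (@intg_le _ _ (fun t => ind a b t * M)); last exact/intgZr/intg_ind.
  by apply: measurable_funM; [exact: measurable_ind|exact: continuous_measurable_fun].
move=> t; rewrite normrM ger0_norm ?ind_ge0//.
have [/andP[t0 t1]|] := boolP (a <= t <= b).
  by rewrite ind1// !mul1r; exact: hM.
by rewrite negb_and -!ltNge => h; rewrite ind0// !mul0r.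
Qed.

(** The derivative is asked for in the open interval only: the primitives to which this is applied
    are frozen outside [[0, 1]] and may have a corner at its ends. *)
Lemma Int_FTC q Q a b : a <= b -> continuous q -> continuous Q ->
  (forall t, a < t -> t < b -> is_derive t 1 Q (q t)) ->
  Int (fun t => ind a b t * q t) = Q b - Q a.
Proof.
move=> + cq cQ dQ; rewrite le_eqVlt => /predU1P[->|ab].
  rewrite subrr; have := @le_norm_Int _ _ (intg_indc b b cq).
  have [M M0 hM] := segment_bound b b cq.
  have h : Int (fun y => `|ind b b y * q y|) <= Int (fun y => ind b b y * M).
    apply: le_Int; [exact/intg_norm/intg_indc|exact/intgZr/intg_ind|move=> t].
    rewrite normrM ger0_norm ?ind_ge0//.
    have [/andP[t0 t1]|] := boolP (b <= t <= b).
      by rewrite ind1// !mul1r; exact: hM.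
    by rewrite negb_and -!ltNge => h; rewrite ind0// !mul0r.
  move=> h1; apply/eqP; rewrite -normr_le0; apply: (le_trans h1); apply: (le_trans h).
  by rewrite IntZr; [rewrite Int_ind// subrr mul0r|exact: intg_ind].
have dd : derivable_oo_LRcontinuous Q a b.
  split; last 2 first.
  - exact/cvg_at_right_filter/cQ.
  - exact/cvg_at_left_filter/cQ.
  by move=> t; rewrite in_itv/= => /andP[at' tb]; have [] := dQ t at' tb.
have hd : {in `]a, b[, Q^`()%classic =1 q}.
  move=> t; rewrite in_itv/= => /andP[at' tb]; rewrite derive1E.
  by have h := dQ t at' tb; rewrite derive_val.
have := continuous_FTC2 ab (continuous_subspaceT cq) dd hd.
rewrite -EFinB => h; rewrite -[RHS]/(fine (Q b - Q a)%:E) -h.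
rewrite -[RHS]/(Rintegral _ _ _) Rintegral_mkcond; apply: eq_Int => t.
by rewrite patchE /ind indicE; case: (t \in _); rewrite ?mul1r ?mul0r.
Qed.

Lemma ind_split q a b c : a <= b -> b <= c -> intg (fun t => ind a c t * q t) ->
  Int (fun t => ind a c t * q t) = Int (fun t => ind a b t * q t) + Int (fun t => ind b c t * q t).
Proof.
move=> ab bc iq.
have i1 : intg (fun t => ind a b t * q t).
  apply: (@intg_le _ _ (fun t => `|ind a c t * q t|)); last exact: intg_norm.
    have := measurable_funM (measurable_ind a b) (intg_measurable iq).
    apply: eq_measurable_fun => t _ /=; rewrite mulrA; congr (_ * _).
    have [/andP[t0 t1]|] := boolP (a <= t <= b); first by rewrite !ind1 ?mulr1// (le_trans t1).
    by rewrite negb_and -!ltNge => h; rewrite ind0// mul0r.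
  move=> t; rewrite !normrM !(ger0_norm (ind_ge0 _ _ _)); apply: ler_wpM2r => //.
  have [/andP[t0 t1]|] := boolP (a <= t <= b); first by rewrite !ind1// (le_trans t1).
  by rewrite negb_and -!ltNge => h; rewrite ind0// ind_ge0.
suff -> : Int (fun t => ind b c t * q t) = Int (fun t => ind a c t * q t) - Int (fun t => ind a b t * q t).
  by rewrite addrC subrK.
symmetry; rewrite -IntB//; rewrite /Int /Rintegral; congr fine.
apply: ae_eq_integral => //.
- by apply/measurable_EFinP; apply: intg_measurable; exact: intgB.
- apply/measurable_EFinP.
  have := measurable_funM (measurable_ind b c) (intg_measurable iq).
  apply: eq_measurable_fun => t _ /=; rewrite mulrA; congr (_ * _).
  have [/andP[t0 t1]|] := boolP (b <= t <= c); first by rewrite !ind1 ?mulr1// (le_trans ab).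
  by rewrite negb_and -!ltNge => h; rewrite ind0// mul0r.
(* The two segments share [b], the only point where the integrands can disagree. *)
exists [set b]; split => //; first exact: lebesgue_measure_set1.
move=> t /= h; apply/eqP; apply: contra_notT h => tb _; congr EFin.
have [tltb|tgtb|e] := ltgtP t b; last by rewrite e eqxx in tb.
  rewrite (@ind0 _ b c) ?tltb// mul0r.
  have [ta|ta] := leP a t; last by rewrite !ind0 ?ta// !mul0r subrr.
  by rewrite !ind1 ?subrr// ltW// (lt_le_trans tltb).
rewrite (@ind0 _ a b) ?tgtb ?orbT// mul0r subr0.
have [tc|tc] := leP t c; last by rewrite !ind0 ?tc ?orbT.
by rewrite !ind1//; exact: ltW (le_lt_trans _ tgtb).
Qed.

Lemma Int_ae_ind f g a b : measurable_fun setT f -> measurable_fun setT g ->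
  (forall t, a < t -> t < b -> f t = g t) ->
  Int (fun t => ind a b t * f t) = Int (fun t => ind a b t * g t).
Proof.
move=> mf mg fg; rewrite /Int /Rintegral; congr fine; apply: ae_eq_integral => //.
- by apply/measurable_EFinP; apply: measurable_funM => //; exact: measurable_ind.
- by apply/measurable_EFinP; apply: measurable_funM => //; exact: measurable_ind.
exists [set a; b]; split => //.
- by apply: measurableU.
- have : (mu ([set a] `|` [set b]) <= mu [set a] + mu [set b])%E by exact: measureU2.
  by rewrite !lebesgue_measure_set1 adde0 => h; apply/eqP; rewrite eq_le h measure_ge0.
move=> t /= h; apply: contra_notP h => /not_orP[/eqP ta /eqP tb] _; congr EFin.
have [tlta|tgta|e] := ltgtP t a; [by rewrite ind0 ?tlta// !mul0r| |by rewrite e eqxx in ta].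
have [tltb|tgtb|e] := ltgtP t b; [by rewrite fg| |by rewrite e eqxx in tb].
by rewrite ind0 ?tgtb ?orbT// !mul0r.
Qed.

Section CompactSupport.
Variables (f : R -> R) (r : R).
Hypotheses (cf : continuous f) (f0 : forall x, r < `|x| -> f x = 0).

Lemma ind_out x : r < `|x| -> ind (- r) r x = 0.
Proof.
move=> h; apply: ind0; have [x0|x0] := leP 0 x.
  by rewrite ger0_norm// in h; rewrite h orbT.
by rewrite ltr0_norm// in h; rewrite ltrNr h.
Qed.

Lemma ind_in x : `|x| <= r -> ind (- r) r x = 1.
Proof. by rewrite ler_norml => /andP[x1 x2]; rewrite ind1. Qed.

Lemma cs_ind x : f x = ind (- r) r x * f x.
Proof.
have [h|h] := leP `|x| r; first by rewrite ind_in// mul1r.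
by rewrite ind_out// mul0r f0.
Qed.

Lemma cs_intg : intg f.
Proof.
rewrite (_ : f = fun x => ind (- r) r x * f x); first exact: intg_indc.
by apply/funext => x; exact: cs_ind.
Qed.

End CompactSupport.

Lemma Int_derive0 f f' r : (forall x, is_derive x 1 f (f' x)) -> continuous f' ->
  (forall x, r < `|x| -> f x = 0) -> Int f' = 0.
Proof.
move=> df cf' f0.
have cf : continuous f by move=> x; apply: differentiable_continuous; apply/derivable1_diffP.
(* A positive radius strictly above [r], so that [f] vanishes at both endpoints even when [r] is
   negative. *)
pose r1 := `|r| + 1.
have rr1 : r < r1 by apply: (le_lt_trans (ler_norm r)); rewrite /r1 ltrDl.
have r10 : 0 < r1 by rewrite /r1 ltr_wpDl.
have f0' x : r1 < `|x| -> f' x = 0.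
  move=> xr; have <- := derive_val (is_derive := df x); rewrite -derive1E.
  apply: derive1_near0; apply: filterS (near_norm_gt xr) => y yr.
  by rewrite f0// (lt_trans rr1).
transitivity (Int (fun x => ind (- r1) r1 x * f' x)).
  by apply: eq_Int => x; exact: cs_ind.
rewrite (@Int_FTC f' f)//; last by rewrite ge0_cp// ltW.
by rewrite !f0 ?subrr// ?normrN gtr0_norm.
Qed.

End Calculus.

(** * Bounds for test functions on the plane *)

Section TestFunctions.
Context {R : realType}.
Implicit Types (F G : R -> R -> R) (t x r M : R).

Definition vanish r F : Prop := forall t x, (r < `|t|) || (r < `|x|) -> F t x = 0.

Lemma vanish_partial_t r F : vanish r F -> vanish r (partial_t F).
Proof.
move=> vF t x /orP[h|h]; apply: derive1_near0.
  by apply: filterS (near_norm_gt h) => s sr; rewrite vF// sr.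
by apply: (@filterE _ _ (nbhs_filter t)) => s; rewrite vF// h orbT.
Qed.

Lemma vanish_partial_x r F : vanish r F -> vanish r (partial_x F).
Proof.
move=> vF t x /orP[h|h]; apply: derive1_near0.
  by apply: (@filterE _ _ (nbhs_filter x)) => y; rewrite vF// h.
by apply: filterS (near_norm_gt h) => y yr; rewrite vF// yr orbT.
Qed.

Lemma vanish_bound r F : continuous (fun z : R * R => F z.1 z.2) -> vanish r F ->
  exists2 M, 0 <= M & forall t x, `|F t x| <= M * ind (- r) r x.
Proof.
move=> cF vF.
have : compact ((fun z : R * R => F z.1 z.2) @` (`[- r, r]%classic `*` `[- r, r]%classic)).
  apply: continuous_compact; first exact: continuous_subspaceT.
  by apply: compact_setX; exact: segment_compact.
move=> /compact_bounded [N [Nr hN]].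
exists (`|N| + 1); first by rewrite addr_ge0.
move=> t x.
have [h|h] := boolP ((r < `|t|) || (r < `|x|)).
  by rewrite vF// normr0 mulr_ge0 ?addr_ge0 ?ind_ge0.
move: h; rewrite negb_or -!leNgt => /andP[tr xr].
rewrite ind_in// mulr1; apply: (hN (`|N| + 1)).
  by apply: (le_lt_trans (real_ler_norm Nr)); rewrite ltrDl.
by exists (t, x) => //=; rewrite !in_itv/= -!ler_norml tr xr.
Qed.

Lemma test_vanish (A : set (R * R)) F : test_function A F -> exists r, vanish r F.
Proof.
move=> [_ [C [cC _ F0]]]; have [N [Nr hN]] := compact_bounded cC.
exists (`|N| + 1) => t x h; apply: F0 => Ctx.
have := hN (`|N| + 1) _ _ Ctx; rewrite (le_lt_trans (real_ler_norm Nr)) ?ltrDl// => /(_ isT).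
move=> /=; rewrite prod_normE ge_max => /andP[h1 h2].
by move: h; rewrite !ltNge h1 h2.
Qed.

Lemma cont_l F t : continuous (fun z : R * R => F z.1 z.2) -> continuous (F t).
Proof.
move=> cF x V /(cF (t, x)) [[A B] [/= At Bx] AB].
by apply: filterS Bx => y By; apply: (AB (t, y)); split => //=; exact: nbhs_singleton At.
Qed.

Lemma cont_r F x : continuous (fun z : R * R => F z.1 z.2) -> continuous (F^~ x).
Proof.
move=> cF t V /(cF (t, x)) [[A B] [/= At Bx] AB].
by apply: filterS At => s As; apply: (AB (s, x)); split => //=; exact: nbhs_singleton Bx.
Qed.

Lemma cont_meas2 F : continuous (fun z : R * R => F z.1 z.2) -> meas2 F.
Proof.
move=> cF; apply: measurable_caratheodory => [t|x]; first exact: cont_l.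
apply: continuous_measurable_fun; exact: cont_r.
Qed.

Lemma lip_cont2 F : (forall t x y, `|F t x - F t y| <= `|x - y|) -> (forall x, continuous (F^~ x)) ->
  continuous (fun z : R * R => F z.1 z.2).
Proof.
move=> lF cF [t x]; apply/cvgrPdist_lt => e e0.
have e2 : 0 < e / 2 by rewrite divr_gt0.
have /cvgrPdist_lt/(_ _ e2) h1 := cF x t.
have h2 : \forall y \near x, `|x - y| < e / 2 by have /cvgrPdist_lt := @cvg_id _ (nbhs x); exact.
exists ([set s | `|F t x - F s x| < e / 2], [set y | `|x - y| < e / 2]) => //= -[s y] [/= hs hy].
have -> : F t x - F s y = (F t x - F s x) + (F s x - F s y) by rewrite addrA subrK.
apply: (le_lt_trans (ler_normD _ _)); rewrite [ltRHS](splitr e); apply: ltrD => //.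
exact: le_lt_trans hy.
Qed.

End TestFunctions.

(** * The weak solution of a step function *)

Section IntCont.
Context {R : realType}.
Implicit Types (H : R -> R -> R) (f p : R -> R) (t x r M : R).

Lemma cont_Int_cs H r : (forall x, continuous (H^~ x)) -> (forall t, measurable_fun setT (H t)) ->
  (forall t0, exists M, forall t x, `|t - t0| < 1 -> `|H t x| <= M * ind (- r) r x) ->
  continuous (fun t => Int (H t)) /\ forall t, intg (H t).
Proof.
move=> cH mH bH.
have iH t0 M : (forall t x, `|t - t0| < 1 -> `|H t x| <= M * ind (- r) r x) ->
    forall t, `|t - t0| < 1 -> intg (H t).
  move=> hM t tt; apply: (@intg_le _ _ (fun x => M * ind (- r) r x)) => //; last exact/intgZl/intg_ind.
  by move=> x; exact: hM.
split=> t0; have [M hM] := bH t0.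
  apply: (@cont_Int _ H (fun x => M * ind (- r) r x) t0 1) => //; first exact: iH hM.
    by move=> t x _; exact: cH.
  exact/intgZl/intg_ind.
by apply: (iH _ _ hM); rewrite subrr normr0.
Qed.

Lemma mul_ind_bound p f r B M : 0 <= B -> (forall x, `|x| <= r -> `|p x| <= B) ->
  (forall x, `|f x| <= M * ind (- r) r x) -> forall x, `|p x * f x| <= B * M * ind (- r) r x.
Proof.
move=> B0 hp hf x; rewrite normrM -mulrA.
have [h|h] := leP `|x| r; first by apply: ler_pM => //; exact: hp.
have := hf x; rewrite ind_out// !mulr0 normr_le0 => /eqP ->; by rewrite normr0 mulr0.
Qed.

Lemma norm_half_le (u v : R) : `|u| <= v -> `|u / 2| <= v / 2.
Proof.
move=> h; rewrite normrM (@ger0_norm _ (2^-1)); last by rewrite invr_ge0.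
by apply: ler_wpM2r => //; rewrite invr_ge0.
Qed.

Lemma norm_sqrM_le (c u p m : R) : 0 <= c -> `|u| <= 1 -> `|p| <= m -> `|c * u ^+ 2 * p| <= c * m.
Proof.
move=> c0 u1 pm; have u0 := normr_ge0 u; have p0 := normr_ge0 p.
rewrite [X in `|X|](_ : _ = c * (u * (u * p))); last by ring.
rewrite !normrM (ger0_norm c0); apply: ler_wpM2l => //; apply: le_trans pm.
have h : `|u| * `|p| <= `|p| by rewrite ler_piMl.
apply: le_trans h; rewrite ler_piMl//; exact: mulr_ge0.
Qed.

Lemma continuous_sqr (h : R -> R) x : {for x, continuous h} -> {for x, continuous (fun y => h y ^+ 2)}.
Proof. by move=> ch; apply: (cvgM ch ch). Qed.

Lemma Phixx_cont c a f : profile f -> 0 <= c -> 0 < a -> continuous (Phixx c a f : R -> R).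
Proof.
move=> hf c0 a0 x.
have dc (h : R -> R) l : is_derive x 1 h l -> {for x, continuous h}.
  by move=> [dh _]; apply: differentiable_continuous; apply/derivable1_diffP.
have cJ n : {for x, continuous (J (fun y => ex c (f y)) n a)}.
  exact: dc (dJ_x n x (egrow_ex hf c0) a0).
have ch : {for x, continuous (heat a (om c f))}.
  exact: dc (dheat_x x (egrow_om hf c0) a0).
have cd : {for x, continuous (derive1 (Phi c a f))} by exact: (pr_cont (profile_Phi_all a hf c0)).
apply: cvgB; last first.
  by apply: cvgM; [exact: cvg_cst|exact: continuous_sqr cd].
apply: cvgM; last by apply: cvgV => //; rewrite gt_eqF// heat_om_gt0.
apply: cvgM; last exact: cvg_cst.
apply: cvgB; last exact: cJ.
by apply: cvgM; [exact: cJ|exact: cvg_cst].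
Qed.

End IntCont.

Section Psi.
Context {R : realType}.
Notation mu := (@lebesgue_measure R).
Variables (gam w wd g : R -> R).
Hypothesis gam0 : forall t, 0 <= gam t.
Hypothesis mgam : measurable_fun setT gam.
Hypothesis hg : profile g.
Hypothesis wc : continuous w.
Hypothesis wdc : continuous wd.
Hypothesis wm : forall s t : R, s <= t -> w s <= w t.
Hypothesis wsm : forall s t : R, 0 <= s -> s < t -> t <= 1 -> w s < w t.
Hypothesis dw : forall t : R, 0 < t -> t < 1 -> is_derive t 1 w (wd t).
Implicit Types (s t e x y r M : R) (es : seq R) (phi : R -> R -> R) (f : R -> R).

(* The differences glue the Cole-Hopf formulas of consecutive pieces continuously. *)
Fixpoint psi s es t : R -> R :=
  if es is e :: es' then fun x => Phi (gam s) (w e - w (Num.min t e)) (pval gam w g e es') x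
    + (psi e es' (Num.max t e) x - pval gam w g e es' x)
  else g.

Fixpoint stepf s es : Prop :=
  if es is e :: es' then (forall t, s <= t -> t < e -> gam t = gam s) /\ stepf e es' else True.

Lemma psi_start s es : path <=%R s es -> psi s es s = pval gam w g s es.
Proof.
elim: es s => //= e es IH s /andP[se pe]; apply/funext => x.
by rewrite min_l// max_r// IH// subrr addr0.
Qed.

Lemma psi_left s e es t : path <=%R e es -> t <= e ->
  psi s (e :: es) t = Phi (gam s) (w e - w t) (pval gam w g e es).
Proof.
move=> pe te; apply/funext => x /=.
by rewrite min_l// max_r// psi_start// subrr addr0.
Qed.

Lemma psi_right s e es t : e <= t -> psi s (e :: es) t = psi e es t.
Proof.
move=> te; apply/funext => x /=.
by rewrite min_r// max_l// subrr Phi0 addrC subrK.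
Qed.

Lemma psi_end s es t : path <=%R s es -> last s es <= t -> psi s es t = g.
Proof.
elim: es s => //= e es IH s /andP[se pe] lt.
have et : e <= t by apply: le_trans lt; exact: path_le_last.
by rewrite -/(psi s (e :: es) t) psi_right// IH.
Qed.

Lemma profile_psi s es t : path <=%R s es -> profile (psi s es t).
Proof.
elim: es s => //= e es IH s /andP[se pe].
case/orP: (le_total t e) => te.
  by rewrite -/(psi s (e :: es) t) psi_left//; apply: profile_Phi_all => //; exact: profile_pval.
by rewrite -/(psi s (e :: es) t) psi_right//; exact: IH.
Qed.

Lemma psi_cont_t s es x : continuous (fun t => psi s es t x).
Proof.
elim: es s => [|e es IH] s /=; first by move=> t; exact: cvg_cst.
move=> t; apply: cvgD.
  apply: (@continuous_comp _ _ _ (fun t => w e - w (Num.min t e)) (fun a => Phi (gam s) a (pval gam w g e es) x)).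
    apply: cvgB; first exact: cvg_cst.
    apply: (@continuous_comp _ _ _ (fun t => Num.min t e) w); last exact: wc.
    by apply: continuous_min; [exact: cvg_id|exact: cvg_cst].
  by apply: Phi_a_cont => //; exact: profile_pval.
apply: cvgB; last exact: cvg_cst.
apply: (@continuous_comp _ _ _ (fun t => Num.max t e) (fun t => psi e es t x)); last exact: IH.
by apply: continuous_max; [exact: cvg_id|exact: cvg_cst].
Qed.

Lemma psi_cont2 s es : path <=%R s es -> continuous (fun z : R * R => psi s es z.1 z.2).
Proof.
move=> pe; apply: lip_cont2 => [t x y|x]; last exact: psi_cont_t.
exact/pr_lip/profile_psi.
Qed.

Lemma psi_meas2 s es : path <=%R s es -> meas2 (psi s es).
Proof. by move=> pe; apply: cont_meas2; exact: psi_cont2. Qed.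

(** With the continuity in [x], this yields the joint measurability of the space derivative. *)
Lemma dpsi_cont_t s es x : path <=%R s es -> continuous (fun t => derive1 (psi s es t) x).
Proof.
elim: es s => [|e es IH] s; first by move=> _ /= t; exact: cvg_cst.
move=> /= /andP[se pe].
have hF := profile_pval w e es gam0 hg.
rewrite (_ : (fun t => _) = (fun t => derive1 (Phi (gam s) (w e - w (Num.min t e)) (pval gam w g e es)) x
    + (derive1 (psi e es (Num.max t e)) x - derive1 (pval gam w g e es) x))); last first.
  apply/funext => t; rewrite derive1E.
  have h1 := pr_is_derive x (profile_Phi_all (w e - w (Num.min t e)) hF (gam0 s)).
  have h2 := pr_is_derive x (profile_psi (Num.max t e) pe).
  have h3 := pr_is_derive x hF.
  by have := is_deriveD h1 (is_deriveB h2 h3); move=> ?; rewrite derive_val.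
move=> t; apply: cvgD.
  apply: (@continuous_comp _ _ _ (fun t => w e - w (Num.min t e)) (fun a => derive1 (Phi (gam s) a (pval gam w g e es)) x)).
    apply: cvgB; first exact: cvg_cst.
    apply: (@continuous_comp _ _ _ (fun t => Num.min t e) w); last exact: wc.
    by apply: continuous_min; [exact: cvg_id|exact: cvg_cst].
  exact: dPhi_a_cont.
apply: cvgB; last exact: cvg_cst.
apply: (@continuous_comp _ _ _ (fun t => Num.max t e) (fun t => derive1 (psi e es t) x)); last exact: IH.
by apply: continuous_max; [exact: cvg_id|exact: cvg_cst].
Qed.

Lemma dpsi_meas2 s es : path <=%R s es -> meas2 (fun t x => derive1 (psi s es t) x).
Proof.
move=> pe; apply: measurable_caratheodory => [t|x]; first exact: pr_cont (profile_psi t pe).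
by apply: continuous_measurable_fun; exact: dpsi_cont_t.
Qed.

Section Test.
Variables (phi : R -> R -> R) (r : R).
Hypothesis sphi : smooth2 phi.
Hypothesis vphi : vanish r phi.

Let phit := partial_t phi.
Let phixx := partial_x (partial_x phi).

Let cphi : continuous (fun z : R * R => phi z.1 z.2).
Proof. by have [] := sphi [::]. Qed.
Let cphit : continuous (fun z : R * R => phit z.1 z.2).
Proof. by have [] := sphi [:: true]. Qed.
Let cphix : continuous (fun z : R * R => partial_x phi z.1 z.2).
Proof. by have [] := sphi [:: false]. Qed.
Let cphixx : continuous (fun z : R * R => phixx z.1 z.2).
Proof. by have [] := sphi [:: false; false]. Qed.

Lemma test_dt t x : is_derive t 1 (phi^~ x) (phit t x).
Proof. by rewrite /phit /partial_t derive1E; apply: derivableP; have [] := sphi [::]. Qed.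
Lemma test_dx t x : is_derive x 1 (phi t) (partial_x phi t x).
Proof. by rewrite /partial_x derive1E; apply: derivableP; have [] := sphi [::]. Qed.
Lemma test_dxx t x : is_derive x 1 (partial_x phi t) (phixx t x).
Proof.
rewrite (_ : phixx t x = 'D_1 (partial_x phi t) x); last by rewrite -derive1E.
by have [_ _ h] := sphi [:: false]; apply: derivableP; exact: h.
Qed.

Lemma test_bounds : exists2 M, 0 <= M & forall t x, [/\ `|phi t x| <= M * ind (- r) r x,
  `|phit t x| <= M * ind (- r) r x, `|partial_x phi t x| <= M * ind (- r) r x & `|phixx t x| <= M * ind (- r) r x].
Proof.
have [M1 M10 h1] := vanish_bound cphi vphi.
have [M2 M20 h2] := vanish_bound cphit (vanish_partial_t vphi).
have [M3 M30 h3] := vanish_bound cphix (vanish_partial_x vphi).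
have [M4 M40 h4] := vanish_bound cphixx (vanish_partial_x (vanish_partial_x vphi)).
have aux A B i : 0 <= i -> A <= B -> A * i <= B * i :> R by move=> i0; exact: ler_wpM2r.
exists (M1 + M2 + M3 + M4); first by rewrite !addr_ge0.
move=> t x; have i0 := ind_ge0 (- r) r x.
split; [apply: (le_trans (h1 t x))|apply: (le_trans (h2 t x))|apply: (le_trans (h3 t x))|apply: (le_trans (h4 t x))];
  apply: aux => //; lra.
Qed.

Section Piece.
Variables (c s e : R) (f : R -> R).
Hypotheses (c0 : 0 <= c) (hf : profile f) (s0 : 0 <= s) (se : s <= e) (e1 : e <= 1).

Let P t := Phi c (w e - w t) f.

Let hP t : profile (P t). Proof. exact: profile_Phi_all. Qed.

Let cP x : continuous (P^~ x).
Proof.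
move=> t; apply: (@continuous_comp _ _ _ (fun t => w e - w t) (fun a => Phi c a f x)).
  by apply: cvgB; [exact: cvg_cst|exact: wc].
exact: Phi_a_cont.
Qed.

Let cdP x : continuous (fun t => derive1 (P t) x).
Proof.
move=> t; apply: (@continuous_comp _ _ _ (fun t => w e - w t) (fun a => derive1 (Phi c a f) x)).
  by apply: cvgB; [exact: cvg_cst|exact: wc].
exact: dPhi_a_cont.
Qed.

Let ctM (u v : R -> R -> R) x : continuous (u^~ x) -> continuous (v^~ x) -> continuous (fun t => u t x * v t x).
Proof. by move=> cu cv t; apply: cvgM; [exact: cu|exact: cv]. Qed.

Let cdP2 x : continuous (fun t => (derive1 (P t) x : R) ^+ 2).
Proof. exact: (@ctM (fun t y => derive1 (P t) y) (fun t y => derive1 (P t) y) x (@cdP x) (@cdP x)). Qed.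

Let bP t0 : exists2 B, 0 <= B & forall t x, t0 <= t -> `|x| <= r -> `|P t x| <= B.
Proof.
have [V1 V10 hV] := Phi_ub (w e - w t0) hf c0.
exists (V1 + `|r|); first by rewrite addr_ge0.
move=> t x tt xr; rewrite ger0_norm; last exact: pr_ge0.
apply: (le_trans (pr_le _ (hP t))); apply: lerD.
  by apply: hV; rewrite lerD2l lerN2; exact: wm.
exact: le_trans (ler_norm r).
Qed.

(** [Q] tests the solution at a fixed time, and [q] is the tested equation with the space
    derivatives of second order moved to [phi]. The weak formulation amounts to [Q' = q] inside each
    level: integrated in time, it leaves boundary terms that telescope from one level to the
    next. *)
Let Q t := Int (fun x => P t x * phi t x).
Let q t := Int (fun x => P t x * phit t x - wd t / 2 * (P t x * phixx t x + c * derive1 (P t) x ^+ 2 * phi t x)).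

Let cQ : continuous Q.
Proof.
have [M M0 hM] := test_bounds.
apply: (@cont_Int_cs _ (fun t x => P t x * phi t x) r _ _ _).1 => [x|t|t0].
- by apply: ctM; [exact: cP|exact: cont_r].
- apply: measurable_funM; apply: continuous_measurable_fun; [exact: pr_continuous|exact: cont_l].
- have [B B0 hB] := bP (t0 - 1); exists (B * M) => t x tt.
  apply: (@mul_ind_bound _ (P t) (phi t)) => // [y yr|y]; last by have [] := hM t y.
  by apply: hB => //; move: tt; rewrite ltr_norml => /andP[h _]; lra.
Qed.

Let hH t0 : exists2 M, 0 <= M & forall t x, `|t - t0| < 1 ->
  `|P t x * phit t x - wd t / 2 * (P t x * phixx t x + c * derive1 (P t) x ^+ 2 * phi t x)| <= M * ind (- r) r x.
Proof.
have [M M0 hM] := test_bounds.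
have [B B0 hB] := bP (t0 - 1).
have [W W0 hW] := segment_bound (t0 - 1) (t0 + 1) wdc.
exists (B * M + W / 2 * (B * M + c * M)).
  by rewrite !addr_ge0 ?mulr_ge0 ?addr_ge0 ?mulr_ge0 ?invr_ge0.
move=> t x; rewrite ltr_norml => /andP[t1 t2].
have t1' : t0 - 1 <= t by lra.
have t2' : t <= t0 + 1 by lra.
have i0 := ind_ge0 (- r) r x.
have [m1 m2 _ m4] := hM t x.
have k1 : `|P t x * phit t x| <= B * M * ind (- r) r x.
  apply: (@mul_ind_bound _ (P t) (phit t)) => // [y yr|y]; last by have [] := hM t y.
  exact: hB.
have k2 : `|P t x * phixx t x| <= B * M * ind (- r) r x.
  apply: (@mul_ind_bound _ (P t) (phixx t)) => // [y yr|y]; last by have [] := hM t y.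
  exact: hB.
have k3 : `|c * derive1 (P t) x ^+ 2 * phi t x| <= c * M * ind (- r) r x.
  by rewrite -[leRHS]mulrA; apply: norm_sqrM_le => //; exact: pr_le1.
rewrite mulrDl; apply: (le_trans (ler_normB _ _)); apply: lerD => //.
rewrite normrM -[leRHS]mulrA; apply: ler_pM => //.
  by apply: norm_half_le; exact: hW.
by rewrite mulrDl; apply: (le_trans (ler_normD _ _)); exact: lerD.
Qed.

Let mH t : measurable_fun setT (fun x => P t x * phit t x - wd t / 2 * (P t x * phixx t x + c * derive1 (P t) x ^+ 2 * phi t x)).
Proof.
have mP : measurable_fun setT (P t) by apply: continuous_measurable_fun; exact: pr_continuous.
have m1 : measurable_fun setT (phit t) by apply: continuous_measurable_fun; exact: cont_l.
have m2 : measurable_fun setT (phixx t) by apply: continuous_measurable_fun; exact: cont_l.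
have m3 : measurable_fun setT (phi t) by apply: continuous_measurable_fun; exact: cont_l.
have m4 : measurable_fun setT (derive1 (P t)) by apply: continuous_measurable_fun; exact: pr_cont.
apply: measurable_funB; first exact: measurable_funM.
apply: measurable_funM => //; apply: measurable_funD; first exact: measurable_funM.
by apply: measurable_funM => //; apply: measurable_funM => //; exact: measurable_funX.
Qed.

Let cq : continuous q.
Proof.
apply: (@cont_Int_cs _ (fun t x => P t x * phit t x - wd t / 2 * (P t x * phixx t x + c * derive1 (P t) x ^+ 2 * phi t x)) r _ _ _).1 => [x|t|t0].
- move=> t; apply: cvgB; first by apply: ctM; [exact: cP|exact: cont_r].
  apply: cvgM; first by apply: cvgM; [exact: wdc|exact: cvg_cst].
  apply: cvgD; first by apply: ctM; [exact: cP|exact: cont_r].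
  apply: cvgM; last exact: (cont_r cphi).
  by apply: cvgM; [exact: cvg_cst|exact: cdP2].
- exact: mH.
- by have [M M0 hM] := hH t0; exists M.
Qed.

(** Green's identity in [x]. It is classical for [t < e], where the variance [w e - w t] is positive
    and the solution has two derivatives. *)
Lemma ibp_xx t : s < t -> t < e ->
  Int (fun x => Phixx c (w e - w t) f x * phi t x) = Int (fun x => P t x * phixx t x).
Proof.
move=> st te.
have a0 : 0 < w e - w t by rewrite subr_gt0 wsm// ltW// (le_lt_trans s0).
have v1 x : r < `|x| -> phi t x = 0 by move=> h; rewrite vphi// h orbT.
have v2 x : r < `|x| -> phixx t x = 0.
  by move=> h; apply: (vanish_partial_x (vanish_partial_x vphi)); rewrite h orbT.
have v3 x : r < `|x| -> partial_x phi t x = 0.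
  by move=> h; apply: (vanish_partial_x vphi); rewrite h orbT.
have cxx : continuous (Phixx c (w e - w t) f) by exact: Phixx_cont.
have c1 : continuous (fun x => Phixx c (w e - w t) f x * phi t x).
  by move=> x; apply: cvgM; [exact: cxx|exact: cont_l].
have c2 : continuous (fun x => P t x * phixx t x).
  by move=> x; apply: cvgM; [exact: pr_continuous|exact: cont_l].
apply/eqP; rewrite -subr_eq0 -IntB; last 2 first.
- by apply: (cs_intg (r := r)) => // x xr; rewrite v1// mulr0.
- by apply: (cs_intg (r := r)) => // x xr; rewrite v2// mulr0.
apply/eqP; apply: (@Int_derive0 _ (fun x => derive1 (P t) x * phi t x - P t x * partial_x phi t x) _ r).
- move=> x; have h1 := is_deriveM (dPhi_xx x hf c0 a0) (test_dx t x).
  have h2 := is_deriveM (pr_is_derive x (hP t)) (test_dxx t x).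
  have h := is_deriveB h1 h2; apply: (is_derive_eq h); rewrite /GRing.scale/= /P.
  by move: (Phixx _ _ _ _) (derive1 _ x) (Phi _ _ _ _) => ? ? ?; ring.
- by move=> x; apply: cvgB; [exact: c1|exact: c2].
- by move=> x xr; rewrite v1// v3// !mulr0 subrr.
Qed.

Lemma dQ t : s < t -> t < e -> is_derive t 1 Q (q t).
Proof.
move=> st te.
have [M M0 hM] := test_bounds.
have [B B0 hB] := bP s.
have [W W0 hW] := segment_bound 0 1 wdc.
(* The bound on [Phixx] explodes at [t = e]. Within distance [d] of [t] the variance is at least
   [a0], its value at [t + d]. *)
have [d [d0 d1 d2]] : exists d : R, [/\ 0 < d, 2 * d <= t - s & 2 * d <= e - t].
  exists (Num.min (t - s) (e - t) / 2).
  have m0 : 0 < Num.min (t - s) (e - t) by rewrite lt_min !subr_gt0 st te.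
  have m1 : Num.min (t - s) (e - t) <= t - s by rewrite ge_min lexx.
  have m2 : Num.min (t - s) (e - t) <= e - t by rewrite ge_min lexx orbT.
  by move: (Num.min _ _) m0 m1 m2 => m m0 m1 m2; split; lra.
have near u : `|u - t| < d -> [/\ s < u, u < e & u <= t + d].
  by rewrite ltr_norml => /andP[u1 u2]; split; lra.
have td0 : 0 <= t + d by apply: addr_ge0; [exact: le_trans s0 (ltW st)|exact: ltW].
have tde : t + d < e.
  apply: (@lt_le_trans _ _ (t + 2 * d)); last by rewrite addrC -lerBrDr.
  by rewrite ltrD2l ltr_pMl// ltr1n.
pose a0 := w e - w (t + d).
have a00 : 0 < a0 by rewrite subr_gt0; exact: wsm.
pose A := w e - w s.
have aA u : s < u -> u < e -> u <= t + d -> a0 <= w e - w u /\ w e - w u <= A.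
  by move=> su ue ut; rewrite !lerD2l !lerN2; split; apply: wm; rewrite // ltW.
have ttd : t <= t + d by rewrite lerDl ltW.
have A0 : 0 < A by have [h1 h2] := aA t st te ttd; exact: lt_le_trans a00 (le_trans h1 h2).
have [C [k [C0 k0 hC]]] := Phi_bounds hf c0 A0.
pose dF u x := P u x * phit u x + phi u x * (- wd u * ((Phixx c (w e - w u) f x + c * derive1 (P u) x ^+ 2) / 2)).
have qE : q t = Int (dF t).
  have i1 : intg (fun x => P t x * phit t x).
    apply: (cs_intg (r := r)) => [x|x xr]; first by apply: cvgM; [exact: pr_continuous|exact: cont_l].
    by rewrite /phit (vanish_partial_t vphi) ?mulr0// xr orbT.
  have i2 : intg (fun x => P t x * phixx t x).
    apply: (cs_intg (r := r)) => [x|x xr]; first by apply: cvgM; [exact: pr_continuous|exact: cont_l].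
    by rewrite /phixx (vanish_partial_x (vanish_partial_x vphi)) ?mulr0// xr orbT.
  have i3 : intg (fun x => c * derive1 (P t) x ^+ 2 * phi t x).
    apply: (cs_intg (r := r)) => [x|x xr]; last by rewrite vphi ?mulr0// xr orbT.
    apply: cvgM; last exact: cont_l.
    by apply: cvgM; [exact: cvg_cst|apply: continuous_sqr; exact: pr_cont].
  have i4 : intg (fun x => Phixx c (w e - w t) f x * phi t x).
    apply: (cs_intg (r := r)) => [x|x xr]; last by rewrite vphi ?mulr0// xr orbT.
    apply: cvgM; last exact: cont_l.
    by apply: Phixx_cont => //; rewrite subr_gt0 wsm// ltW// (le_lt_trans s0).
  have i23 := intgD i2 i3; have i43 := intgD i4 i3.
  transitivity (Int (fun x => P t x * phit t x - wd t / 2 * (Phixx c (w e - w t) f x * phi t x + c * derive1 (P t) x ^+ 2 * phi t x))).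
    rewrite /q (IntB i1 (intgZl _ i23)) (IntB i1 (intgZl _ i43)) (IntZl _ i23) (IntZl _ i43).
    by rewrite (IntD i2 i3) (IntD i4 i3) ibp_xx.
  apply: eq_Int => x; rewrite /dF; move: (Phixx _ _ _ _) (derive1 _ x) (P t x) (wd t) => ? ? ? ?; by field.
rewrite qE.
apply: (@derive_Int _ (fun u x => P u x * phi u x) dF
  (fun x => (B * M + W * ((C * expR (k * `|r|) / a0 ^+ 2 + c) / 2) * M) * ind (- r) r x) t d d0).
- move=> u _; apply: (cs_intg (r := r)) => [x|x xr]; last by rewrite vphi ?mulr0// xr orbT.
  by apply: cvgM; [exact: pr_continuous|exact: cont_l].
- move=> u x /near[su ue ut].
  have [h1 h2] := aA u su ue ut.
  have ha : is_derive u 1 (fun u => w e - w u) (- wd u).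
    have dwu := dw (le_lt_trans s0 su) (lt_le_trans ue e1).
    have := is_deriveB (is_derive_cst (w e) u 1) dwu; move=> h; apply: (is_derive_eq h).
    by rewrite sub0r.
  have hp : is_derive (w e - w u) 1 (fun a => Phi c a f x) ((Phixx c (w e - w u) f x + c * derive1 (Phi c (w e - w u) f) x ^+ 2) / 2).
    by apply: dPhi_a => //; exact: lt_le_trans h1.
  have hc := @is_derive1_comp _ (fun a => Phi c a f x) (fun u => w e - w u) u _ _ hp ha.
  have h := is_deriveM hc (test_dt u x); apply: (is_derive_eq h).
  rewrite /GRing.scale/= /dF /P; move: (Phixx _ _ _ _) (derive1 _ x) (Phi _ _ _ _) => ? ? ?; ring.
- exact/intgZl/intg_ind.
- move=> u x /near[su ue ut].
  have [h1 h2] := aA u su ue ut.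
  have i0 := ind_ge0 (- r) r x.
  have [n1 n2 _ _] := hM u x.
  have k1 : `|P u x * phit u x| <= B * M * ind (- r) r x.
    apply: (@mul_ind_bound _ (P u) (phit u)) => // [y yr|y]; last by have [] := hM u y.
    by apply: hB => //; exact: ltW.
  rewrite mulrDl; apply: (le_trans (ler_normD _ _)); apply: lerD => //.
  rewrite mulrC; apply: (@mul_ind_bound _ (fun x => - wd u * ((Phixx c (w e - w u) f x + c * derive1 (P u) x ^+ 2) / 2)) (phi u)).
  + apply: mulr_ge0 => //; apply: divr_ge0 => //; apply: addr_ge0 => //.
    by apply: divr_ge0; [apply: mulr_ge0 => //; exact: expR_ge0|exact/exprn_ge0/ltW].
  + move=> y yr; rewrite normrM normrN; apply: ler_pM => //.
      by apply: hW; [exact: le_trans (ltW su)|exact: le_trans (ltW ue) e1].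
    apply: norm_half_le.
    apply: (le_trans (ler_normD _ _)); apply: lerD.
      apply: (le_trans (hC _ y (lt_le_trans a00 h1) h2)).
      apply: ler_pM; [by apply: mulr_ge0 => //; exact: expR_ge0|by rewrite invr_ge0 exprn_ge0// ltW// (lt_le_trans a00)| |].
        apply: ler_wpM2l => //; rewrite ler_expR; apply: ler_wpM2l => //.
        exact: le_trans (ler_norm r).
      rewrite lef_pV2 ?posrE ?exprn_gt0 ?(lt_le_trans a00)//.
      by rewrite lerXn2r ?nnegrE ?(ltW a00)// ltW// (lt_le_trans a00).
    rewrite normrM (ger0_norm c0) normrX ler_piMr// expr_le1//; exact: pr_le1.
  + by move=> y; have [] := hM u y.
Qed.

Lemma Int_piece : Int (fun t => ind s e t * q t) = Q e - Q s.
Proof. by apply: Int_FTC => //; exact: dQ. Qed.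

Lemma measurable_q : measurable_fun setT q.
Proof. by apply: continuous_measurable_fun. Qed.

End Piece.
Variable Gm : R.
Hypothesis gamb : forall t, gam t <= Gm.

Let H s es t x := psi s es t x * phit t x
  - wd t / 2 * (psi s es t x * phixx t x + gam t * derive1 (psi s es t) x ^+ 2 * phi t x).
Let qq s es t := Int (fun x => ind 0 1 t * H s es t x).

Lemma psi_bound s es : path <=%R s es ->
  exists2 B, 0 <= B & forall t x, 0 <= t -> t <= 1 -> `|x| <= r -> `|psi s es t x| <= B.
Proof.
move=> pe; have [B B0 hB] := segment_bound 0 1 (@psi_cont_t s es 0).
exists (B + `|r|); first by rewrite addr_ge0.
move=> t x t0 t1 xr; have hp := profile_psi t pe.
rewrite ger0_norm; last exact: pr_ge0.
apply: (le_trans (pr_le _ hp)); apply: lerD; last exact: le_trans (ler_norm r).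
by have := hB t t0 t1; rewrite ger0_norm//; exact: pr_ge0.
Qed.

Lemma H_bound s es : path <=%R s es -> exists2 M, 0 <= M &
  forall t x, 0 <= t -> t <= 1 -> `|H s es t x| <= M * ind (- r) r x.
Proof.
move=> pe.
have [M M0 hM] := test_bounds.
have [B B0 hB] := psi_bound pe.
have [W W0 hW] := segment_bound 0 1 wdc.
have Gm0 : 0 <= Gm by exact: le_trans (gam0 0) (gamb 0).
exists (B * M + W / 2 * (B * M + Gm * M)).
  by apply: addr_ge0; [exact: mulr_ge0|apply: mulr_ge0; [exact: divr_ge0|apply: addr_ge0; exact: mulr_ge0]].
move=> t x t0 t1; have hp := profile_psi t pe.
have i0 := ind_ge0 (- r) r x.
have [m1 m2 _ m4] := hM t x.
have k1 : `|psi s es t x * phit t x| <= B * M * ind (- r) r x.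
  apply: (@mul_ind_bound _ (psi s es t) (phit t)) => // [y yr|y]; last by have [] := hM t y.
  exact: hB.
have k2 : `|psi s es t x * phixx t x| <= B * M * ind (- r) r x.
  apply: (@mul_ind_bound _ (psi s es t) (phixx t)) => // [y yr|y]; last by have [] := hM t y.
  exact: hB.
have k3 : `|gam t * derive1 (psi s es t) x ^+ 2 * phi t x| <= Gm * M * ind (- r) r x.
  apply: (@le_trans _ _ (gam t * (M * ind (- r) r x))).
    by apply: norm_sqrM_le => //; exact: pr_le1.
  by rewrite -mulrA; apply: ler_wpM2r => //; exact: mulr_ge0.
rewrite /H mulrDl; apply: (le_trans (ler_normB _ _)); apply: lerD => //.
rewrite normrM -[leRHS]mulrA; apply: ler_pM => //.
  by apply: norm_half_le; exact: hW.
by rewrite mulrDl; apply: (le_trans (ler_normD _ _)); exact: lerD.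
Qed.

Lemma H_meas2 s es : path <=%R s es -> meas2 (H s es).
Proof.
move=> pe.
have mp := psi_meas2 pe; have md := dpsi_meas2 pe.
have m1 := cont_meas2 cphi; have m2 := cont_meas2 cphit; have m3 := cont_meas2 cphixx.
have mg : meas2 (fun t x => gam t) by exact: (measurableT_comp mgam measurable_fst).
have mw : meas2 (fun t x => wd t) by exact: (measurableT_comp (continuous_measurable_fun wdc) measurable_fst).
apply: measurable_funB; first exact: measurable_funM mp m2.
apply: measurable_funM; first exact: measurable_funM.
apply: measurable_funD; first exact: measurable_funM mp m3.
apply: measurable_funM => //; apply: measurable_funM => //; exact: measurable_funX.
Qed.

Lemma intg_qq s es : path <=%R s es -> intg (qq s es).
Proof.
move=> pe; have [M M0 hM] := H_bound pe.
apply: (@intg_IntF _ (fun t x => ind 0 1 t * H s es t x) (fun t => M * ind 0 1 t) (ind (- r) r)).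
- have mi : meas2 (fun t x => ind 0 1 t) by exact: (measurableT_comp (measurable_ind 0 1) measurable_fst).
  exact: measurable_funM mi (H_meas2 pe).
- exact/intgZl/intg_ind.
- exact: intg_ind.
- move=> t x; rewrite normrM ger0_norm ?ind_ge0//.
  have [/andP[t0 t1]|] := boolP (0 <= t <= 1); last first.
    by rewrite negb_and -!ltNge => h; rewrite ind0// !mul0r mulr0 mul0r.
  by rewrite ind1// mul1r mulr1; exact: hM.
Qed.

Lemma qqE s es t : 0 <= t -> t <= 1 -> qq s es t = Int (H s es t).
Proof. by move=> t0 t1; apply: eq_Int => x; rewrite ind1// mul1r. Qed.

Let Q s es t := Int (fun x => psi s es t x * phi t x).

(** On the interior of a level the integrand is that of [Int_piece]; the breakpoints are negligible
    and the boundary terms match because [psi] is continuous in time. *)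
Lemma Int_levels s es : 0 <= s -> path <=%R s es -> last s es <= 1 -> stepf s es ->
  Int (fun t => ind s (last s es) t * qq s es t) = Q s es (last s es) - Q s es s.
Proof.
elim: es s => [|e es IH] s s0.
  move=> pe _ _; rewrite subrr.
  rewrite (@Int_ae_ind _ (qq s [::]) (fun=> 0)) => //.
  - by under eq_Int do rewrite mulr0; rewrite /Int Rintegral_cst// mul0r.
  - exact: intg_measurable (intg_qq pe).
  - by move=> t /lt_trans h /h; rewrite ltxx.
move=> pse; have /= /andP[se pe] := pse; move=> l1 [gs sf].
have ee : e <= last e es by exact: path_le_last.
have e1 : e <= 1 by exact: le_trans l1.
have e0 : 0 <= e by exact: le_trans se.
have mq := intg_measurable (intg_qq pse).
have iq : intg (fun t => ind s (last e es) t * qq s (e :: es) t).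
  apply: (@intg_le _ _ (fun t => `|qq s (e :: es) t|)); last exact/intg_norm/intg_qq.
    by apply: measurable_funM => //; exact: measurable_ind.
  by move=> t; rewrite normrM ger0_norm ?ind_ge0// ler_piMl// ind_le1.
rewrite (ind_split se ee iq).
have hF := profile_pval w e es gam0 hg.
have Ee : psi s (e :: es) e = pval gam w g e es by rewrite psi_left// subrr Phi0.
have Es : psi s (e :: es) s = Phi (gam s) (w e - w s) (pval gam w g e es) by rewrite psi_left.
have El : psi s (e :: es) (last e es) = psi e es (last e es) by rewrite psi_right.
have -> : Int (fun t => ind s e t * qq s (e :: es) t) = Q s (e :: es) e - Q s (e :: es) s.
  have mqp := measurable_q e (gam0 s) hF.
  rewrite (Int_ae_ind mq mqp).
    by rewrite (Int_piece (gam0 s) hF s0 se e1) /Q Ee Es subrr Phi0.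
  move=> t st te; rewrite qqE; last 2 first.
  - exact: le_trans (ltW st).
  - exact: le_trans (ltW te) e1.
  apply: eq_Int => x; rewrite /H psi_left//; last exact: ltW.
  by rewrite (gs t (ltW st) te).
have -> : Int (fun t => ind e (last e es) t * qq s (e :: es) t) = Q e es (last e es) - Q e es e.
  transitivity (Int (fun t => ind e (last e es) t * qq e es t)); last exact: IH.
  apply: Int_ae_ind; [exact: mq|exact: intg_measurable (intg_qq pe)|].
  move=> t et _; apply: eq_Int => x; rewrite /H psi_right//; exact: ltW.
rewrite /Q El (psi_start pe) Ee; move: (Int _) (Int _) (Int _) => ? ? ?; ring.
Qed.

End Test.

Lemma psi_weak (c : nat -> R) (beta Gm : R) (alpha : R -> R) es :
  (forall t, gam t <= Gm) ->
  (forall t, 0 <= t -> t <= 1 -> beta * alpha t = gam t) ->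
  (forall t, 0 <= t -> t <= 1 -> xi'' c t = wd t) ->
  (forall x, ln (cosh (beta * x)) / beta = g x) ->
  path <=%R 0 es -> last 0 es = 1 -> stepf 0 es ->
  weak_solution c beta alpha (psi 0 es).
Proof.
move=> gamb alphaE xiE gE pe l1 sf.
have cpsi := psi_cont2 pe.
have mpsi := psi_meas2 pe.
have mdpsi := dpsi_meas2 pe.
have dle1 t x : `|derive1 (psi 0 es t) x| <= 1 by have h := profile_psi t pe; exact: (pr_le1 h).
split; first exact: continuous_subspaceT.
exists (fun t x => derive1 (psi 0 es t) x); split.
  split; first exact: measurable_funTS.
    by exists 1; apply: aeW => z _; exact: dle1.
  move=> phi tphi; have sphi := tphi.1; have [r vphi] := test_vanish tphi.
  have [M M0 hM] := test_bounds sphi vphi.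
  have [B B0 hB] := psi_bound r pe.
  have [cphi _ _] := sphi [::]; have [cphix _ _] := sphi [:: false].
  pose G1 (z : R * R) := psi 0 es z.1 z.2 * partial_x phi z.1 z.2.
  pose G2 (z : R * R) := derive1 (psi 0 es z.1) z.2 * phi z.1 z.2.
  have m1 : measurable_fun (strip R : set (measurableTypeR R * measurableTypeR R)) G1.
    by apply: measurable_funTS; exact: measurable_funM mpsi (cont_meas2 cphix).
  have m2 : measurable_fun (strip R : set (measurableTypeR R * measurableTypeR R)) G2.
    by apply: measurable_funTS; exact: measurable_funM mdpsi (cont_meas2 cphi).
  have i0 K : 0 <= K -> forall t : R, 0 <= K * ind 0 1 t.
    by move=> K0 t; apply: mulr_ge0 => //; exact: ind_ge0.
  have b1 t x : 0 <= t -> t <= 1 -> `|G1 (t, x)| <= (B * M * ind 0 1 t) * ind (- r) r x.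
    move=> t0 t1; rewrite (@ind1 _ 0 1)// mulr1 /G1/=.
    apply: (@mul_ind_bound _ (psi 0 es t) (partial_x phi t)) => // [y yr|y]; last by have [] := hM t y.
    exact: hB.
  have b2 t x : 0 <= t -> t <= 1 -> `|G2 (t, x)| <= (1 * M * ind 0 1 t) * ind (- r) r x.
    move=> t0 t1; rewrite (@ind1 _ 0 1)// mulr1 /G2/=.
    by apply: (@mul_ind_bound _ (derive1 (psi 0 es t)) (phi t)) => // y; have [] := hM t y.
  have iI K : intg (fun t => K * ind 0 1 t) by exact/intgZl/intg_ind.
  have ir := @intg_ind R (- r) r.
  have r0 := @ind_ge0 R (- r) r.
  rewrite (Rintegral_strip m1 (iI _) ir b1 (i0 _ (mulr_ge0 B0 M0)) r0).
  rewrite (Rintegral_strip m2 (iI _) ir b2 (i0 _ (mulr_ge0 ler01 M0)) r0).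
  rewrite -IntN; last exact: intg_strip m2 (iI _) ir b2 (i0 _ (mulr_ge0 ler01 M0)) r0.
  apply: eq_Int => t; rewrite -mulrN; congr (_ * _).
  have hp := profile_psi t pe.
  have v1 x : r < `|x| -> phi t x = 0 by move=> h; rewrite vphi// h orbT.
  have v3 x : r < `|x| -> partial_x phi t x = 0.
    by move=> h; apply: (vanish_partial_x vphi); rewrite h orbT.
  have c1 : continuous (fun x => G1 (t, x)).
    by move=> x; apply: cvgM; [exact: pr_continuous|exact: cont_l].
  have c2 : continuous (fun x => G2 (t, x)).
    by move=> x; apply: cvgM; [exact: pr_cont|exact: cont_l].
  apply/eqP; rewrite -subr_eq0 opprK -IntD; last 2 first.
  - by apply: (cs_intg (r := r)) => // x xr; rewrite /G1/= v3// mulr0.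
  - by apply: (cs_intg (r := r)) => // x xr; rewrite /G2/= v1// mulr0.
  apply/eqP; apply: (@Int_derive0 _ (fun x => psi 0 es t x * phi t x) _ r).
  - move=> x; have h := is_deriveM (pr_is_derive x hp) (test_dx sphi t x).
    by apply: (is_derive_eq h); rewrite /GRing.scale/= /G1 /G2/= [phi t x * _]mulrC.
  - by move=> x; apply: cvgD; [exact: c1|exact: c2].
  - by move=> x xr; rewrite v1// mulr0.
move=> phi tphi; have sphi := tphi.1; have [r vphi] := test_vanish tphi.
have [cphi _ _] := sphi [::]; have [cphit _ _] := sphi [:: true]; have [cphixx _ _] := sphi [:: false; false].
have phi0 x : phi 0 x = 0.
  by have [_ [K [_ KA K0]]] := tphi; apply: K0 => /KA /=; rewrite ltxx.
have [M M0 hM] := H_bound sphi vphi gamb pe.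
pose G (z : R * R) := - (psi 0 es z.1 z.2 * partial_t phi z.1 z.2) + xi'' c z.1 / 2 *
  (psi 0 es z.1 z.2 * partial_x (partial_x phi) z.1 z.2 + beta * alpha z.1 * (derive1 (psi 0 es z.1) z.2) ^+ 2 * phi z.1 z.2).
pose H (z : R * R) := psi 0 es z.1 z.2 * partial_t phi z.1 z.2
  - wd z.1 / 2 * (psi 0 es z.1 z.2 * partial_x (partial_x phi) z.1 z.2 + gam z.1 * (derive1 (psi 0 es z.1) z.2) ^+ 2 * phi z.1 z.2).
have GE t x : 0 <= t -> t <= 1 -> G (t, x) = - H (t, x).
  by move=> t0 t1; rewrite /G /H/= xiE// alphaE// opprB addrC.
have mH : measurable_fun (strip R : set (measurableTypeR R * measurableTypeR R)) H.
  by apply: measurable_funTS; exact: H_meas2.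
have mG : measurable_fun (strip R : set (measurableTypeR R * measurableTypeR R)) G.
  apply: (@eq_measurable_fun _ _ _ _ _ (fun z => - H z)); last exact: measurable_funN.
  by move=> [t x]; rewrite inE => -[/= /andP[t0 t1]]; rewrite GE.
have bG t x : 0 <= t -> t <= 1 -> `|G (t, x)| <= (M * ind 0 1 t) * ind (- r) r x.
  by move=> t0 t1; rewrite GE// normrN ind1// mulr1; exact: hM.
have iI : intg (fun t => M * ind 0 1 t) by exact/intgZl/intg_ind.
have i0 : forall t : R, 0 <= M * ind 0 1 t.
  by move=> t; apply: mulr_ge0 => //; exact: ind_ge0.
have -> : \int[(mu \x mu)%E]_(z in strip R) G z = - (Int (fun t => ind 0 1 t * Int (fun x => ind 0 1 t * H (t, x)))).
  rewrite (Rintegral_strip mG iI (@intg_ind R (- r) r) bG i0 (@ind_ge0 R (- r) r)).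
  rewrite -IntN.
    apply: eq_Int => t; have [/andP[t0 t1]|] := boolP (0 <= t <= 1); last first.
      by rewrite negb_and -!ltNge => h; rewrite ind0// !mul0r oppr0.
    rewrite ind1// !mul1r -IntN; first by apply: eq_Int => x; rewrite mul1r GE.
    apply: intgZl.
    apply: (@intg_le _ _ (fun x => M * ind (- r) r x)); [|by move=> x; exact: hM|exact/intgZl/intg_ind].
    have hm : meas2 (fun t x => H (t, x)) by exact: H_meas2.
    exact: (@meas2_l _ _ hm t).
  have iq := intg_qq sphi vphi gamb pe.
  apply: (@intg_le _ _ (fun t => `|Int (fun x => ind 0 1 t * H (t, x))|)); last exact: intg_norm iq.
    by apply: measurable_funM; [exact: measurable_ind|exact: intg_measurable iq].
  by move=> t; rewrite normrM ger0_norm ?ind_ge0// ler_piMl// ind_le1.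
have l01 : last 0 es <= 1 by rewrite l1.
have := Int_levels sphi vphi gamb (lexx 0) pe l01 sf; rewrite l1 => ->.
rewrite psi_end ?l1//.
rewrite (_ : Int (fun x => psi 0 es 0 x * phi 0 x) = 0); last first.
  by under eq_Int do rewrite phi0 mulr0; rewrite /Int Rintegral_cst// mul0r.
rewrite subr0; apply/eqP; rewrite addrC subr_eq0; apply/eqP; apply: eq_Int => x.
by rewrite gE mulrC.
Qed.

End Psi.

(** * Smooth cutoffs and mollifiers *)

Section Smooth1.
Context {R : realType}.
Implicit Types (f g a b : R -> R) (x y k l : R) (n m i j : nat).

Fixpoint Cn n f : Prop :=
  if n is n'.+1 then (forall x, derivable f x 1) /\ Cn n' (derive1 f) else True.

Definition smooth1 f := forall n, Cn n f.

Lemma derive1_val f x l : is_derive x 1 f l -> derive1 f x = l.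
Proof. by move=> h; rewrite derive1E derive_val. Qed.

Lemma CnS n f : Cn n.+1 f -> Cn n f.
Proof. by elim: n f => // n IH f [df /IH cf]; split. Qed.

Lemma Cn_eq n f g : f =1 g -> Cn n f -> Cn n g.
Proof. by move=> /funext ->. Qed.

Lemma Cn_cst n c : Cn n (fun=> c).
Proof.
elim: n c => //= n IH c; split; first by move=> x; exact: derivable_cst.
by apply: Cn_eq (IH 0) => x; rewrite derive1_cst.
Qed.

Lemma CnD n f g : Cn n f -> Cn n g -> Cn n (fun x => f x + g x).
Proof.
elim: n f g => //= n IH f g [df cf] [dg cg]; split; first by move=> x; exact: derivableD.
apply: Cn_eq (IH _ _ cf cg) => x; rewrite !derive1E.
by rewrite (@deriveD _ _ _ f g).
Qed.

Lemma CnM n f g : Cn n f -> Cn n g -> Cn n (fun x => f x * g x).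
Proof.
elim: n f g => // n IH f g hf hg; have cf := CnS hf; have cg := CnS hg.
have [df cf'] := hf; have [dg cg'] := hg.
split; first by move=> x; exact: derivableM.
apply: Cn_eq (CnD (IH _ _ cf cg') (IH _ _ cg cf')) => x; rewrite !derive1E.
by rewrite (@deriveM _ _ f g).
Qed.

Lemma CnZ n k f : Cn n f -> Cn n (fun x => k * f x).
Proof. by move=> cf; apply: CnM => //; exact: Cn_cst. Qed.

Lemma CnB n f g : Cn n f -> Cn n g -> Cn n (fun x => f x - g x).
Proof.
move=> cf cg; apply: Cn_eq (CnD cf (CnZ (-1) cg)) => x; by rewrite mulN1r.
Qed.

Lemma Cn_affine n k l f : Cn n f -> Cn n (fun x => f (k * x + l)).
Proof.
elim: n f => // n IH f [df cf].
have d x : is_derive x 1 (fun x => f (k * x + l)) (k * derive1 f (k * x + l)).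
  have h1 : is_derive (k * x + l) 1 f (derive1 f (k * x + l)) by rewrite derive1E; exact/derivableP.
  have h2 : is_derive x 1 (fun x : R => k * x + l) k.
    by apply: is_derive_eq; rewrite addr0 /GRing.scale/= mulr1.
  by have := @is_derive1_comp _ f (fun x => k * x + l) x _ _ h1 h2; rewrite mulrC.
split; first by move=> x; have [] := d x.
by apply: Cn_eq (CnZ k (IH _ cf)) => x; exact/esym/derive1_val.
Qed.

Lemma CnV n f : (forall x, f x != 0) -> Cn n f -> Cn n (fun x => (f x)^-1).
Proof.
move=> f0; elim: n => // n IH hf; have [df cf] := hf; have iv := IH (CnS hf).
split; first by move=> x; exact: derivableV.
apply: Cn_eq (CnZ (-1) (CnM cf (CnM iv iv))) => x; rewrite !derive1E.
rewrite (@deriveV _ _ f)// /GRing.scale/= -exprVn expr2 mulN1r mulNr; congr (- _).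
by rewrite mulrC.
Qed.

Lemma smooth1_derive f : smooth1 f -> smooth1 (derive1 f).
Proof. by move=> sf n; have [] := sf n.+1. Qed.

Lemma smooth1_is_derive f x : smooth1 f -> is_derive x 1 f (derive1 f x).
Proof. by move=> sf; rewrite derive1E; apply: derivableP; have [] := sf 1%N. Qed.

Lemma smooth1_cont f : smooth1 f -> continuous f.
Proof. by move=> sf x; apply: differentiable_continuous; apply/derivable1_diffP; have [] := sf 1%N. Qed.

(** The flat functions [x^(-m) * exp (- 1 / x)]. Allowing all powers [m] makes the family stable
    under differentiation, so that smoothness is an induction on the order. *)
Definition eh m x : R := if 0 < x then x^-1 ^+ m * expR (- x^-1) else 0.

Lemma eh_ge0 m x : 0 <= eh m x.
Proof.
by rewrite /eh; case: ltP => // x0; rewrite mulr_ge0 ?expR_ge0// exprn_ge0// invr_ge0 ltW.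
Qed.

Lemma eh_gt0 m x : 0 < x -> 0 < eh m x.
Proof. by move=> x0; rewrite /eh x0 mulr_gt0 ?expR_gt0// exprn_gt0// invr_gt0. Qed.

Lemma eh_le0 m x : x <= 0 -> eh m x = 0.
Proof. by rewrite /eh leNgt => /negbTE ->. Qed.

(** From [exp y >= y^(m+2) / (m+2)!] at [y = 1 / x]. A quadratic bound at 0 is what makes the
    derivative there exist and vanish. *)
Lemma eh_bound m x : 0 < x -> eh m x <= m.+2`!%:R * x ^+ 2.
Proof.
move=> x0; rewrite /eh x0; have y0 : 0 < x^-1 by rewrite invr_gt0.
have := expR_ge1Dxn m.+1 (ltW y0).
set y := x^-1 in y0 *; have -> : x = y^-1 by rewrite invrK.
move=> h; rewrite expRN ler_pdivrMr ?expR_gt0//.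
have f0 : 0 < m.+2`!%:R :> R by rewrite ltr0n fact_gt0.
have h2 : y ^+ m.+2 <= m.+2`!%:R * expR y.
  rewrite mulrC -ler_pdivrMr//; apply: le_trans h; by rewrite lerDr.
apply: (@le_trans _ _ ((m.+2`!%:R * expR y) / y ^+ 2)).
  by rewrite ler_pdivlMr ?exprn_gt0// -exprD addn2.
by rewrite le_eqVlt; apply/orP; left; apply/eqP; move: (expR y) => E; field; rewrite gt_eqF.
Qed.

Lemma deh m x : is_derive x 1 (eh m) (eh m.+2 x - m%:R * eh m.+1 x).
Proof.
case: (ltgtP x 0) => [x0|x0|->].
- rewrite !eh_le0 ?(ltW x0)// mulr0 subr0.
  have d0 : is_derive x 1 (fun=> 0 : R) 0 by exact: is_derive_cst.
  move: d0; apply: near_eq_is_derive.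
  have : \forall y \near x, y < 0 by exact: lt_nbhsl.
  by apply: filterS => y y0; rewrite eh_le0// ltW.
- have xn0 : x != 0 by rewrite gt_eqF.
  have hi : is_derive x 1 (fun y : R => y^-1) (- x^-1 ^+ 2).
    have h := is_deriveV xn0 (is_derive_id x 1).
    by apply: (is_derive_eq h); rewrite /GRing.scale/= mulr1 exprVn.
  have hX := is_deriveX m hi; rewrite exprfctE in hX.
  have hE := @is_derive1_comp _ expR (fun y : R => - y^-1) x _ _ (is_derive_expR (- x^-1)) (is_deriveN hi).
  have h := is_deriveM hX hE.
  have d : is_derive x 1 (fun y : R => y^-1 ^+ m * expR (- y^-1)) (eh m.+2 x - m%:R * eh m.+1 x).
    have alg (E y : R) : y ^+ m * (E * - - y ^+ 2) + E * (1 * m%:R * y ^+ m.-1 * - y ^+ 2) =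
        y ^+ m.+2 * E - 1 * m%:R * (y ^+ m.+1 * E).
      by case: (m) => [|p]; rewrite ?mulr0 ?mul0r /= !exprS ?expr0; ring.
    apply: (is_derive_eq h); rewrite /GRing.scale/= /eh x0 -mulr_natr.
    exact: alg.
  move: d; apply: near_eq_is_derive.
  have : \forall y \near x, 0 < y by exact: lt_nbhsr.
  by apply: filterS => y y0; rewrite /eh y0.
- rewrite !eh_le0// mulr0 subr0.
  have hl : h^-1 *: (eh m (h + 0) - eh m 0) @[h --> 0^'] --> (0 : R).
    rewrite (eh_le0 m (lexx 0)).
    have C0 : 0 <= m.+2`!%:R :> R by exact: ler0n.
    apply: (@squeeze_cvgr _ _ _ _ (fun h => - (m.+2`!%:R * `|h|)) (fun h => m.+2`!%:R * `|h|)).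
    - near=> h; rewrite -ler_norml addr0 subr0 /GRing.scale/= normrM normfV.
      have h0 : 0 < `|h| by rewrite normr_gt0; near: h; exact: nbhs_dnbhs_neq.
      rewrite mulrC ler_pdivrMr// -mulrA -expr2 real_normK ?num_real//.
      rewrite ger0_norm ?eh_ge0//; case: (ltP 0 h) => [/(eh_bound m)//|/(eh_le0 m) ->].
      by rewrite mulr_ge0// sqr_ge0.
    - rewrite -[X in _ --> X]oppr0; apply: cvgN; rewrite -[X in _ --> X](mulr0 (m.+2`!%:R)).
      apply: cvgM; first exact: cvg_cst.
      rewrite -[X in _ --> X](@normr0 _ R); apply: cvg_norm; exact: nbhs_dnbhs.
    - rewrite -[X in _ --> X](mulr0 (m.+2`!%:R)); apply: cvgM; first exact: cvg_cst.
      rewrite -[X in _ --> X](@normr0 _ R); apply: cvg_norm; exact: nbhs_dnbhs.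
  have dd : derivable (eh m) 0 1.
    apply/cvg_ex; exists 0; move: hl; apply: cvg_trans; apply: near_eq_cvg.
    by near=> h; rewrite /= [h *: _]mulr1.
  split => //; apply: cvg_lim => //; move: hl; apply: cvg_trans; apply: near_eq_cvg.
  by near=> h; rewrite /= [h *: _]mulr1.
Unshelve. all: by end_near. Qed.

Lemma smooth1_eh m : smooth1 (eh m).
Proof.
move=> n; elim: n m => // n IH m; split; first by move=> x; have [] := deh m x.
apply: Cn_eq (CnB (IH m.+2) (CnZ m%:R (IH m.+1))) => x.
by have ? := deh m x; rewrite derive1E derive_val.
Qed.

Lemma eh_denom_gt0 x : 0 < eh 0 x + eh 0 (1 - x).
Proof.
have [x0|x0] := ltP 0 x; first by rewrite ltr_pwDl ?eh_gt0 ?eh_ge0.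
by rewrite ltr_wpDl ?eh_ge0// eh_gt0// subr_gt0 (le_lt_trans x0).
Qed.

Definition Sstep x : R := eh 0 x / (eh 0 x + eh 0 (1 - x)).

Lemma smooth1_Sstep : smooth1 Sstep.
Proof.
move=> n; apply: CnM; first exact: smooth1_eh.
apply: CnV => [x|]; first by rewrite gt_eqF// eh_denom_gt0.
apply: CnD; first exact: smooth1_eh.
apply: Cn_eq (Cn_affine (-1) 1 (smooth1_eh 0 n)) => x; by rewrite mulN1r addrC.
Qed.

Lemma Sstep0 x : x <= 0 -> Sstep x = 0.
Proof. by move=> x0; rewrite /Sstep eh_le0// mul0r. Qed.

Lemma Sstep1 x : 1 <= x -> Sstep x = 1.
Proof.
move=> x1; rewrite /Sstep (@eh_le0 _ (1 - x)) ?subr_le0// addr0 divff// gt_eqF// eh_gt0//.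
exact: lt_le_trans x1.
Qed.

Lemma Sstep_norm x : `|Sstep x| <= 1.
Proof.
rewrite ger0_norm; last by rewrite divr_ge0 ?eh_ge0// ltW// eh_denom_gt0.
by rewrite ler_pdivrMr ?eh_denom_gt0// mul1r lerDl eh_ge0.
Qed.

(** A smooth function of mass 1 supported in [[0, 1]]. The constants below contain its L^1 norm
    [norm1 rho] in place of its mass. *)
Definition rho : R -> R := derive1 Sstep.

Lemma smooth1_rho : smooth1 rho.
Proof. exact/smooth1_derive/smooth1_Sstep. Qed.

Lemma derive1_vanish f r1 r2 : (forall x, (x < r1) || (r2 < x) -> f x = 0) ->
  forall x, (x < r1) || (r2 < x) -> derive1 f x = 0.
Proof.
move=> f0 x /orP[h|h]; apply: derive1_near0.
  have : \forall y \near x, y < r1 by exact: lt_nbhsl.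
  by apply: filterS => y yr; rewrite f0// yr.
have : \forall y \near x, r2 < y by exact: lt_nbhsr.
by apply: filterS => y yr; rewrite f0// yr orbT.
Qed.

Lemma rho_vanish x : (x < 0) || (1 < x) -> rho x = 0.
Proof.
move=> /orP[h|h]; rewrite /rho.
  apply: derive1_near0; have : \forall y \near x, y < 0 by exact: lt_nbhsl.
  by apply: filterS => y yr; rewrite Sstep0// ltW.
have d : is_derive x 1 Sstep 0.
  have d0 : is_derive x 1 (fun=> 1 : R) 0 by exact: is_derive_cst.
  move: d0; apply: near_eq_is_derive.
  have : \forall y \near x, 1 < y by exact: lt_nbhsr.
  by apply: filterS => y yr; rewrite Sstep1// ltW.
by rewrite derive1E derive_val.
Qed.

Lemma Int_rho : Int rho = 1.
Proof.
have c := smooth1_cont smooth1_rho.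
transitivity (Int (fun y => ind 0 1 y * rho y)).
  apply: eq_Int => y; have [/andP[h1 h2]|] := boolP (0 <= y <= 1); first by rewrite ind1// mul1r.
  by rewrite negb_and -!ltNge => h; rewrite ind0// mul0r rho_vanish.
rewrite (@Int_FTC _ rho Sstep 0 1 ler01 c (smooth1_cont smooth1_Sstep) (fun t _ _ => smooth1_is_derive t smooth1_Sstep)).
by rewrite Sstep1// Sstep0// subr0.
Qed.

Definition Dn i f : R -> R := iter i (fun g : R -> R => (derive1 g : R -> R)) f.

Lemma smooth1_Dn i f : smooth1 f -> smooth1 (Dn i f).
Proof. by move=> sf; elim: i => //= i IH; exact: smooth1_derive. Qed.

Lemma tensor_t a b t x : smooth1 a -> partial_t (fun t x => a t * b x) t x = derive1 a t * b x.
Proof.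
move=> sa; apply: derive1_val.
have h := is_deriveM (smooth1_is_derive t sa) (is_derive_cst (b x) t 1).
by apply: (is_derive_eq h); rewrite /GRing.scale/= mulr0 add0r mulrC.
Qed.

Lemma tensor_x a b t x : smooth1 b -> partial_x (fun t x => a t * b x) t x = a t * derive1 b x.
Proof.
move=> sb; apply: derive1_val.
have h := is_deriveM (is_derive_cst (a t) x 1) (smooth1_is_derive x sb).
by apply: (is_derive_eq h); rewrite /GRing.scale/= mulr0 addr0.
Qed.

Lemma tensor_iter a b w : smooth1 a -> smooth1 b ->
  exists i j, iter_partial w (fun t x => a t * b x) = (fun t x => Dn i a t * Dn j b x).
Proof.
move=> sa sb; elim: w => [|d w [i [j IH]]]; first by exists 0%N, 0%N.
rewrite /= IH; case: d; [exists i.+1, j|exists i, j.+1]; apply/funext => t; apply/funext => x.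
  by rewrite tensor_t//; exact: smooth1_Dn.
by rewrite tensor_x//; exact: smooth1_Dn.
Qed.

Lemma tensor_smooth2 a b : smooth1 a -> smooth1 b -> smooth2 (fun t x => a t * b x).
Proof.
move=> sa sb w; have [i [j ->]] := tensor_iter w sa sb.
have sa' := smooth1_Dn i sa; have sb' := smooth1_Dn j sb.
split.
- move=> z; apply: cvgM.
    by apply: (@continuous_comp _ _ _ fst (Dn i a)); [exact: cvg_fst|exact: smooth1_cont].
  by apply: (@continuous_comp _ _ _ snd (Dn j b)); [exact: cvg_snd|exact: smooth1_cont].
- by move=> t x; apply: derivableM; [have [] := sa' 1%N|exact: derivable_cst].
- by move=> t x; apply: derivableM; [exact: derivable_cst|have [] := sb' 1%N].
Qed.

(** Products are the test functions that the uniqueness proof feeds into the weak formulation: the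
    factor in time becomes a cutoff, the factor in space a mollifier. *)
Lemma tensor_test (A : set (R * R)) a b (a1 a2 b1 b2 : R) : smooth1 a -> smooth1 b ->
  (forall t, (t < a1) || (a2 < t) -> a t = 0) -> (forall x, (x < b1) || (b2 < x) -> b x = 0) ->
  (forall t x, a1 <= t -> t <= a2 -> A (t, x)) ->
  test_function A (fun t x => a t * b x).
Proof.
move=> sa sb va vb hA; split; first exact: tensor_smooth2.
exists (`[a1, a2]%classic `*` `[b1, b2]%classic); split.
- by apply: compact_setX; exact: segment_compact.
- by move=> [t x] [/= + _]; rewrite in_itv/= => /andP[h1 h2]; exact: hA.
- move=> t x h; have [ht|ht] := boolP ((t < a1) || (a2 < t)); first by rewrite va// mul0r.
  have [hx|hx] := boolP ((x < b1) || (b2 < x)); first by rewrite vb// mulr0.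
  exfalso; apply: h; split => /=; rewrite in_itv/=.
    by move: ht; rewrite negb_or -!leNgt.
  by move: hx; rewrite negb_or -!leNgt.
Qed.

End Smooth1.

Section DCT.
Context {R : realType}.
Notation mu := (@lebesgue_measure R).

Lemma Int_dct (f_ : nat -> R -> R) (f g : R -> R) :
  (forall n, measurable_fun setT (f_ n)) -> intg g ->
  (forall n x, `|f_ n x| <= g x) -> (forall x, f_ n x @[n --> \oo] --> f x) ->
  intg f /\ Int (f_ n) @[n --> \oo] --> Int f.
Proof.
move=> mf ig fg cf.
have mff : measurable_fun setT f by apply: (@measurable_fun_cvg _ _ _ _ f_).
have i_ n : intg (f_ n) by exact: intg_le (mf n) (fg n) ig.
have [] := @dominated_convergence _ _ R mu setT measurableT (fun n x => (f_ n x)%:E) (EFin \o f) (EFin \o g).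
- by move=> n; apply/measurable_EFinP; exact: mf.
- by apply/measurable_EFinP; exact: mff.
- apply: aeW => x _; apply: cvg_EFin; [by apply: nearW => n|exact: cf].
- exact: ig.
- by apply: aeW => x n _; rewrite /= lee_fin; exact: fg.
move=> h1 _ h3; split => //.
by apply: fine_cvg; rewrite -(@IntE _ f).
Qed.

End DCT.

Section AlmostEverywhere.
Context d (T : measurableType d) (R : realType) (m : {measure set T -> \bar R}).

Lemma ae_imply (P Q : T -> Prop) : (forall x, P x -> Q x) -> {ae m, forall x, P x} -> {ae m, forall x, Q x}.
Proof. by move=> PQ; apply: filterS. Qed.

Lemma ae_forall_nat (P : nat -> T -> Prop) : (forall n, {ae m, forall x, P n x}) -> {ae m, forall x, forall n, P n x}.
Proof.
move=> h; apply: (@negligibleS _ _ _ m (\bigcup_n (~` P n))); last exact: negligible_bigcup.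
by move=> x /= hx; have /existsNP[n hn] := hx; exists n.
Qed.

Lemma ae_and (P Q : T -> Prop) : {ae m, forall x, P x} -> {ae m, forall x, Q x} -> {ae m, forall x, P x /\ Q x}.
Proof. by move=> hP hQ; apply: filterI. Qed.

End AlmostEverywhere.

(** * Localisation in time of tested identities *)

Section TimeLimits.
Context {R : realType}.
Notation mu := (@lebesgue_measure R).
Implicit Types (a : R -> R) (s t x y : R) (n : nat).

Lemma smooth1_scale_shift f (k t : R) : smooth1 f -> smooth1 (fun x => f (k * (x - t))).
Proof.
by move=> sf n; apply: Cn_eq (Cn_affine k (- (k * t)) (sf n)) => x; rewrite mulrBr.
Qed.

Definition acut n s t x : R := Sstep (n.+1%:R * (x - s)) - Sstep (n.+1%:R * (x - t)).

Lemma smooth1_acut n s t : smooth1 (acut n s t).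
Proof.
move=> m; apply: CnB; exact: smooth1_scale_shift smooth1_Sstep _.
Qed.

Lemma derive1_acut n s t x :
  derive1 (acut n s t) x = n.+1%:R * rho (n.+1%:R * (x - s)) - n.+1%:R * rho (n.+1%:R * (x - t)).
Proof.
have d (v : R) : is_derive x 1 (fun x => Sstep (n.+1%:R * (x - v))) (n.+1%:R * rho (n.+1%:R * (x - v))).
  have h1 := smooth1_is_derive (n.+1%:R * (x - v)) smooth1_Sstep.
  have h2 : is_derive x 1 (fun x : R => n.+1%:R * (x - v)) n.+1%:R.
    by apply: is_derive_eq; rewrite oppr0 addr0 /GRing.scale/= mulr1.
  by have := @is_derive1_comp _ Sstep _ x _ _ h1 h2; rewrite mulrC.
by apply: derive1_val; exact: is_deriveB.
Qed.

Lemma acut_vanish n s t x : s <= t -> (x < s) || (t + 1 < x) -> acut n s t x = 0.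
Proof.
move=> st /orP[xs|xt]; rewrite /acut.
  by rewrite !Sstep0 ?subrr// nmulr_lle0 ?subr_lt0 ?(lt_le_trans xs)// ?ltW// ltr0n.
have n1 : 1 <= n.+1%:R :> R by rewrite ler1n.
have n0 : 0 <= n.+1%:R :> R by [].
rewrite !Sstep1 ?subrr//.
  by apply: (le_trans n1); rewrite ler_peMr// lerBrDl ltW.
by apply: (le_trans n1); rewrite ler_peMr// lerBrDl ltW// (le_lt_trans _ xt)// lerD2r.
Qed.

Lemma Sstep_cvg x t : Sstep (n.+1%:R * (x - t)) @[n --> \oo] --> (if t < x then 1 else 0 : R).
Proof.
case: ltP => tx; last first.
  apply: cvg_near_cst; near=> n; rewrite Sstep0//.
  by rewrite pmulr_rle0 ?subr_le0// ltr0n.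
apply: cvg_near_cst; near=> n; rewrite Sstep1//.
rewrite -ler_pdivrMr ?subr_gt0// mul1r.
have : (x - t)^-1 <= n%:R by near: n; exact: nbhs_infty_ger.
by move=> h; apply: (le_trans h); rewrite ler_nat.
Unshelve. all: by end_near. Qed.

Lemma cont_lim0 (g : R -> R) t C : continuous g -> 0 <= t -> t <= 1 ->
  (forall s, 0 < s -> s < 1 -> `|g s| <= C * `|s - t|) -> g t = 0.
Proof.
move=> cg t0 t1 hC; apply/eqP; rewrite -normr_le0 leNgt; apply/negP => gt0.
(* Points of the open interval that converge to [t] from the side of 1/2, also when [t] is 0 or
   1. *)
pose sn (n : nat) := t + (1/2 - t) / n.+1%:R.
have sn01 n : 0 < sn n /\ sn n < 1.
  have e0 : 0 < n.+1%:R^-1 :> R by rewrite invr_gt0.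
  have e1 : n.+1%:R^-1 <= 1 :> R by rewrite invf_le1// ler1n.
  rewrite /sn; move: (n.+1%:R^-1) e0 e1 => e e0 e1; split; nra.
have cs : sn n @[n --> \oo] --> t.
  rewrite -[X in _ --> X]addr0; apply: cvgD; first exact: cvg_cst.
  rewrite -[X in _ --> X](mulr0 (1/2 - t)); apply: cvgM; [exact: cvg_cst|exact: cvg_harmonic].
have c1 : `|g (sn n)| @[n --> \oo] --> `|g t|.
  by apply: cvg_norm; apply: continuous_cvg cs; exact: cg.
have c2 : C * `|sn n - t| @[n --> \oo] --> 0.
  rewrite -[X in _ --> X](mulr0 C); apply: cvgM; first exact: cvg_cst.
  rewrite -[X in _ --> X](@normr0 _ R) -(subrr t); apply: cvg_norm; apply: cvgB => //; exact: cvg_cst.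
have : lim (`|g (sn n)| @[n --> \oo]) <= lim (C * `|sn n - t| @[n --> \oo]).
  apply: ler_lim; [by apply/cvg_ex; exists (`|g t|) |by apply/cvg_ex; exists 0|].
  by apply: nearW => n; have [h1 h2] := sn01 n; exact: hC.
rewrite (cvg_lim _ c1)// (cvg_lim _ c2)// leNgt gt0; exact.
Qed.

Section Identity.
Variables (B H : R -> R) (Hb : R).
Hypotheses (cB : continuous B) (mH : measurable_fun setT H) (bH : forall t, `|H t| <= Hb).

Let iH s t : intg (fun x => ind s t x * H x).
Proof.
apply: (@intg_le _ _ (fun x => Hb * ind s t x)); last exact/intgZl/intg_ind.
  by apply: measurable_funM => //; exact: measurable_ind.
move=> x; rewrite normrM ger0_norm ?ind_ge0// mulrC; apply: ler_wpM2r; [exact: ind_ge0|exact: bH].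
Qed.

Lemma Int_indH_bound s t : s <= t -> `|Int (fun x => ind s t x * H x)| <= Hb * (t - s).
Proof.
move=> st; apply: (le_trans (le_norm_Int (iH s t))).
rewrite -(Int_ind st) -IntZl; last exact: intg_ind.
apply: le_Int; [exact/intg_norm/iH|exact/intgZl/intg_ind|move=> x].
by rewrite normrM ger0_norm ?ind_ge0// mulrC; apply: ler_wpM2r; [exact: ind_ge0|exact: bH].
Qed.

(** Take for [a] a smooth step that rises just after [t]: [a'] tends to a Dirac mass at [t] and [a]
    to the indicator of []t, 1]]. As [a] may be nonzero at time 1, the hypothesis also encodes
    [B 1 = 0]. Continuity of both sides reaches [t = 0] and [t = 1]. *)
Lemma terminal_identity :
  (forall (a : R -> R) (a1 a2 : R), smooth1 a -> 0 < a1 -> (forall t, (t < a1) || (a2 < t) -> a t = 0) ->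
    Int (fun t => ind 0 1 t * (- derive1 a t * B t + a t * H t)) = 0) ->
  forall t, 0 <= t -> t <= 1 -> B t = Int (fun s => ind t 1 s * H s).
Proof.
move=> id.
have main t : 0 < t -> t < 1 -> B t = Int (fun s => ind t 1 s * H s).
  move=> t0 t1.
  have idn n : Int (fun x => ind 0 1 x * (Sstep (n.+1%:R * (x - t)) * H x)) =
      Int (fun x => ind 0 1 x * (n.+1%:R * rho (n.+1%:R * (x - t)) * B x)).
    have tt2 : t <= 2 by lra.
    (* The second step, at 2, only makes the support of the cutoff compact; it is invisible on
       [[0, 1]]. *)
    have := id (acut n t 2) t (2 + 1) (smooth1_acut n t 2) t0 (fun x => @acut_vanish n t 2 x tt2).
    have i1 : intg (fun x => ind 0 1 x * (Sstep (n.+1%:R * (x - t)) * H x)).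
      apply: (@intg_le _ _ (fun x => Hb * ind 0 1 x)); last exact/intgZl/intg_ind.
        apply: measurable_funM; [exact: measurable_ind|apply: measurable_funM => //].
        by apply: continuous_measurable_fun; apply: smooth1_cont; exact: smooth1_scale_shift smooth1_Sstep.
      move=> x; rewrite normrM ger0_norm ?ind_ge0// mulrC; apply: ler_wpM2r; first exact: ind_ge0.
      rewrite normrM -[leRHS]mul1r; apply: ler_pM => //; exact: Sstep_norm.
    have i2 : intg (fun x => ind 0 1 x * (n.+1%:R * rho (n.+1%:R * (x - t)) * B x)).
      apply: intg_indc => x; apply: cvgM; last exact: cB.
      apply: cvgM; first exact: cvg_cst.
      exact: (smooth1_cont (smooth1_scale_shift n.+1%:R t smooth1_rho)).
    move=> h; apply/eqP; rewrite -subr_eq0 -IntB//; apply/eqP; rewrite -[RHS]h; apply: eq_Int => x.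
    have [/andP[x0 x1]|] := boolP (0 <= x <= 1); last first.
      by rewrite negb_and -!ltNge => ?; rewrite ind0// !mul0r subrr.
    rewrite ind1// !mul1r derive1_acut /acut (@Sstep0 _ (n.+1%:R * (x - 2))); last first.
      by rewrite pmulr_rle0 ?ltr0n// subr_le0; lra.
    rewrite (@rho_vanish _ (n.+1%:R * (x - 2))); last first.
      by rewrite pmulr_rlt0 ?ltr0n// subr_lt0; apply/orP; left; lra.
    by rewrite mulr0 !subr0; move: (rho _) (Sstep _) => ? ?; ring.
  have c1 : Int (fun x => ind 0 1 x * (Sstep (n.+1%:R * (x - t)) * H x)) @[n --> \oo] --> Int (fun s => ind t 1 s * H s).
    have -> : Int (fun s => ind t 1 s * H s) = Int (fun x => ind 0 1 x * ((if t < x then 1 else 0) * H x)).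
      transitivity (Int (fun x => ind t 1 x * (ind 0 1 x * ((if t < x then 1 else 0) * H x)))).
        apply: Int_ae_ind => //.
          apply: measurable_funM; [exact: measurable_ind|apply: measurable_funM => //].
          by apply: measurable_fun_ifT => //; exact: measurable_fun_ltr.
        by move=> x tx x1; rewrite tx mul1r ind1 ?mul1r// ltW// (lt_trans t0).
      apply: eq_Int => x; have [tx|tx] := ltP t x; last by rewrite mul0r !mulr0.
      rewrite mul1r mulrA; congr (_ * _); have [x1|x1] := leP x 1.
        by rewrite !ind1 ?mulr1// ltW// (lt_trans t0).
      by rewrite !ind0 ?x1 ?orbT// mul0r.
    apply: (@Int_dct _ _ _ (fun x => Hb * ind 0 1 x) _ _ _ _).2.
    - move=> n; apply: measurable_funM; [exact: measurable_ind|apply: measurable_funM => //].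
      by apply: continuous_measurable_fun; apply: smooth1_cont; exact: smooth1_scale_shift smooth1_Sstep.
    - exact/intgZl/intg_ind.
    - move=> n x; rewrite normrM ger0_norm ?ind_ge0// mulrC; apply: ler_wpM2r; first exact: ind_ge0.
      rewrite normrM -[leRHS]mul1r; apply: ler_pM => //; exact: Sstep_norm.
    - move=> x; apply: cvgM; first exact: cvg_cst.
      by apply: cvgM; [exact: Sstep_cvg|exact: cvg_cst].
  have c2 : Int (fun x => ind 0 1 x * (n.+1%:R * rho (n.+1%:R * (x - t)) * B x)) @[n --> \oo] --> B t.
    (* The substitution [x = t + y / (n + 1)] turns the concentrating bump into the fixed [rho], and
       the limit falls on [B]. *)
    have E n : Int (fun x => ind 0 1 x * (n.+1%:R * rho (n.+1%:R * (x - t)) * B x)) =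
        Int (fun y => ind 0 1 (t + n.+1%:R^-1 * y) * (rho y * B (t + n.+1%:R^-1 * y))).
      have n0 : 0 < n.+1%:R^-1 :> R by rewrite invr_gt0.
      have i2 : intg (fun x => ind 0 1 x * (n.+1%:R * rho (n.+1%:R * (x - t)) * B x)).
        apply: intg_indc => x; apply: cvgM; last exact: cB.
        apply: cvgM; first exact: cvg_cst.
        exact: (smooth1_cont (smooth1_scale_shift n.+1%:R t smooth1_rho)).
      rewrite (Int_affine t n0 i2) -IntZl; last exact: (intg_affine t n0 i2).
      apply: eq_Int => y; rewrite addrAC subrr add0r mulVKf//.
      rewrite mulrCA; congr (_ * _); rewrite -mulrA mulKf//.
    rewrite (funext E).
    have [M M0 hM] := segment_bound 0 2 cB.
    have [K K0 hK] := segment_bound 0 1 (smooth1_cont (@smooth1_rho R)).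
    have EB : B t = Int (fun y => rho y * B t).
      rewrite IntZr ?Int_rho ?mul1r//.
      apply: (@cs_intg _ rho 1) => [|x x1]; first exact: smooth1_cont smooth1_rho.
      rewrite rho_vanish//; move: x1; rewrite lter_normr => /orP[->|x1]; [by rewrite orbT|].
      by apply/orP; left; lra.
    rewrite [X in _ --> X]EB.
    apply: (@Int_dct _ _ _ (fun x => K * M * ind 0 1 x) _ _ _ _).2.
    - move=> n; apply: measurable_funM.
        apply: (measurableT_comp (measurable_ind 0 1)).
        by apply: measurable_funD => //; exact: measurable_funM.
      apply: continuous_measurable_fun => y; apply: cvgM; first exact: (smooth1_cont smooth1_rho).
      apply: (@continuous_comp _ _ _ (fun y => t + n.+1%:R^-1 * y) B); last exact: cB.
      by apply: cvgD; [exact: cvg_cst|apply: cvgM; [exact: cvg_cst|exact: cvg_id]].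
    - exact/intgZl/intg_ind.
    - move=> n y; rewrite normrM ger0_norm ?ind_ge0//.
      have [/andP[y0 y1]|] := boolP (0 <= y <= 1); last first.
        by rewrite negb_and -!ltNge => h; rewrite rho_vanish// mul0r normr0 mulr0 ind0// mulr0.
      rewrite (ind1 y0 y1) mulr1; apply: (@le_trans _ _ (1 * (K * M))); last by rewrite mul1r.
      apply: ler_pM => //; first exact: ind_le1.
      have e0 : 0 <= n.+1%:R^-1 :> R by rewrite invr_ge0.
      have e1 : n.+1%:R^-1 <= 1 :> R by rewrite invf_le1// ler1n.
      rewrite normrM; apply: ler_pM => //; first exact: hK.
      have h0 : 0 <= n.+1%:R^-1 * y by exact: mulr_ge0.
      have h1 : n.+1%:R^-1 * y <= 1 by rewrite mulr_ile1.
      by move: (_ * y) h0 h1 => v h0 h1; apply: hM; lra.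
    - move=> y; have [/andP[y0 y1]|] := boolP (0 <= y <= 1); last first.
        rewrite negb_and -!ltNge => h; rewrite rho_vanish// mul0r.
        by under eq_fun do rewrite mul0r mulr0; exact: cvg_cst.
      have cy : t + n.+1%:R^-1 * y @[n --> \oo] --> t.
        rewrite -[X in _ --> X]addr0; apply: cvgD; first exact: cvg_cst.
        rewrite -[X in _ --> X](mul0r y); apply: cvgM; [exact: cvg_harmonic|exact: cvg_cst].
      rewrite -[X in _ --> X]mul1r; apply: cvgM.
        apply: cvg_near_cst; near=> n; apply: ind1.
          by rewrite addr_ge0 ?(ltW t0)// mulr_ge0// invr_ge0.
        by apply: ltW; near: n; exact: (cvgr_lt t).
      by apply: cvgM; [exact: cvg_cst|apply: continuous_cvg cy; exact: cB].
  have := @cvg_unique _ (@Rhausdorff R) _ _ _ _ c2; apply.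
  by move: c1; under eq_fun do rewrite idn.
move=> t t0 t1.
apply/eqP; rewrite -subr_eq0; apply/eqP.
apply: (@cont_lim0 (fun s => B s - Int (fun s => ind t 1 s * H s)) t Hb) => //.
  by move=> s; apply: cvgB; [exact: cB|exact: cvg_cst].
move=> s s0 s1; rewrite main//.
have [st|ts] := leP s t.
  by rewrite (ind_split st t1 (iH _ _)) addrK distrC (@ger0_norm _ (t - s)) ?subr_ge0//; exact: Int_indH_bound.
rewrite (ind_split (ltW ts) (ltW s1) (iH _ _)) opprD addrA addrAC subrr add0r normrN (@gtr0_norm _ (s - t)) ?subr_gt0//.
exact/Int_indH_bound/ltW.
Unshelve. all: by end_near. Qed.

(** Smooth cutoffs approximate the indicators of intervals inside []0, 1[], so [H] integrates to 0
    over each of them; as [H] is only measurable, Lebesgue differentiation concludes almost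
    everywhere. *)
Lemma interior_identity :
  (forall (a : R -> R) (a1 a2 : R), smooth1 a -> 0 < a1 -> a2 < 1 -> (forall t, (t < a1) || (a2 < t) -> a t = 0) ->
    Int (fun t => ind 0 1 t * (a t * H t)) = 0) ->
  {ae mu, forall t, 0 < t -> t < 1 -> H t = 0}.
Proof.
move=> id.
have zero (s t : R) : 0 < s -> s < t -> t < 1 -> Int (fun x => ind s t x * H x) = 0.
  move=> s0 st t1.
  pose lim01 (v x : R) : R := if v < x then 1 else 0.
  have mlim v : measurable_fun setT (lim01 v).
    by apply: measurable_fun_ifT => //; exact: measurable_fun_ltr.
  have c1 : Int (fun x => ind 0 1 x * (acut n s t x * H x)) @[n --> \oo] -->
      Int (fun x => ind 0 1 x * ((lim01 s x - lim01 t x) * H x)).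
    apply: (@Int_dct _ _ _ (fun x => 2 * Hb * ind 0 1 x) _ _ _ _).2.
    - move=> n; apply: measurable_funM; [exact: measurable_ind|apply: measurable_funM => //].
      by apply: continuous_measurable_fun; apply: smooth1_cont; exact: smooth1_acut.
    - exact/intgZl/intg_ind.
    - move=> n x; rewrite normrM ger0_norm ?ind_ge0// mulrC; apply: ler_wpM2r; first exact: ind_ge0.
      rewrite normrM; apply: ler_pM => //.
      have := ler_normB (Sstep (n.+1%:R * (x - s))) (Sstep (n.+1%:R * (x - t))).
      move=> h; apply: (le_trans h); rewrite -[2]/(1 + 1); apply: lerD; exact: Sstep_norm.
    - move=> x; apply: cvgM; first exact: cvg_cst.
      by apply: cvgM; [apply: cvgB; exact: Sstep_cvg|exact: cvg_cst].
  have c2 : Int (fun x => ind 0 1 x * (acut n s t x * H x)) @[n --> \oo] --> 0.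
    apply: cvg_near_cst; near=> n.
    have nt : t + n.+1%:R^-1 < 1.
      near: n; apply: (@cvgr_lt _ _ _ _ _ t) => //.
      by rewrite -[X in _ --> X]addr0; apply: cvgD; [exact: cvg_cst|exact: cvg_harmonic].
    apply: (id _ s (t + n.+1%:R^-1) (smooth1_acut n s t)) => // x /orP[xs|xt].
      by rewrite (@acut_vanish n s t x (ltW st))// xs.
    have n1 : 0 < n.+1%:R :> R by [].
    have h : 1 <= n.+1%:R * (x - t).
      by rewrite mulrC -ler_pdivrMr// mul1r lerBrDl ltW.
    rewrite /acut !Sstep1 ?subrr//; apply: (le_trans h); apply: ler_wpM2l => //.
    by rewrite lerD2l lerN2 ltW.
  transitivity (Int (fun x => ind 0 1 x * ((lim01 s x - lim01 t x) * H x))); last first.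
    exact: cvg_unique _ (@Rhausdorff R) _ _ _ _ c1 c2.
  transitivity (Int (fun x => ind s t x * (ind 0 1 x * ((lim01 s x - lim01 t x) * H x)))).
    apply: Int_ae_ind => //.
      apply: measurable_funM; [exact: measurable_ind|apply: measurable_funM => //].
      exact: measurable_funB.
    move=> x sx xt; rewrite /lim01 sx ltNge (ltW xt)/= subr0 mul1r ind1 ?mul1r//; apply: ltW.
      exact: lt_trans sx.
    exact: lt_trans t1.
  apply: eq_Int => x; rewrite /lim01; have [sx|sx] := ltP s x; last first.
    by rewrite (@ltNge _ _ t) (le_trans sx (ltW st))/= subrr mul0r !mulr0.
  have [tx|tx] := ltP t x; first by rewrite subrr mul0r !mulr0.
  by rewrite (@ind1 _ s t) ?mul1r// ltW.
have li : locally_integrable setT (fun x => ind 0 1 x * H x).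
  apply: open_integrable_locally; [exact: openT|exact: iH].
apply: ae_imply (lebesgue_differentiation li) => x lx x0 x1.
have x20 : 0 < x / 2 by rewrite divr_gt0.
have x2 : x / 2 < x by lra.
have ilim : (@lebesgue_measure R).-integrable [set` Interval (BLeft (x / 2)) (BRight ((x + 1) / 2))]
    (EFin \o (fun x => ind 0 1 x * H x)).
  by apply: integrableS (iH 0 1).
have xu : x < (x + 1) / 2 by lra.
have bl : (BLeft (x / 2)%R < BRight x)%E by rewrite /Order.lt/= x2.
have [dF] := FTC1_lebesgue_pt xu ilim bl lx.
rewrite ind1 ?mul1r ?(ltW x0) ?(ltW x1)// => <-.
apply: derive1_near0.
have n1 : \forall y \near x, x / 2 < y by exact: lt_nbhsr.
have n2 : \forall y \near x, y < 1 by exact: lt_nbhsl.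
near=> y.
have y1 : x / 2 < y by near: y.
have y2 : y < 1 by near: y.
rewrite -[RHS](zero _ _ x20 y1 y2) Rintegral_mkcond; apply: eq_Int => v.
rewrite patchE; have [/andP[h1 h2]|h] := boolP (x / 2 <= v <= y).
  rewrite mem_set; last by rewrite /= in_itv/= h1.
  rewrite (@ind1 _ 0 1) ?(ind1 h1 h2)//; [exact: le_trans (ltW x20) h1|exact: le_trans h2 (ltW y2)].
rewrite memNset; last by rewrite /= in_itv/=; exact/negP.
by move: h; rewrite negb_and -!ltNge => h; rewrite ind0// mul0r.
Unshelve. all: by end_near. Qed.
End Identity.

End TimeLimits.

(** * Mollification in space *)

Section Kernels.
Context {R : realType}.
Notation mu := (@lebesgue_measure R).
Implicit Types (k f : R -> R) (g : R -> R -> R) (s t x y r C : R).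

Definition csm k : Prop := smooth1 k /\ exists2 r, 0 <= r & forall x, r < `|x| -> k x = 0.

Lemma csm_derive k : csm k -> csm (derive1 k).
Proof.
move=> [sk [r r0 kr]]; split; first exact: smooth1_derive.
exists r => // x xr; apply: derive1_near0.
by apply: filterS (near_norm_gt xr) => y yr; exact: kr.
Qed.

Lemma csm_dom k : csm k -> exists M r, [/\ 0 <= M, 0 <= r & forall x, `|k x| <= M * ind (- r) r x].
Proof.
move=> [sk [r r0 kr]]; have [M M0 hM] := segment_bound (- r) r (smooth1_cont sk).
exists M, r; split => // x; have [xr|xr] := leP `|x| r; last by rewrite kr// normr0 ind_out// mulr0.
by rewrite ind_in// mulr1; move: xr; rewrite ler_norml => /andP[h1 h2]; exact: hM.
Qed.

Lemma csm_intg k : csm k -> intg k.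
Proof. by move=> [sk [r r0 kr]]; apply: (@cs_intg _ k r) => //; exact: smooth1_cont. Qed.

Definition norm1 k : R := Int (fun y => `|k y|).

Lemma norm1_ge0 k : 0 <= norm1 k.
Proof. by apply: Int_ge0 => y. Qed.

Lemma csm_rho : csm (@rho R).
Proof.
split; first exact: smooth1_rho.
exists 1 => // x; rewrite lter_normr => h; rewrite rho_vanish//.
by move: h => /orP[->|h]; [rewrite orbT|apply/orP; left; lra].
Qed.

Lemma intg_refl f x : intg f -> intg (fun y => f (x - y)).
Proof.
move=> hf; have h := @intg_affine _ 1 x _ ltr01 hf.
have := intg_opp h; congr (intg _); apply/funext => y; by rewrite mul1r.
Qed.

Lemma Int_refl f x : intg f -> Int (fun y => f (x - y)) = Int f.
Proof.
move=> hf; have h := @intg_affine _ 1 x _ ltr01 hf.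
rewrite (@Int_affine _ 1 x f ltr01 hf) mul1r -[RHS](Int_opp h).
by apply: eq_Int => y; rewrite mul1r.
Qed.

Definition conv k g t x : R := Int (fun y => g t y * k (x - y)).

Lemma csm_shift_meas k x : csm k -> measurable_fun setT (fun y => k (x - y)).
Proof. by move=> ck; apply: intg_measurable; apply: intg_refl; exact: csm_intg. Qed.

Lemma intg_conv k g t x C : csm k -> measurable_fun setT (g t) -> (forall y, `|g t y| <= C) ->
  intg (fun y => g t y * k (x - y)).
Proof.
move=> ck mg gC; apply: (@intg_le _ _ (fun y => C * `|k (x - y)|)).
- by apply: measurable_funM => //; exact: csm_shift_meas.
- by move=> y; rewrite normrM; apply: ler_wpM2r.
- by apply/intgZl/intg_norm/intg_refl/csm_intg.
Qed.

Lemma conv_bound k g t x C : csm k -> measurable_fun setT (g t) -> (forall y, `|g t y| <= C) ->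
  `|conv k g t x| <= C * norm1 k.
Proof.
move=> ck mg gC; have i := intg_conv x ck mg gC.
apply: (le_trans (le_norm_Int i)).
rewrite /norm1 -(Int_refl x (intg_norm (csm_intg ck))) -IntZl; last exact: (intg_refl x (intg_norm (csm_intg ck))).
apply: le_Int; [exact: intg_norm|exact/intgZl/(intg_refl x (intg_norm (csm_intg ck)))|].
by move=> y; rewrite normrM; apply: ler_wpM2r.
Qed.

(* Near [x0], the kernel only sees a fixed compact set. *)
Lemma csm_shift_dom k x0 : csm k -> exists M b, [/\ 0 <= M, 0 <= b &
  forall x y, `|x - x0| < 1 -> `|k (x - y)| <= M * ind (- b) b y].
Proof.
move=> ck; have [M [r [M0 r0 hM]]] := csm_dom ck.
exists M, (`|x0| + r + 1); split => //; first by rewrite !addr_ge0.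
move=> x y xx; apply: (le_trans (hM _)); apply: ler_wpM2l => //.
have [h|h] := leP `|y| (`|x0| + r + 1); first by rewrite (ind_in h) ind_le1.
rewrite ind_out ?ind_ge0//.
have h1 := ler_normD (y - x) (x - x0 + x0).
have h2 := ler_normD (x - x0) x0.
have h3 : y - x + (x - x0 + x0) = y by ring.
rewrite h3 in h1; rewrite distrC; lra.
Qed.

Lemma dconv k g t x : csm k -> measurable_fun setT (g t) ->
  (forall b, exists C, forall y, `|y| <= b -> `|g t y| <= C) ->
  is_derive x 1 (conv k g t) (conv (derive1 k) g t x).
Proof.
move=> ck mg gC; have cdk := csm_derive ck.
have [M [b [M0 b0 hM]]] := csm_shift_dom x ck.
have [M' [b' [M0' b0' hM']]] := csm_shift_dom x cdk.
have [C hC] := gC b; have [C' hC'] := gC b'.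
have bnd (q : R -> R) N c c1 y : 0 <= N -> (forall y, `|y| <= c -> `|g t y| <= c1) -> `|q y| <= N * ind (- c) c y ->
    `|g t y * q y| <= `|c1| * N * ind (- c) c y.
  move=> N0 h hq; rewrite normrM -mulrA; have [yc|yc] := leP `|y| c.
    by apply: ler_pM => //; apply: (le_trans (h y yc)); exact: ler_norm.
  by move: hq; rewrite (ind_out yc) !mulr0 normr_le0 => /eqP ->; rewrite normr0 mulr0.
apply: (@derive_Int _ (fun x y => g t y * k (x - y)) (fun x y => g t y * derive1 k (x - y))
  (fun y => `|C'| * M' * ind (- b') b' y) x 1) => //.
- move=> v vx; apply: (@intg_le _ _ (fun y => `|C| * M * ind (- b) b y)); last exact/intgZl/intg_ind.
    by apply: measurable_funM => //; exact: csm_shift_meas.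
  by move=> y; apply: (bnd (fun y => k (v - y))) => //; exact: hM.
- move=> v y _; have hk := smooth1_is_derive (v - y) ck.1.
  have hs : is_derive v 1 (fun v : R => v - y) 1 by apply: is_derive_eq; rewrite oppr0 addr0.
  have h := is_deriveZ (g t y) (@is_derive1_comp _ k (fun v => v - y) v _ _ hk hs).
  by apply: (is_derive_eq h); rewrite /GRing.scale/= mulr1.
- exact/intgZl/intg_ind.
- by move=> v y vx; apply: (bnd (fun y => derive1 k (v - y))) => //; exact: hM'.
Qed.

Lemma box_bound g r : continuous (fun z : R * R => g z.1 z.2) ->
  exists2 M, 0 <= M & forall t x, `|t| <= r -> `|x| <= r -> `|g t x| <= M.
Proof.
move=> cF.
have : compact ((fun z : R * R => g z.1 z.2) @` (`[- r, r]%classic `*` `[- r, r]%classic)).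
  apply: continuous_compact; first exact: continuous_subspaceT.
  by apply: compact_setX; exact: segment_compact.
move=> /compact_bounded [N [Nr hN]].
exists (`|N| + 1); first by rewrite addr_ge0.
move=> t x tr xr; apply: (hN (`|N| + 1)).
  by apply: (le_lt_trans (real_ler_norm Nr)); rewrite ltrDl.
by exists (t, x) => //=; rewrite !in_itv/= -!ler_norml tr xr.
Qed.

Lemma conv_cont_t k g x : csm k -> continuous (fun z : R * R => g z.1 z.2) -> continuous (fun t => conv k g t x).
Proof.
move=> ck cg t.
have [M [b [M0 b0 hM]]] := csm_shift_dom x ck.
have [C C0 hC] := box_bound (`|t| + b + 1) cg.
have cl s := cont_l (t := s) cg.
have ks : continuous (fun y => k (x - y)).
  move=> y; apply: (@continuous_comp _ _ _ (fun y => x - y) k); last exact: (smooth1_cont ck.1).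
  by apply: cvgB; [exact: cvg_cst|exact: cvg_id].
have kb y : `|k (x - y)| <= M * ind (- b) b y by apply: hM; rewrite subrr normr0.
have bnd s y : `|s - t| < 1 -> `|g s y * k (x - y)| <= C * M * ind (- b) b y.
  move=> st; rewrite normrM -mulrA; have [yb|yb] := leP `|y| b.
    apply: ler_pM => //; apply: hC; last by apply: (le_trans yb); rewrite -addrA addrCA lerDl addr_ge0.
    have := ler_normD (s - t) t; rewrite subrK; lra.
  by have := kb y; rewrite (ind_out yb) !mulr0 normr_le0 => /eqP ->; rewrite normr0 mulr0.
apply: (@cont_Int _ (fun t y => g t y * k (x - y)) (fun y => C * M * ind (- b) b y) t 1) => //.
- move=> s st; apply: (@intg_le _ _ (fun y => C * M * ind (- b) b y)); last exact/intgZl/intg_ind.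
    by apply: continuous_measurable_fun => y; apply: cvgM; [exact: cl|exact: ks].
  by move=> y; exact: bnd.
- by move=> s y _; apply: cvgM; [exact: cont_r cg s|exact: cvg_cst].
- exact/intgZl/intg_ind.
Qed.

Lemma conv_meas_t k g x C : csm k -> meas2 g -> (forall t y, `|g t y| <= C * ind 0 1 t) ->
  measurable_fun setT (fun t => conv k g t x).
Proof.
move=> ck mg gC; apply: intg_measurable.
apply: (@intg_IntF _ (fun t y => g t y * k (x - y)) (fun t => C * ind 0 1 t) (fun y => `|k (x - y)|)).
- apply: measurable_funM => //.
  exact: (measurableT_comp (csm_shift_meas x ck) measurable_snd).
- exact/intgZl/intg_ind.
- exact/intg_norm/intg_refl/csm_intg.
- by move=> t y; rewrite normrM; apply: ler_wpM2r.
Qed.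

Lemma refl_smooth k x : smooth1 k -> smooth1 (fun y => k (x - y)).
Proof.
by move=> sk n; apply: Cn_eq (Cn_affine (-1) x (sk n)) => y; rewrite mulN1r addrC.
Qed.

Lemma refl_derive k x y : smooth1 k -> derive1 (fun y => k (x - y)) y = - derive1 k (x - y).
Proof.
move=> sk; apply: derive1_val.
have hs : is_derive y 1 (fun y : R => x - y) (-1).
  have h0 := is_deriveB (is_derive_cst x y 1) (is_derive_id y (1 : R)).
  by apply: (is_derive_eq h0); rewrite sub0r.
have h := @is_derive1_comp _ k (fun y => x - y) y _ _ (smooth1_is_derive (x - y) sk) hs.
by apply: (is_derive_eq h); rewrite mulrN1.
Qed.

Lemma ae_cont_le0 (h : R -> R) : continuous h -> {ae mu, forall t, 0 < t -> t < 1 -> h t <= 0} ->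
  forall t, 0 <= t -> t <= 1 -> h t <= 0.
Proof.
move=> ch hae t t0 t1; rewrite leNgt; apply/negP => ht.
have /nbhs_ballP[e /= e0 he] : \forall s \near t, 0 < h s by exact: (cvgr_gt _ (ch t)).
pose a := Num.max 0 (t - e); pose b := Num.min 1 (t + e).
have ab : a < b.
  rewrite /a /b gt_max !lt_min; apply/andP; split; apply/andP; split; lra.
have [N [mN N0 hN]] := hae.
have sub : `]a, b[%classic `<=` N.
  move=> s /=; rewrite in_itv/= /a /b gt_max lt_min => /andP[/andP[s0 s1] /andP[s2 s3]].
  apply: hN => /= hs; have := hs s0 s2; apply/negP; rewrite -ltNge; apply: he.
  by rewrite /ball/= ltr_norml; apply/andP; split; lra.
have : (mu `]a, b[%classic <= mu N)%E by apply: le_measure => //; rewrite inE.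
rewrite N0 lebesgue_measure_itv/= lte_fin ab -EFinB lee_fin subr_le0 leNgt ab; exact.
Qed.

End Kernels.

(** * Heat estimates and the Duhamel formula *)

Section HeatEstimates.
Context {R : realType}.
Implicit Types (f g : R -> R) (a b x y C : R).

Lemma egrow_bdd g C : measurable_fun setT g -> (forall y, `|g y| <= C) -> egrow g.
Proof. by move=> mg gC; apply: (@egrow_le _ g (fun=> C)) => //; exact: egrow_cst. Qed.

Lemma heat_bound g a x C : measurable_fun setT g -> (forall y, `|g y| <= C) -> `|heat a g x| <= C.
Proof.
move=> mg gC; have eg := egrow_bdd mg gC.
apply: (le_trans (heat_norm a x eg)); rewrite -(heat_cst C a x).
by apply: le_heat => //; [exact: egrow_norm|exact: egrow_cst].
Qed.

Lemma lipK f f' C : (forall y, is_derive y 1 f (f' y)) -> (forall y, `|f' y| <= C) ->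
  forall x y, `|f x - f y| <= C * `|x - y|.
Proof.
move=> df fC.
have cf : continuous f by move=> z; apply: differentiable_continuous; apply/derivable1_diffP.
suff main x y : x < y -> `|f y - f x| <= C * `|y - x|.
  move=> x y; case: (ltgtP x y) => [xy|xy|->]; last by rewrite !subrr !normr0 mulr0.
    by rewrite distrC (distrC x); exact: main.
  exact: main.
move=> xy; have [v _ ->] := MVT xy (fun z _ => df z) (continuous_subspaceT cf).
by rewrite normrM; apply: ler_wpM2r.
Qed.

Section Smooth.
Variables (g g1 g2 : R -> R) (C0 C1 C2 : R).
Hypotheses (dg : forall y, is_derive y 1 g (g1 y)) (dg1 : forall y, is_derive y 1 g1 (g2 y)).
Hypotheses (mg2 : measurable_fun setT g2).
Hypotheses (b0 : forall y, `|g y| <= C0) (b1 : forall y, `|g1 y| <= C1) (b2 : forall y, `|g2 y| <= C2).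

Let cg : continuous g.
Proof. by move=> z; apply: differentiable_continuous; apply/derivable1_diffP. Qed.

Let cg1 : continuous g1.
Proof. by move=> z; apply: differentiable_continuous; apply/derivable1_diffP. Qed.

Lemma dheat_smooth a x : 0 < a -> is_derive a 1 (fun a => heat a g x) (heat a g2 x / 2).
Proof.
move=> a0; have e0 := egrow_bdd (continuous_measurable_fun cg) b0.
have e1 := egrow_bdd (continuous_measurable_fun cg1) b1.
have e2 := egrow_bdd mg2 b2.
by rewrite -(heat_ibp x e0 e1 e2 dg dg1 a0); exact: dheat_a.
Qed.

Lemma heat_mvt a b x : 0 <= a -> a < b ->
  exists2 v, a < v < b & heat b g x - heat a g x = heat v g2 x / 2 * (b - a).
Proof.
move=> a0 ab; have e0 := egrow_bdd (continuous_measurable_fun cg) b0.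
have dh v : v \in `]a, b[ -> is_derive v 1 (fun a => heat a g x) (heat v g2 x / 2).
  by rewrite in_itv/= => /andP[av _]; apply: dheat_smooth; exact: le_lt_trans av.
have ch : {within `[a, b], continuous (fun a => heat a g x)}.
  by apply: continuous_subspaceT => v; exact: heat_cont.
have [v hv E] := MVT ab dh ch.
by exists v => //; move: hv; rewrite in_itv.
Qed.

Lemma heat_lip a b x : 0 <= a -> a <= b -> `|heat b g x - heat a g x| <= C2 / 2 * (b - a).
Proof.
move=> a0; rewrite le_eqVlt => /predU1P[->|ab]; first by rewrite !subrr normr0 mulr0.
have [v _ ->] := heat_mvt x a0 ab.
have ba : 0 <= b - a by rewrite subr_ge0 ltW.
rewrite normrM (ger0_norm ba); apply: ler_wpM2r => //.
by apply: norm_half_le; exact: heat_bound.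
Qed.

End Smooth.

(** All derivatives are put on [g], so the expansion is uniform down to [a = 0]; the quadratic
    remainder is the form that [quad_const] consumes. *)
Lemma heat_taylor (g g1 g2 g3 g4 : R -> R) (C0 C1 C2 C3 C4 : R) a b x :
  (forall y, is_derive y 1 g (g1 y)) -> (forall y, is_derive y 1 g1 (g2 y)) ->
  (forall y, is_derive y 1 g2 (g3 y)) -> (forall y, is_derive y 1 g3 (g4 y)) ->
  measurable_fun setT g4 ->
  (forall y, `|g y| <= C0) -> (forall y, `|g1 y| <= C1) -> (forall y, `|g2 y| <= C2) ->
  (forall y, `|g3 y| <= C3) -> (forall y, `|g4 y| <= C4) ->
  0 <= a -> a <= b ->
  `|heat b g x - heat a g x - (b - a) / 2 * heat a g2 x| <= C4 / 4 * (b - a) ^+ 2.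
Proof.
move=> d1 d2 d3 d4 m4 b0 b1 b2 b3 b4 a0; rewrite le_eqVlt => /predU1P[->|ab].
  by rewrite !subrr !mul0r subr0 normr0 expr0n/= mulr0.
have cg2 : continuous g2 by move=> z; apply: differentiable_continuous; apply/derivable1_diffP.
have [v /andP[av vb] ->] := heat_mvt d1 d2 (continuous_measurable_fun cg2) b0 b1 b2 x a0 ab.
have C40 : 0 <= C4 by exact: le_trans (normr_ge0 _) (b4 0).
have h := heat_lip d3 d4 m4 b2 b3 b4 x a0 (ltW av).
have -> : heat v g2 x / 2 * (b - a) - (b - a) / 2 * heat a g2 x = (b - a) / 2 * (heat v g2 x - heat a g2 x) by ring.
have ba : 0 <= (b - a) / 2 by rewrite divr_ge0// subr_ge0 ltW.
rewrite normrM ger0_norm//; apply: (le_trans (ler_wpM2l ba h)).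
rewrite (_ : C4 / 4 * (b - a) ^+ 2 = (b - a) / 2 * (C4 / 2 * (b - a))); last by field.
by apply: ler_wpM2l => //; apply: ler_wpM2l; [exact: divr_ge0|lra].
Qed.

Lemma egrow_norm_id : egrow (fun z : R => `|z|).
Proof. exact/egrow_norm/egrow_id. Qed.

(** The derivative falls on the kernel: its first absolute moment [sqrt a * E|Z|] is divided by
    [a]. *)
Lemma heat_grad g a x y C : measurable_fun setT g -> (forall y, `|g y| <= C) -> 0 < a ->
  `|heat a g x - heat a g y| <= C * Eg (fun z : R => `|z|) / Num.sqrt a * `|x - y|.
Proof.
move=> mg gC a0; have eg := egrow_bdd mg gC.
have C0 : 0 <= C by exact: le_trans (normr_ge0 _) (gC 0).
have s0 : 0 < Num.sqrt a by rewrite sqrtr_gt0.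
apply: (lipK (fun y => dheat_x y eg a0)) => v.
rewrite normrN normrM (@ger0_norm _ a^-1); last by rewrite invr_ge0 ltW.
have -> : C * Eg (fun z : R => `|z|) / Num.sqrt a = (C * Num.sqrt a * Eg (fun z : R => `|z|)) / a.
  have e : a = Num.sqrt a * Num.sqrt a by rewrite -expr2 sqr_sqrtr// ltW.
  move: (Eg _) => E; rewrite {3}e; field; by rewrite gt_eqF.
apply: ler_wpM2r; first by rewrite invr_ge0 ltW.
rewrite JE// -EgZl; last exact: egrow_norm_id.
have e1 : egrow (fun z => g (v + Num.sqrt a * z) * (- (Num.sqrt a * z)) ^+ 1).
  apply: egrowM; first exact: egrow_affine.
  have := egrowM (egrow_cst (- Num.sqrt a)) (@egrow_id R).
  by congr egrow; apply/funext => z; rewrite mulNr.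
apply: (le_trans (le_norm_Eg e1)); apply: le_Eg.
- exact: egrow_norm.
- by apply: egrowM; [exact: egrow_cst|exact: egrow_norm_id].
move=> z; rewrite expr1 normrM normrN normrM (ger0_norm (ltW s0)) -mulrA.
by apply: ler_wpM2r => //; apply: mulr_ge0 => //; exact: ltW.
Qed.

(** Summing [m + 1] increments of order [1 / m^2] gives a total of order [1 / m]. This takes the
    place of a derivative in time, which a source that is only measurable in time does not
    provide. *)
Lemma quad_const (D : R -> R) C s t : s <= t ->
  (forall v v', s <= v -> v <= v' -> v' <= t -> `|D v' - D v| <= C * (v' - v) ^+ 2) -> D t = D s.
Proof.
move=> st hD.
have step n m : (n <= m.+1)%N ->
    `|D (s + n%:R * ((t - s) / m.+1%:R)) - D s| <= n%:R * (C * ((t - s) / m.+1%:R) ^+ 2).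
  set d := (t - s) / m.+1%:R.
  have d0 : 0 <= d by rewrite divr_ge0// subr_ge0.
  have dm : m.+1%:R * d = t - s by rewrite /d mulrC divfK// pnatr_eq0.
  elim: n => [|n IH] nm; first by rewrite !mul0r addr0 subrr normr0.
  have e1 : s + n.+1%:R * d = (s + n%:R * d) + d by rewrite -natr1; ring.
  have -> : D (s + n.+1%:R * d) - D s = (D (s + n.+1%:R * d) - D (s + n%:R * d)) + (D (s + n%:R * d) - D s).
    by rewrite addrA subrK.
  apply: (le_trans (ler_normD _ _)).
  have -> : n.+1%:R * (C * d ^+ 2) = C * d ^+ 2 + n%:R * (C * d ^+ 2) by rewrite -natr1; ring.
  apply: lerD; last exact: IH (ltnW nm).
  have := hD (s + n%:R * d) (s + n.+1%:R * d).
  have -> : s + n.+1%:R * d - (s + n%:R * d) = d by rewrite e1; ring.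
  apply.
  - by rewrite lerDl mulr_ge0.
  - by rewrite e1 lerDl.
  - have h : n.+1%:R * d <= m.+1%:R * d by apply: ler_wpM2r => //; rewrite ler_nat.
    by rewrite dm in h; lra.
have lim0 : C * (t - s) ^+ 2 / m.+1%:R @[m --> \oo] --> 0.
  rewrite -[X in _ --> X](mulr0 (C * (t - s) ^+ 2)); apply: cvgM; [exact: cvg_cst|exact: cvg_harmonic].
apply/eqP; rewrite -subr_eq0 -normr_le0.
have -> : `|D t - D s| = lim (`|D t - D s| @[_ --> \oo]) by rewrite lim_cst.
have -> : 0 = lim (C * (t - s) ^+ 2 / m.+1%:R @[m --> \oo]) by rewrite (cvg_lim _ lim0).
apply: ler_lim; [exact: is_cvg_cst|by apply/cvg_ex; exists 0|].
apply: nearW => m; have := step m.+1 m (leqnn _).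
have -> : s + m.+1%:R * ((t - s) / m.+1%:R) = t.
  by rewrite mulrC divfK ?pnatr_eq0// addrC subrK.
move=> h; apply: (le_trans h); rewrite le_eqVlt; apply/orP; left; apply/eqP.
have n0 : m.+1%:R != 0 :> R by rewrite pnatr_eq0.
by move: (m.+1%:R : R) n0 => n n0; field.
Qed.

End HeatEstimates.

Section HeatTime.
Context {R : realType}.
Notation mu := (@lebesgue_measure R).
Implicit Types (h : R -> R -> R) (q f : R -> R) (s t x y a C : R).

Lemma Int_ind_bound f s t C : s <= t -> intg (fun v => ind s t v * f v) ->
  (forall v, s <= v -> v <= t -> `|f v| <= C) -> `|Int (fun v => ind s t v * f v)| <= C * (t - s).
Proof.
move=> st i b; apply: (le_trans (le_norm_Int i)).
rewrite -(Int_ind st) -IntZl; last exact: intg_ind.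
apply: le_Int; [exact: intg_norm|by apply: intgZl; exact: intg_ind|move=> v].
rewrite normrM mulrC (ger0_norm (ind_ge0 s t v)).
have [/andP[h1 h2]|] := boolP (s <= v <= t); first by rewrite ler_wpM2r ?ind_ge0// b.
by rewrite negb_and -!ltNge => h; rewrite ind0// !mulr0.
Qed.

Section HeatInt.
Variables (h : R -> R -> R) (C : R).
Hypotheses (ch : forall t, continuous (h t)) (mh : forall y, measurable_fun setT (h^~ y)).
Hypothesis bh : forall t y, `|h t y| <= C.
Variable q : R -> R.
Hypothesis mq : measurable_fun setT q.
Variables s t x : R.

Let Fn v z := ind s t v * h v (x + Num.sqrt (q v) * z) * Gd z.

Let C0 : 0 <= C.
Proof. exact: le_trans (normr_ge0 _) (bh 0 0). Qed.

Let FnB v z : `|Fn v z| <= (C * ind s t v) * Gd z.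
Proof.
rewrite /Fn normrM (ger0_norm (Gd_ge0 z)) ler_wpM2r ?Gd_ge0//.
by rewrite normrM mulrC (ger0_norm (ind_ge0 s t v)) ler_wpM2r ?ind_ge0.
Qed.

Let mhx z : measurable_fun setT (fun v => h v (x + Num.sqrt (q v) * z)).
Proof.
have mh2 : meas2 h by apply: measurable_caratheodory.
apply: (measurableT_comp (f := fun p : measurableTypeR R * measurableTypeR R => h p.1 p.2) mh2
  (g := fun v => (v, x + Num.sqrt (q v) * z))).
apply: measurable_fun_pair => //; apply: measurable_funD => //; apply: measurable_funM => //.
apply: measurableT_comp => //; apply: continuous_measurable_fun; exact: sqrt_continuous.
Qed.

Let mFn : meas2 Fn.
Proof.
apply: measurable_caratheodory => [v z|z].
  apply: cvgM; last first.
    apply: cvgZr; apply: (@continuous_comp _ _ _ (fun z : R => - (2^-1 * z ^+ 2)) expR); last exact: continuous_expR.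
    by apply: cvgN; apply: cvgZr; apply: exprn_continuous.
  apply: cvgZr; apply: (@continuous_comp _ _ _ (fun z : R => x + Num.sqrt (q v) * z) (h v)); last exact: ch.
  by apply: cvgD; [exact: cvg_cst|apply: cvgZr; exact: cvg_id].
apply: measurable_funM => //; apply: measurable_funM; first exact: measurable_ind.
exact: mhx.
Qed.

Let IFn v : Int (Fn v) = ind s t v * heat (q v) (h v) x.
Proof.
rewrite /heat /Eg -IntZl; last first.
  apply: intg_Gd; apply: (@egrow_affine _ (h v)); apply: (@egrow_bdd _ _ C) => //.
  exact: continuous_measurable_fun.
by apply: eq_Int => z; rewrite /Fn mulrA.
Qed.

Let iC : intg (fun v => C * ind s t v).
Proof. by apply: intgZl; exact: intg_ind. Qed.

Let iG : intg (@Gd R).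
Proof.
have := intg_Gd (egrow_cst (1 : R)); apply: eq_integrable => // y _ /=; by rewrite mul1r.
Qed.

Lemma intg_heat_time : intg (fun v => ind s t v * heat (q v) (h v) x).
Proof.
by have := intg_IntF mFn iC iG FnB; rewrite (funext IFn).
Qed.

Lemma heat_time_swap : Int (fun v => ind s t v * heat (q v) (h v) x) =
  Int (fun z => Int (fun v => ind s t v * h v (x + Num.sqrt (q v) * z)) * Gd z).
Proof.
rewrite -(funext IFn) (Int_swap mFn iC iG FnB); apply: eq_Int => z.
rewrite -IntZr//; apply: (@intg_le _ _ (fun v => C * ind s t v)) => //.
  apply: measurable_funM; first exact: measurable_ind.
  exact: mhx.
by move=> v; rewrite normrM mulrC (ger0_norm (ind_ge0 s t v)) ler_wpM2r ?ind_ge0.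
Qed.
End HeatInt.

Section Duhamel.
Variables (U U1 U2 U3 U4 G G1 G2 : R -> R -> R) (w wt : R -> R).
Variables (C0 C1 C2 C3 C4 L D0 D1 D2 W : R).
Hypothesis dU : forall t x, is_derive x 1 (U t) (U1 t x).
Hypothesis dU1 : forall t x, is_derive x 1 (U1 t) (U2 t x).
Hypothesis dU2 : forall t x, is_derive x 1 (U2 t) (U3 t x).
Hypothesis dU3 : forall t x, is_derive x 1 (U3 t) (U4 t x).
Hypothesis mU4 : forall t, measurable_fun setT (U4 t).
Hypothesis dG : forall t x, is_derive x 1 (G t) (G1 t x).
Hypothesis dG1 : forall t x, is_derive x 1 (G1 t) (G2 t x).
Hypothesis mG2 : forall t, measurable_fun setT (G2 t).
Hypothesis mU2 : forall x, measurable_fun setT (U2^~ x).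
Hypothesis mG : forall x, measurable_fun setT (G^~ x).
Hypotheses (b0 : forall t x, 0 <= t -> t <= 1 -> `|U t x| <= C0) (b1 : forall t x, 0 <= t -> t <= 1 -> `|U1 t x| <= C1)
  (b2 : forall t x, 0 <= t -> t <= 1 -> `|U2 t x| <= C2) (b3 : forall t x, 0 <= t -> t <= 1 -> `|U3 t x| <= C3)
  (b4 : forall t x, 0 <= t -> t <= 1 -> `|U4 t x| <= C4).
Hypotheses (e0 : forall t x, `|G t x| <= D0) (e1 : forall t x, `|G1 t x| <= D1) (e2 : forall t x, `|G2 t x| <= D2).
Hypothesis U2L : forall s t x, 0 <= s -> s <= t -> t <= 1 -> `|U2 s x - U2 t x| <= L * (t - s).
Hypothesis mwt : measurable_fun setT wt.
Hypotheses (wt0 : forall t, 0 <= wt t) (wtW : forall t, wt t <= W) (wt_out : forall t, ~~ (0 <= t <= 1) -> wt t = 0).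
Hypothesis wc : continuous w.
Hypothesis wm : forall s t, s <= t -> w s <= w t.
Hypothesis wI : forall s t, 0 <= s -> s <= t -> t <= 1 -> Int (fun v => ind s t v * wt v) = (w t - w s) / 2.
Hypothesis incr : forall s t x, 0 <= s -> s <= t -> t <= 1 ->
  U s x = Int (fun v => ind s t v * (wt v * (U2 v x + G v x))) + U t x.
Hypothesis Uend : forall x, U 1 x = 0.

Let src t x := wt t * (U2 t x + G t x).

Let W0 : 0 <= W. Proof. exact: le_trans (wt0 0) (wtW 0). Qed.
Let C20 : 0 <= C2. Proof. exact: le_trans (normr_ge0 _) (b2 0 (lexx 0) ler01). Qed.
Let D00 : 0 <= D0. Proof. exact: le_trans (normr_ge0 _) (e0 0 0). Qed.
Let D20 : 0 <= D2. Proof. exact: le_trans (normr_ge0 _) (e2 0 0). Qed.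
Let L0 : 0 <= L.
Proof. by have := le_trans (normr_ge0 _) (U2L 0 (lexx 0) ler01 (lexx 1)); rewrite subr0 mulr1. Qed.
Let C40 : 0 <= C4. Proof. exact: le_trans (normr_ge0 _) (b4 0 (lexx 0) ler01). Qed.

Let der_cont (g g' : R -> R) : (forall y : R, is_derive y 1 g (g' y)) -> continuous g.
Proof. by move=> d y; apply: differentiable_continuous; apply/derivable1_diffP; have [] := d y. Qed.

Let src_bd t x : `|src t x| <= W * (C2 + D0).
Proof.
rewrite /src; have [/andP[t0 t1]|h] := boolP (0 <= t <= 1); last first.
  by rewrite wt_out// mul0r normr0 mulr_ge0// addr_ge0.
rewrite normrM (ger0_norm (wt0 t)); apply: ler_pM => //.
by apply: (le_trans (ler_normD _ _)); apply: lerD; [exact: b2|exact: e0].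
Qed.

Let csrc t : continuous (src t).
Proof.
move=> y; apply: cvgZr; apply: cvgD; [exact: (der_cont (dU2 t))|exact: (der_cont (dG t))].
Qed.

Let msrc y : measurable_fun setT (src^~ y).
Proof. by apply: measurable_funM => //; apply: measurable_funD. Qed.

Let eg_bdd (g : R -> R) C : continuous g -> (forall y, `|g y| <= C) -> egrow g.
Proof. by move=> cg b; apply: (@egrow_bdd _ _ C) => //; exact: continuous_measurable_fun. Qed.

Let w_lip s t : 0 <= s -> s <= t -> t <= 1 -> w t - w s <= 2 * W * (t - s).
Proof.
move=> s0 st t1; have iw : intg (fun v => ind s t v * wt v).
  apply: (@intg_le _ _ (fun v => W * ind s t v)).
  - by apply: measurable_funM => //; exact: measurable_ind.
  - move=> v; rewrite normrM mulrC (ger0_norm (ind_ge0 s t v)) ler_wpM2r ?ind_ge0//.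
    by rewrite (ger0_norm (wt0 v)).
  by apply: intgZl; exact: intg_ind.
have := le_trans (ler_norm _) (@Int_ind_bound wt s t W st iw _); rewrite wI// => h.
have : (w t - w s) / 2 <= W * (t - s) by apply: h => v _ _; rewrite (ger0_norm (wt0 v)).
by rewrite ler_pdivrMr// (_ : W * (t - s) * 2 = 2 * W * (t - s)); last by ring.
Qed.

(** [D v] heats [U v] back to time [s] and adds the contribution of the source on [[s, v]]. It
    equals the left side at [v = s] and the right side at [v = 1], where [U] vanishes, and it is
    constant because its increments are quadratic. *)
Lemma duhamel s x : 0 <= s -> s <= 1 ->
  U s x = Int (fun v => ind s 1 v * (wt v * heat (w v - w s) (G v) x)).
Proof.
move=> s0 s1; pose a v := w v - w s.
have ac : continuous a by move=> v; apply: cvgB; [exact: wc|exact: cvg_cst].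
pose h v y := wt v * G v y.
have ch v : continuous (h v) by move=> y; apply: cvgZr; exact: (der_cont (dG v)).
have mh y : measurable_fun setT (h^~ y) by apply: measurable_funM.
have bh v y : `|h v y| <= W * D0.
  by rewrite /h normrM; apply: ler_pM => //; rewrite (ger0_norm (wt0 v)).
have hE b v y : heat b (h v) y = wt v * heat b (G v) y.
  by rewrite /h heatZ//; apply: (@eg_bdd _ D0) => //; exact: (der_cont (dG v)).
have mq (q : R -> R) : continuous q -> measurable_fun setT q by move=> ?; exact: continuous_measurable_fun.
have iI q v v' : measurable_fun setT q -> intg (fun r => ind v v' r * (wt r * heat (q r) (G r) x)).
  move=> mqq; have := intg_heat_time ch mh bh mqq v v' x.
  by apply: eq_integrable => // r _ /=; rewrite hE.
pose D v := heat (a v) (U v) x + Int (fun r => ind s v r * (wt r * heat (a r) (G r) x)).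
have Ds : D s = U s x.
  rewrite /D /a subrr heat0; have := @Int_ind_bound (fun r => wt r * heat (a r) (G r) x) s s (W * D0) (lexx s) (iI _ _ _ (mq _ ac)).
  rewrite subrr mulr0 => hb; rewrite (_ : Int _ = 0) ?addr0//; apply/eqP; rewrite -normr_le0; apply: hb => v _ _.
  by rewrite -hE; apply: heat_bound => // ; exact: continuous_measurable_fun.
have D1e : D 1 = Int (fun r => ind s 1 r * (wt r * heat (a r) (G r) x)).
  by rewrite /D (_ : heat _ _ _ = 0) ?add0r// (_ : U 1 = fun=> 0) ?heat_cst//; apply/funext => y; exact: Uend.
rewrite -Ds -[RHS]D1e; apply/esym.
(* The first part of the constant is the remainder of the heat flow over a clock increment of at
   most [2 * W * (v' - v)]; the second comes from freezing the second derivative of [U] and the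
   heating time of the source on [[v, v']]. *)
apply: (@quad_const _ D (C4 / 4 * (2 * W) ^+ 2 + W * (L + D2 * W))) => // v v' sv vv' v'1.
have v0 : 0 <= v := le_trans s0 sv.
have v'0 : 0 <= v' := le_trans v0 vv'.
have v1 : v <= 1 := le_trans vv' v'1.
have av0 : 0 <= a v by rewrite subr_ge0; exact: wm.
have avv : a v <= a v' by rewrite lerD2r; exact: wm.
have inc2 : heat (a v) (U v) x - heat (a v) (U v') x =
    Int (fun r => ind v v' r * (wt r * (heat (a v) (U2 r) x + heat (a v) (G r) x))).
  rewrite -heatB; [|apply: (@eg_bdd _ C0); [exact: der_cont (dU v)|by move=> y; exact: b0]
                   |apply: (@eg_bdd _ C0); [exact: der_cont (dU v')|by move=> y; exact: b0]].
  have -> : (fun y => U v y - U v' y) = (fun y => Int (fun r => ind v v' r * src r y)).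
    by apply/funext => y; rewrite (incr y v0 vv' v'1) addrK.
  transitivity (Int (fun r => ind v v' r * heat (a v) (src r) x)).
    by rewrite (@heat_time_swap src _ csrc msrc src_bd (fun=> a v) (@measurable_cst _ _ _ _ _ _)).
  apply: eq_Int => r; have [/andP[r0 r1]|] := boolP (v <= r <= v'); last first.
    by rewrite negb_and -!ltNge => hr; rewrite ind0// !mul0r.
  have r00 := le_trans v0 r0; have r11 := le_trans r1 v'1.
  have g1 : egrow (U2 r) by apply: (@eg_bdd _ C2); [exact: der_cont (dU2 r)|by move=> y; exact: b2].
  have g2 : egrow (G r) by apply: (@eg_bdd _ D0); [exact: der_cont (dG r)|by move=> y; exact: e0].
  by rewrite /src heatZ ?heatD//; exact: egrowD.
have iw : intg (fun r => ind v v' r * (wt r * heat (a v) (U2 v') x)).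
  apply: (@intg_le _ _ (fun r => W * C2 * ind v v' r)).
  - apply: measurable_funM; first exact: measurable_ind.
    exact: measurable_funM.
  - move=> r; rewrite normrM mulrC (ger0_norm (ind_ge0 v v' r)) ler_wpM2r ?ind_ge0//.
    rewrite normrM; apply: ler_pM => //; first by rewrite (ger0_norm (wt0 r)).
    by apply: heat_bound; [apply: continuous_measurable_fun; exact: der_cont (dU2 v')|move=> y; exact: b2].
  by apply: intgZl; exact: intg_ind.
have isr : intg (fun r => ind v v' r * (wt r * (heat (a v) (U2 r) x + heat (a v) (G r) x))).
  have := @intg_heat_time src _ csrc msrc src_bd (fun=> a v) (@measurable_cst _ _ _ _ _ _) v v' x.
  apply: eq_integrable => // r _ /=; congr (_%:E).
  have [/andP[r0 r1]|] := boolP (v <= r <= v'); last first.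
    by rewrite negb_and -!ltNge => hr; rewrite ind0// !mul0r.
  have r00 := le_trans v0 r0; have r11 := le_trans r1 v'1.
  have g1 : egrow (U2 r) by apply: (@eg_bdd _ C2); [exact: der_cont (dU2 r)|by move=> y; exact: b2].
  have g2 : egrow (G r) by apply: (@eg_bdd _ D0); [exact: der_cont (dG r)|by move=> y; exact: e0].
  by rewrite /src heatZ ?heatD//; exact: egrowD.
have iG' := iI a v v' (mq _ ac).
have tay := heat_taylor x (dU v') (dU1 v') (dU2 v') (dU3 v') (mU4 v')
  (fun y => b0 y v'0 v'1) (fun y => b1 y v'0 v'1) (fun y => b2 y v'0 v'1) (fun y => b3 y v'0 v'1)
  (fun y => b4 y v'0 v'1) av0 avv.
pose E := heat (a v') (U v') x - heat (a v) (U v') x - (a v' - a v) / 2 * heat (a v) (U2 v') x.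
(* The first-order term of the expansion, written as an integral of [wt], cancels the change of [U]
   on [[v, v']] up to differences of frozen and unfrozen terms, which are of order [v' - v]. *)
have DE : D v' - D v = E + Int (fun r => ind v v' r * (wt r * heat (a v) (U2 v') x
    - wt r * (heat (a v) (U2 r) x + heat (a v) (G r) x) + wt r * heat (a r) (G r) x)).
  rewrite (_ : Int _ = (a v' - a v) / 2 * heat (a v) (U2 v') x - (heat (a v) (U v) x - heat (a v) (U v') x)
     + Int (fun r => ind v v' r * (wt r * heat (a r) (G r) x))); last first.
    rewrite inc2.
    have -> : (a v' - a v) / 2 * heat (a v) (U2 v') x = Int (fun r => ind v v' r * (wt r * heat (a v) (U2 v') x)).
      rewrite (_ : a v' - a v = w v' - w v); last by rewrite /a; ring.
      rewrite -(wI v0 vv' v'1) -IntZr; first by apply: eq_Int => r; rewrite mulrA.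
      apply: (@intg_le _ _ (fun r => W * ind v v' r)).
      - by apply: measurable_funM => //; exact: measurable_ind.
      - move=> r; rewrite normrM mulrC (ger0_norm (ind_ge0 v v' r)) ler_wpM2r ?ind_ge0//.
        by rewrite (ger0_norm (wt0 r)).
      by apply: intgZl; exact: intg_ind.
    rewrite -(IntB iw isr) -(IntD (intgB iw isr) iG').
    by apply: eq_Int => r; ring.
  rewrite /D (ind_split sv vv' (iI a s v' (mq _ ac))) /E.
  by move: (Int _) (Int _) (heat _ _ _) (heat _ _ _) (heat _ _ _) => *; ring.
rewrite DE [X in _ <= X * _]addrC mulrDl addrC; apply: (le_trans (ler_normD _ _)); apply: lerD; last first.
  apply: (le_trans tay); rewrite -[leRHS]mulrA; apply: ler_wpM2l; first by rewrite divr_ge0.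
  rewrite -exprMn; apply: lerXn2r; rewrite ?nnegrE ?subr_ge0//.
    by rewrite mulr_ge0 ?mulr_ge0// subr_ge0.
  rewrite (_ : a v' - a v = w v' - w v); last by rewrite /a; ring.
  exact: w_lip.
rewrite expr2 mulrA; apply: Int_ind_bound => //.
  have := intgD (intgB iw isr) iG'; apply: eq_integrable => // r _ /=; congr (_%:E).
  by move: (heat _ _ _) (heat _ _ _) (heat _ _ _) (heat _ _ _) => *; ring.
move=> r vr rv'; have r00 := le_trans v0 vr; have r11 := le_trans rv' v'1.
have g1 : egrow (U2 r) by apply: (@eg_bdd _ C2); [exact: der_cont (dU2 r)|by move=> y; exact: b2].
have g1' : egrow (U2 v') by apply: (@eg_bdd _ C2); [exact: der_cont (dU2 v')|by move=> y; exact: b2].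
have h1 : `|heat (a v) (U2 v') x - heat (a v) (U2 r) x| <= L * (v' - v).
  rewrite -heatB//; apply: heat_bound.
    by apply: measurable_funB; apply: continuous_measurable_fun; [exact: der_cont (dU2 v')|exact: der_cont (dU2 r)].
  move=> y; rewrite distrC; apply: (le_trans (U2L y r00 rv' v'1)); apply: ler_wpM2l => //.
  by rewrite lerD2l lerN2.
have h2 : `|heat (a r) (G r) x - heat (a v) (G r) x| <= D2 * W * (v' - v).
  have avr : a v <= a r by rewrite lerD2r; exact: wm.
  apply: (le_trans (heat_lip (dG r) (dG1 r) (mG2 r) (e0 r) (e1 r) (e2 r) x av0 avr)).
  rewrite (_ : a r - a v = w r - w v); last by rewrite /a; ring.
  have q1 := w_lip v0 vr r11.
  have q2 : D2 / 2 * (w r - w v) <= D2 / 2 * (2 * W * (r - v)) by apply: ler_wpM2l => //; rewrite divr_ge0.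
  apply: (le_trans q2); rewrite (_ : D2 / 2 * (2 * W * (r - v)) = D2 * W * (r - v)); last by field.
  by apply: ler_wpM2l; [exact: mulr_ge0|rewrite lerD2r].
rewrite (_ : wt r * _ - _ + _ = wt r * ((heat (a v) (U2 v') x - heat (a v) (U2 r) x) +
   (heat (a r) (G r) x - heat (a v) (G r) x))); last by ring.
rewrite normrM -[leRHS]mulrA; apply: ler_pM => //; first by rewrite (ger0_norm (wt0 r)).
by apply: (le_trans (ler_normD _ _)); rewrite [leRHS]mulrDl; apply: lerD.
Qed.
End Duhamel.
End HeatTime.

(** * Uniqueness of weak solutions *)

Section Mollifier.
Context {R : realType}.
Notation mu := (@lebesgue_measure R).
Implicit Types (f g k : R -> R) (t x y r C L : R) (n : nat).

(** One-sided: supported in [[0, 1 / (n + 1)]], so the average at [x] sees only points just to the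
    left of [x]. *)
Definition mol n y : R := n.+1%:R * rho (n.+1%:R * y).

Lemma csm_mol n : csm (mol n).
Proof.
split.
  move=> i; apply: CnZ; apply: (@Cn_eq _ _ (fun y => rho (n.+1%:R * y + 0))); last exact/Cn_affine/smooth1_rho.
  by move=> y; rewrite addr0.
exists 1 => // x; rewrite lter_normr => h; rewrite /mol rho_vanish ?mulr0//.
have n1 : (1 : R) <= n.+1%:R by rewrite ler1n.
move: h => /orP[h|h]; apply/orP.
  by right; apply: (lt_le_trans h); rewrite ler_peMl//; lra.
by left; rewrite pmulr_rlt0//; lra.
Qed.

Lemma mol_out n y : (y < 0) || (n.+1%:R^-1 < y) -> mol n y = 0.
Proof.
move=> h; rewrite /mol rho_vanish ?mulr0//; move: h => /orP[h|h]; apply/orP; [left|right].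
  by rewrite pmulr_rlt0.
by move: h; rewrite -[X in X < _ -> _]div1r ltr_pdivrMr// mulrC.
Qed.

Lemma norm1_mol n : norm1 (mol n) = norm1 (@rho R).
Proof.
have ir := intg_norm (csm_intg (@csm_rho R)).
have n0 : (0 : R) < n.+1%:R by [].
rewrite /norm1 (@Int_affine _ n.+1%:R 0 _ n0 ir) -(IntZl _ (intg_affine 0 n0 ir)).
by apply: eq_Int => y; rewrite /mol normrM add0r ger0_norm.
Qed.

Lemma Int_mol n : Int (mol n) = 1.
Proof.
have n0 : (0 : R) < n.+1%:R by [].
rewrite -(@Int_rho R) (@Int_affine _ n.+1%:R 0 _ n0 (csm_intg (@csm_rho R))) -IntZl.
  by apply: eq_Int => y; rewrite /mol add0r.
exact: intg_affine n0 (csm_intg (@csm_rho R)).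
Qed.

Lemma mol_le : exists2 M, 0 <= M & forall n y, `|mol n y| <= n.+1%:R * M.
Proof.
have [M [r [M0 r0 hM]]] := csm_dom (@csm_rho R).
exists M => // n y; rewrite /mol normrM ger0_norm//; apply: ler_wpM2l => //.
by apply: (le_trans (hM _)); rewrite ler_piMr// ind_le1.
Qed.

Lemma mol_sub f n x : intg (fun y => f y * mol n (x - y)) ->
  Int (fun y => f y * mol n (x - y)) - f x = Int (fun y => (f y - f x) * mol n (x - y)).
Proof.
move=> i; have im := intg_refl x (csm_intg (csm_mol n)).
rewrite -[X in _ - X]mulr1 -(Int_mol n) -(Int_refl x (csm_intg (csm_mol n))) -(IntZl _ im).
rewrite -(IntB i (intgZl _ im)); apply: eq_Int => y; ring.
Qed.

Lemma mol_near f n x C : continuous f -> (forall y, x - n.+1%:R^-1 <= y -> y <= x -> `|f y - f x| <= C) ->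
  0 <= C -> intg (fun y => f y * mol n (x - y)) ->
  `|Int (fun y => f y * mol n (x - y)) - f x| <= C * norm1 (@rho R).
Proof.
move=> cf fC C0 i; rewrite mol_sub//; have im := intg_refl x (csm_intg (csm_mol n)).
have i' : intg (fun y => (f y - f x) * mol n (x - y)).
  have := intgB i (intgZl (f x) im); congr (intg _); apply/funext => y; ring.
apply: (le_trans (le_norm_Int i')).
rewrite -(norm1_mol n) /norm1 -(Int_refl x (intg_norm (csm_intg (csm_mol n)))) -IntZl; last exact: intg_norm.
apply: le_Int; [exact: intg_norm|by apply: intgZl; exact: intg_norm|move=> y].
rewrite normrM; have [/andP[h1 h2]|] := boolP (x - n.+1%:R^-1 <= y <= x).
  by apply: ler_wpM2r => //; exact: fC.
rewrite negb_and -!ltNge => h; rewrite mol_out ?normr0 ?mulr0//.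
by move: h => /orP[h|h]; apply/orP; [right; rewrite ltrBrDl; move: h; rewrite ltrBrDr|left; rewrite subr_lt0].
Qed.

Lemma ball_dev_intg f x r C : measurable_fun setT f -> (forall y, `|f y| <= C) ->
  intg (fun y => \1_(ball x r : set R) y * `|f y - f x|).
Proof.
move=> mf fC.
apply: (@intg_le _ _ (fun y => (C + C) * ind (x - r) (x + r) y)); last by apply: intgZl; exact: intg_ind.
  apply: measurable_funM; first by apply: measurable_indic; exact: measurable_ball.
  by apply: measurableT_comp => //; apply: measurable_funB.
move=> y; rewrite normrM normr_id indicE; have [yb|yb] := pselect ((ball x r : set R) y); last first.
  rewrite (memNset yb) normr0 mul0r mulr_ge0// ?ind_ge0// addr_ge0//; exact: le_trans (fC 0).
rewrite (mem_set yb) normr1 mul1r; have {}yb : `|x - y| < r := yb.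
have /andP[h1 h2] : x - r <= y <= x + r by move: yb; rewrite ltr_norml => /andP[h1 h2]; apply/andP; split; lra.
by rewrite ind1// mulr1; apply: (le_trans (ler_normB _ _)); exact: lerD.
Qed.

Lemma davgE f x r C : 0 < r -> measurable_fun setT f -> (forall y, `|f y| <= C) ->
  davg f x r = ((r *+ 2)^-1 * Int (fun y => \1_(ball x r) y * `|f y - f x|))%:E.
Proof.
move=> r0 mf fC; rewrite /davg /iavg lebesgue_measure_ball ?ltW// inver.
rewrite mulrn_eq0 /= gt_eqF// EFinM; congr (_ * _)%E.
rewrite -IntE; last first. exact: ball_dev_intg mf fC.
rewrite integral_mkcond; apply: eq_integral => y _; rewrite patchE indicE.
by case: (y \in _); rewrite ?mul1r ?mul0r.
Qed.

(** The ball of radius [2 / (n + 1)] contains the support of the kernel, which is at most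
    [M * (n + 1)]; at a Lebesgue point the mean deviation over this ball is small, so the averages
    come close to [f x]. *)
Lemma lebesgue_pt_le f x C L : measurable_fun setT f -> (forall y, `|f y| <= C) ->
  lebesgue_pt f x -> (forall n, `|Int (fun y => f y * mol n (x - y))| <= L) -> `|f x| <= L.
Proof.
move=> mf fC lp hL; rewrite leNgt; apply/negP => Lf.
have [M M0 hM] := mol_le.
(* The average differs from [f x] by at most [4 * M] times the mean deviation over the ball of
   radius [2 / (n + 1)]; a deviation below [e] therefore contradicts the gap [|f x| - L]. *)
pose e := (`|f x| - L) / (4 * M + 1).
have M4 : 0 < 4 * M + 1 by rewrite ltr_wpDl// mulr_ge0.
have e0 : 0 < e by rewrite divr_gt0// subr_gt0.
have : \forall r \near 0^'+, (davg f x r < e%:E)%E.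
  by apply: (lp [set y | (y < e%:E)%E]); apply: open_nbhs_nbhs; split; [exact: open_ereal_lt_ereal|rewrite /= lte_fin].
rewrite /at_right /within => -[/= d d0 hd].
have [n nd] : exists n, 2 / n.+1%:R < d.
  have [n] := ltr_add_invr (divr_gt0 d0 (ltr0n R 2)); rewrite add0r => h; exists n.
  by rewrite mulrC -ltr_pdivlMr.
pose r : R := 2 / n.+1%:R; have r0 : 0 < r by rewrite divr_gt0.
have := hd r; rewrite /= sub0r normrN gtr0_norm// => /(_ nd r0).
rewrite (davgE x r0 mf fC) lte_fin => hr.
have ck := csm_mol n.
have i : intg (fun y => f y * mol n (x - y)) := @intg_conv R (mol n) (fun=> f) 0 x C ck mf fC.
have im := intg_refl x (csm_intg ck).
have i' : intg (fun y => (f y - f x) * mol n (x - y)).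
  have := intgB i (intgZl (f x) im); congr (intg _); apply/funext => y; ring.
set A := Int _ in hr.
have iA : intg (fun y => \1_(ball x r) y * `|f y - f x|). exact: ball_dev_intg mf fC.
have h1 : `|Int (fun y => f y * mol n (x - y)) - f x| <= n.+1%:R * M * A.
  rewrite mol_sub//; apply: (le_trans (le_norm_Int i')); rewrite -IntZl//.
  apply: le_Int; [exact: intg_norm|exact: intgZl|move=> y].
  rewrite normrM mulrC; have [yb|yb] := pselect ((ball x r : set R) y).
    by rewrite indicE (mem_set yb) mul1r; apply: ler_wpM2r => //; exact: hM.
  rewrite mol_out ?normr0 ?mul0r; first by rewrite mulr_ge0 ?mulr_ge0.
  apply/negPn/negP; rewrite negb_or -!leNgt => /andP[h1 h2]; apply: yb; suff : `|x - y| < r by [].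
  rewrite ger0_norm// /r; apply: (le_lt_trans h2); rewrite -[X in X < _]mul1r ltr_pM2r ?invr_gt0//; lra.
have h2 : n.+1%:R * M * A <= 4 * M * e.
  have -> : n.+1%:R * M * A = 4 * M * ((r *+ 2)^-1 * A).
    have fld (v c B : R) : v != 0 -> v * c * B = 4 * c * ((2 / v *+ 2)^-1 * B).
      by move=> v0; rewrite -(mulr_natr (2 / v)); field.
    exact: fld.
  by apply: ler_wpM2l; [exact: mulr_ge0|exact: ltW].
have h3 : (4 * M + 1) * e = `|f x| - L by rewrite /e mulrC divfK// gt_eqF.
have h4 : `|f x| <= `|Int (fun y => f y * mol n (x - y))| + `|Int (fun y => f y * mol n (x - y)) - f x|.
  by rewrite addrC -lerBlDr; apply: (le_trans (lerB_dist _ _)); rewrite distrC.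
have h5 := hL n; move: h1 h2 h3 h4 h5; rewrite mulrDl mul1r.
move: (Int _) (A) => I A' *; move: (n.+1%:R * M * A') (4 * M * e) `|I - f x| => *; lra.
Qed.

Lemma locally_integrable_bdd f C : measurable_fun setT f -> (forall y, `|f y| <= C) -> locally_integrable setT f.
Proof.
move=> mf fC; split => // [|K _ cK]; first exact: openT.
have mK : measurable (K : set (measurableTypeR R)) by apply: closed_measurable; exact: compact_closed.
apply: (@le_lt_trans _ _ (\int[mu]_(y in K) (cst C%:E) y)%E).
  apply: ge0_le_integral => //.
  - by apply/measurable_EFinP; apply: measurableT_comp => //; exact: measurable_funTS.
  - by move=> y _; rewrite lee_fin; exact: le_trans (fC y).
rewrite integral_cst//; apply: lte_mul_pinfty => //; first by rewrite lee_fin; exact: le_trans (fC 0).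
exact: compact_finite_measure.
Qed.

Lemma mol_bound_ae f C L : measurable_fun setT f -> (forall y, `|f y| <= C) ->
  (forall n x, `|Int (fun y => f y * mol n (x - y))| <= L) -> {ae mu, forall x, `|f x| <= L}.
Proof.
move=> mf fC h; apply: (ae_imply _ (lebesgue_differentiation (locally_integrable_bdd mf fC))) => x lp.
by apply: (lebesgue_pt_le mf fC lp) => n.
Qed.

Lemma conv_bound_ae k g C L x : csm k -> measurable_fun setT g -> (forall y, `|g y| <= C) -> 0 <= L ->
  {ae mu, forall y, `|g y| <= L} -> `|Int (fun y => g y * k (x - y))| <= L * norm1 k.
Proof.
move=> ck mg gC L0 gL; pose g' y := Num.max (- L) (Num.min L (g y)).
have mg' : measurable_fun setT g' by apply: measurable_maxr => //; exact: measurable_minr.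
have g'L y : `|g' y| <= L.
  by rewrite ler_norml /g' le_max lexx /= ge_max ge_min lexx /= andbT; lra.
have -> : Int (fun y => g y * k (x - y)) = Int (fun y => g' y * k (x - y)).
  have mk := csm_shift_meas x ck.
  apply: (@ae_eq_Rintegral R _ _ mu setT _ _ measurableT (measurable_funM mg mk) (measurable_funM mg' mk)).
  apply: (ae_imply _ gL) => y; rewrite ler_norml => /andP[h1 h2] _.
  by rewrite /= /g' min_r// max_r.
exact: (@conv_bound R k (fun=> g') 0 x L ck mg' g'L).
Qed.

Lemma lip_derive_bound g x l C : is_derive x 1 g l -> (forall y, `|g x - g y| <= C * `|x - y|) -> `|l| <= C.
Proof.
move=> dg gC; have [d <-] := dg.
have h := @cvg_norm _ _ _ _ (dnbhs_filter (0 : R)) _ _ d; rewrite -['D_1 g x]/(lim _) -(cvg_lim _ h)//; apply: limr_le; first by apply/cvg_ex; eexists; exact: h.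
near=> e; have e0 : e != 0 by near: e; exact: nbhs_dnbhs_neq.
rewrite normrM normfV ler_pdivrMl ?normr_gt0// mulrC distrC; apply: (le_trans (gC _)).
by rewrite /GRing.scale /= mulr1 opprD addrCA subrr addr0 normrN.
Unshelve. all: by end_near.
Qed.
End Mollifier.

(** * The linear equation for a difference of two solutions *)

Section Linear.
Context {R : realType}.
Notation mu := (@lebesgue_measure R).
(** [u] stands for a difference of solutions, [z] for its weak derivative in [x], [f] for the
    difference of the quadratic terms. [I1] says that [z] is this derivative; [I2] says that
    [u_t = - wd / 2 * (u_xx + f)] with [u = 0] at time 1. Both are tested with products only. *)
Variables (u z f : R -> R -> R) (w wd : R -> R) (Z F W : R).
Hypothesis cu : continuous (fun p : R * R => u p.1 p.2).
Hypotheses (mz : meas2 z) (bz : forall t x, `|z t x| <= Z * ind 0 1 t).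
Hypotheses (mf : meas2 f) (bf : forall t x, `|f t x| <= F * ind 0 1 t).
Hypothesis wc : continuous w.
Hypothesis wdc : continuous wd.
Hypothesis wm : forall s t : R, s <= t -> w s <= w t.
Hypothesis wsm : forall s t : R, 0 <= s -> s < t -> t <= 1 -> w s < w t.
Hypothesis dw : forall t : R, 0 < t -> t < 1 -> is_derive t 1 w (wd t).
Hypothesis wd0 : forall t, 0 <= t -> t <= 1 -> 0 <= wd t.
Hypothesis wdW : forall t, 0 <= t -> t <= 1 -> wd t <= W.
Hypothesis I1 : forall (a b : R -> R) (a1 a2 b1 b2 : R), smooth1 a -> smooth1 b ->
  0 < a1 -> a2 < 1 -> (forall t, (t < a1) || (a2 < t) -> a t = 0) ->
  (forall x, (x < b1) || (b2 < x) -> b x = 0) ->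
  Int (fun t => ind 0 1 t * (a t * (Int (fun x => u t x * derive1 b x) + Int (fun x => z t x * b x)))) = 0.
Hypothesis I2 : forall (a b : R -> R) (a1 a2 b1 b2 : R), smooth1 a -> smooth1 b ->
  0 < a1 -> (forall t, (t < a1) || (a2 < t) -> a t = 0) ->
  (forall x, (x < b1) || (b2 < x) -> b x = 0) ->
  Int (fun t => ind 0 1 t * (- derive1 a t * Int (fun x => u t x * b x) +
    a t * (wd t / 2 * (Int (fun x => u t x * derive1 (derive1 b) x) + Int (fun x => f t x * b x))))) = 0.
Implicit Types (k g : R -> R) (s t x y C : R).

Lemma refl_vanish k x : csm k -> exists b1 b2, forall y, (y < b1) || (b2 < y) -> k (x - y) = 0.
Proof.
move=> [_ [r r0 kr]]; exists (x - r), (x + r) => y h; apply: kr; rewrite lter_normr.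
by move: h => /orP[h|h]; apply/orP; [left|right]; lra.
Qed.

Lemma ind01_le1 C t : 0 <= C -> C * ind 0 1 t <= C.
Proof. by move=> C0; rewrite ler_piMr// ind_le1. Qed.

Lemma Z_ge0 : 0 <= Z.
Proof. by have := le_trans (normr_ge0 _) (bz 0 0); rewrite ind1// mulr1. Qed.

Lemma F_ge0 : 0 <= F.
Proof. by have := le_trans (normr_ge0 _) (bf 0 0); rewrite ind1// mulr1. Qed.

Lemma W_ge0 : 0 <= W.
Proof. exact: le_trans (wd0 (lexx 0) ler01) (wdW (lexx 0) ler01). Qed.

Lemma conv_f_bound k t x : csm k -> `|conv k f t x| <= F * norm1 k.
Proof.
move=> ck; apply: conv_bound => //; first exact: (meas2_l mf).
by move=> y; apply: (le_trans (bf t y)); exact: ind01_le1 F_ge0.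
Qed.

Lemma conv_z_bound k t x : csm k -> `|conv k z t x| <= Z * norm1 k.
Proof.
move=> ck; apply: conv_bound => //; first exact: (meas2_l mz).
by move=> y; apply: (le_trans (bz t y)); exact: ind01_le1 Z_ge0.
Qed.

Lemma conv_u_derive k t x : csm k -> is_derive x 1 (conv k u t) (conv (derive1 k) u t x).
Proof.
move=> ck; have cut := cont_l (t := t) cu.
apply: dconv => //; first exact: continuous_measurable_fun.
by move=> b; have [M _ hM] := segment_bound (- b) b cut; exists M => y; rewrite ler_norml => /andP[h1 h2]; exact: hM.
Qed.

Lemma conv_f_derive k t x : csm k -> is_derive x 1 (conv k f t) (conv (derive1 k) f t x).
Proof.
move=> ck; apply: dconv => //; first exact: (meas2_l mf).
move=> b; exists F => y _; apply: (le_trans (bf t y)); exact: ind01_le1 F_ge0.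
Qed.

Lemma conv_u_intg k t x : csm k -> intg (fun y => u t y * k (x - y)).
Proof.
move=> ck; have [b1 [b2 vb]] := refl_vanish x ck.
have ckx : continuous (fun y => k (x - y)) by apply: smooth1_cont; exact: refl_smooth ck.1.
have cut : continuous (u t) := cont_l (t := t) cu.
apply: (@cs_intg _ _ (Num.max `|b1| `|b2|)).
  by move=> y; apply: continuousM; [exact: cut|exact: ckx].
move=> y; rewrite gt_max => /andP[h1 h2]; rewrite vb ?mulr0//.
have [y0|y0] := lerP 0 y.
  by rewrite (ger0_norm y0) in h2; rewrite (le_lt_trans (ler_norm b2) h2) orbT.
rewrite (ltr0_norm y0) in h1; have := le_lt_trans (ler_norm (- b1)); rewrite normrN => /(_ _ h1) => h.
by apply/orP; left; lra.
Qed.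

(** The exceptional set of times depends on the kernel and on the point, which has to be repaired by
    countability and continuity in [contract]. *)
Lemma conv_z_ae k x : csm k ->
  {ae mu, forall t, 0 < t -> t < 1 -> conv (derive1 k) u t x = conv k z t x}.
Proof.
move=> ck.
have cK := @conv_cont_t R _ u x (csm_derive ck) cu.
have mK := @conv_meas_t R k z x Z ck mz bz.
pose H t := ind 0 1 t * (- conv (derive1 k) u t x + conv k z t x).
have [M M0 hM] := segment_bound 0 1 cK.
have mH : measurable_fun setT H.
  apply: measurable_funM; first exact: measurable_ind.
  by apply: measurable_funD => //; apply: measurable_funN; exact: continuous_measurable_fun.
have bH t : `|H t| <= M + Z * norm1 k.
  rewrite /H; have [/andP[t0 t1]|] := boolP (0 <= t <= 1); last first.
    rewrite negb_and -!ltNge => h; rewrite ind0// mul0r normr0 addr_ge0// mulr_ge0 ?Z_ge0//.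
    exact: norm1_ge0.
  rewrite ind1// mul1r; apply: (le_trans (ler_normD _ _)); rewrite normrN; apply: lerD; first exact: hM.
  exact: conv_z_bound.
apply: (ae_imply _ (interior_identity mH bH _)) => [t h t0 t1|a a1 a2 sa a10 a21 va].
  move: (h t0 t1); rewrite /H ind1 ?ltW// mul1r => /eqP; rewrite addrC subr_eq0 => /eqP ->; done.
have [b1 [b2 vb]] := refl_vanish x ck.
apply: etrans (I1 sa (refl_smooth x ck.1) a10 a21 va vb); apply: eq_Int => t.
rewrite /H; have [/andP[t0 t1]|] := boolP (0 <= t <= 1); last first.
  by rewrite negb_and -!ltNge => h; rewrite ind0// !mul0r.
rewrite ind1// !mul1r; congr (_ * (_ + _)).
by rewrite /conv -IntN; [apply: eq_Int => y; rewrite refl_derive; [rewrite mulrN|exact: ck.1]|exact: conv_u_intg (csm_derive ck)].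
Qed.


Lemma refl_derive2 k x y : csm k -> derive1 (derive1 (fun y => k (x - y))) y = derive1 (derive1 k) (x - y).
Proof.
move=> ck; rewrite (_ : derive1 (fun y => k (x - y)) = fun y => - derive1 k (x - y)); last first.
  by apply/funext => v; rewrite refl_derive//; exact: ck.1.
have sk := smooth1_derive ck.1.
have h := smooth1_is_derive y (refl_smooth x sk).
rewrite (derive1_val (is_deriveN h)) refl_derive//; exact: opprK.
Qed.

(** Half the speed of the clock, extended by 0 so as to be bounded on the whole line. *)
Definition wt t : R := ind 0 1 t * (wd t / 2).

Lemma wtE t : 0 <= t -> t <= 1 -> wt t = wd t / 2.
Proof. by move=> t0 t1; rewrite /wt ind1// mul1r. Qed.

Lemma wt_out t : ~~ (0 <= t <= 1) -> wt t = 0.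
Proof. by rewrite negb_and -!ltNge => h; rewrite /wt ind0// mul0r. Qed.

Lemma wt_ge0 t : 0 <= wt t.
Proof.
have [/andP[t0 t1]|h] := boolP (0 <= t <= 1); last by rewrite wt_out.
by rewrite wtE// divr_ge0// wd0.
Qed.

Lemma wt_le t : wt t <= W / 2.
Proof.
have [/andP[t0 t1]|h] := boolP (0 <= t <= 1); last by rewrite wt_out// divr_ge0// W_ge0.
by rewrite wtE// ler_pM2r// wdW.
Qed.

Lemma measurable_wt : measurable_fun setT wt.
Proof.
apply: measurable_funM; first exact: measurable_ind.
apply: measurable_funM => //; exact: continuous_measurable_fun.
Qed.

Definition src k t x : R := wt t * (conv (derive1 (derive1 k)) u t x + conv k f t x).

Lemma measurable_src k x : csm k -> measurable_fun setT (src k ^~ x).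
Proof.
move=> ck; have c2 := csm_derive (csm_derive ck).
apply: measurable_funM; first exact: measurable_wt.
apply: measurable_funD; last exact: (@conv_meas_t R k f x F ck mf bf).
by apply: continuous_measurable_fun; exact: (@conv_cont_t R _ u x c2 cu).
Qed.

Lemma terminal_src k t x : csm k -> 0 <= t -> t <= 1 ->
  conv k u t x = Int (fun s => ind t 1 s * src k s x).
Proof.
move=> ck t0 t1; have c2 := csm_derive (csm_derive ck).
have cK := @conv_cont_t R _ u x c2 cu.
have [M M0 hM] := segment_bound 0 1 cK.
apply: (@terminal_identity R (fun t => conv k u t x) (src k ^~ x) (W / 2 * (M + F * norm1 k))) => //.
- exact: (@conv_cont_t R k u x ck cu).
- exact: measurable_src.
- move=> s; rewrite /src; have [/andP[s0 s1]|h] := boolP (0 <= s <= 1); last first.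
    rewrite wt_out// mul0r normr0 mulr_ge0 ?divr_ge0 ?W_ge0// addr_ge0// mulr_ge0 ?F_ge0//.
    exact: norm1_ge0.
  rewrite normrM; apply: ler_pM => //; first by rewrite (ger0_norm (wt_ge0 s)) wt_le.
  by apply: (le_trans (ler_normD _ _)); apply: lerD; [exact: hM|exact: conv_f_bound].
move=> a a1 a2 sa a10 va; have [b1 [b2 vb]] := refl_vanish x ck.
apply: etrans (I2 sa (refl_smooth x ck.1) a10 va vb); apply: eq_Int => s.
have [/andP[s0 s1]|] := boolP (0 <= s <= 1); last first.
  rewrite negb_and -!ltNge => /ind0 ->; exact: etrans (mul0r _) (esym (mul0r _)).
have e2 : conv (derive1 (derive1 k)) u s x =
    Int (fun y => u s y * derive1 (derive1 (fun y => k (x - y))) y).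
  by apply: eq_Int => y; rewrite refl_derive2.
have -> : src k s x = wd s / 2 * (Int (fun y => u s y * derive1 (derive1 (fun y => k (x - y))) y) +
    Int (fun y => f s y * k (x - y))).
  by rewrite /src (wtE s0 s1) e2.
reflexivity.
Qed.

(** [u] has no a priori bound in [x], but the derivative of its mollification is the mollification
    of the bounded [z]. This holds for almost every time and extends to all of them by
    continuity. *)
Lemma conv_u_bound1 k t x : csm k -> 0 <= t -> t <= 1 -> `|conv (derive1 k) u t x| <= Z * norm1 k.
Proof.
move=> ck t0 t1; rewrite -subr_le0.
apply: (@ae_cont_le0 R (fun t => `|conv (derive1 k) u t x| - Z * norm1 k)) => //.
  move=> s; apply: cvgB; last exact: cvg_cst.
  by apply: cvg_norm; exact: (@conv_cont_t R _ u x (csm_derive ck) cu).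
apply: (ae_imply _ (conv_z_ae x ck)) => s h s0 s1.
by rewrite subr_le0 h//; exact: conv_z_bound.
Qed.

Definition srcB k : R := W / 2 * (Z * norm1 (derive1 k) + F * norm1 k).

Lemma srcB_ge0 k : 0 <= srcB k.
Proof.
apply: mulr_ge0; first by rewrite divr_ge0// W_ge0.
by rewrite addr_ge0// mulr_ge0 ?Z_ge0 ?F_ge0//; exact: norm1_ge0.
Qed.

Lemma src_bound k t x : csm k -> `|src k t x| <= srcB k.
Proof.
move=> ck; rewrite /src; have [/andP[t0 t1]|h] := boolP (0 <= t <= 1); last first.
  by rewrite wt_out// mul0r normr0 srcB_ge0.
rewrite normrM; apply: ler_pM => //; first by rewrite (ger0_norm (wt_ge0 t)) wt_le.
apply: (le_trans (ler_normD _ _)); apply: lerD; last exact: conv_f_bound.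
exact: conv_u_bound1 (csm_derive ck) _ _.
Qed.

Lemma intg_src k s t x : csm k -> intg (fun v => ind s t v * src k v x).
Proof.
move=> ck; apply: (@intg_le _ _ (fun v => srcB k * ind s t v)).
- by apply: measurable_funM; [exact: measurable_ind|exact: measurable_src].
- move=> v; rewrite normrM mulrC (ger0_norm (ind_ge0 s t v)); apply: ler_wpM2r; first exact: ind_ge0.
  exact: src_bound.
by apply: intgZl; exact: intg_ind.
Qed.

Lemma conv_u_incr k s t x : csm k -> 0 <= s -> s <= t -> t <= 1 ->
  conv k u s x = Int (fun v => ind s t v * src k v x) + conv k u t x.
Proof.
move=> ck s0 st t1; rewrite !terminal_src//; [|exact: le_trans s0 st|exact: le_trans st t1].
by apply: ind_split => //; exact: intg_src.
Qed.

Lemma conv_u_lip k s t x : csm k -> 0 <= s -> s <= t -> t <= 1 ->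
  `|conv k u s x - conv k u t x| <= srcB k * (t - s).
Proof.
move=> ck s0 st t1; rewrite (conv_u_incr x ck s0 st t1) addrK.
by apply: Int_indH_bound => //; [exact: measurable_src|move=> v; exact: src_bound].
Qed.

Lemma conv_u1 k x : csm k -> conv k u 1 x = 0.
Proof.
move=> ck; rewrite terminal_src//; have h := @Int_indH_bound R (src k ^~ x) (srcB k) _ _ 1 1 (lexx 1).
apply/eqP; rewrite -normr_le0; move: h; rewrite subrr mulr0; apply; first exact: measurable_src.
by move=> v; exact: src_bound.
Qed.

(** Boundedness of the mollified [u] comes from the terminal time: it vanishes at 1 and its time
    derivative is controlled by the bounds on space derivatives. *)
Lemma conv_u_bound k t x : csm k -> 0 <= t -> t <= 1 -> `|conv k u t x| <= srcB k.
Proof.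
move=> ck t0 t1; have := conv_u_lip x ck t0 t1 (lexx 1); rewrite conv_u1// subr0 => h.
by apply: (le_trans h); rewrite ler_piMr ?srcB_ge0//; lra.
Qed.

Lemma Int_wt s t : 0 <= s -> s <= t -> t <= 1 -> Int (fun v => ind s t v * wt v) = (w t - w s) / 2.
Proof.
move=> s0 st t1; have -> : (w t - w s) / 2 = w t / 2 - w s / 2 by ring.
have c1 : continuous (fun v => wd v / 2) by move=> v; apply: cvgMl; exact: wdc.
have c2 : continuous (fun v => w v / 2) by move=> v; apply: cvgMl; exact: wc.
have <- : Int (fun v => ind s t v * (wd v / 2)) = w t / 2 - w s / 2.
  apply: (@Int_FTC R (fun v => wd v / 2) (fun v => w v / 2) s t st c1 c2).
  move=> v sv vt; have dv := dw (le_lt_trans s0 sv) (lt_le_trans vt t1).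
  have -> : (fun v => w v / 2) = (fun v => 2^-1 * w v) by apply/funext => ?; exact: mulrC.
  by rewrite mulrC; exact: (is_deriveZ (2^-1)).
apply: eq_Int => v; have [/andP[h1 h2]|] := boolP (s <= v <= t).
  by rewrite wtE//; [exact: le_trans h1|exact: le_trans t1].
by rewrite negb_and -!ltNge => h; rewrite ind0// !mul0r.
Qed.

Lemma conv_cont k (g : R -> R -> R) t : csm k -> (forall x, is_derive x 1 (conv k g t) (conv (derive1 k) g t x)) ->
  continuous (conv k g t).
Proof. by move=> ck d y; apply: differentiable_continuous; apply/derivable1_diffP; have [] := d y. Qed.

Lemma duhamel_conv k s x : csm k -> 0 <= s -> s <= 1 ->
  conv k u s x = Int (fun v => ind s 1 v * (wt v * heat (w v - w s) (conv k f v) x)).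
Proof.
move=> k0 s0 s1; have k1 := csm_derive k0; have k2 := csm_derive k1; have k3 := csm_derive k2.
have k4 := csm_derive k3.
apply: (@duhamel R (conv k u) _ _ _ _ (conv k f) _ _ w wt
  (srcB k) (Z * norm1 k) (Z * norm1 (derive1 k)) (Z * norm1 (derive1 (derive1 k)))
  (Z * norm1 (derive1 (derive1 (derive1 k)))) (srcB (derive1 (derive1 k)))
  (F * norm1 k) (F * norm1 (derive1 k)) (F * norm1 (derive1 (derive1 k))) (W / 2)
  (fun t x => conv_u_derive t x k0) (fun t x => conv_u_derive t x k1)
  (fun t x => conv_u_derive t x k2) (fun t x => conv_u_derive t x k3) _
  (fun t x => conv_f_derive t x k0) (fun t x => conv_f_derive t x k1)) => //.
- by move=> t; apply: continuous_measurable_fun; apply: conv_cont => // y; exact: conv_u_derive.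
- by move=> t; apply: continuous_measurable_fun; apply: conv_cont => // y; exact: conv_f_derive.
- by move=> y; apply: continuous_measurable_fun; exact: (@conv_cont_t R _ u y k2 cu).
- by move=> y; exact: (@conv_meas_t R k f y F k0 mf bf).
- by move=> t y; exact: conv_u_bound.
- by move=> t y; exact: conv_u_bound1.
- by move=> t y; exact: conv_u_bound1.
- by move=> t y; exact: conv_u_bound1.
- by move=> t y; exact: conv_u_bound1.
- by move=> t y; exact: conv_f_bound.
- by move=> t y; exact: conv_f_bound.
- by move=> t y; exact: conv_f_bound.
- by move=> ? ? ?; exact: conv_u_lip.
- exact: measurable_wt.
- exact: wt_ge0.
- exact: wt_le.
- exact: wt_out.
- exact: Int_wt.
- by move=> ? ? ?; exact: conv_u_incr.
- by move=> ?; exact: conv_u1.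
Qed.

Let mE : R := Eg (fun z => `|z|).

Section Gradient.
Variables (la S : R).
Hypotheses (la0 : 0 < la) (S0 : 0 <= S).
Hypothesis fS : {ae mu, forall t, forall k x, csm k -> `|conv k f t x| <= S * expR (- (la * w t)) * norm1 k}.

(* [Q] is an antiderivative of [q], which dominates the kernel
   exp (- la a) / sqrt a because exp (- y) <= 1 / (1 + y); the truncation at
   [m] keeps both continuous at the singular time. *)
Let Q (a m : R) := 2 / Num.sqrt la * atan (Num.sqrt (la * Num.max a m)).
Let q (a m d : R) := d / (Num.sqrt (Num.max a m) * (1 + la * Num.max a m)).

Let dQ (a : R -> R) (m d t : R) : continuous a -> 0 < m -> m < a t -> is_derive t 1 a d ->
  is_derive t 1 (fun t => Q (a t) m) (q (a t) m d).
Proof.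
move=> ca m0 ma da; have at0 := lt_trans m0 ma.
have nb : \forall v \near t, 2 / Num.sqrt la * atan (Num.sqrt (la * a v)) = Q (a v) m.
  have : \forall v \near t, m < a v by exact: (cvgr_gt _ (ca t)).
  by apply: filterS => v mv; rewrite /Q max_l// ltW.
apply: (near_eq_is_derive nb).
have lat : 0 < la * a t by exact: mulr_gt0.
have d1 : is_derive t 1 (fun v => la * a v) (la * d) by exact: is_deriveZ.
have d2 := @is_derive1_comp _ Num.sqrt (fun v => la * a v) t _ _ (is_derive1_sqrt lat) d1.
have d3 := @is_derive1_comp _ atan (fun v => Num.sqrt (la * a v)) t _ _ (is_derive1_atan (Num.sqrt (la * a t))) d2.
have d4 := is_deriveZ (2 / Num.sqrt la) d3.
apply: (is_derive_eq d4); rewrite /q (max_l (ltW ma)) sqr_sqrtr; last exact: ltW.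
rewrite sqrtrM ?ltW// /GRing.scale /=.
have sl : 0 < Num.sqrt la by rewrite sqrtr_gt0.
have sa : 0 < Num.sqrt (a t) by rewrite sqrtr_gt0.
have el : la = Num.sqrt la ^+ 2 by rewrite sqr_sqrtr// ltW.
have p : 1 + la * a t != 0 by rewrite gt_eqF// addr_gt0.
rewrite [la * d](_ : _ = Num.sqrt la ^+ 2 * d); last by rewrite -el.
by field; rewrite p !gt_eqF.
Qed.

(** Along the clock, the decay [exp (- la * w)] of the source and the singularity of the heat
    gradient integrate to order [1 / sqrt la]: a large [la] makes the passage from source to
    gradient small. The factor pi bounds the variation of arctan. *)
Lemma conv_grad k s x y : csm k -> 0 <= s -> s <= 1 ->
  `|conv k u s x - conv k u s y| <= (pi * mE / Num.sqrt la) * (S * norm1 k * expR (- (la * w s))) * `|x - y|.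
Proof.
move=> ck s0 s1; set N := S * norm1 k * _; pose a v := w v - w s.
have nk := norm1_ge0 k; have mE0 : 0 <= mE by apply: Eg_ge0 => v; exact: normr_ge0.
have N0 : 0 <= N by rewrite /N !mulr_ge0// expR_ge0.
have sl : 0 < Num.sqrt la by rewrite sqrtr_gt0.
have ca : continuous a by move=> v; apply: cvgB; [exact: wc|exact: cvg_cst].
move: s1; rewrite le_eqVlt => /predU1P[s1|s1].
  rewrite [X in conv k u X](_ : s = 1)// !conv_u1// subrr normr0; apply: mulr_ge0 => //; apply: mulr_ge0 => //.
  by apply: divr_ge0; [exact: mulr_ge0 (pi_ge0 R) mE0|exact: ltW].
have cG v : continuous (conv k f v) by apply: conv_cont => // r; exact: conv_f_derive.
have mG v : measurable_fun setT (conv k f v) by exact: continuous_measurable_fun.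
have [NN [mN NN0 NP]] := fS.
have GN v r : ~ NN v -> `|conv k f v r| <= N * expR (- (la * a v)).
  move=> nv; have -> : N * expR (- (la * a v)) = S * expR (- (la * w v)) * norm1 k.
    rewrite /N /a (_ : - (la * w v) = - (la * w s) + - (la * (w v - w s))); last by ring.
    by rewrite expRD; ring.
  by apply: contrapT => np; apply: nv; apply: NP => /= /(_ k r ck).
have as0 v : s <= v -> 0 <= a v by move=> sv; rewrite subr_ge0; exact: wm.
have GN1 v r : ~ NN v -> s <= v -> `|conv k f v r| <= N.
  move=> nv sv; apply: (le_trans (GN v r nv)); rewrite ler_piMr// -expR0 ler_expR oppr_le0.
  by rewrite mulr_ge0 ?as0// ltW.
pose h v r := wt v * conv k f v r.
have ch v : continuous (h v) by move=> r; apply: cvgZr; exact: cG.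
have mh r : measurable_fun setT (h^~ r).
  by apply: measurable_funM; [exact: measurable_wt|exact: (@conv_meas_t R k f r F ck mf bf)].
have bh v r : `|h v r| <= W / 2 * (F * norm1 k).
  rewrite /h normrM; apply: ler_pM => //; first by rewrite (ger0_norm (wt_ge0 v)) wt_le.
  exact: conv_f_bound.
have ma : measurable_fun setT a by exact: continuous_measurable_fun.
have eG v : egrow (conv k f v) by apply: (@egrow_bdd _ _ (F * norm1 k)) => // r; exact: conv_f_bound.
have iI b c r : intg (fun v => ind b c v * (wt v * heat (a v) (conv k f v) r)).
  have := intg_heat_time ch mh bh ma b c r.
  by apply: eq_integrable => // v _ /=; rewrite /h heatZ.
pose H v := wt v * (heat (a v) (conv k f v) x - heat (a v) (conv k f v) y).
have HE b c : (fun v => ind b c v * H v) = (fun v => ind b c v * (wt v * heat (a v) (conv k f v) x) -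
   ind b c v * (wt v * heat (a v) (conv k f v) y)) by apply/funext => v; rewrite /H [wt v * (_ - _)]mulrBr mulrBr.
have iH b c : intg (fun v => ind b c v * H v) by rewrite HE; exact: intgB.
have -> : conv k u s x - conv k u s y = Int (fun v => ind s 1 v * H v).
  by rewrite HE (IntB (iI s 1 x) (iI s 1 y)) (duhamel_conv x ck s0 (ltW s1)) (duhamel_conv y ck s0 (ltW s1)).
(* The bound on the source is known off the null set [NN]; [H'] erases the integrand on [NN] without
   changing the integral. *)
pose H' v := \1_(~` NN) v * H v.
have H'1 v C : 0 <= C -> (~ NN v -> `|H v| <= C) -> `|H' v| <= C.
  move=> C0 hv; rewrite /H' indicE; have [nv|nv] := pselect (NN v).
    by rewrite (memNset (fun h : (~` NN) v => h nv)) mul0r normr0.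
  by rewrite (mem_set (nv : (~` NN) v)) mul1r hv.
have H'0 v : `|H' v| <= `|H v|.
  by rewrite /H' normrM indicE; case: (v \in _); rewrite ?normr1 ?normr0 ?mul1r// mul0r.
have mH b c : measurable_fun setT (fun v => ind b c v * H v) by exact: intg_measurable (iH b c).
have HE' b c v : ind b c v * H' v = \1_(~` NN) v * (ind b c v * H v) by rewrite /H' mulrCA.
have mH' b c : measurable_fun setT (fun v => ind b c v * H' v).
  rewrite (funext (HE' b c)); apply: measurable_funM => //; apply: measurable_indic; exact: measurableC.
have iH' b c : intg (fun v => ind b c v * H' v).
  apply: (@intg_le _ _ (fun v => `|ind b c v * H v|)) => //; last exact: intg_norm.
  by move=> v; rewrite normrM [leRHS]normrM; apply: ler_wpM2l => //; exact: H'0.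
have -> : Int (fun v => ind s 1 v * H v) = Int (fun v => ind s 1 v * H' v).
  apply: (@ae_eq_Rintegral R _ _ mu setT _ _ measurableT (mH s 1) (mH' s 1)).
  exists NN; split => // v /= nv; apply: contrapT => nnv; apply: nv => _.
  by rewrite HE' indicE mem_set// mul1r.
set B := pi * mE / Num.sqrt la * N * `|x - y|.
(* The heat gradient is singular at time [s]. On [[s, s + e]] the bound without gradient is enough,
   and [e] is sent to 0 afterwards. *)
have key e : 0 < e -> e < 1 - s -> `|Int (fun v => ind s 1 v * H' v)| <= W * N * e + B.
  move=> e0 e1; have se : s < s + e by rewrite ltrDl.
  have se1 : s + e < 1 by rewrite addrC -ltrBrDr.
  rewrite (ind_split (ltW se) (ltW se1) (iH' _ _)).
  apply: (le_trans (ler_normD _ _)); apply: lerD.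
    rewrite [leRHS](_ : _ = W * N * (s + e - s)); last by rewrite addrAC subrr add0r.
    apply: Int_ind_bound => //; [exact: ltW|move=> v sv ve].
    apply: H'1 => [|nv]; first exact: mulr_ge0 W_ge0 N0.
    rewrite /H normrM [leRHS](_ : _ = W / 2 * (N + N)); last by field.
    apply: ler_pM => //; first by rewrite (ger0_norm (wt_ge0 v)) wt_le.
    apply: (le_trans (ler_normB _ _)); apply: lerD; apply: heat_bound => // r; exact: GN1.
  pose m := a (s + e); have m0 : 0 < m by rewrite subr_gt0 wsm// ltW.
  have cm v : 0 < Num.max (a v) m by rewrite lt_max m0 orbT.
  have cmx : continuous (fun v => Num.max (a v) m).
    by move=> v; apply: (@continuous_max R _ a (fun=> m) v); [exact: ca|exact: cvg_cst].
  have cs : continuous (fun v => Num.sqrt (Num.max (a v) m)).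
    by move=> v; apply: (@continuous_comp _ _ _ (fun v => Num.max (a v) m) Num.sqrt); [exact: cmx|exact: sqrt_continuous].
  have den v : Num.sqrt (Num.max (a v) m) * (1 + la * Num.max (a v) m) != 0.
    by rewrite gt_eqF// mulr_gt0 ?sqrtr_gt0// addr_gt0// mulr_gt0.
  have cq : continuous (fun v => q (a v) m (wd v)).
    move=> v; apply: cvgM; [exact: wdc|apply: cvgV; first exact: den].
    apply: cvgM; [exact: cs|apply: cvgD; [exact: cvg_cst|apply: cvgZr; exact: cmx]].
  have cQ : continuous (fun v => Q (a v) m).
    move=> v; apply: cvgZr; apply: (@continuous_comp _ _ _ (fun v => Num.sqrt (la * Num.max (a v) m)) atan); last exact: continuous_atan.
    apply: (@continuous_comp _ _ _ (fun v => la * Num.max (a v) m) Num.sqrt); last exact: sqrt_continuous.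
    by apply: cvgZr; exact: cmx.
  have se0 := le_lt_trans s0 se.
  have dq : Int (fun v => ind (s + e) 1 v * q (a v) m (wd v)) = Q (a 1) m - Q (a (s + e)) m.
    apply: (@Int_FTC R (fun v => q (a v) m (wd v)) (fun v => Q (a v) m) _ _ (ltW se1) cq cQ) => v v0 v1.
    apply: dQ => //; first by rewrite ltrD2r wsm// ltW.
    rewrite /a -[wd v]subr0; apply: is_deriveB; exact: dw (lt_trans se0 v0) v1.
  have iq : intg (fun v => ind (s + e) 1 v * q (a v) m (wd v)) by exact: intg_indc.
  apply: (le_trans (le_norm_Int (iH' _ _))).
  apply: (@le_trans _ _ (N * mE * `|x - y| / 2 * Int (fun v => ind (s + e) 1 v * q (a v) m (wd v)))); last first.
    have : Q (a 1) m - Q (a (s + e)) m <= 2 / Num.sqrt la * pi.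
      rewrite /Q -mulrBr; apply: ler_wpM2l; first by rewrite divr_ge0// ltW.
      have := atan_ltpi2 (Num.sqrt (la * Num.max (a 1) m)).
      have := atan_gtNpi2 (Num.sqrt (la * Num.max (a (s + e)) m)).
      move: (atan _) (atan _) => p1 p2; lra.
    rewrite dq => h1; have n0 : 0 <= N * mE * `|x - y| / 2 by rewrite divr_ge0// !mulr_ge0.
    apply: (le_trans (ler_wpM2l n0 h1)); rewrite le_eqVlt; apply/orP; left; apply/eqP.
    by rewrite /B; field; rewrite gt_eqF.
  rewrite -IntZl//; apply: le_Int; [exact: intg_norm|exact: intgZl|move=> v].
  rewrite normrM (ger0_norm (ind_ge0 _ _ _)) mulrCA; have [/andP[v0 v1]|] := boolP (s + e <= v <= 1); last first.
    by rewrite negb_and -!ltNge => hv; rewrite ind0// !mul0r.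
  rewrite ind1// !mul1r.
  have vp : 0 <= v := le_trans (ltW se0) v0.
  have am : m <= a v by rewrite lerD2r; exact: wm.
  have av0 := lt_le_trans m0 am.
  have sa : 0 < Num.sqrt (a v) by rewrite sqrtr_gt0.
  have la1 : 0 < 1 + la * a v by rewrite addr_gt0// mulr_gt0.
  rewrite /q (max_l am); apply: H'1 => [|nv].
    by rewrite !mulr_ge0// ?invr_ge0 ?wd0// mulr_ge0// ltW.
  rewrite /H normrM (ger0_norm (wt_ge0 v)) wtE//.
  apply: (@le_trans _ _ (wd v / 2 * (N * expR (- (la * a v)) * mE / Num.sqrt (a v) * `|x - y|))).
    apply: ler_wpM2l; first by rewrite divr_ge0// wd0.
    by apply: heat_grad => // r; exact: GN.
  have ex : expR (- (la * a v)) <= (1 + la * a v)^-1.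
    by rewrite expRN lef_pV2 ?posrE ?expR_gt0// expR_ge1Dx.
  rewrite [leRHS](_ : _ = wd v / 2 * (N * mE / Num.sqrt (a v) * `|x - y|) * (1 + la * a v)^-1); last first.
    by field; rewrite !gt_eqF.
  rewrite [leLHS](_ : _ = wd v / 2 * (N * mE / Num.sqrt (a v) * `|x - y|) * expR (- (la * a v))); last by ring.
  apply: ler_wpM2l => //; rewrite mulr_ge0 ?divr_ge0 ?wd0// mulr_ge0// divr_ge0 ?mulr_ge0//; exact: ltW.
have WN : 0 <= W * N by rewrite mulr_ge0// W_ge0.
rewrite leNgt; apply/negP => hlt.
pose d := `|Int (fun v => ind s 1 v * H' v)| - B; have d0 : 0 < d by rewrite subr_gt0.
have WN1 : 0 < W * N + 1 by rewrite ltr_wpDl.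
(* Small enough for [W * N * e] to stay below the supposed excess [d], and for [s + e] to stay below
   1. *)
pose e := Num.min ((1 - s) / 2) (d / (W * N + 1)).
have e0 : 0 < e by rewrite lt_min divr_gt0 ?subr_gt0//= divr_gt0.
have es : e < 1 - s.
  by apply: (@le_lt_trans _ _ ((1 - s) / 2)); [by rewrite ge_min lexx|]; rewrite ltr_pdivrMr// ltr_pMr ?subr_gt0// ltr1n.
have := key e e0 es; apply/negP; rewrite -ltNge -ltrBrDr -/d.
have : e * (W * N + 1) <= d by rewrite -ler_pdivlMr// ge_min lexx orbT.
by rewrite mulrDr mulr1 mulrC; apply: lt_le_trans; rewrite ltrDl.
Qed.

End Gradient.

Section Contraction.
Variable M : R.
Hypotheses (M0 : 0 <= M) (fM : forall t x, `|f t x| <= M * `|z t x|).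

(** A bound [S * exp (- la * w t)] on the source, expressed through its mollifications, with one
    null set of times for all kernels and points. *)
Let P la S := {ae mu, forall t, forall k x, csm k -> `|conv k f t x| <= S * expR (- (la * w t)) * norm1 k}.

Let P_le la S S' : S <= S' -> P la S -> P la S'.
Proof.
move=> SS; apply: ae_imply => t h k x ck; apply: (le_trans (h k x ck)).
by rewrite ler_wpM2r ?norm1_ge0// ler_wpM2r ?expR_ge0.
Qed.

Let mE0 : 0 <= mE. Proof. by apply: Eg_ge0 => v; exact: normr_ge0. Qed.

Let conv_du la S k t x : 0 < la -> 0 <= S -> P la S -> csm k -> 0 <= t -> t <= 1 ->
  `|conv (derive1 k) u t x| <= (pi * mE / Num.sqrt la) * (S * norm1 k * expR (- (la * w t))).
Proof.
move=> la0 S0 pS ck t0 t1; apply: (lip_derive_bound (conv_u_derive t x ck)) => y.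
exact: conv_grad.
Qed.

Let ae_neq (a : R) : {ae mu, forall t, t <> a}.
Proof.
exists [set a]; split; [exact: measurable_set1|exact: lebesgue_measure_set1|].
by move=> t /= /contrapT ->.
Qed.

Let conv_zero k t x : csm k -> (forall y, f t y = 0) -> conv k f t x = 0.
Proof.
move=> ck fz; transitivity (Int (fun y => 0 * k (x - y))); first by apply: eq_Int => y; rewrite fz.
by rewrite (IntZl 0 (intg_refl x (csm_intg ck))) mul0r.
Qed.

(* A bound S on the source gives the gradient bound for the mollified solution;
   Lebesgue differentiation passes it to z, and the source is controlled by z. *)
Let contract la S : 0 < la -> 0 <= S -> P la S -> P la (M * (pi * mE / Num.sqrt la * S * norm1 (@rho R))).
Proof.
move=> la0 S0 pS; set kap := pi * mE / Num.sqrt la.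
have kap0 : 0 <= kap by apply: divr_ge0; [exact: mulr_ge0 (pi_ge0 R) mE0|exact: sqrtr_ge0].
pose L t := kap * (S * norm1 (@rho R) * expR (- (la * w t))).
have L0 t : 0 <= L t by rewrite /L; apply: mulr_ge0 => //; rewrite !mulr_ge0 ?expR_ge0//; exact: norm1_ge0.
have h1 n x : {ae mu, forall t, 0 < t -> t < 1 -> `|conv (mol n) z t x| <= L t}.
  apply: (ae_imply _ (conv_z_ae x (csm_mol n))) => t h t0 t1.
  by rewrite -h// /L -(norm1_mol n); apply: conv_du => //; [exact: csm_mol|exact: ltW|exact: ltW].
(* Countably many statements, one for each mollifier and each rational point (enumerated by
   [unpickle]), have a common null set of times; continuity in [x] of the mollified function then
   reaches every point. *)
have h2 : {ae mu, forall t, forall n (q : nat), 0 < t -> t < 1 ->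
    if @unpickle (int * nat)%type q is Some p then is_true (`|conv (mol n) z t (p.1%:~R / p.2.+1%:R)| <= L t) else True}.
  apply: ae_forall_nat => n; apply: ae_forall_nat => q; case: (unpickle q) => [p|]; first exact: h1.
  by apply: aeW.
have h3 := ae_and h2 (ae_and (ae_neq 0) (ae_neq 1)).
apply: (ae_imply _ h3) => t [hq [tn0 tn1]] k x ck.
have [/andP[t0 t1]|] := boolP (0 < t < 1); last first.
  rewrite negb_and -!leNgt => ht; have fz y : f t y = 0.
    apply/eqP; rewrite -normr_le0; apply: (le_trans (bf t y)); rewrite ind0 ?mulr0//.
    by move: ht => /orP[ht|ht]; apply/orP; [left|right]; rewrite lt_neqAle ht andbT; apply/eqP => // /esym.
  rewrite (conv_zero x ck fz) normr0.
  by rewrite mulr_ge0 ?norm1_ge0// mulr_ge0 ?expR_ge0// mulr_ge0// mulr_ge0 ?norm1_ge0// mulr_ge0.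
have zb n y : `|conv (mol n) z t y| <= L t.
  have cz : continuous (conv (mol n) z t).
    move=> v; apply: differentiable_continuous; apply/derivable1_diffP.
    have dz : is_derive v 1 (conv (mol n) z t) (conv (derive1 (mol n)) z t v).
      apply: dconv; [exact: csm_mol|exact: (meas2_l mz)|].
      move=> b; exists Z => r _; apply: (le_trans (bz t r)); exact: ind01_le1 Z_ge0.
    by have [] := dz.
  have cv : `|conv (mol n) z t ((Num.floor (m.+1%:R * y))%:~R / m.+1%:R)| @[m --> \oo] --> `|conv (mol n) z t y|.
    apply: cvg_norm; apply: (@cvg_comp _ _ _ (fun m => (Num.floor (m.+1%:R * y))%:~R / m.+1%:R) (conv (mol n) z t)).
      exact: floor_approx_cvg.
    exact: cz.
  rewrite -(cvg_lim _ cv)//; apply: limr_le; first by apply/cvg_ex; eexists; exact: cv.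
  near=> m; have := hq n (pickle (Num.floor (m.+1%:R * y), m)) t0 t1.
  by rewrite pickleK.
have zL : {ae mu, forall y, `|z t y| <= L t}.
  apply: (@mol_bound_ae _ _ Z) => //; first exact: (meas2_l mz).
  by move=> y; apply: (le_trans (bz t y)); exact: ind01_le1 Z_ge0.
have fL : {ae mu, forall y, `|f t y| <= M * L t}.
  by apply: (ae_imply _ zL) => y h; apply: (le_trans (fM t y)); exact: ler_wpM2l.
rewrite [leRHS](_ : _ = M * L t * norm1 k); last by rewrite /L; ring.
apply: (@conv_bound_ae _ k (f t) F) => //; first exact: (meas2_l mf).
  by move=> y; apply: (le_trans (bf t y)); exact: ind01_le1 F_ge0.
exact: mulr_ge0.
Unshelve. all: by end_near.
Qed.

(** With [b = M * (pi * mE) * norm1 rho], the square root of [la] is [2 * b + 1], so the factor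
    [b / sqrt la] of [contract] is below 1/2. *)
Let la : R := (2 * (M * (pi * mE) * norm1 (@rho R)) + 1) ^+ 2.

Let B0 : 0 <= M * (pi * mE) * norm1 (@rho R).
Proof. by rewrite mulr_ge0 ?norm1_ge0// mulr_ge0// mulr_ge0// pi_ge0. Qed.

Let la0 : 0 < la.
Proof. by rewrite exprn_gt0// ltr_wpDl// mulr_ge0. Qed.

(** The crude bound [F] on the source in weighted form: [w t <= w 1] for every [t] up to 1. *)
Let S0 : R := F * expR (la * w 1).

Let S00 : 0 <= S0.
Proof. by rewrite mulr_ge0 ?expR_ge0// F_ge0. Qed.

Let decay n : P la (S0 / 2 ^+ n).
Proof.
elim: n => [|n IH].
  apply: aeW => t k x ck; rewrite expr0 divr1; have [t1|t1] := leP t 1.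
    apply: (le_trans (conv_f_bound t x ck)); rewrite ler_wpM2r ?norm1_ge0// /S0 -mulrA ler_peMr ?F_ge0//.
    by rewrite -expRD -[X in X <= _]expR0 ler_expR subr_ge0 ler_wpM2l ?(ltW la0)// wm.
  have fz y : f t y = 0.
    by apply/eqP; rewrite -normr_le0; apply: (le_trans (bf t y)); rewrite ind0 ?mulr0// t1 orbT.
  rewrite (conv_zero x ck fz) normr0.
  by rewrite mulr_ge0 ?norm1_ge0// mulr_ge0 ?expR_ge0.
apply: (P_le _ (contract la0 _ IH)); last by rewrite divr_ge0// exprn_ge0.
have b1 : 0 < 2 * (M * (pi * mE) * norm1 (@rho R)) + 1 by rewrite ltr_wpDl// mulr_ge0.
have -> : Num.sqrt la = 2 * (M * (pi * mE) * norm1 (@rho R)) + 1 by rewrite sqrtr_sqr ger0_norm// ltW.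
have p2 : (0 : R) < 2 ^+ n by rewrite exprn_gt0.
have s0 : 0 <= S0 / 2 ^+ n by rewrite divr_ge0// ltW.
rewrite [leRHS](_ : _ = S0 / 2 ^+ n * 2^-1); last by rewrite exprS; field; rewrite gt_eqF.
rewrite [leLHS](_ : _ = S0 / 2 ^+ n * (M * (pi * mE) * norm1 (@rho R) / (2 * (M * (pi * mE) * norm1 (@rho R)) + 1))); last by ring.
apply: ler_wpM2l => //; rewrite ler_pdivrMr//; move: (M * (pi * mE) * _) => b; lra.
Qed.

Let small (a b c : R) : 0 <= c -> (forall n, a <= b * (S0 / 2 ^+ n) * c) -> a <= 0.
Proof.
move=> c0 h; have cv : b * (S0 / 2 ^+ n) * c @[n --> \oo] --> b * (S0 * 0) * c.
  apply: cvgMl; apply: cvgZr; apply: cvgZr.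
  have := @cvg_expr R 2^-1 _; rewrite ger0_norm//; have -> : (2^-1 < 1 :> R) by rewrite invf_lt1// ltr1n.
  by move=> /(_ isT) c'; apply: cvg_trans c'; apply: near_eq_cvg; apply: nearW => n; rewrite exprVn.
rewrite mulr0 mulr0 mul0r in cv; rewrite -(cvg_lim _ cv)//; apply: limr_ge; first by apply/cvg_ex; eexists; exact: cv.
by apply: nearW.
Qed.

(** Letting the bounds tend to 0 kills both terms of [src], the second derivative of the mollified
    solution and the mollified source; [terminal_src] recovers the solution from their sum. *)
Lemma conv_u0 k t x : csm k -> 0 <= t -> t <= 1 -> conv k u t x = 0.
Proof.
move=> ck t0 t1; have k1 := csm_derive ck.
have d2 s y : 0 <= s -> s <= 1 -> conv (derive1 (derive1 k)) u s y = 0.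
  move=> s0 s1; apply/eqP; rewrite -normr_le0.
  apply: (@small _ (pi * mE / Num.sqrt la) (norm1 (derive1 k) * expR (- (la * w s)))).
    by rewrite mulr_ge0 ?expR_ge0 ?norm1_ge0.
  move=> n; rewrite -mulrA [X in _ * X]mulrA.
  apply: (@conv_du la (S0 / 2 ^+ n) (derive1 k) s y la0 _ (decay n) k1 s0 s1).
  by rewrite divr_ge0// exprn_ge0.
have f0 : {ae mu, forall s, conv k f s x = 0}.
  have h := ae_forall_nat decay; apply: (ae_imply _ h) => s hs; apply/eqP; rewrite -normr_le0.
  apply: (@small _ 1 (expR (- (la * w s)) * norm1 k)); first by rewrite mulr_ge0 ?expR_ge0 ?norm1_ge0.
  by move=> n; rewrite mul1r mulrA; exact: hs.
rewrite terminal_src//.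
have ms : measurable_fun setT (fun s => ind t 1 s * src k s x) by exact: intg_measurable (intg_src t 1 x ck).
transitivity (Int (fun s => 0 * ind t 1 s)); last by rewrite IntZl ?mul0r//; exact: intg_ind.
apply: (@ae_eq_Rintegral R _ _ mu setT _ _ measurableT ms).
  by apply: measurable_funM => //; exact: measurable_ind.
apply: (ae_imply _ f0) => s fs _; rewrite /src; have [/andP[s0 s1]|h] := boolP (0 <= s <= 1).
  by rewrite fs d2// addr0 !mulr0 mul0r.
by rewrite wt_out// !mul0r mulr0.
Qed.

Lemma linear_unique t x : 0 <= t -> t <= 1 -> u t x = 0.
Proof.
move=> t0 t1; apply/eqP; rewrite -normr_le0; apply/ler_addgt0Pl => e e0; rewrite addr0.
have cut : continuous (u t) := cont_l (t := t) cu.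
have n1 : 0 < norm1 (@rho R) + 1 by rewrite ltr_wpDl// norm1_ge0.
have d0 : 0 < e / (norm1 (@rho R) + 1) by rewrite divr_gt0.
have : \forall y \near x, `|u t x - u t y| < e / (norm1 (@rho R) + 1).
  by have /cvgrPdist_lt := cut x; apply.
move=> /nbhs_ballP[d /= dd0 hd].
have [n nd] : exists n, n.+1%:R^-1 < d.
  by have [n] := ltr_add_invr dd0; rewrite add0r => h; exists n.
have i := conv_u_intg t x (csm_mol n).
have := @mol_near R (u t) n x (e / (norm1 (@rho R) + 1)) cut _ (ltW d0) i.
rewrite (_ : Int _ = 0); last by exact: (conv_u0 x (csm_mol n)).
rewrite sub0r normrN => h; apply: (le_trans (h _)).
  move=> y h1 h2; rewrite distrC; apply: ltW; apply: hd; suff : `|x - y| < d by [].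
  by rewrite ger0_norm ?subr_ge0//; apply: le_lt_trans nd; rewrite lerBlDr addrC -lerBlDr.
by rewrite mulrAC ler_pdivrMr// ler_wpM2l ?(ltW e0)// lerDl.
Qed.
End Contraction.
End Linear.

(** * Two weak solutions of the Parisi equation agree *)

Section WeakUniqueness.
Context {R : realType}.
Notation mu := (@lebesgue_measure R).
Notation RR := (measurableTypeR R * measurableTypeR R)%type.
Implicit Types (G P v : R -> R -> R) (a b : R -> R) (t x C : R).

(** A common frame for the two kinds of factors in the weak identities: continuous functions tested
    against a compactly supported [b], and bounded measurable ones. *)
Definition loc G b := meas2 G /\
  exists2 C, 0 <= C & forall t x, 0 <= t -> t <= 1 -> `|G t x * b x| <= C * `|b x|.

Lemma loc_cont G b (b1 b2 : R) : continuous (fun z : R * R => G z.1 z.2) ->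
  (forall x, (x < b1) || (b2 < x) -> b x = 0) -> loc G b.
Proof.
move=> cG vb; split; first exact: cont_meas2.
have [C C0 hC] := box_bound (`|b1| + `|b2| + 1) cG; exists C => // t x t0 t1.
have [/andP[h1 h2]|] := boolP (b1 <= x <= b2); last first.
  by rewrite negb_and -!ltNge => h; rewrite (vb x h) mulr0 normr0 mulr0.
rewrite normrM; apply: ler_wpM2r => //; apply: hC.
  by rewrite ger0_norm//; apply: (le_trans t1); rewrite lerDr addr_ge0.
have := ler_norm b2; have := ler_norm (- b1); rewrite normrN => q1 q2.
have := normr_ge0 b1; have := normr_ge0 b2; rewrite ler_norml => q3 q4.
by apply/andP; split; lra.
Qed.

Lemma loc_bdd G b C : meas2 G -> (forall t x, `|G t x| <= C) -> loc G b.
Proof.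
move=> mG GC; split => //; exists C; first exact: le_trans (GC 0 0).
by move=> t x _ _; rewrite normrM; apply: ler_wpM2r.
Qed.

Lemma loc_scale (q : R -> R) Q G b : measurable_fun setT q -> (forall t, 0 <= t -> t <= 1 -> `|q t| <= Q) ->
  loc G b -> loc (fun t x => q t * G t x) b.
Proof.
move=> mq qQ [mG [C C0 GC]]; split.
  apply: measurable_funM => //; apply: (measurableT_comp mq); exact: measurable_fst.
exists (Q * C) => [|t x t0 t1]; first by rewrite mulr_ge0//; exact: le_trans (qQ 0 (lexx 0) ler01).
rewrite -mulrA normrM -[leRHS]mulrA; apply: ler_pM => //; [exact: qQ|exact: GC].
Qed.

Lemma loc_intg G b t : loc G b -> intg b -> 0 <= t -> t <= 1 -> intg (fun x => G t x * b x).
Proof.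
move=> [mG [C C0 GC]] ib t0 t1; apply: (@intg_le _ _ (fun x => C * `|b x|)).
- by apply: measurable_funM; [exact: (meas2_l mG)|exact: intg_measurable].
- by move=> x; exact: GC.
by apply/intgZl/intg_norm.
Qed.

Lemma box_intg b (b1 b2 : R) : smooth1 b -> (forall x, (x < b1) || (b2 < x) -> b x = 0) -> intg b.
Proof.
move=> sb vb; apply: csm_intg; split => //; exists (`|b1| + `|b2|) => [|x]; first exact: addr_ge0.
rewrite lter_normr => h; apply: vb; have := ler_norm b2; have := ler_norm (- b1); rewrite normrN => q1 q2.
have := normr_ge0 b1; have := normr_ge0 b2 => q3 q4.
by move: h => /orP[h|h]; apply/orP; [right|left]; lra.
Qed.

Section Tensor3.
Variables (G1 G2 G3 : R -> R -> R) (a1 a2 a3 b1 b2 b3 : R -> R).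
Hypotheses (l1 : loc G1 b1) (l2 : loc G2 b2) (l3 : loc G3 b3).
Hypotheses (ca1 : continuous a1) (ca2 : continuous a2) (ca3 : continuous a3).
Hypotheses (ib1 : intg b1) (ib2 : intg b2) (ib3 : intg b3).

Let H (z : R * R) := G1 z.1 z.2 * (a1 z.1 * b1 z.2) +
  (G2 z.1 z.2 * (a2 z.1 * b2 z.2) + G3 z.1 z.2 * (a3 z.1 * b3 z.2)).
Let S t := a1 t * Int (fun x => G1 t x * b1 x) +
  (a2 t * Int (fun x => G2 t x * b2 x) + a3 t * Int (fun x => G3 t x * b3 x)).

Let mterm G a b : loc G b -> continuous a -> intg b ->
  measurable_fun [set: RR] (fun z => G z.1 z.2 * (a z.1 * b z.2)).
Proof.
move=> [mG _] ca ib; apply: measurable_funM => //; apply: measurable_funM.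
  by apply: (measurableT_comp (continuous_measurable_fun ca)); exact: measurable_fst.
by apply: (measurableT_comp (intg_measurable ib)); exact: measurable_snd.
Qed.

Let bterm G a b : loc G b -> continuous a -> exists2 K, 0 <= K &
  forall t x, 0 <= t -> t <= 1 -> `|G t x * (a t * b x)| <= K * `|b x|.
Proof.
move=> [_ [C C0 GC]] ca; have [A A0 hA] := segment_bound 0 1 ca.
exists (A * C) => [|t x t0 t1]; first exact: mulr_ge0.
by rewrite mulrCA normrM -[leRHS]mulrA; apply: ler_pM => //; [exact: hA|exact: GC].
Qed.

(** Three products are as many as the terms of the tested equation: time derivative, second space
    derivative and quadratic term. *)
Lemma strip_tensor : intg (fun t => ind 0 1 t * S t) /\
  \int[(mu \x mu)%E]_(z in strip R) H z = Int (fun t => ind 0 1 t * S t).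
Proof.
have mH : measurable_fun (strip R : set RR) H.
  apply: measurable_funTS; apply: measurable_funD; first exact: mterm.
  by apply: measurable_funD; exact: mterm.
have [K1 k10 h1] := bterm l1 ca1; have [K2 k20 h2] := bterm l2 ca2; have [K3 k30 h3] := bterm l3 ca3.
pose g2 x := K1 * `|b1 x| + (K2 * `|b2 x| + K3 * `|b3 x|).
have i2 : intg g2 by apply: intgD; [|apply: intgD]; apply/intgZl/intg_norm.
have g20 x : 0 <= g2 x by rewrite !addr_ge0// mulr_ge0.
have Hg t x : 0 <= t -> t <= 1 -> `|H (t, x)| <= ind 0 1 t * g2 x.
  move=> t0 t1; rewrite ind1// mul1r; apply: (le_trans (ler_normD _ _)); apply: lerD; first exact: h1.
  by apply: (le_trans (ler_normD _ _)); apply: lerD; [exact: h2|exact: h3].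
have e : (fun t => ind 0 1 t * Int (fun x => H (t, x))) = (fun t => ind 0 1 t * S t).
  apply/funext => t; have [/andP[t0 t1]|] := boolP (0 <= t <= 1); last first.
    by rewrite negb_and -!ltNge => h; rewrite ind0// !mul0r.
  congr (_ * _); rewrite /H /S /=.
  have j1 := loc_intg l1 ib1 t0 t1; have j2 := loc_intg l2 ib2 t0 t1; have j3 := loc_intg l3 ib3 t0 t1.
  rewrite -!IntZl// -(IntD (intgZl (a2 t) j2) (intgZl (a3 t) j3)).
  rewrite -(IntD (intgZl (a1 t) j1) (intgD (intgZl (a2 t) j2) (intgZl (a3 t) j3))).
  by apply: eq_Int => x; ring.
split.
  by rewrite -e; exact: (intg_strip mH (intg_ind 0 1) i2 Hg (ind_ge0 0 1) g20).
by rewrite (Rintegral_strip mH (intg_ind 0 1) i2 Hg (ind_ge0 0 1) g20) e.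
Qed.
End Tensor3.

(** Nearest point of [[0, 1]]. A weak solution is determined and continuous on the strip only;
    composing with this extends it continuously to the plane. *)
Definition clamp t : R := Num.max 0 (Num.min 1 t).

Lemma clamp01 t : 0 <= clamp t <= 1.
Proof. by rewrite /clamp le_max lexx /= ge_max ler01 ge_min lexx. Qed.

Lemma clampE t : 0 <= t -> t <= 1 -> clamp t = t.
Proof. by move=> t0 t1; rewrite /clamp min_r// max_r. Qed.

Lemma clamp_cont : continuous clamp.
Proof.
move=> t; apply: (@continuous_max R _ (fun=> 0) (fun t => Num.min 1 t) t); first exact: cvg_cst.
by apply: (@continuous_min R _ (fun=> 1) id t); [exact: cvg_cst|exact: cvg_id].
Qed.

Lemma clamp_cont2 P : {within strip R, continuous (fun z : R * R => P z.1 z.2)} ->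
  continuous (fun z : R * R => P (clamp z.1) z.2).
Proof.
move=> cP z.
have cc : continuous (fun z : R * R => (clamp z.1, z.2)).
  by move=> q; apply: (@cvg_pair _ _ _ _ (nbhs (clamp q.1)) (nbhs q.2)); [apply: (@cvg_comp _ _ _ fst clamp); [exact: cvg_fst|exact: clamp_cont]|exact: cvg_snd].
move/subspace_continuousP : cP => /(_ (clamp z.1, z.2)) h.
have {}h := h (clamp01 z.1).
apply: (@cvg_trans _ ((fun z : R * R => P z.1 z.2) @ (within (strip R) (nbhs (clamp z.1, z.2))))); last exact: h.
move=> A hA; have := cc z _ hA; rewrite /= => q.
by apply: (@filterS _ (nbhs z) _ _ _ _ q) => p /= hp; apply: hp; exact: clamp01.
Qed.

Section Solutions.
Variables (c : nat -> R) (beta : R) (alpha : R -> R) (w wd : R -> R) (Gm W : R).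
Hypotheses (malpha : measurable_fun setT alpha) (bal : forall t, 0 <= t -> t <= 1 -> `|beta * alpha t| <= Gm).
Hypothesis xiE : forall t, 0 <= t -> t <= 1 -> xi'' c t = wd t.
Hypotheses (wc : continuous w) (wdc : continuous wd).
Hypothesis wm : forall s t : R, s <= t -> w s <= w t.
Hypothesis wsm : forall s t : R, 0 <= s -> s < t -> t <= 1 -> w s < w t.
Hypothesis dw : forall t : R, 0 < t -> t < 1 -> is_derive t 1 w (wd t).
Hypothesis wd0 : forall t, 0 <= t -> t <= 1 -> 0 <= wd t.
Hypothesis wdW : forall t, 0 <= t -> t <= 1 -> wd t <= W.

Let ga t := ind 0 1 t * (beta * alpha t).

Let mga : measurable_fun setT ga.
Proof. by apply: measurable_funM; [exact: measurable_ind|exact: measurable_funM]. Qed.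

Let Gm0 : 0 <= Gm. Proof. exact: le_trans (normr_ge0 _) (bal (lexx 0) ler01). Qed.

Let gaB t : `|ga t| <= Gm.
Proof.
rewrite /ga; have [/andP[t0 t1]|] := boolP (0 <= t <= 1); first by rewrite ind1// mul1r bal.
by rewrite negb_and -!ltNge => h; rewrite ind0// mul0r normr0.
Qed.

Let wdB t : 0 <= t -> t <= 1 -> `|wd t / 2| <= W / 2.
Proof. by move=> t0 t1; rewrite ger0_norm ?divr_ge0 ?wd0// ler_pM2r// wdW. Qed.

Let mwd2 : measurable_fun setT (fun t => wd t / 2).
Proof. by apply: measurable_funM => //; exact: continuous_measurable_fun. Qed.

(* The weak derivative is truncated to a bounded function, defined everywhere. *)
Lemma weak_tensor Psi : weak_solution c beta alpha Psi -> exists (v : R -> R -> R) (V : R),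
  [/\ meas2 v, forall t x, `|v t x| <= V * ind 0 1 t,
   forall a b (a1 a2 b1 b2 : R), smooth1 a -> smooth1 b -> 0 < a1 -> a2 < 1 ->
    (forall t, (t < a1) || (a2 < t) -> a t = 0) -> (forall x, (x < b1) || (b2 < x) -> b x = 0) ->
    intg (fun t => ind 0 1 t * (a t * (Int (fun x => Psi (clamp t) x * derive1 b x) + Int (fun x => v t x * b x)))) /\
    Int (fun t => ind 0 1 t * (a t * (Int (fun x => Psi (clamp t) x * derive1 b x) + Int (fun x => v t x * b x)))) = 0 &
   forall a b (a1 a2 b1 b2 : R), smooth1 a -> smooth1 b -> 0 < a1 ->
    (forall t, (t < a1) || (a2 < t) -> a t = 0) -> (forall x, (x < b1) || (b2 < x) -> b x = 0) ->
    let S := fun t => - derive1 a t * Int (fun x => Psi (clamp t) x * b x) +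
      (a t * Int (fun x => wd t / 2 * Psi (clamp t) x * derive1 (derive1 b) x) +
       a t * Int (fun x => wd t / 2 * (ga t * v t x ^+ 2) * b x)) in
    intg (fun t => ind 0 1 t * S t) /\
    Int (fun t => ind 0 1 t * S t) = - Int (fun x => a 1 * b x * (ln (cosh (beta * x)) / beta))].
Proof.
move=> [cPsi [v [[mv [V0 aeV] hv1] hv2]]].
pose V := Num.max 0 V0; have V00 : 0 <= V by rewrite le_max lexx.
pose cl t x := Num.max (- V) (Num.min V (v t x)).
have clB t x : `|cl t x| <= V.
  by rewrite ler_norml /cl le_max lexx /= ge_max ge_min lexx /= andbT; lra.
pose vt t x := ind 0 1 t * cl t x.
have mvt : meas2 vt.
  apply: (@meas2_strip _ (fun z => cl z.1 z.2)).
  by apply: measurable_maxr => //; exact: measurable_minr.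
have bvt t x : `|vt t x| <= V * ind 0 1 t.
  by rewrite /vt normrM mulrC (ger0_norm (ind_ge0 0 1 t)) ler_wpM2r ?ind_ge0.
have bvt' t x : `|vt t x| <= V by apply: (le_trans (bvt t x)); rewrite ler_piMr ?ind_le1.
have vE : {ae (mu \x mu)%E, forall z : RR, strip R z -> v z.1 z.2 = vt z.1 z.2}.
  apply: (ae_imply _ aeV) => z h sz; have /= /andP[z0 z1] := sz.
  rewrite /vt ind1// mul1r /cl; have hV : `|v z.1 z.2| <= V by rewrite le_max h ?orbT.
  by move: hV; rewrite ler_norml => /andP[q1 q2]; rewrite min_r// max_r.
pose P t x := Psi (clamp t) x.
have cP : continuous (fun z : R * R => P z.1 z.2) := clamp_cont2 cPsi.
have PE z : strip R z -> Psi z.1 z.2 = P z.1 z.2 by move=> /andP[z0 z1]; rewrite /P clampE.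
have ms := measurable_strip (R := R).
have mP : measurable_fun [set: RR] (fun z => P z.1 z.2) := cont_meas2 cP.
have msm (g : R -> R) : smooth1 g -> measurable_fun [set: RR] (fun z => g z.1).
  by move=> sg; apply: (measurableT_comp (continuous_measurable_fun (smooth1_cont sg))); exact: measurable_fst.
have msm2 (g : R -> R) : smooth1 g -> measurable_fun [set: RR] (fun z => g z.2).
  by move=> sg; apply: (measurableT_comp (continuous_measurable_fun (smooth1_cont sg))); exact: measurable_snd.
exists vt, V; split => //.
  move=> a b a1 a2 b1 b2 sa sb a10 a21 va vb.
  have tf : test_function [set z : R * R | 0 < z.1 < 1] (fun t x => a t * b x).
    apply: (tensor_test sa sb va vb) => t x h1 h2 /=.
    by rewrite (lt_le_trans a10 h1) (le_lt_trans h2 a21).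
  have vb' := derive1_vanish vb; have sb' := smooth1_derive sb.
  have l1 : loc P (derive1 b) := loc_cont cP vb'.
  have l2 : loc vt b := loc_bdd b mvt bvt'.
  have l3 : loc (fun _ _ => 0) b.
    by apply: (@loc_bdd _ _ 0) => [|t x]; [exact: measurable_cst|rewrite normr0].
  have ca := smooth1_cont sa; have ib := box_intg sb vb; have ib' := box_intg sb' vb'.
  have term G b' : loc G b' -> intg b' -> intg (fun t => ind 0 1 t * (a t * Int (fun x => G t x * b' x))) /\
      \int[(mu \x mu)%E]_(z in strip R) (G z.1 z.2 * (a z.1 * b' z.2)) =
      Int (fun t => ind 0 1 t * (a t * Int (fun x => G t x * b' x))).
    move=> lG jb; have := strip_tensor lG l3 l3 ca ca ca jb ib ib.
    have -> : (fun t => ind 0 1 t * (a t * Int (fun x => G t x * b' x) +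
        (a t * Int (fun x => 0 * b x) + a t * Int (fun x => 0 * b x)))) =
        (fun t => ind 0 1 t * (a t * Int (fun x => G t x * b' x))).
      by apply/funext => t; rewrite (IntZl 0 ib) mul0r mulr0 !addr0.
    have -> // : (fun z : R * R => G z.1 z.2 * (a z.1 * b' z.2) + (0 * (a z.1 * b z.2) + 0 * (a z.1 * b z.2))) =
      (fun z : R * R => G z.1 z.2 * (a z.1 * b' z.2)) by apply/funext => z; rewrite !mul0r !addr0.
  have [i1 e1] := term _ _ l1 ib'; have [i2 e2] := term _ _ l2 ib.
  have SE : (fun t => ind 0 1 t * (a t * (Int (fun x => Psi (clamp t) x * derive1 b x) + Int (fun x => vt t x * b x)))) =
    (fun t => ind 0 1 t * (a t * Int (fun x => P t x * derive1 b x)) + ind 0 1 t * (a t * Int (fun x => vt t x * b x))).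
    by apply/funext => t; rewrite mulrDr mulrDr.
  rewrite SE; split; first exact: intgD.
  rewrite (IntD i1 i2) -e1 -e2.
  have := hv1 _ tf.
  have -> : \int[(mu \x mu)%E]_(z in strip R) (Psi z.1 z.2 * partial_x (fun t x => a t * b x) z.1 z.2) =
    \int[(mu \x mu)%E]_(z in strip R) (P z.1 z.2 * (a z.1 * derive1 b z.2)).
    by apply: eq_Rintegral => z /set_mem sz; rewrite PE// tensor_x.
  have -> : \int[(mu \x mu)%E]_(z in strip R) (v z.1 z.2 * (a z.1 * b z.2)) =
    \int[(mu \x mu)%E]_(z in strip R) (vt z.1 z.2 * (a z.1 * b z.2)).
    have mab : measurable_fun (strip R : set RR) (fun z => a z.1 * b z.2).
      by apply: measurable_funTS; apply: measurable_funM; [exact: msm|exact: msm2].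
    apply: ae_eq_Rintegral => //.
    - exact: measurable_funM.
    - by apply: measurable_funM => //; exact: measurable_funTS.
    by apply: (ae_imply _ vE) => z h sz; rewrite h.
  by move=> ->; rewrite addNr.
move=> a b a1 a2 b1 b2 sa sb a10 va vb S.
have tf : test_function [set z : R * R | 0 < z.1] (fun t x => a t * b x).
  by apply: (tensor_test sa sb va vb) => t x h1 h2 /=; exact: lt_le_trans a10 h1.
have vb' := derive1_vanish vb; have sb' := smooth1_derive sb.
have vb'' := derive1_vanish vb'; have sb'' := smooth1_derive sb'.
have ib := box_intg sb vb; have ib'' := box_intg sb'' vb''.
have l1 : loc P b := loc_cont cP vb.
have l2 : loc (fun t x => wd t / 2 * P t x) (derive1 (derive1 b)) := loc_scale mwd2 wdB (loc_cont cP vb'').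
have l3 : loc (fun t x => wd t / 2 * (ga t * vt t x ^+ 2)) b.
  apply: (loc_scale mwd2 wdB); apply: (@loc_bdd _ _ (Gm * V ^+ 2)).
    apply: measurable_funM; last exact: measurable_funX.
    by apply: (measurableT_comp mga); exact: measurable_fst.
  move=> t x; rewrite normrM; apply: ler_pM => //.
  by rewrite normrX; apply: lerXn2r; rewrite ?nnegrE.
have ca := smooth1_cont sa; have ca' := smooth1_cont (smooth1_derive sa).
have cna' : continuous (fun t => - derive1 a t) by move=> t; apply: cvgN; exact: ca'.
have [i e] := strip_tensor l1 l2 l3 cna' ca ca ib ib'' ib.
split; first exact: i.
rewrite -[LHS]e; have := hv2 _ tf; move/eqP; rewrite addr_eq0 => /eqP <-.
have mx (G : R -> R -> R) a' b' : meas2 G -> smooth1 a' -> smooth1 b' ->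
    measurable_fun (strip R : set RR) (fun z => G z.1 z.2 * (a' z.1 * b' z.2)).
  move=> mG sa' sb1; apply: measurable_funTS; apply: measurable_funM => //.
  by apply: measurable_funM; [exact: msm|exact: msm2].
have px2 : partial_x (partial_x (fun t x => a t * b x)) = (fun t x => a t * derive1 (derive1 b) x).
  have -> : partial_x (fun t x => a t * b x) = (fun t x => a t * derive1 b x).
    by apply/funext => t; apply/funext => x; rewrite tensor_x.
  by apply/funext => t; apply/funext => x; rewrite tensor_x.
pose E v' (z : R * R) := P z.1 z.2 * (- derive1 a z.1 * b z.2) +
  (wd z.1 / 2 * P z.1 z.2 * (a z.1 * derive1 (derive1 b) z.2) +
   wd z.1 / 2 * (ga z.1 * v' z.1 z.2 ^+ 2) * (a z.1 * b z.2)).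
transitivity (\int[(mu \x mu)%E]_(z in strip R) E v z); last first.
  apply: eq_Rintegral => z /set_mem sz; rewrite /E -(PE z sz) tensor_t// px2.
  have /= /andP[z0 z1] := sz; rewrite (xiE z0 z1) /ga ind1// mul1r.
  move: (Psi _ _) (v _ _) (derive1 a _) (wd _) (derive1 (derive1 b) _) => q1 q2 q3 q4 q5; ring.
have sna : smooth1 (fun t => - derive1 a t).
  by move=> n; apply: (@Cn_eq _ _ (fun t => -1 * derive1 a t)); [move=> t; rewrite mulN1r|exact/CnZ/smooth1_derive].
have mE v' : measurable_fun (strip R : set RR) (fun z => v' z.1 z.2) -> measurable_fun (strip R : set RR) (E v').
  move=> mv'; apply: measurable_funD; first exact: (mx P (fun t => - derive1 a t) b).
  apply: measurable_funD; first exact: (mx _ _ _ l2.1).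
  apply: measurable_funM; last first.
    by apply: measurable_funTS; apply: measurable_funM; [exact: msm|exact: msm2].
  apply: measurable_funM; first by apply: measurable_funTS; apply: (measurableT_comp mwd2); exact: measurable_fst.
  apply: measurable_funM; first by apply: measurable_funTS; apply: (measurableT_comp mga); exact: measurable_fst.
  exact: measurable_funX.
apply: ae_eq_Rintegral => //; [by apply: mE; exact: measurable_funTS|exact: mE|].
by apply: (ae_imply _ vE) => z h sz; rewrite /E h.
Qed.

(** The terminal terms cancel, and [v1^2 - v2^2 = (v1 + v2) * (v1 - v2)] with both derivatives
    bounded, so the source of the linear equation is at most a constant times the gradient of the
    difference. *)
Lemma weak_unique Psi1 Psi2 : weak_solution c beta alpha Psi1 -> weak_solution c beta alpha Psi2 ->
  forall t x, 0 <= t -> t <= 1 -> Psi1 t x = Psi2 t x.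
Proof.
move=> w1 w2 t x t0 t1.
have [v1 [V1 [mv1 bv1 A1 B1]]] := weak_tensor w1; have [v2 [V2 [mv2 bv2 A2 B2]]] := weak_tensor w2.
have V10 : 0 <= V1 by have := le_trans (normr_ge0 _) (bv1 0 0); rewrite ind1// mulr1.
have V20 : 0 <= V2 by have := le_trans (normr_ge0 _) (bv2 0 0); rewrite ind1// mulr1.
pose u s y := Psi1 (clamp s) y - Psi2 (clamp s) y.
pose z s y := v1 s y - v2 s y.
pose f s y := ga s * (v1 s y ^+ 2 - v2 s y ^+ 2).
have cu : continuous (fun p : R * R => u p.1 p.2).
  by move=> p; apply: cvgB; [exact: clamp_cont2 w1.1 p|exact: clamp_cont2 w2.1 p].
have mz : meas2 z by exact: measurable_funB.
have bz s y : `|z s y| <= (V1 + V2) * ind 0 1 s.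
  by rewrite /z mulrDl; apply: (le_trans (ler_normB _ _)); apply: lerD.
have mf : meas2 f.
  apply: measurable_funM; first by apply: (measurableT_comp mga); exact: measurable_fst.
  by apply: measurable_funB; exact: measurable_funX.
have bv s y : `|v1 s y + v2 s y| <= V1 + V2.
  apply: (le_trans (ler_normD _ _)); apply: lerD.
    by apply: (le_trans (bv1 s y)); rewrite ler_piMr// ind_le1.
  by apply: (le_trans (bv2 s y)); rewrite ler_piMr// ind_le1.
have fM s y : `|f s y| <= Gm * (V1 + V2) * `|z s y|.
  rewrite /f (_ : _ - _ = (v1 s y + v2 s y) * z s y); last by rewrite /z; ring.
  by rewrite mulrA normrM ler_wpM2r// normrM; apply: ler_pM.
have bf s y : `|f s y| <= Gm * (V1 + V2) * (V1 + V2) * ind 0 1 s.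
  apply: (le_trans (fM s y)); rewrite -[leRHS]mulrA; apply: ler_wpM2l; last exact: bz.
  by rewrite mulr_ge0// addr_ge0.
have GV : 0 <= Gm * (V1 + V2) by rewrite mulr_ge0// addr_ge0.
have bv1' s y : `|v1 s y| <= V1 by apply: (le_trans (bv1 s y)); rewrite ler_piMr// ind_le1.
have bv2' s y : `|v2 s y| <= V2 by apply: (le_trans (bv2 s y)); rewrite ler_piMr// ind_le1.
pose Q1 s y := Psi1 (clamp s) y; pose Q2 s y := Psi2 (clamp s) y.
have cP1 : continuous (fun z : R * R => Q1 z.1 z.2) := clamp_cont2 w1.1.
have cP2 : continuous (fun z : R * R => Q2 z.1 z.2) := clamp_cont2 w2.1.
have lq v V b : meas2 v -> (forall s y, `|v s y| <= V) -> loc (fun s y => ga s * v s y ^+ 2) b.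
  move=> mv bvv; apply: (@loc_bdd _ _ (Gm * V ^+ 2)).
    apply: measurable_funM; last exact: measurable_funX.
    by apply: (measurableT_comp mga); exact: measurable_fst.
  move=> s y; rewrite normrM; apply: ler_pM => //.
  by rewrite normrX; apply: lerXn2r; rewrite ?nnegrE//; exact: le_trans (bvv 0 0).
have := @linear_unique R u z f w wd _ _ W cu mz bz mf bf wc wdc wm wsm dw wd0 wdW _ _ _ GV fM t x t0 t1.
rewrite /u clampE// => h; apply/eqP; rewrite -subr_eq0; apply/eqP; apply: h.
- move=> a b a1 a2 b1 b2 sa sb a10 a21 va vb.
  have [i1 e1] := A1 _ _ _ _ _ _ sa sb a10 a21 va vb; have [i2 e2] := A2 _ _ _ _ _ _ sa sb a10 a21 va vb.
  have e12 : Int _ - Int _ = 0 := etrans (f_equal2 (fun p q => p - q) e1 e2) (subrr _).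
  rewrite -(IntB i1 i2) in e12; apply: etrans e12; apply: eq_Int => s.
  have [/andP[s0 s1]|] := boolP (0 <= s <= 1); last first.
    by rewrite negb_and -!ltNge => hs; rewrite ind0// !mul0r subrr.
  rewrite -mulrBr -mulrBr; congr (_ * (_ * _)).
  have vb' := derive1_vanish vb; have ib := box_intg sb vb; have ib' := box_intg (smooth1_derive sb) vb'.
  have j1 := loc_intg (@loc_cont Q1 _ _ _ cP1 vb') ib' s0 s1; have j2 := loc_intg (@loc_cont Q2 _ _ _ cP2 vb') ib' s0 s1.
  have j3 := loc_intg (loc_bdd b mv1 bv1') ib s0 s1; have j4 := loc_intg (loc_bdd b mv2 bv2') ib s0 s1.
  rewrite opprD addrACA -(IntB j1 j2) -(IntB j3 j4).
  by congr (_ + _); apply: eq_Int => y; rewrite mulrBl.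
move=> a b a1 a2 b1 b2 sa sb a10 va vb.
have [i1 e1] := B1 _ _ _ _ _ _ sa sb a10 va vb; have [i2 e2] := B2 _ _ _ _ _ _ sa sb a10 va vb.
have e12 : Int _ - Int _ = 0 := etrans (f_equal2 (fun p q => p - q) e1 e2) (subrr _).
rewrite -(IntB i1 i2) in e12; apply: etrans e12; apply: eq_Int => s.
have [/andP[s0 s1]|] := boolP (0 <= s <= 1); last first.
  by rewrite negb_and -!ltNge => hs; rewrite ind0// !mul0r subrr.
rewrite -mulrBr; congr (_ * _).
have vb' := derive1_vanish vb; have vb'' := derive1_vanish vb'.
have ib := box_intg sb vb; have ib'' := box_intg (smooth1_derive (smooth1_derive sb)) vb''.
have j1 := loc_intg (@loc_cont Q1 _ _ _ cP1 vb) ib s0 s1; have j2 := loc_intg (@loc_cont Q2 _ _ _ cP2 vb) ib s0 s1.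
have k1 := loc_intg (@loc_cont Q1 _ _ _ cP1 vb'') ib'' s0 s1; have k2 := loc_intg (@loc_cont Q2 _ _ _ cP2 vb'') ib'' s0 s1.
have q1 := loc_intg (@lq _ _ b mv1 bv1') ib s0 s1; have q2 := loc_intg (@lq _ _ b mv2 bv2') ib s0 s1.
have -> : Int (fun y => u s y * b y) = Int (fun y => Psi1 (clamp s) y * b y) - Int (fun y => Psi2 (clamp s) y * b y).
  by rewrite -(IntB j1 j2); apply: eq_Int => y; rewrite mulrBl.
have -> : Int (fun y => u s y * derive1 (derive1 b) y) =
    Int (fun y => Psi1 (clamp s) y * derive1 (derive1 b) y) - Int (fun y => Psi2 (clamp s) y * derive1 (derive1 b) y).
  by rewrite -(IntB k1 k2); apply: eq_Int => y; rewrite mulrBl.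
have -> : Int (fun y => f s y * b y) = Int (fun y => ga s * v1 s y ^+ 2 * b y) - Int (fun y => ga s * v2 s y ^+ 2 * b y).
  by rewrite -(IntB q1 q2); apply: eq_Int => y; rewrite /f; ring.
have sc (g h : R -> R) : intg (fun y => g y * h y) ->
    Int (fun y => wd s / 2 * g y * h y) = wd s / 2 * Int (fun y => g y * h y).
  by move=> ig; rewrite -(IntZl _ ig); apply: eq_Int => y; rewrite mulrA.
rewrite (sc _ _ k1) (sc _ _ k2) (sc _ _ q1) (sc _ _ q2).
by move: (Int _) (Int _) (Int _) (Int _) (Int _) (Int _) (derive1 a s) (wd s / 2) => *; ring.
Qed.


End Solutions.
End WeakUniqueness.

(** * The Parisi functional of a step function *)

Section Levels.
Context {R : realType}.
Implicit Types (gam w : R -> R) (s e t x : R) (es qs : seq R).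

Lemma levsum_cat gam w s es1 es2 :
  levsum gam w s (es1 ++ es2) = levsum gam w s es1 + levsum gam w (last s es1) es2.
Proof. by elim: es1 s => [|e es1 IH] s /=; rewrite ?add0r// IH addrA. Qed.

Lemma levsumB gam w w' s es :
  levsum gam w s es - levsum gam w' s es = levsum gam (fun t => w t - w' t) s es.
Proof. by elim: es s => [|e es IH] s /=; rewrite ?subrr// -IH; ring. Qed.

Lemma levsum_ge gam w s es (m : R) : path <=%R s es -> 0 <= s -> last s es <= 1 -> 0 <= m ->
  (forall t, s <= t -> m <= gam t) ->
  (forall t u, 0 <= t -> t <= u -> u <= 1 -> w t <= w u) ->
  m * (w (last s es) - w s) <= levsum gam w s es.
Proof.
move=> + + + m0; elim: es s => [|e es IH] s /=; first by rewrite subrr mulr0.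
move=> /andP[se pe] s0 l1 mg wmono; have e0 := le_trans s0 se.
have el := path_le_last pe.
have := IH e pe e0 l1 (fun t et => mg t (le_trans se et)) wmono => h.
have -> : m * (w (last e es) - w s) = m * (w e - w s) + m * (w (last e es) - w e) by ring.
apply: lerD => //; apply: ler_wpM2r; first by rewrite subr_ge0; apply: wmono => //; exact: le_trans l1.
exact: mg.
Qed.

Lemma levsum_shift gam gam' w s es (d : R) : path <=%R s es ->
  (forall t, s <= t -> t < last s es -> gam' t = gam t + d) ->
  levsum gam' w s es = levsum gam w s es + d * (w (last s es) - w s).
Proof.
elim: es s => [|e es IH] s /=; first by rewrite subrr mulr0 addr0.
move=> /andP[se pe] g; rewrite (IH e pe (fun t et => g t (le_trans se et))).
have := path_le_last pe; rewrite le_eqVlt => /predU1P[el|el]; last first.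
  by rewrite g ?(le_lt_trans se)//; ring.
rewrite -el subrr mulr0 addr0; move: se; rewrite le_eqVlt => /predU1P[->|se].
  by rewrite !subrr !mulr0 addr0.
by rewrite g -?el//; ring.
Qed.

(** Jumps occur in [qs] only, with the right-continuous convention of distribution functions: a jump
    at [t] is seen between [s] and [t], a jump at [s] is not. *)
Definition steps gam qs : Prop :=
  forall s t, s <= t -> (forall q, q \in qs -> ~~ (s < q <= t)) -> gam s = gam t.

(** Breakpoints beyond the jumps merely subdivide levels, so one list can serve two step functions
    that are to be compared. *)
Lemma stepf_steps gam qs s es : path <=%R s es -> steps gam qs ->
  (forall q, q \in qs -> s < q -> q < last s es -> q \in es) -> stepf gam s es.
Proof.
move=> + sg; elim: es s => [//|e es IH] s /= /andP[se pe] h; have el := path_le_last pe.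
split.
  move=> t st te; apply/esym; apply: sg => // q qq; apply/negP => /andP[sq qt].
  have qe := le_lt_trans qt te; have := h q qq sq (lt_le_trans qe el).
  rewrite inE => /predU1P[qe'|qes]; first by rewrite qe' ltxx in qe.
  have := order_path_min le_trans pe => /allP /(_ q qes) eq; by move: qe; rewrite ltNge eq.
apply: IH => // q qq eq ql; have := h q qq (le_lt_trans se eq) ql.
by rewrite inE => /predU1P[qe|//]; rewrite qe ltxx in eq.
Qed.
End Levels.

(** * The clock of the mixture and the functional at step functions *)

Section Model.
Context {R : realType}.
Notation mu := (@lebesgue_measure R).
Variable c : nat -> R.
Hypothesis hc : (\sum_(2 <= p <oo) (2 ^+ p * c p ^+ 2)%:E < +oo)%E.
Hypothesis nz : exists2 p, (2 <= p)%N & c p != 0.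
Implicit Types (s t x : R).

(** The first derivative of the mixture, frozen outside [[0, 1]]: the clock in which the Parisi
    equation has unit diffusion coefficient. [vxi] is its speed on [[0, 1]]. *)
Definition wxi t : R := xi1 c (clamp t).
Definition vxi t : R := xi2 c (clamp t).

Let clamp_lt2 t : `|clamp t| < 2.
Proof.
have /andP[h0 h1] := clamp01 t; rewrite ger0_norm//; apply: (le_lt_trans h1); by rewrite ltr1n.
Qed.

Lemma clamp_mono s t : s <= t -> clamp s <= clamp t.
Proof.
move=> st; rewrite /clamp ge_max; apply/andP; split; first by rewrite le_max lexx.
rewrite le_max; apply/orP; right; rewrite le_min; apply/andP; split; first by rewrite ge_min lexx.
by rewrite ge_min st orbT.
Qed.

Lemma wxi_cont : continuous wxi.
Proof.
move=> t; apply: (@continuous_comp _ _ _ clamp (xi1 c)); first exact: clamp_cont.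
apply: differentiable_continuous; apply/derivable1_diffP.
by have [] := dxi1 hc (clamp_lt2 t).
Qed.

Lemma vxi_cont : continuous vxi.
Proof.
by move=> t; apply: (@continuous_comp _ _ _ clamp (xi2 c)); [exact: clamp_cont|exact: xi2_cont].
Qed.

Lemma xi''_vxi t : 0 <= t -> t <= 1 -> xi'' c t = vxi t.
Proof.
by move=> t0 t1; rewrite /vxi clampE// xi''E// ger0_norm// (le_lt_trans t1)// ltr1n.
Qed.

Lemma clamp_near t : 0 < t -> t < 1 -> \forall s \near t, clamp s = s.
Proof.
move=> t0 t1; have h0 := lt_nbhsr t0; have h1 := lt_nbhsl t1.
by near=> s; apply: clampE; apply: ltW; near: s.
Unshelve. all: by end_near.
Qed.

Lemma dwxi t : 0 < t -> t < 1 -> is_derive t 1 wxi (vxi t).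
Proof.
move=> t0 t1; rewrite /vxi clampE ?ltW//.
apply: (@near_eq_is_derive _ _ _ (xi1 c)).
  by have := clamp_near t0 t1; apply: filterS => s; rewrite /wxi => ->.
by apply: (dxi1 hc); rewrite gtr0_norm// (lt_trans t1)// ltr1n.
Qed.

Lemma vxi_ge0 t : 0 <= vxi t.
Proof.
by have /andP[h0 h1] := clamp01 t; apply: (xi2_ge0 hc) => //; apply: (le_lt_trans h1); rewrite ltr1n.
Qed.

Lemma le_vxi s t : s <= t -> vxi s <= vxi t.
Proof.
move=> st; have /andP[h0 h1] := clamp01 s; have /andP[h2 h3] := clamp01 t.
by apply: (le_xi2 hc) => //; [exact: clamp_mono|apply: (le_lt_trans h3); rewrite ltr1n].
Qed.

Lemma vxi_gt0 t : 0 < t -> 0 < vxi t.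
Proof.
move=> t0; have [p p2 cp] := nz; apply: (xi2_gt0 hc p2 cp).
  by rewrite /clamp lt_max lt_min t0 ltr01 orbT.
by have /andP[h0 h1] := clamp01 t; apply: (le_lt_trans h1); rewrite ltr1n.
Qed.

(** [t * xi' - xi] is the primitive of [t * xi''], the weight of the penalty term in the functional.
    The difference [w3xi] has derivative [(1 - t) * xi''] and measures the net effect of a level. *)
Definition w2xi t : R := clamp t * wxi t - xi c (clamp t).
Definition w3xi t : R := wxi t - w2xi t.

Lemma w2xi_cont : continuous w2xi.
Proof.
move=> t; apply: cvgB.
  by apply: cvgM; [exact: clamp_cont|exact: wxi_cont].
apply: (@continuous_comp _ _ _ clamp (xi c)); first exact: clamp_cont.
apply: differentiable_continuous; apply/derivable1_diffP.
by have [] := dxi hc (clamp_lt2 t).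
Qed.

Lemma dw2xi t : 0 < t -> t < 1 -> is_derive t 1 w2xi (t * vxi t).
Proof.
move=> t0 t1.
apply: (@near_eq_is_derive _ _ _ (fun s => s * wxi s - xi c s)).
  by have := clamp_near t0 t1; apply: filterS => s; rewrite /w2xi => ->.
have t2 : `|t| < 2 by rewrite gtr0_norm// (lt_trans t1)// ltr1n.
have h := is_deriveB (is_deriveM (is_derive_id t 1) (dwxi t0 t1)) (dxi hc t2).
apply: (is_derive_eq h); rewrite /GRing.scale /= mulr1 /wxi clampE ?ltW//; ring.
Qed.

Lemma dw3xi t : 0 < t -> t < 1 -> is_derive t 1 w3xi ((1 - t) * vxi t).
Proof.
move=> t0 t1; have h := is_deriveB (dwxi t0 t1) (dw2xi t0 t1).
by apply: (is_derive_eq h); ring.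
Qed.

Lemma xi_FTC (q Q : R -> R) s t : continuous q -> continuous Q ->
  (forall v : R, 0 < v -> v < 1 -> is_derive v 1 Q (q v)) -> 0 <= s -> s <= t -> t <= 1 ->
  Int (fun v => ind s t v * q v) = Q t - Q s.
Proof.
move=> cq cQ dQ s0 st t1; apply: Int_FTC => // v sv vt.
by apply: dQ; [exact: le_lt_trans sv|exact: lt_le_trans t1].
Qed.

Lemma xi_incr (q Q : R -> R) s t (m : R) : continuous q -> continuous Q ->
  (forall v : R, 0 < v -> v < 1 -> is_derive v 1 Q (q v)) -> 0 <= s -> s <= t -> t <= 1 ->
  (forall v, s <= v -> v <= t -> m <= q v) -> m * (t - s) <= Q t - Q s.
Proof.
move=> cq cQ dQ s0 st t1 mq; rewrite -(xi_FTC cq cQ dQ s0 st t1) -(Int_ind st) -IntZl; last exact: intg_ind.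
apply: le_Int; [by apply: intgZl; exact: intg_ind|exact: intg_indc|move=> v].
rewrite mulrC; have [/andP[h1 h2]|] := boolP (s <= v <= t); first by rewrite ler_wpM2l ?ind_ge0// mq.
by rewrite negb_and -!ltNge => h; rewrite ind0// !mul0r.
Qed.

Lemma xi_decr (q Q : R -> R) s t (m : R) : continuous q -> continuous Q ->
  (forall v : R, 0 < v -> v < 1 -> is_derive v 1 Q (q v)) -> 0 <= s -> s <= t -> t <= 1 ->
  (forall v, s <= v -> v <= t -> q v <= m) -> Q t - Q s <= m * (t - s).
Proof.
move=> cq cQ dQ s0 st t1 qm.
have := @xi_incr (fun v => - q v) (fun v => - Q v) s t (- m).
move=> h; rewrite -lerN2 -mulNr; apply: (le_trans (h _ _ _ s0 st t1 _)).
- by move=> v; apply: cvgN; exact: cq.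
- by move=> v; apply: cvgN; exact: cQ.
- by move=> v v0 v1; apply: is_deriveN; exact: dQ.
- by move=> v sv vt; rewrite lerN2 qm.
- by rewrite opprB opprK addrC.
Qed.

Let c3 : continuous (fun t => (1 - t) * vxi t).
Proof.
by move=> t; apply: cvgM; [apply: cvgB; [exact: cvg_cst|exact: cvg_id]|exact: vxi_cont].
Qed.

Lemma w3xi_cont : continuous w3xi.
Proof. by move=> t; apply: cvgB; [exact: wxi_cont|exact: w2xi_cont]. Qed.

Lemma le_wxi s t : s <= t -> wxi s <= wxi t.
Proof.
move=> st; have /andP[h0 h1] := clamp01 s; have /andP[h2 h3] := clamp01 t.
have := @xi_incr vxi wxi (clamp s) (clamp t) 0 vxi_cont wxi_cont dwxi h0 (clamp_mono st) h3 (fun v _ _ => vxi_ge0 v).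
by rewrite mul0r subr_ge0 /wxi (clampE h0 h1) (clampE h2 h3).
Qed.

Lemma le_w3xi s t : 0 <= s -> s <= t -> t <= 1 -> w3xi s <= w3xi t.
Proof.
move=> s0 st t1; rewrite -subr_ge0.
have := @xi_incr _ w3xi s t 0 c3 w3xi_cont dw3xi s0 st t1; rewrite mul0r; apply => v sv vt.
by rewrite mulr_ge0 ?vxi_ge0// subr_ge0; exact: le_trans vt t1.
Qed.

Lemma lt_wxi s t : 0 <= s -> s < t -> t <= 1 -> wxi s < wxi t.
Proof.
move=> s0 st t1; pose m := (s + t) / 2.
have m1 : s < m by rewrite /m; lra.
have m2 : m < t by rewrite /m; lra.
have m0 := le_lt_trans s0 m1.
apply: (le_lt_trans (le_wxi (ltW m1))); rewrite -subr_gt0.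
apply: (@lt_le_trans _ _ (vxi m * (t - m))); first by rewrite mulr_gt0 ?vxi_gt0// subr_gt0.
apply: (xi_incr vxi_cont wxi_cont dwxi (ltW m0) (ltW m2) t1) => v mv _; exact: le_vxi.
Qed.

Lemma lt_w3xi s : 0 <= s -> s < 1 -> w3xi s < w3xi 1.
Proof.
move=> s0 s1; pose m1 := (2 * s + 1) / 3; pose m2 := (s + 2) / 3.
have h1 : s < m1 by rewrite /m1; lra.
have h2 : m1 < m2 by rewrite /m1 /m2; lra.
have h3 : m2 < 1 by rewrite /m2; lra.
have h0 := le_lt_trans s0 h1.
apply: (le_lt_trans (le_w3xi s0 (ltW h1) (ltW (lt_trans h2 h3)))).
apply: (@lt_le_trans _ _ (w3xi m2)); last by apply: le_w3xi (ltW h3) (lexx 1); exact: ltW (lt_trans h0 h2).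
rewrite -subr_gt0; apply: (@lt_le_trans _ _ ((1 - m2) * vxi m1 * (m2 - m1))).
  by rewrite !mulr_gt0 ?vxi_gt0// subr_gt0.
apply: (xi_incr c3 w3xi_cont dw3xi (ltW h0) (ltW h2) (ltW h3)) => v mv vm.
apply: ler_pM; rewrite ?vxi_ge0//; [by rewrite subr_ge0 ltW|by rewrite lerD2l lerN2|exact: le_vxi].
Qed.

Section Functional.
Variables (beta h : R) (alpha : R -> R) (es : seq R).
Hypothesis beta0 : 0 < beta.
Hypothesis alpha01 : forall t, 0 <= alpha t <= 1.
Hypothesis amono : forall s t, s <= t -> alpha s <= alpha t.
Let gam t := beta * alpha t.
Hypotheses (pes : path <=%R 0 es) (les : last 0 es = 1) (ses : stepf gam 0 es).

Let gam0 t : 0 <= gam t.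
Proof. by rewrite mulr_ge0 ?(ltW beta0)//; have /andP[] := alpha01 t. Qed.

Let malpha : measurable_fun setT alpha.
Proof.
by apply: (@nondecreasing_measurable _ setT); [exact: measurableT|move=> s t; exact: amono].
Qed.

Let gamB t : gam t <= beta.
Proof. by rewrite /gam ler_piMr ?(ltW beta0)//; have /andP[] := alpha01 t. Qed.

(** [parisi_pde] is some chosen weak solution. The glued Cole-Hopf solution shows that the choice is
    made among actual solutions, and uniqueness gives its value at [(0, h)]. *)
Lemma parisi_pde_step : parisi_pde c beta alpha 0 h = pval gam wxi (lcosh beta) 0 es h.
Proof.
have mgam : measurable_fun setT gam by exact: measurable_funM.
have sol : weak_solution c beta alpha (psi gam wxi (lcosh beta) 0 es).
  apply: (@psi_weak R gam wxi vxi (lcosh beta) gam0 mgam (profile_lcosh beta0) wxi_cont vxi_cont le_wxi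
    lt_wxi dwxi c beta beta alpha es gamB) => //.
  exact: xi''_vxi.
rewrite -(@psi_start R gam wxi (lcosh beta) 0 es pes).
have h1 : weak_solution c beta alpha (parisi_pde c beta alpha) by apply: (xgetPex (fun _ _ : R => 0)); exists (psi gam wxi (lcosh beta) 0 es).
have hB t : 0 <= t -> t <= 1 -> `|beta * alpha t| <= beta by move=> _ _; rewrite ger0_norm; [exact: gamB|exact: gam0].
have v1 t : 0 <= t -> t <= 1 -> vxi t <= vxi 1 by move=> _; exact: le_vxi.
have uniq := @weak_unique R c beta alpha wxi vxi beta (vxi 1) malpha hB xi''_vxi wxi_cont vxi_cont le_wxi lt_wxi dwxi
  (fun t _ _ => vxi_ge0 t) v1.
exact: (uniq _ _ h1 sol 0 h (lexx 0) ler01).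
Qed.

Let pen_level s es' : 0 <= s -> path <=%R s es' -> last s es' <= 1 -> stepf gam s es' ->
  Int (fun t => ind s (last s es') t * (gam t * (t * vxi t))) = levsum gam w2xi s es'.
Proof.
elim: es' s => [|e es' IH] s s0 /=.
  move=> _ s1 _; apply/eqP; rewrite -normr_le0.
  rewrite (_ : Int _ = Int (fun t => ind s s t * (0 * (gam s * (s * vxi s))))); last first.
    have m1 : measurable_fun setT (fun t => gam t * (t * vxi t)).
      apply: measurable_funM; first exact: measurable_funM.
      by apply: measurable_funM => //; apply: continuous_measurable_fun; exact: vxi_cont.
    apply: (@Int_ae_ind _ _ (fun=> 0 * (gam s * (s * vxi s))) s s m1 (@measurable_cst _ _ _ _ _ _)) => t ts st.
    by have := lt_trans ts st; rewrite ltxx.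
  by rewrite IntZr ?mul0r ?mulr0 ?normr0//; exact: intg_ind.
move=> /andP[se pe] l1 [cg sg]; have e0 := le_trans s0 se; have el := path_le_last pe.
have m1 : measurable_fun setT (fun t => gam t * (t * vxi t)).
  apply: measurable_funM; first exact: measurable_funM.
  by apply: measurable_funM => //; apply: continuous_measurable_fun; exact: vxi_cont.
rewrite (@ind_split _ _ s e (last e es') se el); last first.
  apply: (@intg_le _ _ (fun t => beta * vxi 1 * ind s (last e es') t)).
  - by apply: measurable_funM; [exact: measurable_ind|exact: m1].
  - move=> t; rewrite normrM mulrC (ger0_norm (ind_ge0 _ _ t)).
    have [/andP[q1 q2]|] := boolP (s <= t <= last e es'); last first.
      by rewrite negb_and -!ltNge => hq; rewrite ind0// !mulr0.
    apply: ler_wpM2r; first exact: ind_ge0.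
    have t0 := le_trans s0 q1; have t1 := le_trans q2 l1.
    have tv0 : 0 <= t * vxi t by exact: mulr_ge0 t0 (vxi_ge0 t).
    rewrite (@ger0_norm _ (gam t * (t * vxi t))); last exact: mulr_ge0 (gam0 t) tv0.
    apply: ler_pM => //.
    rewrite -[leRHS]mul1r; apply: ler_pM; rewrite ?vxi_ge0//; exact: le_vxi.
  by apply: intgZl; exact: intg_ind.
rewrite (IH e e0 pe l1 sg); congr (_ + _).
have c2 : continuous (fun t => t * vxi t) by move=> t; apply: cvgM; [exact: cvg_id|exact: vxi_cont].
rewrite -(xi_FTC c2 w2xi_cont dw2xi s0 se (le_trans el l1)) -IntZl; last exact: intg_indc.
transitivity (Int (fun t => ind s e t * (gam s * (t * vxi t)))); last by apply: eq_Int => t; rewrite mulrCA.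
apply: Int_ae_ind => //.
  by apply: measurable_funM => //; apply: continuous_measurable_fun.
by move=> t st te; rewrite cg// ltW.
Qed.

Lemma parisi_functional_step : parisi_functional c h beta alpha =
  ln 2 / beta + pval gam wxi (lcosh beta) 0 es h - levsum gam w2xi 0 es / 2.
Proof.
rewrite /parisi_functional parisi_pde_step [2^-1 * _]mulrC; congr (_ - _ / 2).
have := pen_level (lexx 0) pes; rewrite les => /(_ (lexx 1) ses) <-.
rewrite /Int Rintegral_mkcond; congr Rintegral; apply/funext => t.
rewrite patchE /ind indicE; have [/set_mem ht|_] := boolP (t \in _); last by rewrite mul0r.
move: ht; rewrite /= in_itv /= => /andP[t0 t1].
by rewrite mul1r -xi''_vxi// /gam !mulrA.
Qed.
End Functional.
End Model.

(** * Probability measures with finite support *)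

Section Probabilities.
Context {R : realType}.
Implicit Types (mu : probability R R) (s t q x a : R) (S : set R).

(** If no list of distinct points of [S] is longer than [k], one of maximal length exhausts [S]. *)
Lemma set_or_large (S : set R) k :
  (exists x : 'I_k.+1 -> R, injective x /\ forall i, S (x i)) \/
  (exists qs : seq R, [/\ (size qs <= k)%N, uniq qs & forall x, x \in qs <-> S x]).
Proof.
have [[qs [us qS ks]]|hn] := pselect (exists qs : seq R, [/\ uniq qs, forall x, x \in qs -> S x & (k < size qs)%N]).
  left; exists (fun i : 'I_k.+1 => nth 0 qs i); split => [i j /eqP|i].
    by rewrite nth_uniq// ?(leq_trans (ltn_ord _) ks)// => /eqP e; apply: val_inj.
  by apply/qS/mem_nth; rewrite (leq_trans (ltn_ord _) ks).
right; pose P n := `[< exists qs : seq R, [/\ uniq qs, forall x, x \in qs -> S x & size qs = n] >].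
have P0 : exists n, P n by exists 0%N; apply/asboolP; exists [::].
have Pk n : P n -> (n <= k)%N.
  by move=> /asboolP[qs [u qS e]]; rewrite leqNgt; apply/negP => kn; apply: hn; exists qs; rewrite e.
case: (ex_maxnP P0 Pk) => n /asboolP[qs [u qS e]] mx.
exists qs; split => // [|x]; first by rewrite e; apply: Pk; apply/asboolP; exists qs.
split; first exact: qS.
move=> Sx; apply/negPn/negP => xqs.
have : P n.+1.
  apply/asboolP; exists (x :: qs); split => //=; [by rewrite xqs|move=> y|by rewrite e].
  by rewrite inE => /predU1P[->//|]; exact: qS.
by move=> /mx; rewrite ltnn.
Qed.

(** Every point outside the support lies in a null interval with rational endpoints, and there are
    countably many of these. *)
Lemma support_null mu : mu.-negligible (~` measure_support mu).
Proof.
pose I (p : rat * rat) : set R := `](ratr p.1), (ratr p.2)[%classic.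
pose N n : set R := if @unpickle (rat * rat)%type n is Some p then
  if mu (I p) == 0%E then I p else set0 else set0.
have N0 n : mu.-negligible (N n).
  rewrite /N; case: (unpickle n) => [p|]; last exact: negligible_set0.
  case: ifPn => [/eqP e|_]; last exact: negligible_set0.
  by apply/negligibleP => //; exact: measurable_itv.
apply: negligibleS (negligible_bigcup N0) => x; rewrite /measure_support /= => /existsNP[U /not_implyP[oU /not_implyP[Ux nU]]].
have U0 : mu U = 0%E by apply/eqP; move/negP : nU; rewrite -leNgt => h; rewrite eq_le h measure_ge0.
have := open_nbhs_nbhs (conj oU Ux) => /nbhs_ballP[e /= e0 eU].
have xe1 : x - e < x by rewrite ltrBlDr ltrDl.
have xe2 : x < x + e by rewrite ltrDl.
have [a] := rat_in_itvoo xe1; have [b] := rat_in_itvoo xe2; rewrite !in_itv /= => /andP[xb be] /andP[ea ax].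
have IU : I (a, b) `<=` U.
  move=> y; rewrite /I /= in_itv /= => /andP[ay yb]; apply: eU; suff : `|x - y| < e by [].
  by rewrite ltr_norml; apply/andP; split; move: (ratr a : R) (ratr b : R) ea ax ay xb be yb => ? ? *; lra.
exists (pickle (a, b)); first by [].
rewrite /N pickleK.
have -> : mu (I (a, b)) = 0%E.
  apply/eqP; rewrite -measure_le0 -U0; apply: le_measure => //; rewrite inE; first exact: measurable_itv.
  exact: open_measurable.
by rewrite eqxx /I /= in_itv /= ax xb.
Qed.

Lemma null_outside mu (A : set R) : measurable A -> (forall x, A x -> ~ measure_support mu x) -> mu A = 0%E.
Proof.
move=> mA h; apply: measure_negligible => //; apply: negligibleS (support_null mu) => x Ax.
exact: h.
Qed.

Lemma measure_df mu t : mu `]-oo, t]%classic = (distribution_function mu t)%:E.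
Proof. by rewrite fineK//; apply: fin_num_measure; exact: measurable_itv. Qed.

Lemma df_ge0 mu t : 0 <= distribution_function mu t.
Proof. by apply: fine_ge0; exact: measure_ge0. Qed.

Lemma df_le1 mu t : distribution_function mu t <= 1.
Proof. by rewrite -lee_fin -measure_df; apply: probability_le1; exact: measurable_itv. Qed.

Lemma df_diff mu s t : s <= t -> mu `]s, t]%classic = (distribution_function mu t - distribution_function mu s)%:E.
Proof.
move=> st; have e : `]-oo, t]%classic = `]-oo, s]%classic `|` `]s, t]%classic :> set R.
  apply/seteqP; split => y /=; rewrite !in_itv /=; first by move=> yt; have [ys|ys] := leP y s; [left|right].
  by move=> [ys|/andP[]//]; exact: le_trans ys st.
have := measure_df mu t; rewrite e measureU; [|exact: measurable_itv|exact: measurable_itv|].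
  move=> h; have {}h : ((distribution_function mu s)%:E + mu `]s, t]%classic = (distribution_function mu t)%:E)%E.
    by rewrite -measure_df; exact: h.
  by rewrite EFinB -h [X in (X - _)%E]addeC addeK.
by apply/seteqP; split => y //=; rewrite !in_itv /= => -[ys /andP[sy _]]; move: sy; rewrite ltNge ys.
Qed.

Lemma le_df mu s t : s <= t -> distribution_function mu s <= distribution_function mu t.
Proof. by move=> st; rewrite -subr_ge0 -lee_fin -(df_diff mu st) measure_ge0. Qed.

Lemma df1 mu : unit_supported mu -> distribution_function mu 1 = 1.
Proof.
move=> us; apply/le_anti/andP; split; first exact: df_le1.
rewrite -lee_fin -measure_df -[X in (X <= _)%E]us; apply: le_measure; rewrite ?inE; try exact: measurable_itv.
by move=> y /=; rewrite !in_itv /= => /andP[].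
Qed.

Lemma support01 mu x : unit_supported mu -> measure_support mu x -> 0 <= x <= 1.
Proof.
move=> us sx; apply/negPn/negP => nx.
have := sx (~` `[0, 1]%classic); rewrite probability_setC; last exact: measurable_itv.
rewrite us subee// ltxx => h; suff : false by []; apply: h.
  by rewrite openC; exact: itv_closed.
by move=> /=; rewrite in_itv /=; exact/negP.
Qed.

Section Atoms.
Variables (mu : probability R R) (qs : seq R).
Hypothesis us : unit_supported mu.
Hypothesis qsS : forall x, x \in qs <-> measure_support mu x.

Lemma atom01 q : q \in qs -> 0 <= q <= 1.
Proof. by move=> /qsS; exact: support01. Qed.

Lemma df_steps : steps (distribution_function mu) qs.
Proof.
move=> s t st h; have := df_diff mu st; rewrite null_outside => [[e]||]; last 2 first.
- exact: measurable_itv.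
- by move=> x /=; rewrite in_itv /= => xst /qsS /h; rewrite xst.
by apply/esym/eqP; rewrite -subr_eq0 -e.
Qed.

Lemma df_before t : (forall q, q \in qs -> t < q) -> distribution_function mu t = 0.
Proof.
move=> h; have m0 : mu `]-oo, t]%classic = 0%E.
  apply: null_outside; first exact: measurable_itv.
  by move=> x /=; rewrite in_itv /= => xt /qsS /h; rewrite ltNge xt.
by rewrite /distribution_function m0.
Qed.

(** In a finite support every point is isolated: a small ball around [q] has positive mass, and all
    of it sits at [q]. *)
Lemma atom_gt0 q : q \in qs -> 0 < fine (mu [set q]).
Proof.
move=> qq; have mq : measurable [set q] by exact: measurable_set1.
rewrite lt_neqAle fine_ge0 ?measure_ge0// andbT eq_sym fine_eq0; last exact: fin_num_measure.
apply/eqP => q0.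
have [e e0 he] : exists2 e : R, 0 < e & forall x, x \in qs -> x != q -> e <= `|q - x|.
  elim: (qs) => [|y l [e e0 he]]; first by exists 1.
  have [->|yq] := eqVneq y q.
    by exists e => // x; rewrite inE => /predU1P[->|/he//]; rewrite eqxx.
  exists (Num.min e `|q - y|); first by rewrite lt_min e0 normr_gt0 subr_eq0 eq_sym.
  move=> x; rewrite inE => /predU1P[->|xl xq]; first by rewrite ge_min lexx orbT.
  by rewrite ge_min he.
have /(_ (ball q e) (ball_open q e) (ballxx q e0)) := (qsS q).1 qq.
rewrite (_ : mu _ = 0%E) ?ltxx//; apply: measure_negligible; first exact: measurable_ball.
apply: (negligibleS _ (negligibleU ((negligibleP mu mq).2 q0) (support_null mu))) => x xe.
have [->|xq] := eqVneq x q; [by left|right] => /qsS xs.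
by have := he x xs xq; rewrite leNgt => /negP; apply.
Qed.
End Atoms.

Lemma df_dirac (s t : R) : distribution_function (dirac s : probability R R) t = ((s <= t)%R)%:R.
Proof.
have e : (dirac s : probability R R) `]-oo, t]%classic = (\1_(`]-oo, t]%classic : set R) s)%:E by exact: diracE.
rewrite /distribution_function e /= indicE; have [st|st] := leP s t.
  by rewrite mem_set//= in_itv.
by rewrite memNset//= in_itv /=; apply/negP; rewrite -ltNge.
Qed.

(** The measure with mass [a] moved from [q] to [s]. It is assembled from [mu] off [q] and two
    weighted Dirac masses, so that no subtraction of measures occurs; its total mass is 1 and
    normalising does not change it. *)
Lemma transfer mu a q s : unit_supported mu -> 0 <= s -> s <= 1 -> 0 <= q -> q <= 1 ->
  0 <= a -> a <= fine (mu [set q]) -> exists nu : probability R R, unit_supported nu /\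
  forall t, distribution_function nu t = distribution_function mu t + a * ((s <= t)%R)%:R - a * ((q <= t)%R)%:R.
Proof.
move=> us s0 s1 q0 q1 a0 ap; pose p := fine (mu [set q]).
have mq : measurable [set q] by exact: measurable_set1.
have pE : mu [set q] = p%:E by rewrite fineK//; exact: fin_num_measure.
have b0 : 0 <= p - a by rewrite subr_ge0.
pose m1 : {measure set R -> \bar R} := measure_add (mscale (NngNum b0) (dirac q)) (mscale (NngNum a0) (dirac s)).
pose m : {measure set R -> \bar R} := measure_add (mrestr mu (measurableC mq)) m1.
have mE A : measurable A -> m A = (mu A + (a * \1_A s - a * \1_A q)%:E)%E.
  move=> mA.
  have -> : m A = (mu (A `&` ~` [set q]) + ((p - a)%:E * (\1_A q)%:E + a%:E * (\1_A s)%:E))%E.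
    by rewrite /m [LHS]measure_addE; congr (_ + _)%E; rewrite /m1 [LHS]measure_addE.
  have e : mu A = (mu (A `&` ~` [set q]) + (p * \1_A q)%:E)%E.
    have eA : A = (A `&` ~` [set q]) `|` (A `&` [set q]) by rewrite -setIUr setUC setUv setIT.
    rewrite {1}eA measureU; [|exact: measurableI mA (measurableC mq)|exact: measurableI|]; last first.
      by rewrite setIACA [~` _ `&` _]setIC setICr setI0.
    congr (_ + _)%E; rewrite indicE; have [qA|qA] := boolP (q \in A).
      rewrite mulr1 -pE; congr (mu _); apply/seteqP; split => y /=; first by move=> [].
      by move=> ->; split => //; exact: set_mem.
    rewrite mulr0 (_ : A `&` _ = set0) ?measure0//; apply/seteqP; split => y //= [Ay yq].
    by move: qA; rewrite -yq mem_set.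
  rewrite e -addeA; congr (_ + _)%E; rewrite !indicE -!EFinM -!EFinD.
  by congr (_%:E); ring.
have mT : m setT = 1%E.
  by rewrite mE// probability_setT !indicE !in_setT !mulr1 subrr adde0.
pose nu : probability R R := mnormalize m mu.
have nuE A : measurable A -> nu A = m A.
  by move=> mA; rewrite /nu /= /mnormalize mT onee_eq0 /= invr1 mule1.
exists nu; split.
  rewrite /unit_supported nuE; last exact: measurable_itv.
  rewrite mE; last exact: measurable_itv.
  by rewrite us !indicE !mem_set ?mulr1 ?subrr ?adde0//= in_itv /= ?s0 ?q0.
move=> t; rewrite /distribution_function nuE; last exact: measurable_itv.
rewrite mE; last exact: measurable_itv.
rewrite measure_df /= !indicE -addrA.
have mem x : (x \in (`]-oo, t]%classic : set R)) = (x <= t).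
  by apply/idP/idP => [/set_mem|xt]; [|apply/mem_set]; rewrite /= in_itv.
by rewrite !mem.
Qed.
End Probabilities.

(** * Bounds at a minimizer *)

Section SortedBreakpoints.
Context {R : realType}.
Implicit Types (l qs : seq R) (s b x : R) (P : pred R).

Definition srt P qs : seq R := sort <=%R [seq x <- qs | P x].

Lemma mem_srt P qs x : (x \in srt P qs) = P x && (x \in qs).
Proof. by rewrite mem_sort mem_filter. Qed.

Lemma path_srt P qs s : (forall x, x \in qs -> P x -> s <= x) -> path <=%R s (srt P qs).
Proof.
move=> h; rewrite path_min_sorted; first by apply: sort_sorted; exact: le_total.
by apply/allP => x; rewrite mem_srt => /andP[Px xq]; exact: h.
Qed.

Lemma last_srt P qs s b : s <= b -> (forall x, x \in qs -> P x -> x <= b) -> last s (srt P qs) <= b.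
Proof.
move=> sb h; have := mem_last s (srt P qs); rewrite inE => /predU1P[->//|].
by rewrite mem_srt => /andP[Px xq]; exact: h.
Qed.

Lemma size_srt P qs : (size (srt P qs) <= size qs)%N.
Proof. by rewrite size_sort size_filter count_size. Qed.
End SortedBreakpoints.

Lemma gap_lower {R : realType} (w0 wh ws wg : R) : 0 < wg - ws -> wh <= ws ->
  (wh - w0) / 2 <= (wg - ws) / 8 + (ws - w0) / 2.
Proof. by move=> *; lra. Qed.

Lemma gap_upper {R : realType} (w0 wh ws wg w1 : R) : wg <= w1 -> 0 < wg - ws -> w0 < wh -> wh <= ws ->
  (wg - ws) / 8 + (ws - w0) / 2 <= w1 - w0.
Proof. by move=> *; lra. Qed.

Section Estimates.
Context {R : realType}.
Variable c : nat -> R.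
Hypothesis hc : (\sum_(2 <= p <oo) (2 ^+ p * c p ^+ 2)%:E < +oo)%E.
Hypothesis nz : exists2 p, (2 <= p)%N & c p != 0.
Variables (h : R) (k : nat).
Implicit Types (s t q x : R).
Notation w := (wxi c).
Notation vx := (vxi c).
Notation w3 := (w3xi c).

Let V : R := w 1 - w 0.

Let V0 : 0 < V.
Proof. by rewrite subr_gt0; exact: (lt_wxi hc nz (lexx 0) ltr01 (lexx 1)). Qed.

(** For [beta >= 1], an upper bound for the difference between the value reached from level 0, at
    most [|h| + sqrt V * E|Z|], and the linear lower bound [h - ln 2 / beta]. *)
Definition energy : R := ln 2 + 2 * `|h| + Num.sqrt V * Eg (fun z : R => `|z|).

Section Minimizer.
Variables (beta : R) (mu : probability R R) (qs : seq R).
Hypothesis beta1 : 1 <= beta.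
Hypothesis us : unit_supported mu.
Hypothesis hmin : is_minimizer c h beta (distribution_function mu).
Hypothesis qsS : forall x, x \in qs <-> measure_support mu x.

Let beta0 : 0 < beta. Proof. exact: lt_le_trans ltr01 beta1. Qed.
Let gam t : R := beta * distribution_function mu t.
Let df01 (nu : probability R R) t : 0 <= distribution_function nu t <= 1.
Proof. by rewrite df_ge0 df_le1. Qed.
Let gam_mono s t : s <= t -> gam s <= gam t.
Proof. by move=> st; rewrite ler_pM2l//; exact: le_df. Qed.
Let gam0 t : 0 <= gam t.
Proof. by rewrite mulr_ge0 ?(ltW beta0)// df_ge0. Qed.
Let gsteps : steps gam qs.
Proof. by move=> s t st hq; rewrite /gam (df_steps qsS st hq). Qed.

(** The Dirac mass at 1 has level 0 before time 1 and no penalty. For the minimizer, log cosh is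
    replaced by a line of slope 1, which yields half the integral of [gam] against [w]; minus the
    penalty this is half the integral against [w3], and [gam] is at least [gam q] after [q]. *)
Lemma apriori q : q \in qs -> gam q * (w3 1 - w3 q) <= 2 * energy.
Proof.
move=> qq; have /andP[q0 q1] := atom01 us qsS qq.
pose l1 := srt (fun x => x < q) qs; pose l3 := srt (fun x => q < x) qs ++ [:: 1 : R].
pose es := l1 ++ q :: l3.
have q01 x : x \in qs -> 0 <= x /\ x <= 1 by move=> xq; have /andP[] := atom01 us qsS xq.
have p1 : path <=%R 0 l1 by apply: path_srt => x /q01[].
have p3 : path <=%R q l3.
  rewrite cat_path /= andbT; apply/andP; split; first by apply: path_srt => x _; exact: ltW.
  by apply: last_srt => // x /q01[].
have e1 : last q l3 = 1 by rewrite last_cat.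
have pes : path <=%R 0 es by rewrite cat_path /= p3 andbT p1; apply: last_srt => // x _; exact: ltW.
have les : last 0 es = 1 by rewrite last_cat /= e1.
have ses : stepf gam 0 es.
  apply: (stepf_steps pes gsteps) => x xq x0 _; rewrite mem_cat mem_srt inE mem_cat mem_srt xq !andbT.
  by case: ltgtP; rewrite ?orbT.
have e := parisi_functional_step hc nz h beta0 (df01 mu) (@le_df _ mu) pes les ses.
have us1 : unit_supported (dirac (1 : R) : probability R R).
  have e' : (dirac (1 : R) : probability R R) `[0, 1]%classic = (\1_(`[0, 1]%classic : set R) 1)%:E by exact: diracE.
  by rewrite /unit_supported e' indicE mem_set//= in_itv /= ler01 lexx.
have p' : path <=%R (0 : R) [:: 1] by rewrite /= ler01.
have s' : stepf (fun t => beta * distribution_function (dirac (1 : R) : probability R R) t) 0 [:: 1].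
  by split => // t t0 t1; rewrite !df_dirac !leNgt t1 ltr01.
have e2 := parisi_functional_step hc nz h beta0 (df01 (dirac (1 : R))) (@le_df _ (dirac (1 : R))) p' (erefl _) s'.
have := hmin.2 (distribution_function (dirac (1 : R) : probability R R)) (ex_intro2 _ _ (dirac (1 : R) : probability R R) us1 (erefl _)).
have d0 : distribution_function (dirac (1 : R) : probability R R) 0 = 0 by rewrite df_dirac leNgt ltr01.
rewrite e e2 /= d0 mulr0 mul0r add0r mul0r subr0 -addrA lerD2l => hle.
have hP : Phi 0 (w 1 - w 0) (lcosh beta) h <= `|h| + Num.sqrt V * Eg (fun z : R => `|z|).
  by apply: Phi0_le; [exact: profile_lcosh|move=> y; exact: lcosh_le].
have wm s t : 0 <= s -> s <= t -> t <= 1 -> w s <= w t by move=> _ st _; exact: (le_wxi hc).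
have les1 : last 0 es <= 1 by rewrite les.
have hL := @pval_lower R gam w gam0 wm (lcosh beta) 0 es (ln 2 / beta) h (profile_lcosh beta0) (lexx 0) pes les1
  (fun y => @lcosh_ge R beta y beta0).
have hl3 : gam q * (w3 1 - w3 q) <= levsum gam w3 0 es.
  rewrite levsum_cat /=; apply: (@le_trans _ _ (levsum gam w3 q l3)).
    rewrite -[in leLHS]e1; apply: levsum_ge => //; [by rewrite e1|move=> t qt; exact: gam_mono|].
    by move=> t v; exact: (le_w3xi hc).
  rewrite -[leLHS]add0r addrA lerD2r.
  have hl1 : last 0 l1 <= q by apply: last_srt => // x _; exact: ltW.
  have l10 : 0 <= last 0 l1 by exact: path_le_last p1.
  apply: addr_ge0.
    have := @levsum_ge R gam w3 0 l1 0 p1 (lexx 0) (le_trans hl1 q1) (lexx 0) (fun t _ => gam0 t) (fun t v => @le_w3xi R c hc t v).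
    by rewrite mul0r.
  by rewrite mulr_ge0// subr_ge0; exact: (le_w3xi hc).
have hw : levsum gam w3 0 es = levsum gam w 0 es - levsum gam (w2xi c) 0 es by rewrite levsumB.
have ln2 : ln 2 / beta <= ln 2 :> R by rewrite ler_pdivrMr// ler_peMr// ln_ge0// ler1n.
have hh := ler_norm (- h); rewrite normrN in hh.
apply: (le_trans hl3); rewrite hw /energy.
move: hle hL hP ln2 hh; move: (levsum _ _ _ _) (levsum _ _ _ _) (pval _ _ _ _ _ _) (Phi _ _ _ _) (ln 2 / beta) (Num.sqrt _ * _) (ln 2) `|h|.
by move=> *; lra.
Qed.

Section Gap.
Variables (A q s g1 : R).
Hypotheses (A0 : 0 <= A) (qq : q \in qs) (gA : forall t, t < q -> gam t <= A).
Hypotheses (s0 : 2^-1 <= s) (sg : s < g1) (gq : g1 <= q).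
Hypothesis free : forall x, x \in qs -> ~~ (s < x < g1).
Hypothesis ks : (size qs <= k)%N.

Let B : R := (A + 1) * Num.sqrt V.

(** Moving mass [e / beta] from [q] to [s] raises [gam] by [e] exactly on [[s, q)]. Both the gain of
    [pval_compare] and the change of the linear terms are proportional to [e], which minimality
    allows to divide out. *)
Lemma gap_inequality : (w g1 - w s) / 4 * th0 B * (cB B / 2) ^+ k.+1 *
    (Num.sqrt ((w g1 - w s) / 8) / Num.sqrt V) * bump ((w 2^-1 - w 0) / 2) h <= (w3 q - w3 s) / 2.
Proof.
have /andP[q0 q1] := atom01 us qsS qq.
have sp : 0 <= s by apply: le_trans s0; rewrite invr_ge0.
have sq : s < q := lt_le_trans sg gq.
have s1 : s <= 1 := ltW (lt_le_trans sq q1).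
have g0 : 0 <= g1 := le_trans sp (ltW sg).
have q01 x : x \in qs -> 0 <= x /\ x <= 1 by move=> xq; have /andP[] := atom01 us qsS xq.
pose l1 := srt (fun x => x <= s) qs; pose l2 := srt (fun x => g1 < x < q) qs.
pose l3 := srt (fun x => q < x) qs ++ [:: 1 : R].
(* One list of breakpoints for both measures. Besides the atoms it contains [s] and [g1], which make
   the atom-free stretch a level of its own, and the final time 1. *)
pose es := l1 ++ s :: g1 :: l2 ++ q :: l3.
have p1 : path <=%R 0 l1 by apply: path_srt => x /q01[].
have p3 : path <=%R q l3.
  rewrite cat_path /= andbT; apply/andP; split; first by apply: path_srt => x _; exact: ltW.
  by apply: last_srt => // x /q01[].
have e3 : last q l3 = 1 by rewrite last_cat.
have pes : path <=%R 0 es.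
  rewrite cat_path p1 /= (ltW sg) cat_path /= p3 andbT; apply/andP; split; first by apply: last_srt.
  apply/andP; split; first by apply: path_srt => x _ /andP[/ltW].
  by apply: last_srt => // x _ /andP[_ /ltW].
have les : last 0 es = 1 by rewrite last_cat /= last_cat.
have mem_es x : x \in s :: q :: qs -> x \in es.
  rewrite /es /l3 !inE !mem_cat !inE !mem_cat inE !mem_cat !mem_srt => /or3P[->|->|xq]; rewrite ?orbT//.
  rewrite xq !andbT; have := free xq; rewrite negb_and -!leNgt => /orP[->//|gx].
  have [xg|xg] := eqVneq x g1; first by rewrite !orbT.
  have {}gx : g1 < x by rewrite lt_neqAle gx eq_sym xg.
  by rewrite gx /=; case: (ltgtP x q); rewrite ?orbT.
pose p := fine (mu [set q]); have p0 : 0 < p := atom_gt0 qsS qq.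
have B0 : 0 <= B by rewrite mulr_ge0 ?sqrtr_ge0// addr_ge0.
have th00 := th0_gt0 B0.
have den : 0 < A * V * th0 B + 1 by apply: ltr_wpDl => //; apply: mulr_ge0; [exact: mulr_ge0 A0 (ltW V0)|exact: ltW].
(* At most [beta * p] so that the atom has enough mass to give, at most 1 so that the raised levels
   obey [B], and at most the last inverse so that the gain meets the smallness condition of
   [pval_compare]. *)
pose e := Num.min (beta * p) (Num.min 1 (A * V * th0 B + 1)^-1).
have e0 : 0 < e by rewrite !lt_min mulr_gt0//= invr_gt0 den ltr01.
have ep : e / beta <= p by rewrite ler_pdivrMr// mulrC ge_min lexx.
have e1 : e <= 1 by rewrite !ge_min lexx orbT.
have eA : e * (A * V * th0 B + 1) <= 1 by rewrite -ler_pdivlMr// div1r !ge_min lexx !orbT.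
have [nu [usn dfn]] := transfer us sp s1 q0 q1 (divr_ge0 (ltW e0) (ltW beta0)) ep.
pose gam' t := beta * distribution_function nu t.
have gE t : gam' t = gam t + e * (s <= t)%R%:R - e * (q <= t)%R%:R.
  by rewrite /gam' dfn /gam; field; rewrite gt_eqF.
have gam'0 t : 0 <= gam' t by rewrite mulr_ge0 ?(ltW beta0)// df_ge0.
have st' : steps gam' (s :: q :: qs).
  move=> x y xy hq; rewrite !gE.
  have -> : gam x = gam y by apply: gsteps => // r rq; apply: hq; rewrite !inE rq !orbT.
  have ef r : r \in s :: q :: qs -> (r <= x)%R = (r <= y)%R.
    move=> rr; have := hq r rr; rewrite negb_and -leNgt -ltNge => /orP[rx|yr].
      by rewrite rx (le_trans rx xy).
    by rewrite !leNgt yr (le_lt_trans xy yr).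
  by rewrite !ef// !inE eqxx ?orbT.
have ses : stepf gam 0 es.
  by apply: (stepf_steps pes gsteps) => x xq _ _; apply: mem_es; rewrite !inE xq !orbT.
have ses' : stepf gam' 0 es.
  by apply: (stepf_steps pes st') => x xq _ _; exact: mem_es.
have eq1 := parisi_functional_step hc nz h beta0 (df01 mu) (@le_df _ mu) pes les ses.
have eq2 := parisi_functional_step hc nz h beta0 (df01 nu) (@le_df _ nu) pes les ses'.
have := hmin.2 _ (ex_intro2 _ _ nu usn (erefl _)); rewrite eq1 eq2 => hle.
have wm x y : 0 <= x -> x <= y -> y <= 1 -> w x <= w y by move=> _ xy _; exact: (le_wxi hc).
have wV x y : 0 <= x -> x <= y -> y <= 1 -> w y - w x <= V.
  by move=> x0 _ y1; apply: lerB; exact: (le_wxi hc).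
have g1' t : 0 <= t -> t < s -> gam' t = gam t.
  by move=> _ ts; rewrite gE !leNgt ts (lt_trans ts sq) /= !mulr0 addr0 subr0.
have g2' t : s <= t -> t < q -> gam' t = gam t + e.
  by move=> st tq; rewrite gE st leNgt tq /= mulr0 mulr1 subr0.
have g3' t : q <= t -> gam' t = gam t.
  by move=> qt; rewrite gE qt (le_trans (ltW sq) qt) mulr1 addrK.
have wsg : w s < w g1 by apply: (lt_wxi hc nz) => //; exact: le_trans q1.
have aV : w g1 - w s <= V by apply: wV => //; [exact: ltW|exact: le_trans q1].
have a0 : 0 < w g1 - w s by rewrite subr_gt0.
have lq3 : last q l3 <= 1 by rewrite e3.
have gAs t : 0 <= t -> t <= s -> gam t <= A by move=> _ ts; apply: gA; exact: le_lt_trans ts sq.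
have AeB : (A + e) * Num.sqrt V <= B by rewrite /B ler_wpM2r ?sqrtr_ge0// lerD2l.
have Ak : A * (e * (w g1 - w s) / 4 * th0 B) <= 1.
  apply: (le_trans _ eA); rewrite [leLHS](_ : _ = e * (A * ((w g1 - w s) / 4) * th0 B)); last by ring.
  apply: ler_wpM2l; first exact: ltW.
  apply: (@le_trans _ _ (A * V * th0 B)); last by rewrite lerDl.
  apply: ler_wpM2r; first exact: ltW.
  by apply: ler_wpM2l => //; move: aV a0; move: (w g1 - w s) => a; move: (V) => v; lra.
have cmp := @pval_compare R gam gam' w (lcosh beta) e s g1 q h A V B l1 l2 l3 gam0 gam'0 wm wV (profile_lcosh beta0)
  e0 pes lq3 sg wsg g1' g2' g3' A0 gAs (ltW V0) AeB Ak.
have lev : levsum gam' (w2xi c) 0 es = levsum gam (w2xi c) 0 es + e * (w2xi c q - w2xi c s).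
  have es2 : es = (l1 ++ [:: s]) ++ (g1 :: l2 ++ [:: q]) ++ l3.
    by rewrite /es -!catA /= -catA.
  have l1s : last 0 (l1 ++ [:: s]) = s by rewrite last_cat.
  have l2q : last s (g1 :: l2 ++ [:: q]) = q by rewrite /= last_cat.
  have L gg : levsum gg (w2xi c) 0 es = levsum gg (w2xi c) 0 (l1 ++ [:: s]) +
      (levsum gg (w2xi c) s (g1 :: l2 ++ [:: q]) + levsum gg (w2xi c) q l3).
    by rewrite es2 levsum_cat l1s [levsum _ _ s _]levsum_cat l2q.
  move: pes; rewrite !L es2 cat_path l1s [path _ s _]cat_path l2q => /and3P[q1' q2' q3'].
  rewrite (@levsum_shift R gam gam' (w2xi c) 0 (l1 ++ [:: s]) 0 q1'); last first.
    by rewrite l1s => t t0 ts; rewrite addr0 g1'.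
  rewrite (@levsum_shift R gam gam' (w2xi c) s _ e q2'); last by rewrite l2q.
  rewrite (@levsum_shift R gam gam' (w2xi c) q l3 0 q3'); last first.
    by move=> t qt _; rewrite addr0 g3'.
  by rewrite l2q !mul0r !addr0 addrAC addrA.
have : e * ((w g1 - w s) / 4 * th0 B * (cB B / 2) ^+ k.+1 *
    (Num.sqrt ((w g1 - w s) / 8) / Num.sqrt V) * bump ((w 2^-1 - w 0) / 2) h) <= e * ((w3 q - w3 s) / 2).
  set gn := (e * (w g1 - w s) / 4 * th0 B * (cB B / 2) ^+ (size l1).+1 *
    (Num.sqrt ((w g1 - w s) / 8) / Num.sqrt ((w g1 - w s) / 8 + (w s - w 0) / 2)) *
    bump ((w g1 - w s) / 8 + (w s - w 0) / 2) h) in cmp.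
  apply: (@le_trans _ _ gn); last first.
    move: hle; rewrite lev -/es.
    have -> : e * ((w3 q - w3 s) / 2) = e / 2 * (w q - w s) - e * (w2xi c q - w2xi c s) / 2 by rewrite /w3xi; field.
    move: cmp; rewrite -/es; move: (pval gam' _ _ _ _ _) (pval gam _ _ _ _ _) (levsum _ _ _ _) (e / 2 * _) (e * _) (ln 2 / beta) gn.
    by move=> *; lra.
  have cb0 : 0 <= cB B / 2 by rewrite divr_ge0// ltW// cB_gt0.
  have cb1 : cB B / 2 <= 1 by rewrite ler_pdivrMr// mul1r (le_trans (cB_le1 B0))// ler1n.
  have sk : ((size l1).+1 <= k.+1)%N by rewrite ltnS (leq_trans _ ks)// size_srt.
  have hp : (cB B / 2) ^+ k.+1 <= (cB B / 2) ^+ (size l1).+1 by exact: ler_wiXn2l.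
  have wsp : w 2^-1 <= w s by exact: (le_wxi hc).
  have w20 : w 0 < w 2^-1.
    by apply: (lt_wxi hc nz) => //; rewrite invf_le1// ler1n.
  (* As [s >= 1/2], the variance reached at time 0 lies between two constants of the mixture: the
     lower one keeps the Gaussian at [h] away from 0, the upper one keeps its prefactor. *)
  have v1 : (w 2^-1 - w 0) / 2 <= (w g1 - w s) / 8 + (w s - w 0) / 2 by exact: gap_lower a0 wsp.
  have v2 : (w g1 - w s) / 8 + (w s - w 0) / 2 <= V.
    exact: gap_upper (le_wxi hc (le_trans gq q1)) a0 w20 wsp.
  have v00 : 0 < (w 2^-1 - w 0) / 2 by rewrite divr_gt0// subr_gt0.
  have hb := @le_bump R _ _ h v00 v1.
  have vp := lt_le_trans v00 v1.
  rewrite /gn [leLHS](_ : _ = e * (w g1 - w s) / 4 * th0 B * (cB B / 2) ^+ k.+1 *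
    (Num.sqrt ((w g1 - w s) / 8) / Num.sqrt V) * bump ((w 2^-1 - w 0) / 2) h); last by ring.
  have f0 : 0 <= e * (w g1 - w s) / 4 * th0 B.
    by rewrite mulr_ge0 ?(ltW th00)// divr_ge0// mulr_ge0// ltW.
  apply: ler_pM => //; first by rewrite mulr_ge0 ?divr_ge0 ?sqrtr_ge0// mulr_ge0// exprn_ge0.
    exact: bump_ge0.
  apply: ler_pM => //; first by rewrite mulr_ge0// exprn_ge0.
    by apply: ler_wpM2l.
  apply: ler_wpM2l; first exact: sqrtr_ge0.
  by rewrite lef_pV2 ?posrE ?sqrtr_gt0//; exact: ler_wsqrtr.
by rewrite ler_pM2l.
Qed.
End Gap.
End Minimizer.

(* The competitor raises the order parameter on an atom-free stretch of length
   proportional to L: the gain is of order L^(3/2), the cost of order L^2. *)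
Lemma atom_away A : 0 <= A -> exists2 L : R, 0 < L < 1 &
  forall beta (mu : probability R R) (qs : seq R), 1 <= beta -> unit_supported mu ->
  is_minimizer c h beta (distribution_function mu) -> (forall x, x \in qs <-> measure_support mu x) ->
  (size qs <= k)%N -> forall q, q \in qs -> (forall t, t < q -> beta * distribution_function mu t <= A) ->
  q <= 1 - L.
Proof.
move=> A0; pose B : R := (A + 1) * Num.sqrt V.
have B0 : 0 <= B by rewrite mulr_ge0 ?sqrtr_ge0// addr_ge0.
have m0 : 0 < vx 2^-1 by apply: (vxi_gt0 hc nz); rewrite invr_gt0.
have M0 : 0 < vx 1 by exact: (vxi_gt0 hc nz).
(* An interval of length [L / (k + 1)] beyond 1/2 carries a clock increment of at least [K * L],
   since [xi''] is nondecreasing. *)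
pose K : R := vx 2^-1 / k.+1%:R.
have K0 : 0 < K by rewrite divr_gt0.
pose bb := bump ((w 2^-1 - w 0) / 2) h.
pose G := K / 4 * th0 B * (cB B / 2) ^+ k.+1 * (Num.sqrt (K / 8) / Num.sqrt V) * bb.
have cb0 : 0 < cB B / 2 by rewrite divr_gt0// cB_gt0.
have G0 : 0 < G.
  apply: mulr_gt0; last exact: expR_gt0.
  apply: mulr_gt0; last by rewrite divr_gt0// sqrtr_gt0// divr_gt0.
  apply: mulr_gt0; last exact: exprn_gt0.
  by apply: mulr_gt0; [exact: divr_gt0|exact: th0_gt0].
(* [r] is the square root of [L]. The gain is at least [G * r^3] and the cost at most [vx 1 * r^4],
   which [vx 1 * r < G] makes incompatible; [r <= 1/2] keeps the intervals to the right of 1/2. *)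
pose r := Num.min 2^-1 (G / (2 * vx 1)).
have r0 : 0 < r by rewrite lt_min invr_gt0 ltr0n/= divr_gt0// mulr_gt0.
have r1 : r <= 2^-1 by rewrite ge_min lexx.
have rG : vx 1 * r < G.
  have : r <= G / (2 * vx 1) by rewrite ge_min lexx orbT.
  rewrite ler_pdivlMr ?mulr_gt0// => hr; have rv : 0 < r * vx 1 by exact: mulr_gt0.
  by rewrite mulrC; apply: lt_le_trans hr; rewrite (_ : r * (2 * vx 1) = r * vx 1 + r * vx 1) ?ltrDl//; ring.
pose L := r ^+ 2.
have L0 : 0 < L by exact: exprn_gt0.
have L1 : L <= 4^-1.
  rewrite (_ : 4^-1 = 2^-1 ^+ 2 :> R); last by field.
  by apply: lerXn2r; rewrite ?nnegrE ?(ltW r0)// invr_ge0.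
exists L; first by rewrite L0 /=; apply: (le_lt_trans L1); rewrite invf_lt1// ltr1n.
move=> beta mu qs beta1 us hmin qsS ks q qq gA; rewrite leNgt; apply/negP => qL.
have /andP[q0 q1] := atom01 us qsS qq.
pose d := L / k.+1%:R; have d0 : 0 < d by rewrite divr_gt0.
have kd : d * k.+1%:R = L by rewrite /d divfK.
pose s (j : 'I_k.+1) : R := q - L + d * j%:R.
have dstep (i j : nat) : (i < j)%N -> d * i%:R + d <= d * j%:R.
  by move=> ij; rewrite -{2}(mulr1 d) -mulrDr natr1 ler_pM2l// ler_nat.
have sj1 j : s j + d <= q.
  by have := dstep j k.+1 (ltn_ord j); rewrite kd /s => hj; lra.
have sj0 j : q - L <= s j by rewrite /s lerDl mulr_ge0// ltW.
(* Pigeonhole: [k + 1] disjoint open intervals, and at most [k] support points. *)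
have [j free] : exists j, forall x, x \in qs -> ~~ (s j < x < s j + d).
  apply: contrapT => /forallNP hn.
  have hx j : exists x, (x \in qs) && (s j < x < s j + d).
    have /existsNP[x /not_implyP[xq /negP]] := hn j.
    by rewrite negbK => hx; exists x; rewrite xq.
  have [x xP] := choice hx.
  have inj : injective x.
    have lt_no (i j : 'I_k.+1) : (i < j)%N -> x i = x j -> False.
      move=> ij e; have /and3P[_ _ h1] := xP i; have /and3P[_ h2 _] := xP j.
      have : s i + d <= s j.
        by have := dstep i j ij; rewrite /s => hj; lra.
      by move=> h3; have := lt_trans h1 (le_lt_trans h3 h2); rewrite e ltxx.
    move=> i j e; have [ij|ji|ij] := ltngtP i j; [by case: (lt_no i j)|by case: (lt_no j i)|exact: val_inj].
  have : (size [seq x i | i <- enum 'I_k.+1] <= size qs)%N.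
    apply: uniq_leq_size; first by rewrite map_inj_uniq// enum_uniq.
    by move=> y /mapP[i _ ->]; have /andP[] := xP i.
  by rewrite size_map size_enum_ord leqNgt ltnS ks.
have s0 : 2^-1 <= s j.
  by apply: le_trans (sj0 j); move: qL L1; move: (L) => l; lra.
have sd : s j < s j + d by rewrite ltrDl.
have gap := gap_inequality beta1 us hmin qsS A0 qq gA s0 sd (sj1 j) free ks.
have sj00 : 0 <= s j by apply: le_trans s0; rewrite invr_ge0.
have sd1 : s j + d <= 1 := le_trans (sj1 j) q1.
pose a := w (s j + d) - w (s j).
have aK : K * L <= a.
  have -> : K * L = vx 2^-1 * ((s j + d) - s j) by rewrite /K /d; ring.
  apply: (xi_incr (vxi_cont hc) (wxi_cont hc) (dwxi hc) sj00 (ltW sd) sd1) => v sv _.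
  by apply: (le_vxi hc); exact: le_trans sv.
(* Between [s j] and [q], at distance at most [L], the factor [1 - v] in the derivative of [w3] is
   at most [2 * L]. *)
have cost : w3 q - w3 (s j) <= 2 * L * vx 1 * L.
  apply: (@le_trans _ _ (2 * L * vx 1 * (q - s j))).
    have c3 : continuous (fun t => (1 - t) * vx t).
      by move=> t; apply: cvgM; [apply: cvgB; [exact: cvg_cst|exact: cvg_id]|exact: vxi_cont].
    apply: (xi_decr c3 (w3xi_cont hc) (dw3xi hc) sj00 (le_trans (ltW sd) (sj1 j)) q1) => v sv vq.
    apply: ler_pM; [by rewrite subr_ge0 (le_trans vq q1)|exact: (vxi_ge0 hc)| |by apply: (le_vxi hc); exact: le_trans vq q1].
    by have := sj0 j; move: qL sv; move: (s j) (L) => sj l; lra.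
  apply: ler_wpM2l; first by rewrite !mulr_ge0// ltW.
  by have := sj0 j; move: (s j) (L) => sj l; lra.
have KL : 0 < K * L by exact: mulr_gt0.
have th00 := th0_gt0 B0.
have low : G * L * r <= (w (s j + d) - w (s j)) / 4 * th0 B * (cB B / 2) ^+ k.+1 *
    (Num.sqrt ((w (s j + d) - w (s j)) / 8) / Num.sqrt V) * bump ((w 2^-1 - w 0) / 2) h.
  have -> : G * L * r = K * L / 4 * th0 B * (cB B / 2) ^+ k.+1 * (Num.sqrt (K * L / 8) / Num.sqrt V) * bb.
    have -> : Num.sqrt (K * L / 8) = Num.sqrt (K / 8) * r.
      rewrite (_ : K * L / 8 = K / 8 * L); last by ring.
      have K8 : 0 <= K / 8 by rewrite divr_ge0// ltW.
      by rewrite (sqrtrM _ K8) (sqrtr_sqr r) gtr0_norm.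
    by rewrite /G; ring.
  apply: ler_wpM2r; first exact: bump_ge0.
  apply: ler_pM.
  - by rewrite mulr_ge0 ?exprn_ge0 ?(ltW cb0)// mulr_ge0 ?(ltW th00)// divr_ge0// ltW.
  - by rewrite divr_ge0 ?sqrtr_ge0.
  - apply: ler_wpM2r; first by rewrite exprn_ge0// ltW.
    by apply: ler_wpM2r; [exact: ltW|rewrite ler_pM2r].
  apply: ler_wpM2r; first by rewrite invr_ge0 sqrtr_ge0.
  by apply: ler_wsqrtr; rewrite ler_pM2r.
have fin : G * L * r <= L * vx 1 * L.
  apply: (le_trans low); apply: (le_trans gap); rewrite ler_pdivrMr//.
  by apply: (le_trans cost); rewrite le_eqVlt; apply/orP; left; apply/eqP; ring.
have : G <= vx 1 * r.
  rewrite -(ler_pM2r (mulr_gt0 L0 r0)) mulrA; apply: (le_trans fin).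
  by rewrite le_eqVlt; apply/orP; left; apply/eqP; rewrite /L; ring.
by rewrite leNgt rG.
Qed.

(** Once [q <= 1 - L], the factor of [gam q] in [apriori] is at least the increment of [w3] over
    [[1 - L, 1]], a positive number depending on [A] only through [L]. *)
Lemma atom_bound A : 0 <= A -> exists2 A' : R, 0 <= A' &
  forall beta (mu : probability R R) (qs : seq R), 1 <= beta -> unit_supported mu ->
  is_minimizer c h beta (distribution_function mu) -> (forall x, x \in qs <-> measure_support mu x) ->
  (size qs <= k)%N -> forall q, q \in qs -> (forall t, t < q -> beta * distribution_function mu t <= A) ->
  beta * distribution_function mu q <= A'.
Proof.
move=> A0; have [L /andP[L0 L1] hL] := atom_away A0.
have e0 : 0 <= energy.
  apply: addr_ge0; first by apply: addr_ge0; [rewrite ln_ge0// ler1n|exact: mulr_ge0].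
  by rewrite mulr_ge0 ?sqrtr_ge0//; apply: Eg_ge0 => z; exact: normr_ge0.
have p0 : 0 <= 1 - L by rewrite subr_ge0 ltW.
have w30 : 0 < w3 1 - w3 (1 - L).
  by rewrite subr_gt0; apply: (lt_w3xi hc nz) => //; rewrite ltrBlDr ltrDl.
exists (2 * energy / (w3 1 - w3 (1 - L))); first by rewrite divr_ge0 ?mulr_ge0// ltW.
move=> beta mu qs b1 us hmin qsS ks q qq gA; have qL := hL _ _ _ b1 us hmin qsS ks _ qq gA.
have /andP[q0 q1] := atom01 us qsS qq.
rewrite ler_pdivlMr//; apply: le_trans (apriori b1 us hmin qsS qq).
apply: ler_wpM2l; first by rewrite mulr_ge0 ?df_ge0// (le_trans ler01 b1).
by rewrite lerD2l lerN2; apply: (le_w3xi hc) => //; rewrite lerBlDr lerDl ltW.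
Qed.

Lemma beta_bound : exists bk : R, forall beta (mu : probability R R) (qs : seq R), 1 <= beta -> unit_supported mu ->
  is_minimizer c h beta (distribution_function mu) -> (forall x, x \in qs <-> measure_support mu x) ->
  (size qs <= k)%N -> beta <= bk.
Proof.
(* The induction counts support points up to an arbitrary time [t], and not only up to atoms, so
   that its hypothesis controls the levels at all times before the next atom. *)
pose cnt (qs : seq R) t := count (fun x => x <= t) qs.
have H n : exists2 A : R, 0 <= A & forall beta (mu : probability R R) (qs : seq R), 1 <= beta -> unit_supported mu ->
    is_minimizer c h beta (distribution_function mu) -> (forall x, x \in qs <-> measure_support mu x) ->
    (size qs <= k)%N -> forall t, (cnt qs t <= n)%N -> beta * distribution_function mu t <= A.
  have noatom (mu : probability R R) (qs : seq R) t : (forall x, x \in qs <-> measure_support mu x) ->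
      ~~ has (fun x => x <= t) qs -> distribution_function mu t = 0.
    by move=> qsS /hasPn hn; apply: (df_before qsS) => q /hn; rewrite -ltNge.
  elim: n => [|n [A A0 IH]].
    exists 0 => // beta mu qs b1 us hmin qsS ks t; rewrite leqn0 => /eqP ct.
    by rewrite (noatom mu qs) ?mulr0// has_count -leqNgt -/(cnt qs t) ct.
  have [A' A'0 hA] := atom_bound A0.
  exists A' => // beta mu qs b1 us hmin qsS ks t ct.
  have [hs|/(noatom mu qs t qsS)->] := boolP (has (fun x => x <= t) qs); last by rewrite mulr0.
  pose q := last 0 (srt (fun x => x <= t) qs).
  have lq : q \in srt (fun x => x <= t) qs.
    have : (0 < size (srt (fun x => (x <= t)%R) qs))%N by rewrite size_sort size_filter -has_count.
    by rewrite /q; case: (srt _ _) => // y l _; exact: (mem_last y l).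
  have qmax x : x \in qs -> x <= t -> x <= q.
    move=> xq xt; have : x \in srt (fun x => x <= t) qs by rewrite mem_srt xt.
    have : sorted <=%R (srt (fun x => x <= t) qs) by apply: sort_sorted; exact: le_total.
    rewrite /q; case: (srt _ _) => // y l /= pl; rewrite inE => /predU1P[->|xl]; first exact: path_le_last.
    move: pl; case/splitPr: xl => l1 l2; rewrite cat_path /= last_cat /= => /and3P[_ _ p2].
    exact: path_le_last.
  have /andP[qt qq] : (q <= t) && (q \in qs) by have := lq; rewrite mem_srt.
  have -> : distribution_function mu t = distribution_function mu q.
    apply/esym; apply: (df_steps qsS) => // x xq; apply/negP => /andP[qx xt].
    by have := qmax x xq xt; rewrite leNgt qx.
  apply: (hA beta mu qs) => // v vq; apply: (IH beta mu qs) => //.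
  rewrite -ltnS; apply: leq_trans ct; rewrite /cnt.
  (* The largest support point [q <= t] is counted at [t] but not at [v < q], hence the strict
     decrease. *)
  pose a x := x <= v; pose b x := (v < x) && (x <= t).
  have h1 := count_predUI a b qs.
  have h2 : (0 < count b qs)%N by rewrite -has_count; apply/hasP; exists q => //; rewrite /b vq.
  have h3 : count (predI a b) qs = 0%N.
    by apply/eqP; rewrite -leqn0 leqNgt -has_count; apply/hasPn => x _ /=; rewrite /a /b; case: leP.
  have h4 : (count (predU a b) qs <= count (fun x => (x <= t)%R) qs)%N.
    apply: sub_count => x /=; rewrite /a /b => /orP[xv|/andP[]//].
    exact: le_trans xv (le_trans (ltW vq) qt).
  by apply: leq_trans h4; rewrite -[leqRHS]addn0 -h3 h1 -addn1 leq_add2l.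
have [A A0 hA] := H k; exists A => beta mu qs b1 us hmin qsS ks.
have := hA beta mu qs b1 us hmin qsS ks 1; rewrite (df1 us) mulr1; apply.
by apply: leq_trans ks; exact: count_size.
Qed.
End Estimates.

(** * The vanishing mixture *)

Section ZeroMixture.
Context {R : realType}.
Variable c : nat -> R.
Hypothesis hc : (\sum_(2 <= p <oo) (2 ^+ p * c p ^+ 2)%:E < +oo)%E.
Hypothesis c0 : forall p, (2 <= p)%N -> c p = 0.

Let xi0 (t : R) : 0 <= t -> t <= 1 -> xi'' c t = 0.
Proof.
move=> t0 t1; rewrite (xi''E hc) ?xi2_eq0//.
by rewrite ger0_norm// (le_lt_trans t1)// ltr1n.
Qed.

Lemma weak_solution_zero beta (alpha alpha' : R -> R) Psi :
  weak_solution c beta alpha Psi -> weak_solution c beta alpha' Psi.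
Proof.
move=> [cP [v [hv w]]]; split => //; exists v; split => // phi tf.
rewrite -[RHS](w phi tf); congr (_ + _); apply: eq_Rintegral => z /set_mem /andP[z0 z1].
by rewrite xi0// !mul0r.
Qed.

Lemma functional_zero h beta (alpha alpha' : R -> R) :
  parisi_functional c h beta alpha = parisi_functional c h beta alpha'.
Proof.
have e1 : parisi_pde c beta alpha = parisi_pde c beta alpha'.
  by congr (xget _ _); apply/seteqP; split => Psi /=; exact: weak_solution_zero.
have pen0 (a : R -> R) : \int[@lebesgue_measure R]_(s in `[0, 1]) (beta * a s * s * xi'' c s) =
    \int[@lebesgue_measure R]_(s in `[0, 1]) (0 : R).
  by apply: eq_Rintegral => s /set_mem; rewrite /= in_itv /= => /andP[s0 s1]; rewrite xi0// mulr0.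
by rewrite /parisi_functional e1 !pen0.
Qed.

Lemma dirac01 (s : R) : 0 <= s -> s <= 1 -> unit_supported (dirac s : probability R R).
Proof.
move=> s0 s1; rewrite /unit_supported.
have e : (dirac s : probability R R) `[0, 1]%classic = (\1_(`[0, 1]%classic : set R) s)%:E by exact: diracE.
by rewrite e indicE mem_set//= in_itv /= s0.
Qed.

(** The functional is constant, so the Dirac masses at 0 and at 1 are both minimizers, which
    contradicts uniqueness. *)
Lemma no_parisi_measure h beta (mu : probability R R) : ~ is_parisi_measure c h beta mu.
Proof.
move=> [_ _ uniq].
have hmin (s : R) : 0 <= s -> s <= 1 -> distribution_function (dirac s : probability R R) = distribution_function mu.
  move=> s0 s1; apply: uniq; split; first by exists (dirac s : probability R R) => //; exact: dirac01.
  by move=> alpha' _; rewrite (functional_zero h beta _ alpha').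
have := congr1 (fun f => f 0) (etrans (hmin 0 (lexx 0) ler01) (esym (hmin 1 ler01 (lexx 1)))).
by rewrite /= !df_dirac lexx leNgt ltr01 => /eqP; rewrite oner_eq0.
Qed.
End ZeroMixture.

Theorem theorem2 (R : realType) (k : nat) (hk : (1 <= k)%N)
    (c : nat -> R)
    (hc : (\sum_(2 <= p <oo) (2 ^+ p * c p ^+ 2)%:E < +oo)%E)
    (h : R) :
  exists betak : R, forall beta : R, 0 < beta -> betak < beta ->
    forall mu : probability R R, is_parisi_measure c h beta mu ->
      exists x : 'I_k.+1 -> R,
        injective x /\ forall i : 'I_k.+1, measure_support mu (x i).
Proof.
have [nz|z] := pselect (exists2 p, (2 <= p)%N & c p != 0); last first.
  exists 0 => beta _ _ mu hmu; exfalso; apply: (no_parisi_measure hc _ hmu) => p p2.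
  by apply/eqP/negPn/negP => cp; apply: z; exists p.
have [bk hbk] := beta_bound hc nz h k.
(* The 1 secures [beta >= 1], under which the estimates at a minimizer are uniform. *)
exists (Num.max 1 bk) => beta _; rewrite gt_max => /andP[b1 bkb] mu [us hmin _].
have [//|[qs [ks _ qsS]]] := set_or_large (measure_support mu) k.
by have := hbk beta mu qs (ltW b1) us hmin qsS ks; rewrite leNgt bkb.
Qed.
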